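(* Let $N$ be a positive integer, $0<s<1$ with $N>2s$, and $p^*_{\alpha,s}=\frac{N+2\alpha+2s}{N-2s}$. Assume either (i) $1/2\le s<1$ and $\alpha>-2s$, or (ii) $0<s<1/2$ and $-2s<\alpha<\frac{2s(N-1)}{1-2s}$. Then the problem $$\mathcal{T}\bar v+\mathcal{A}_{s,N}\bar v=\bar v^{\,p^*_{\alpha,s}}\quad\text{in }\mathbb{R}$$ has a nonnegative, nontrivial variational solution $\bar v\in H^s_K(\mathbb{R})$. Moreover, this solution is classical and positive.
   Context: Fix $\theta\in\mathbb{S}^{N-1}$. Define $K(t)=e^{-t\frac{N+2s}{2}}\int_{\mathbb{S}^{N-1}}|1+e^{-2t}-2e^{-t}\langle\theta,\sigma\rangle|^{-\frac{N+2s}{2}}d\sigma$ for $t\in\mathbb{R}$, and $\mathcal{T}\bar v(\kappa)=\mathrm{P.V.}\int_{\mathbb{R}}(\bar v(\kappa)-\bar v(\tau))K(\kappa-\tau)\,d\tau$. With $\beta=-\frac{N-2s}{2}$, let $$\mathcal{A}_{s,N}=\int_0^\infty\int_{\mathbb{S}^{N-1}}\rho^{N-1}\frac{1-\rho^{\beta}}{|1+\rho^2-2\rho\langle\theta,\sigma\rangle|^{\frac{N+2s}{2}}}\,d\sigma\,d\rho$$ (a positive constant). $H^s_K(\mathbb{R})=\{u\in L^2(\mathbb{R}) : \int_{\mathbb{R}}\int_{\mathbb{R}}(u(\kappa)-u(\tau))^2K(\kappa-\tau)d\tau d\kappa<\infty\}$. A variational solution is $\bar v\in H^s_K(\mathbb{R})$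 with $\frac12\iint(\bar v(\kappa)-\bar v(\tau))(\varphi(\kappa)-\varphi(\tau))K(\kappa-\tau)\,d\tau d\kappa+\mathcal{A}_{s,N}\int\bar v\varphi=\int\bar v^{p^*_{\alpha,s}}\varphi$ for all $\varphi\in H^s_K(\mathbb{R})$.
   Formalization: The integral defining A_{s,N} is not absolutely convergent at ρ=1 when s ≥ 1/2, so it is read as a principal value around ρ=1 (the limit of the integral over |ρ−1|>ε); for s<1/2 this is the ordinary integral. *)

(* Defs.v *)
From HB Require Import structures.
From mathcomp Require Import all_boot all_order all_algebra.
From mathcomp Require Import all_classical all_reals all_analysis.
Set Implicit Arguments. Unset Strict Implicit. Unset Printing Implicit Defensive.
Import Order.TTheory GRing.Theory Num.Theory.
Import numFieldNormedType.Exports.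
Local Open Scope classical_set_scope.
Local Open Scope ring_scope.

Section Defs.
Variable R : realType.
Local Notation leb := (@lebesgue_measure R).

(* Points of R^N are represented as functions nat -> R; only the coordinates
   0 .. N-1 are relevant (the iterated integral below sets the others to 0). *)

(* Lebesgue integral over R^n of a nonnegative function, written as an
   iterated integral of one-dimensional Lebesgue integrals (Tonelli). *)
Fixpoint intRn (n : nat) (f : (nat -> R) -> \bar R) : \bar R :=
  match n with
  | 0 => f (fun _ => 0)
  | n'.+1 => (\int[leb]_(x in [set: R])
                intRn n' (fun y => f (fun i => if i == n' then x else y i)))%E
  end.

Definition normRn (N : nat) (x : nat -> R) : R :=
  Num.sqrt (\sum_(i < N) x i ^+ 2).

Definition dotRn (N : nat) (x y : nat -> R) : R := \sum_(i < N) x i * y i.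

(* Surface measure on S^{N-1} (Folland, Thm 2.49):
   int_{S^{N-1}} g dsigma = N * int_{0 < |x| <= 1} g(x/|x|) dx,
   for nonnegative g. *)
Definition sphere_int (N : nat) (g : (nat -> R) -> \bar R) : \bar R :=
  (N%:R%:E * intRn N (fun x =>
     if ((0 < normRn N x) && (normRn N x <= 1))%R
     then g (fun i => (x i / normRn N x)%R) else 0))%E.

(* b^e for b >= 0 and e < 0, with the singular value 0^e = +oo *)
Definition epowneg (b e : R) : \bar R :=
  if b == 0 then +oo%E else (b `^ e)%:E.

Definition kernelK (N : nat) (s : R) (theta : nat -> R) (t : R) : \bar R :=
  ((expR (- t * ((N%:R + 2 * s) / 2)))%:E *
   sphere_int N (fun sigma =>
     epowneg `|1 + expR (- 2 * t) - 2 * expR (- t) * dotRn N theta sigma|%R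
             (- ((N%:R + 2 * s) / 2))%R))%E.

Definition betaN (N : nat) (s : R) : R := - ((N%:R - 2 * s) / 2).

(* A_{s,N}: the rho-integral is taken as a principal value around the
   singular point rho = 1 (for s < 1/2 it is an absolutely convergent
   Lebesgue integral and the principal value coincides with it). *)
Definition A_trunc (N : nat) (s : R) (theta : nat -> R) (e : R) : \bar R :=
  (\int[leb]_(rho in [set rho : R | (0 < rho)%R /\ (e < `|rho - 1|)%R])
     ((rho ^+ N.-1 * (1 - rho `^ betaN N s))%R%:E *
      sphere_int N (fun sigma =>
        epowneg `|1 + rho ^+ 2 - 2 * rho * dotRn N theta sigma|%R
                (- ((N%:R + 2 * s) / 2))%R)))%E.

Definition A_sN (N : nat) (s : R) (theta : nat -> R) : R :=
  fine (lim (A_trunc N s theta @ 0^'+)).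

Definition crit_exp (N : nat) (alpha s : R) : R :=
  (N%:R + 2 * alpha + 2 * s) / (N%:R - 2 * s).

Definition HsK (K : R -> \bar R) (u : R -> R) : Prop :=
  [/\ measurable_fun [set: R] u,
      (\int[leb]_(x in [set: R]) ((u x) ^+ 2)%R%:E < +oo)%E &
      (\int[(leb \x leb)%E]_(z in [set: R * R])
          (((u z.1 - u z.2) ^+ 2)%R%:E * K (z.1 - z.2)%R) < +oo)%E].

Definition variational_solution (K : R -> \bar R) (A p : R) (v : R -> R) : Prop :=
  HsK K v /\
  forall phi : R -> R, HsK K phi ->
    ((2^-1)%:E * \int[(leb \x leb)%E]_(z in [set: R * R])
        (((v z.1 - v z.2) * (phi z.1 - phi z.2))%R%:E * K (z.1 - z.2)%R)
     + A%:E * \int[leb]_(x in [set: R]) (v x * phi x)%R%:E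
     = \int[leb]_(x in [set: R]) (v x `^ p * phi x)%R%:E)%E.

Definition T_trunc (K : R -> \bar R) (v : R -> R) (kappa e : R) : \bar R :=
  (\int[leb]_(tau in [set tau : R | (e < `|kappa - tau|)%R])
     ((v kappa - v tau)%R%:E * K (kappa - tau)%R))%E.

Definition classical_solution (K : R -> \bar R) (A p : R) (v : R -> R) : Prop :=
  continuous v /\
  forall kappa : R,
    T_trunc K v kappa @ 0^'+ --> (v kappa `^ p - A * v kappa)%:E.

End Defs.

(* Main.v *)
(* The kernel is even, nonincreasing on (0, oo), comparable to |t|^(-1-2s) at 0 and
   exponentially small at infinity: with the angle c between theta and sigma it is
   the spherical integral of (2 cosh t - 2 c)^(-(N+2s)/2), and 2 - 2c is comparable to the
   squared distance from sigma to the axis of theta.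

   Existence. Minimise the quadratic form Q on the cone of nonnegative even functions,
   nonincreasing on (0, oo), subject to int u^(p+1) = 1.  Monotonicity gives pointwise
   decay bounds in terms of the energy, so Helly's selection theorem replaces compact
   embedding.  To see that the minimiser solves the equation without constraints, solve
   the linear equation with truncated right-hand side min(u^p, M) on (-M, M) by a monotone
   iteration which preserves the cone; minimality forces its solutions w to satisfy
   Q(w) <= 1/lambda, whence Q(lambda w - u) -> 0.

   Regularity. Comparing u at r and 2r through a test function gives boundedness.  Energy
   estimates for iterated translation differences, a one-dimensional Morrey inequality and
   interpolation bound second differences by |t|^gamma with gamma > 2s, so the
   singular integral converges absolutely after symmetrisation, is continuous, and equals
   u^p - A u.  At a zero of u the singular integral would be negative.

   The constant A. With rho = e^t the integrand becomes (e^(bt) - 1) K(t), b = (N-2s)/2; its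
   even part (cosh(bt) - 1) K(t) is positive and integrable, and the odd part cancels up to
   the gap between ln(1+e) and -ln(1-e), which contributes O(e^(2-2s)). *)

Require Import Defs.
From HB Require Import structures.
From mathcomp Require Import all_boot all_order all_algebra.
From mathcomp Require Import all_classical all_reals all_analysis.
From mathcomp Require Import measurable_realfun ring lra.
Set Implicit Arguments. Unset Strict Implicit. Unset Printing Implicit Defensive.
Import Order.TTheory GRing.Theory Num.Theory.
Import numFieldNormedType.Exports.
Local Open Scope classical_set_scope.
Local Open Scope ring_scope.

(** * Invariance of Lebesgue integrals *)

Section invariance.
Context {R : realType}.
Local Notation leb := (@lebesgue_measure R).
Local Open Scope ereal_scope.

Lemma measurable_shift (a : R) : measurable_fun [set: R] (fun x : R => x + a)%R.
Proof. by apply: measurable_funD. Qed.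

Lemma lebesgue_measure_shift (a : R) (A : set R) : measurable A ->
  leb ((fun x : R => x + a)%R @^-1` A) = leb A.
Proof.
move=> mA.
pose phi : R -> R := fun x => (x + a)%R.
have mphi : measurable_fun [set: measurableTypeR R] (phi : measurableTypeR R -> measurableTypeR R) by exact: measurable_shift.
have -> : leb ((fun x : R => x + a)%R @^-1` A) = pushforward leb phi A by [].
pose phiM : {mfun measurableTypeR R >-> measurableTypeR R} := HB.pack phi (isMeasurableFun.Build _ _ _ _ _ mphi).
apply/esym.
apply: (lebesgue_measure_unique (mu := pushforward leb phiM)) => // X [[u v] _ <-] /=.
rewrite /pushforward (_ : phi @^-1` _ = [set` `]u - a, v - a]]%R); last first.
  by apply/seteqP; split => x; rewrite /phi /= !in_itv/= lerBrDr ltrBlDr.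
rewrite !lebesgue_measure_itv/= !lte_fin ltrD2r.
by case: ifP => // _; rewrite -!EFinD; congr (_%:E); ring.
Qed.

Lemma lebesgue_measure_opp (A : set R) : measurable A ->
  leb (-%R @^-1` A) = leb A.
Proof. exact: lebesgue_measureN. Qed.

Lemma ge0_integral_comp_preserving d (T : measurableType d)
    (mu : {measure set T -> \bar R}) (phi : T -> T) (f : T -> \bar R) :
  measurable_fun setT phi ->
  (forall A, measurable A -> mu (phi @^-1` A) = mu A) ->
  measurable_fun [set: T] f -> (forall x, 0 <= f x) ->
  \int[mu]_x f (phi x) = \int[mu]_x f x.
Proof.
move=> mphi hphi mf f0.
have := ge0_integral_pushforward mphi mu measurableT mf (fun x _ => f0 x).
rewrite preimage_setT => <-.
by apply: eq_measure_integral => A mA _; exact: hphi.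
Qed.

Lemma integral_comp_preserving d (T : measurableType d)
    (mu : {measure set T -> \bar R}) (phi : T -> T) (f : T -> \bar R) :
  measurable_fun setT phi ->
  (forall A, measurable A -> mu (phi @^-1` A) = mu A) ->
  measurable_fun [set: T] f ->
  \int[mu]_x f (phi x) = \int[mu]_x f x.
Proof.
move=> mphi hphi mf; rewrite integralE [RHS]integralE; congr (_ - _).
- have -> : (fun x => f (phi x))^\+ = (f^\+ \o phi) by rewrite -funepos_comp.
  by apply: (@ge0_integral_comp_preserving _ _ mu phi f^\+) => //; exact: measurable_funepos.
- have -> : (fun x => f (phi x))^\- = (f^\- \o phi) by rewrite -funeneg_comp.
  by apply: (@ge0_integral_comp_preserving _ _ mu phi f^\-) => //; exact: measurable_funeneg.
Qed.

Lemma integral_shift (a : R) (f : R -> \bar R) : measurable_fun setT f ->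
  \int[leb]_x f (x + a)%R = \int[leb]_x f x.
Proof.
move=> mf; apply: (@integral_comp_preserving _ _ leb (fun x => x + a)%R f) => //.
  exact: measurable_shift.
by move=> A mA; exact: lebesgue_measure_shift.
Qed.

Lemma integral_opp (f : R -> \bar R) : measurable_fun setT f ->
  \int[leb]_x f (- x)%R = \int[leb]_x f x.
Proof.
move=> mf; apply: (@integral_comp_preserving _ _ leb -%R f) => // A mA.
exact: lebesgue_measure_opp.
Qed.

Lemma integral_sub (a : R) (f : R -> \bar R) : measurable_fun setT f ->
  \int[leb]_x f (a - x)%R = \int[leb]_x f x.
Proof.
move=> mf; rewrite -[RHS](integral_shift a) //.
rewrite -(@integral_opp (fun x => f (x + a)%R)) //.
- by apply: eq_integral => x _; rewrite addrC.
- by apply: measurableT_comp => //; exact: measurable_shift.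
Qed.

Lemma tonelliR (f : R * R -> \bar R) : measurable_fun [set: R * R] f ->
  (forall z, 0 <= f z) ->
  \int[leb \x leb]_z f z = \int[leb]_x \int[leb]_y f (x, y).
Proof. by move=> mf f0; exact: fubini_tonelli1. Qed.

Lemma tonelliC (f : R * R -> \bar R) : measurable_fun [set: R * R] f ->
  (forall z, 0 <= f z) ->
  \int[leb]_x \int[leb]_y f (x, y) = \int[leb]_y \int[leb]_x f (x, y).
Proof. by move=> mf f0; exact: fubini_tonelli. Qed.

Lemma measurable_tonelliR (f : R * R -> \bar R) : measurable_fun [set: R * R] f ->
  (forall z, 0 <= f z) ->
  measurable_fun [set: R] (fun x => \int[leb]_y f (x, y)).
Proof. by move=> mf f0; exact: measurable_fun_fubini_tonelli_F. Qed.

Lemma measurable_diag_shift (a : R) :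
  measurable_fun [set: R * R] (fun z : R * R => (z.1 + a, z.2 + a))%R.
Proof. by apply: measurable_fun_pair; apply: measurable_funD. Qed.

Lemma lebesgue2_measure_shift (a : R) (A : set (R * R)) : measurable A ->
  (leb \x leb) ((fun z => (z.1 + a, z.2 + a))%R @^-1` A) = (leb \x leb) A.
Proof.
move=> mA.
pose phi := fun z : R * R => (z.1 + a, z.2 + a)%R.
have mphi : measurable_fun [set: R * R] phi by exact: measurable_diag_shift.
have mB : measurable (phi @^-1` A) by rewrite -[_ @^-1` _]setTI; exact: mphi.
have mIA : measurable_fun [set: R * R] (EFin \o (\1_A : R * R -> R)).
  by apply/measurable_EFinP; exact: measurable_indic.
have mIB : measurable_fun [set: R * R] (EFin \o (\1_(phi @^-1` A) : R * R -> R)).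
  by apply/measurable_EFinP; exact: measurable_indic.
have pos (B : set (R * R)) z : 0 <= (EFin \o (\1_B : R * R -> R)) z by rewrite /= lee_fin.
have -> : (leb \x leb) (phi @^-1` A) = \int[leb \x leb]_z (EFin \o (\1_(phi @^-1` A) : R * R -> R)) z.
  by rewrite integral_indic // setIT.
have -> : (leb \x leb) A = \int[leb \x leb]_z (EFin \o (\1_A : R * R -> R)) z.
  by rewrite integral_indic // setIT.
rewrite (tonelliR mIB (pos _)) (tonelliR mIA (pos _)).
rewrite -[RHS](integral_shift a); last exact: (measurable_tonelliR mIA).
apply: eq_integral => x _.
rewrite -[RHS](@integral_shift a (fun y => (EFin \o (\1_A : R * R -> R)) ((x + a)%R, y))) //.
by apply: (measurableT_comp mIA); exact: measurable_pair1.
Qed.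

Lemma integral2_shift (a : R) (f : R * R -> \bar R) : measurable_fun setT f ->
  \int[leb \x leb]_z f (z.1 + a, z.2 + a)%R = \int[leb \x leb]_z f z.
Proof.
move=> mf; apply: (@integral_comp_preserving _ _ (leb \x leb) (fun z : R * R => (z.1 + a, z.2 + a))%R f) => //.
  exact: measurable_diag_shift.
exact: lebesgue2_measure_shift.
Qed.

(* Tonelli in the variables [x] and [t = y - x]. *)
Lemma ge0_integral2_diag (f : R * R -> \bar R) : measurable_fun setT f ->
  (forall z, 0 <= f z) ->
  \int[leb \x leb]_z f z = \int[leb]_t \int[leb]_x f (x, x + t)%R.
Proof.
move=> mf f0.
rewrite (tonelliR mf f0).
transitivity (\int[leb]_x \int[leb]_t f (x, x + t)%R).
  apply: eq_integral => x _; rewrite -[LHS](@integral_shift x (fun y => f (x, y))).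
    by apply: eq_integral => t _; rewrite addrC.
  by apply: (measurableT_comp mf); exact: measurable_pair1.
have mg : measurable_fun [set: R * R] (fun z : R * R => f (z.1, z.1 + z.2)%R).
  apply: (measurableT_comp mf); apply: measurable_fun_pair => //.
  exact: measurable_funD.
exact: (@tonelliC (fun z : R * R => f (z.1, z.1 + z.2)%R)).
Qed.

End invariance.

(** * Square-integrable functions *)

Section L2.
Context d (T : measurableType d) (R : realType) (mu : {measure set T -> \bar R}).
Implicit Types f g h : T -> R.

Definition Ltwo f :=
  measurable_fun [set: T] f /\ (\int[mu]_x ((f x) ^+ 2)%:E < +oo)%E.

Definition ip f g : R := \int[mu]_x (f x * g x).

Lemma Ltwo_integrable f : Ltwo f -> mu.-integrable setT (EFin \o (fun x => f x ^+ 2)).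
Proof.
move=> [mf f2]; apply/integrableP; split.
  by apply/measurable_EFinP; exact: measurable_funX.
under eq_integral do rewrite /= ger0_norm ?sqr_ge0 //.
exact: f2.
Qed.

Lemma Ltwo_of_le f (g : T -> R) : measurable_fun [set: T] f ->
  mu.-integrable setT (EFin \o g) -> (forall x, f x ^+ 2 <= g x) -> Ltwo f.
Proof.
move=> mf ig fg; split => //.
have /integrableP[_] : mu.-integrable setT (EFin \o (fun x => f x ^+ 2)).
  apply: (le_integrable _ _ _ ig) => //.
  - by apply/measurable_EFinP; exact: measurable_funX.
  - move=> x _ /=; rewrite lee_fin ger0_norm ?sqr_ge0 // (le_trans (fg x)) //.
    exact: ler_norm.
by under eq_integral do rewrite /= ger0_norm ?sqr_ge0 //.
Qed.

Lemma Ltwo_mul f g : Ltwo f -> Ltwo g ->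
  mu.-integrable setT (EFin \o (fun x => f x * g x)).
Proof.
move=> hf hg; have i1 := Ltwo_integrable hf; have i2 := Ltwo_integrable hg.
apply: (le_integrable _ _ _ (integrableD _ i1 i2)) => //.
- by apply/measurable_EFinP/measurable_funM; [exact: hf.1|exact: hg.1].
- move=> x _ /=; rewrite !lee_fin normrM.
  rewrite [leRHS]ger0_norm ?addr_ge0 ?sqr_ge0 //.
  rewrite -(real_normK (num_real (f x))) -(real_normK (num_real (g x))).
  have := sqr_ge0 (`|f x| - `|g x|); have := mulr_ge0 (normr_ge0 (f x)) (normr_ge0 (g x)).
  nra.
Qed.

Lemma LtwoD f g : Ltwo f -> Ltwo g -> Ltwo (fun x => f x + g x).
Proof.
move=> hf hg; have i1 := Ltwo_integrable hf; have i2 := Ltwo_integrable hg.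
apply: (@Ltwo_of_le _ (fun x => 2 * (f x ^+ 2 + g x ^+ 2))).
- by apply: measurable_funD; [exact: hf.1|exact: hg.1].
- have := integrableZl measurableT 2 (integrableD measurableT i1 i2).
  by apply: eq_integrable => //.
- by move=> x; have := sqr_ge0 (f x - g x); nra.
Qed.

Lemma LtwoZ (a : R) f : Ltwo f -> Ltwo (fun x => a * f x).
Proof.
move=> hf; have i1 := Ltwo_integrable hf.
apply: (@Ltwo_of_le _ (fun x => a ^+ 2 * (f x ^+ 2))).
- by apply: measurable_funM => //; exact: hf.1.
- have := integrableZl measurableT (a ^+ 2) i1.
  by apply: eq_integrable => //.
- by move=> x; rewrite exprMn.
Qed.

Lemma LtwoB f g : Ltwo f -> Ltwo g -> Ltwo (fun x => f x - g x).
Proof.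
move=> hf /(LtwoZ (-1)) hg; have := LtwoD hf hg.
by under eq_fun do rewrite mulN1r.
Qed.

Lemma eq_Ltwo f g : f =1 g -> Ltwo f -> Ltwo g.
Proof. by move=> /funext ->. Qed.

Lemma Ltwo_le f g : measurable_fun [set: T] f -> Ltwo g ->
  (forall x, `|f x| <= `|g x|) -> Ltwo f.
Proof.
move=> mf hg fg; apply: (Ltwo_of_le mf (Ltwo_integrable hg)) => x.
by rewrite -(real_normK (num_real (f x))) -(real_normK (num_real (g x))) lerXn2r ?nnegrE.
Qed.

Lemma ipC f g : ip f g = ip g f.
Proof. by apply: eq_Rintegral => x _; rewrite mulrC. Qed.

Lemma ipDl f g h : Ltwo f -> Ltwo g -> Ltwo h ->
  ip (fun x => f x + g x) h = ip f h + ip g h.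
Proof.
move=> hf hg hh; rewrite -RintegralD //; try exact: Ltwo_mul.
by apply: eq_Rintegral => x _; rewrite mulrDl.
Qed.

Lemma ipZl (a : R) f h : Ltwo f -> Ltwo h -> ip (fun x => a * f x) h = a * ip f h.
Proof.
move=> hf hh; rewrite -RintegralZl //; last exact: Ltwo_mul.
by apply: eq_Rintegral => x _; rewrite mulrA.
Qed.

Lemma ipE f : Ltwo f -> (ip f f)%:E = (\int[mu]_x ((f x) ^+ 2)%:E)%E.
Proof.
move=> hf; rewrite /ip /Rintegral fineK //.
by apply: integrable_fin_num => //; exact: Ltwo_mul.
Qed.

Lemma ip_ge0 f : 0 <= ip f f.
Proof. by apply: Rintegral_ge0 => x _; rewrite -expr2 sqr_ge0. Qed.

Lemma fatou_cvg (f_ : nat -> T -> R) (f : T -> R) (C : \bar R) :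
  (forall n, measurable_fun [set: T] (f_ n)) -> (forall n x, 0 <= f_ n x) ->
  (forall x, f_ ^~ x @ \oo --> f x) ->
  (forall n, (\int[mu]_x (f_ n x)%:E <= C)%E) ->
  (\int[mu]_x (f x)%:E <= C)%E.
Proof.
move=> mf f0 cf iC.
have := @fatou _ _ _ mu setT measurableT (fun n x => (f_ n x)%:E).
have -> : (fun x => limn_einf (fun n => (f_ n x)%:E)) = (fun x => (f x)%:E).
  apply/funext => x; apply: (cvg_limn_einf_sup _).1.
  by apply/fine_cvgP; split; [exact: nearW|exact: cf].
move=> H; apply: (le_trans (H _ _)).
- by move=> n; exact/measurable_EFinP.
- by move=> n x _; rewrite lee_fin.
- rewrite limn_einf_lim; apply: lime_le; first exact: is_cvg_einfs.
  apply: nearW => n; apply: le_trans (iC n).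
  by apply: ereal_inf_lbound; exists n => /=.
Qed.

Lemma dct (f_ : nat -> T -> R) (f g : T -> R) :
  (forall n, measurable_fun [set: T] (f_ n)) -> measurable_fun [set: T] f ->
  (forall x, f_ ^~ x @ \oo --> f x) ->
  mu.-integrable setT (EFin \o g) -> (forall n x, `|f_ n x| <= g x) ->
  (fun n => \int[mu]_x f_ n x) @ \oo --> \int[mu]_x f x.
Proof.
move=> mf_ mf cf ig fg.
have mE n : measurable_fun [set: T] (fun x => (f_ n x)%:E) by exact/measurable_EFinP.
have mE' : measurable_fun [set: T] (fun x => (f x)%:E) by exact/measurable_EFinP.
have [||//if_ _ H] := dominated_convergence (mu := mu) measurableT mE mE' _ ig.
- by apply: aeW => x _; apply/fine_cvgP; split; [exact: nearW|exact: cf].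
- by apply: aeW => x n _; rewrite /= lee_fin.
have : (\int[mu]_x (f x)%:E)%E \is a fin_num by exact: integrable_fin_num.
by move=> /fineK e; move: H; rewrite -e => /fine_cvgP[_].
Qed.

(* Uniform [L^2] bounds plus pointwise convergence give weak convergence: split
   [|(g_n - g) h|] according to whether [|g_n - g| <= M |h|]. *)
Lemma weak_cvg (g_ : nat -> T -> R) g h (C : R) :
  (forall n, measurable_fun [set: T] (g_ n)) ->
  (forall n, (\int[mu]_x ((g_ n x) ^+ 2)%:E <= C%:E)%E) ->
  (forall x, g_ ^~ x @ \oo --> g x) -> measurable_fun [set: T] g ->
  Ltwo h -> ip (g_ n) h @[n --> \oo] --> ip g h.
Proof.
move=> mg bg cg mg' hh.
have hg_ n : Ltwo (g_ n) by split => //; apply: le_lt_trans (bg n) _; exact: ltry.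
have bg' : (\int[mu]_x ((g x) ^+ 2)%:E <= C%:E)%E.
  apply: (@fatou_cvg (fun n x => g_ n x ^+ 2)) => //.
  - by move=> n; exact: measurable_funX.
  - by move=> n x; exact: sqr_ge0.
  - by move=> x; apply: cvgM; exact: cg.
have hg : Ltwo g by split => //; apply: le_lt_trans bg' _; exact: ltry.
have C0 : 0 <= C by rewrite -lee_fin -(ipE hg) ?lee_fin ?ip_ge0 // in bg' *; apply: le_trans bg'; exact: ip_ge0.
have hd n : Ltwo (fun x => g_ n x - g x) by exact: LtwoB.
have bd n : ip (fun x => g_ n x - g x) (fun x => g_ n x - g x) <= 4 * C.
  apply: (@le_trans _ _ (2 * ip (g_ n) (g_ n) + 2 * ip g g)).
    rewrite -!RintegralZl //; try exact: Ltwo_mul.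
    rewrite -RintegralD //; last 2 first.
    - have := integrableZl measurableT 2 (Ltwo_mul (hg_ n) (hg_ n)); exact: eq_integrable.
    - have := integrableZl measurableT 2 (Ltwo_mul hg hg); exact: eq_integrable.
    apply: le_Rintegral => //.
    - exact: Ltwo_mul.
    - have := integrableD measurableT (integrableZl measurableT 2 (Ltwo_mul (hg_ n) (hg_ n))) (integrableZl measurableT 2 (Ltwo_mul hg hg)).
      exact: eq_integrable.
    - by move=> x _; have := sqr_ge0 (g_ n x + g x); nra.
  have := bg n; rewrite -(ipE (hg_ n)) lee_fin.
  by have := bg'; rewrite -(ipE hg) lee_fin; lra.
pose m (M : R) n x : R := Num.min `|(g_ n x - g x) * h x| (M * h x ^+ 2).
have mm M n : measurable_fun [set: T] (m M n).
  apply: measurable_minr.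
    apply: measurableT_comp => //; apply: measurable_funM; last exact: hh.1.
    by apply: measurable_funB.
  by apply: measurable_funM => //; apply: measurable_funX; exact: hh.1.
have m0 M n x : 0 <= M -> 0 <= m M n x.
  by move=> M0; rewrite le_min normr_ge0 mulr_ge0 // sqr_ge0.
have ih M : mu.-integrable setT (EFin \o (fun x => M * h x ^+ 2)).
  by have := integrableZl measurableT M (Ltwo_integrable hh); exact: eq_integrable.
have im M n : 0 <= M -> mu.-integrable setT (EFin \o m M n).
  move=> M0; apply: (le_integrable _ _ _ (ih M)) => //; first exact/measurable_EFinP.
  move=> x _ /=; rewrite lee_fin ger0_norm ?m0 // ger0_norm; last by rewrite mulr_ge0 // sqr_ge0.
  by rewrite ge_min lexx orbT.
have cm M : 0 <= M -> (fun n => \int[mu]_x m M n x) @ \oo --> (0 : R).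
  move=> M0; rewrite (_ : 0 = \int[mu]_x (fun=> 0 : R) x); last by rewrite Rintegral_cst // mul0r.
  apply: (@dct _ _ (fun x => M * h x ^+ 2)) => //.
  - move=> x; apply: (@squeeze_cvgr _ _ _ _ (fun=> 0) (fun n => `|(g_ n x - g x) * h x|)).
    + by apply: nearW => n; rewrite m0 //= ge_min lexx.
    + exact: cvg_cst.
    + rewrite (_ : 0 = `|(g x - g x) * h x|); last by rewrite subrr mul0r normr0.
      by apply: cvg_norm; apply: cvgM; [apply: cvgB; [exact: cg|exact: cvg_cst]|exact: cvg_cst].
  - by move=> n x; rewrite ger0_norm ?m0 // ge_min lexx orbT.
apply/cvgrPdist_le => e e0.
pose M := 8 * C / e + 1.
have M0 : 0 < M by rewrite ltr_wpDl // divr_ge0 // ?mulr_ge0 // ltW.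
have /cvgrPdist_le/(_ _ (divr_gt0 e0 (ltr0Sn _ 1))) := cm M (ltW M0).
apply: filterS => n /=; rewrite sub0r normrN => hn.
rewrite distrC -[ip (g_ n) h - _](_ : \int[mu]_x ((g_ n x - g x) * h x) = _); last first.
  by rewrite -RintegralB //; [apply: eq_Rintegral => x _; rewrite mulrBl|exact: Ltwo_mul|exact: Ltwo_mul].
apply: (le_trans (le_normr_Rintegral measurableT (Ltwo_mul (hd n) hh))).
have id := Ltwo_mul (hd n) (hd n).
have id' : mu.-integrable setT (EFin \o (fun x => M^-1 * ((g_ n x - g x) * (g_ n x - g x)))).
  by have := integrableZl measurableT M^-1 id; exact: eq_integrable.
have ->: e = e / 2 + e / 2 by field.
apply: (@le_trans _ _ (\int[mu]_x m M n x + M^-1 * (4 * C))); last first.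
  rewrite lerD //; first by apply: le_trans hn; exact: ler_norm.
  rewrite ler_pdivrMl // [leRHS](_ : _ = 4 * C + e / 2); first by rewrite lerDl divr_ge0 // ltW.
  by rewrite /M; field; exact: lt0r_neq0.
apply: (@le_trans _ _ (\int[mu]_x m M n x + M^-1 * ip (fun x => g_ n x - g x) (fun x => g_ n x - g x))); last first.
  by rewrite lerD2l ler_wpM2l // invr_ge0 ltW.
rewrite -RintegralZl // -RintegralD //; last exact: im (ltW M0).
apply: le_Rintegral => //.
- by have := integrable_norm (Ltwo_mul (hd n) hh); exact: eq_integrable.
- by have := integrableD measurableT (im M n (ltW M0)) id'; exact: eq_integrable.
move=> x _; rewrite /m /Num.min; set a := g_ n x - g x; set b := h x.
have Maa : 0 <= M^-1 * (a * a) by apply: mulr_ge0; [rewrite invr_ge0 ltW|rewrite -expr2 sqr_ge0].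
have Mbb : 0 <= M * b ^+ 2 by apply: mulr_ge0; [exact: ltW|exact: sqr_ge0].
case: ifPn => [_|]; first by rewrite lerDl.
rewrite -leNgt normrM => hab.
apply: (@le_trans _ _ (M^-1 * (a * a))); last by rewrite lerDr.
rewrite ler_pdivlMl // -expr2 -(real_normK (num_real a)).
have [b0|b0] := eqVneq b 0; first by rewrite b0 normr0 mulr0 mulr0 sqr_ge0.
have hb : 0 < `|b| by rewrite normr_gt0.
rewrite -(real_normK (num_real b)) in hab.
have hMa : M * `|b| <= `|a| by rewrite -(ler_pM2r hb) -mulrA -expr2.
by rewrite expr2 mulrCA ler_wpM2l.
Qed.

End L2.

(** * Selection of pointwise limits *)

Section Helly.
Context {R : realType}.
Implicit Types u : R -> R.

Definition cone u := [/\ forall x, 0 <= u x, forall x, u (- x) = u x &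
  forall x y, 0 < x -> x <= y -> u y <= u x].

Lemma cone_norm u x : cone u -> u `|x| = u x.
Proof. by case=> _ ev _; case: (ger0P x). Qed.

Lemma cone_le u x y : cone u -> x != 0 -> `|x| <= `|y| -> u y <= u x.
Proof.
move=> cu x0 xy; rewrite -(cone_norm x cu) -(cone_norm y cu).
by case: cu => _ _; apply => //; rewrite normr_gt0.
Qed.

Lemma measurable_nonincr_pos u : (forall x y, 0 < x -> x <= y -> u y <= u x) ->
  measurable_fun ([set` `]0%R, +oo[%R] : set R) u.
Proof.
move=> ni; rewrite -[u]opprK; apply/measurable_funN.
apply: (measurability (@RGenCInfty.G R)) => [|/= _ [_] [r] -> <-].
  exact: RGenCInfty.measurableE.
apply: is_interval_measurable => s t/=.
rewrite !in_itv/= !andbT => -[s0 us] [t0 ut] z /andP[sz zt].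
have z0 : 0 < z by exact: lt_le_trans sz.
rewrite !in_itv/= !andbT; split => //.
by apply: le_trans us _; rewrite lerN2; exact: ni.
Qed.

Lemma measurable_cone u : cone u -> measurable_fun [set: R] u.
Proof.
move=> cu; have [_ ev ni] := cu.
have m1 := measurable_nonincr_pos ni.
have -> : [set: R] = [set` `]0%R, +oo[%R] `|` ([set` `]-oo, 0%R[%R] `|` [set 0]).
  apply/seteqP; split => // x _ /=; rewrite !in_itv/= andbT.
  by case: (ltrgtP x 0) => [?|?|->]; [right; left|left|right; right].
apply/measurable_funU => //; first by apply: measurableU.
split => //; apply/measurable_funU => //; split; last first.
  exact: measurable_fun_set1.
have -> : u = u \o -%R by apply/funext => x /=; rewrite ev.
apply: (@measurable_comp _ _ _ _ _ _ ([set` `]0%R, +oo[%R] : set R) u ([set` `]-oo, 0%R[%R] : set R) -%R) => //.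
by move=> _ [x /= + <-]; rewrite !in_itv/= andbT oppr_gt0.
Qed.

Lemma helly_cluster (u_ : nat -> R -> R) (B : R -> R) :
  (forall n x, 0 <= u_ n x <= B x) ->
  exists g : R -> R, forall (S : seq R) (e : R) (N : nat), 0 < e ->
    exists2 n, (N <= n)%N & forall x, x \in S -> `|u_ n x - g x| < e.
Proof.
move=> uB.
pose T := fun _ : R => (R : topologicalType).
pose F : set_system (prod_topology T) := [set A | \forall n \near \oo, A (u_ n)].
have FF : ProperFilter F by exact: (@fmap_proper_filter _ _ (u_ : nat -> prod_topology T)).
have K := @tychonoff R T (fun x => [set` `[0, B x]]) (fun x => @segment_compact R 0 (B x)).
have FK : F [set f | forall i : R, [set` `[0, B i]] (f i)].
  by exists 0%N => // n _ x /=; rewrite in_itv/=.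
have [g [gB gc]] := K F FF FK.
exists g => S e N e0.
have nS : nbhs (g : prod_topology T) [set f | forall x, x \in S -> `|f x - g x| < e].
  elim: S => [|y S IH]; first by apply: filterS filterT => f _ x.
  have ny : nbhs (g : prod_topology T) [set f | `|f y - g y| < e].
    have /= := @proj_continuous R T y g [set r : R | `|r - g y| < e].
    apply; apply/nbhs_ballP; exists e => //= r; rewrite /ball/= distrC; exact.
  apply: filterS2 IH ny => f /= h1 h2 x; rewrite inE => /predU1P[->//|]; exact: h1.
have [|f [[n /= Nn <-] h]] := gc [set f | exists2 n, (N <= n)%N & u_ n = f] _ _ nS.
  by exists N => // n /= Nn; exists n.
by exists n.
Qed.

Lemma cone_cluster (u_ : nat -> R -> R) g :
  (forall n, cone (u_ n)) ->
  (forall (S : seq R) (e : R) (N : nat), 0 < e ->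
    exists2 n, (N <= n)%N & forall x, x \in S -> `|u_ n x - g x| < e) -> cone g.
Proof.
move=> cu H; split.
- move=> x; apply/ler_addgt0Pl => e e0.
  have [n _ /(_ x (mem_head _ _))] := H [:: x] e 0%N e0.
  by have [+ _ _] := cu n => /(_ x); rewrite ltr_norml => ? /andP[? ?]; lra.
- move=> x; apply/eqP; rewrite -subr_eq0 -normr_le0; apply/ler_addgt0Pl => e e0.
  have [n _ h] := H [:: x; - x] (e / 2) 0%N (divr_gt0 e0 (ltr0Sn _ 1)).
  have := h x; have := h (- x); rewrite !inE !eqxx ?orbT /= => /(_ isT) + /(_ isT).
  have [_ -> _] := cu n; rewrite !ltr_norml ler_norml => /andP[? ?] /andP[? ?].
  by apply/andP; lra.
- move=> x y x0 xy; apply/ler_addgt0Pl => e e0.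
  have [n _ h] := H [:: x; y] (e / 2) 0%N (divr_gt0 e0 (ltr0Sn _ 1)).
  have := h x; have := h y; rewrite !inE !eqxx ?orbT /= => /(_ isT) + /(_ isT).
  have [_ _ /(_ x y x0 xy) ?] := cu n; rewrite !ltr_norml => /andP[? ?] /andP[? ?].
  by lra.
Qed.

Lemma left_point (P : R -> Prop) (x a : R) : a < x -> (\forall y \near x^'-, P y) ->
  exists q : rat, a < ratr q /\ ratr q < x /\ P (ratr q).
Proof.
move=> ax [i /= i0 H].
have : Num.max a (x - i) < x by rewrite gt_max ax ltrBlDr ltrDl.
move=> /rat_in_itvoo[q].
rewrite in_itv/= gt_max => /andP[/andP[aq iq] qx]; exists q; split => //; split => //.
by apply: H => //=; rewrite ger0_norm ?subr_ge0 ?ltW // ltrBlDl -ltrBlDr.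
Qed.

Lemma right_point (P : R -> Prop) (x : R) : (\forall y \near x^'+, P y) ->
  exists q : rat, x < ratr q /\ P (ratr q).
Proof.
move=> [i /= i0 H].
have : x < x + i by rewrite ltrDl.
move=> /rat_in_itvoo[q].
rewrite in_itv/= => /andP[xq qi]; exists q; split => //.
by apply: H => //=; rewrite distrC ger0_norm ?subr_ge0 ?ltW // ltrBlDl.
Qed.

Definition jumps (g : R -> R) : set R :=
  \bigcup_(n in [set: nat]) [set x | x \in (`]n.+1%:R^-1, n.+1%:R[) /\ discontinuity (-%R \o g) x].

Lemma countable_jumps g : cone g -> countable (jumps g).
Proof.
move=> [_ _ ni]; apply: bigcup_countable => // n _; apply: discontinuity_countable.
move=> x y; rewrite !in_itv/= => /andP[x0 _] _ xy; rewrite lerN2 ni //.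
by apply: lt_le_trans x0; rewrite invr_gt0.
Qed.

Lemma cone_squeeze g x e : cone g -> 0 < x -> ~ jumps g x -> 0 < e ->
  exists p q : rat, [/\ 0 < ratr p :> R, ratr p < x, x < ratr q & g (ratr p) - g (ratr q) <= e].
Proof.
move=> [g0 _ ni] x0 nj e0.
pose G := -%R \o g.
have GL : cvg (G y @[y --> x^'-]).
  apply: nondecreasing_at_left_is_cvgr.
  - near=> z; move=> a b; rewrite !in_itv/= => /andP[za _] _ ab; rewrite lerN2 ni //.
    apply: lt_trans za; near: z; exact: nbhs_left_gt.
  - near=> z; exists 0 => _ [y _ <-]; by rewrite /G /= oppr_le0.
have GR : cvg (G y @[y --> x^'+]).
  apply: nondecreasing_at_right_is_cvgr.
  - near=> z; move=> a b; rewrite !in_itv/= => /andP[za _] _ ab; rewrite lerN2 ni //.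
    by apply: lt_trans za.
  - near=> z; exists (- g x) => _ [y /= + <-]; rewrite in_itv/= => /andP[xy _].
    by rewrite lerN2 ni // ltW.
have LR : lim (G y @[y --> x^'-]) = lim (G y @[y --> x^'+]).
  apply: contra_notP nj => /eqP LR.
  pose m := Num.max x x^-1.
  have := truncnS_gt m; rewrite /m gt_max => /andP[h1 h2].
  exists (Num.trunc m) => //; split => //; rewrite in_itv/= h1 andbT.
  by rewrite invf_plt ?posrE.
have e2 : 0 < e / 2 by rewrite divr_gt0.
have [p [p0 [px hp]]] := left_point x0 ((cvgrPdist_le _ _).1 GL _ e2).
have [q [xq hq]] := right_point ((cvgrPdist_le _ _).1 GR _ e2).
exists p, q; split => //.
move: hp hq; rewrite LR /G /= !ler_norml => /andP[? ?] /andP[? ?]; lra.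
Unshelve. all: by end_near. Qed.

Lemma helly (u_ : nat -> R -> R) (B : R -> R) :
  (forall n, cone (u_ n)) -> (forall n x, u_ n x <= B x) ->
  exists phi (u : R -> R), [/\ forall n, (n <= phi n)%N, cone u &
    forall x, (fun n => u_ (phi n) x) @ \oo --> u x].
Proof.
move=> cu uB.
have [|g Hg] := @helly_cluster u_ B.
  by move=> n x; rewrite uB andbT; have [] := cu n.
have cg := cone_cluster cu Hg.
pose S := jumps g `|` range (@ratr R).
have cS : countable S.
  rewrite /S -bigcup2E; apply: bigcup_countable => // -[|[|n]] _ /=.
  - exact: countable_jumps.
  - apply: (@card_le_trans _ _ _ [set: rat]); [exact: card_image_le|exact: countableP].
  - exact: countable0.
have /pfcard_geP[S0|[s]] := cS.
  have : S (ratr 0) by right; exists 0.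
  by rewrite S0.
have phiP n : {m | (n <= m)%N & forall i, (i <= n)%N -> `|u_ m (s i) - g (s i)| < n.+1%:R^-1}.
  apply: cid2; have [|m nm h] := Hg [seq s i | i <- iota 0 n.+1] n.+1%:R^-1 n.
    by rewrite invr_gt0.
  by exists m => // i ni; apply: h; apply: map_f; rewrite mem_iota.
pose phi n := s2val (phiP n).
have nphi n : (n <= phi n)%N by rewrite /phi; case: (phiP n).
have hphi n i : (i <= n)%N -> `|u_ (phi n) (s i) - g (s i)| < n.+1%:R^-1.
  by rewrite /phi; case: (phiP n) => m ? h ?; exact: h.
have cvS x : S x -> (fun n => u_ (phi n) x) @ \oo --> g x.
  move=> Sx; have [i _ <-] := @surj _ _ _ _ s x Sx.
  apply/cvgrPdist_le => e e0.
  near=> n; rewrite distrC; apply: (le_trans (ltW (hphi _ _ _))).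
    by near: n; exact: nbhs_infty_ge.
  rewrite invf_ple ?posrE //; near: n.
  by apply: filterS (nbhs_infty_ger e^-1) => n /le_trans; apply; rewrite ler_nat.
have cvP x : 0 < x -> (fun n => u_ (phi n) x) @ \oo --> g x.
  move=> x0; have [Sx|nS] := pselect (S x); first exact: cvS.
  have nj : ~ jumps g x by move=> h; apply: nS; left.
  apply/cvgrPdist_le => e e0.
  have e2 : 0 < e / 2 by rewrite divr_gt0.
  have [p [q [p0 px xq pq]]] := cone_squeeze cg x0 nj e2.
  have Sp : S (ratr p) by right; exists p.
  have Sq : S (ratr q) by right; exists q.
  have [_ _ gni] := cg.
  have ? := gni _ _ p0 (ltW px); have ? := gni _ _ x0 (ltW xq).
  have /cvgrPdist_le/(_ _ e2) hp := cvS _ Sp.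
  have /cvgrPdist_le/(_ _ e2) hq := cvS _ Sq.
  apply: filterS2 hp hq => n.
  have [_ _ uni] := cu (phi n).
  have ? := uni _ _ p0 (ltW px); have ? := uni _ _ x0 (ltW xq).
  by rewrite !ler_norml => /andP[? ?] /andP[? ?]; apply/andP; lra.
exists phi, g; split => // x.
have [x0|x0|->] := ltgtP x 0.
- have [_ gev _] := cg; rewrite -gev.
  have -> : (fun n => u_ (phi n) x) = (fun n => u_ (phi n) (- x)).
    by apply/funext => n; have [_ -> _] := cu (phi n).
  by apply: cvP; rewrite oppr_gt0.
- exact: cvP.
- by apply: cvS; right; exists 0 => //; rewrite rmorph0.
Unshelve. all: by end_near. Qed.

End Helly.

(** * The quadratic form *)

Lemma quadratic_discr (R : realFieldType) (a b c : R) : 0 <= c ->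
  (forall t, 0 <= a + 2 * t * b + t ^+ 2 * c) -> b ^+ 2 <= a * c.
Proof.
move=> c0 H; have [c00|cN0] := eqVneq c 0.
  have [->|bN0] := eqVneq b 0; first by rewrite c00 mulr0 expr0n.
  have := H (- (a + 1) / (2 * b)); rewrite c00 mulr0 addr0.
  have -> : a + 2 * (- (a + 1) / (2 * b)) * b = -1 by field.
  by lra.
have cp : 0 < c by rewrite lt0r cN0.
have := H (- b / c).
have -> : a + 2 * (- b / c) * b + (- b / c) ^+ 2 * c = (a * c - b ^+ 2) / c by field.
by rewrite pmulr_lge0 ?invr_gt0 // subr_ge0.
Qed.

Section form.
Context {R : realType}.
Local Notation leb := (@lebesgue_measure R).
Local Notation leb2 := ((@lebesgue_measure R) \x (@lebesgue_measure R))%E.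
Variable k : R -> R.
Hypothesis mk : measurable_fun [set: R] k.
Hypothesis k_ge0 : forall t, 0 <= k t.

Definition dl (u : R -> R) (z : R * R) : R :=
  (u z.1 - u z.2) * Num.sqrt (k (z.1 - z.2)).

Definition inH (u : R -> R) := Ltwo leb u /\ Ltwo leb2 (dl u).

Definition Q (A : R) (u v : R -> R) : R :=
  2^-1 * ip leb2 (dl u) (dl v) + A * ip leb u v.

Lemma measurable_kdiff : measurable_fun [set: R * R] (fun z : R * R => k (z.1 - z.2)).
Proof. by apply: (measurableT_comp mk); exact: measurable_funB. Qed.

Lemma measurable_sqrtR : measurable_fun [set: R] (@Num.sqrt R).
Proof. by apply: continuous_measurable_fun; exact: sqrt_continuous. Qed.

Lemma measurable_dl u : measurable_fun [set: R] u -> measurable_fun [set: R * R] (dl u).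
Proof.
move=> mu; apply: measurable_funM.
  by apply: measurable_funB; exact: measurableT_comp.
apply: (measurableT_comp measurable_sqrtR); exact: measurable_kdiff.
Qed.

Lemma dl_mul u v z : dl u z * dl v z = (u z.1 - u z.2) * (v z.1 - v z.2) * k (z.1 - z.2).
Proof. by rewrite /dl mulrACA -expr2 sqr_sqrtr. Qed.

Lemma dl_sqr u z : dl u z ^+ 2 = (u z.1 - u z.2) ^+ 2 * k (z.1 - z.2).
Proof. by rewrite expr2 dl_mul -expr2. Qed.

Lemma dlD u v : dl (fun x => u x + v x) = (fun z => dl u z + dl v z).
Proof. by apply/funext => z; rewrite /dl; ring. Qed.

Lemma dlZ a u : dl (fun x => a * u x) = (fun z => a * dl u z).
Proof. by apply/funext => z; rewrite /dl; ring. Qed.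

Lemma dlB u v : dl (fun x => u x - v x) = (fun z => dl u z - dl v z).
Proof. by apply/funext => z; rewrite /dl; ring. Qed.

Lemma inHD u v : inH u -> inH v -> inH (fun x => u x + v x).
Proof. by move=> [? ?] [? ?]; split; [exact: LtwoD|rewrite dlD; exact: LtwoD]. Qed.

Lemma inHZ a u : inH u -> inH (fun x => a * u x).
Proof. by move=> [? ?]; split; [exact: LtwoZ|rewrite dlZ; exact: LtwoZ]. Qed.

Lemma inHB u v : inH u -> inH v -> inH (fun x => u x - v x).
Proof. by move=> [? ?] [? ?]; split; [exact: LtwoB|rewrite dlB; exact: LtwoB]. Qed.

Lemma inH_meas u : inH u -> measurable_fun [set: R] u.
Proof. by case=> [[]]. Qed.

Lemma inH_contraction (u v : R -> R) : measurable_fun [set: R] v -> inH u ->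
  (forall x, `|v x| <= `|u x|) -> (forall x y, `|v x - v y| <= `|u x - u y|) -> inH v.
Proof.
move=> mv [hu hdu] h1 h2; split; first exact: Ltwo_le hu h1.
apply: (Ltwo_le _ hdu); first exact: measurable_dl.
by move=> z; rewrite /dl !normrM ler_wpM2r.
Qed.

Lemma QC A u v : Q A u v = Q A v u.
Proof. by rewrite /Q ipC [ip leb u v]ipC. Qed.

Lemma QDl A u v w : inH u -> inH v -> inH w ->
  Q A (fun x => u x + v x) w = Q A u w + Q A v w.
Proof.
move=> [? ?] [? ?] [? ?]; rewrite /Q dlD ipDl // ipDl //; ring.
Qed.

Lemma QZl A a u w : inH u -> inH w -> Q A (fun x => a * u x) w = a * Q A u w.
Proof. move=> [? ?] [? ?]; rewrite /Q dlZ ipZl // ipZl //; ring. Qed.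

Lemma QBl A u v w : inH u -> inH v -> inH w ->
  Q A (fun x => u x - v x) w = Q A u w - Q A v w.
Proof.
move=> hu hv hw; have := @QDl A u (fun x => -1 * v x) w hu (inHZ (-1) hv) hw.
by rewrite QZl // mulN1r => <-; congr Q; apply/funext => x; rewrite mulN1r.
Qed.

Lemma Q_ge0 A u : 0 <= A -> 0 <= Q A u u.
Proof. by move=> A0; rewrite addr_ge0 // mulr_ge0 ?ip_ge0. Qed.

Lemma Q_CS A u v : 0 <= A -> inH u -> inH v -> Q A u v ^+ 2 <= Q A u u * Q A v v.
Proof.
move=> A0 hu hv; apply: quadratic_discr => [|t]; first exact: Q_ge0.
have htv := inHZ t hv.
have := Q_ge0 (fun x => u x + t * v x) A0.
have huv := inHD hu htv.
rewrite QDl // [Q A u _]QC [Q A (fun x => t * v x) _]QC !QDl // !QZl // [Q A v u]QC.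
rewrite [Q A u (fun x => t * v x)]QC QZl // [Q A v (fun x => t * v x)]QC QZl // [Q A v u]QC.
set a := Q A u u; set b := Q A u v; set c := Q A v v; rewrite expr2.
by have -> : a + t * b + (t * b + t * (t * c)) = a + 2 * t * b + t * t * c by ring.
Qed.

Lemma energy_le_Q A u : 0 <= A -> inH u -> ip leb2 (dl u) (dl u) <= 2 * Q A u u.
Proof.
move=> A0 hu; rewrite /Q; have := mulr_ge0 A0 (ip_ge0 leb u); lra.
Qed.

Lemma l2_le_Q A u : 0 <= A -> A * ip leb u u <= Q A u u.
Proof. by move=> A0; rewrite /Q lerDr mulr_ge0 ?ip_ge0. Qed.

Lemma dl_shift a u : dl (fun x => u (x + a)) = (fun z => dl u (z.1 + a, z.2 + a)).
Proof.
by apply/funext => z; rewrite /dl /=; congr (_ * Num.sqrt (k _)); ring.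
Qed.

Lemma ip_shift a u v : measurable_fun [set: R] u -> measurable_fun [set: R] v ->
  ip leb (fun x => u (x + a)) (fun x => v (x + a)) = ip leb u v.
Proof.
move=> hu hv; rewrite /ip /Rintegral.
rewrite (@integral_shift _ a (fun x => (u x * v x)%:E)) //.
by apply/measurable_EFinP; exact: measurable_funM.
Qed.

Lemma Ltwo_shift a u : Ltwo leb u -> Ltwo leb (fun x => u (x + a)).
Proof.
move=> [m1 h]; split; first by apply: (measurableT_comp m1); exact: measurable_shift.
rewrite (@integral_shift _ a (fun x => ((u x) ^+ 2)%:E)) //.
by apply/measurable_EFinP; exact: measurable_funX.
Qed.

Lemma inH_shift a u : inH u -> inH (fun x => u (x + a)).
Proof.
move=> [h1 [m2 h2]]; split; first exact: Ltwo_shift.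
rewrite dl_shift; split.
  by apply: (measurableT_comp m2); exact: measurable_diag_shift.
rewrite (@integral2_shift _ a (fun z => ((dl u z) ^+ 2)%:E)) //.
by apply/measurable_EFinP; exact: measurable_funX.
Qed.

Lemma Q_shift A a u v : inH u -> inH v ->
  Q A (fun x => u (x + a)) (fun x => v (x + a)) = Q A u v.
Proof.
move=> [[mu ?] [mdu ?]] [[mv ?] [mdv ?]]; rewrite /Q ip_shift // !dl_shift.
congr (_ * _ + _); rewrite /ip /Rintegral.
rewrite (@integral2_shift _ a (fun z => (dl u z * dl v z)%:E)) //.
by apply/measurable_EFinP; exact: measurable_funM.
Qed.

End form.

Section form_limit.
Context {R : realType}.
Local Notation leb := (@lebesgue_measure R).
Local Notation leb2 := ((@lebesgue_measure R) \x (@lebesgue_measure R))%E.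
Variables (k_ : nat -> R -> R) (k : R -> R) (A : R).
Hypothesis mk_ : forall n, measurable_fun [set: R] (k_ n).
Hypothesis mk : measurable_fun [set: R] k.
Hypothesis k_k : forall n t, 0 <= k_ n t <= k t.
Hypothesis k_cvg : forall t, k_ ^~ t @ \oo --> k t.
Hypothesis A0 : 0 < A.

Lemma inH_le_kernel n u : inH k u -> inH (k_ n) u.
Proof.
move=> [hu hdu]; split => //; apply: (Ltwo_le _ hdu).
  by apply: measurable_dl => //; exact: hu.1.
move=> z; have /andP[? ?] := k_k n (z.1 - z.2).
by rewrite /dl !normrM ler_wpM2l // !ger0_norm ?sqrtr_ge0 // ler_sqrt // (le_trans _ (_ : k_ n (z.1 - z.2) <= _)).
Qed.

Let k0 t : 0 <= k t. Proof. by have /andP[h1 h2] := k_k 0%N t; exact: le_trans h2. Qed.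
Let k_0 n t : 0 <= k_ n t. Proof. by have /andP[] := k_k n t. Qed.

Lemma Q_le_kernel n u : inH k u -> Q (k_ n) A u u <= Q k A u u.
Proof.
move=> hu; have [hl hd] := inH_le_kernel n hu; have [_ hd'] := hu.
rewrite /Q lerD2r ler_wpM2l //; apply: le_Rintegral => //; try exact: Ltwo_mul.
move=> z _; rewrite !dl_mul // -expr2 ler_wpM2l ?sqr_ge0 //.
by have /andP[] := k_k n (z.1 - z.2).
Qed.

Lemma form_limit (u_ : nat -> R -> R) (u : R -> R) (C : R) :
  (forall n, inH (k_ n) (u_ n)) -> (forall n, Q (k_ n) A (u_ n) (u_ n) <= C) ->
  (forall x, u_ ^~ x @ \oo --> u x) -> measurable_fun [set: R] u ->
  [/\ inH k u, Q k A u u <= C &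
    forall phi, inH k phi -> (fun n => Q (k_ n) A (u_ n) phi) @ \oo --> Q k A u phi].
Proof.
move=> hu_ QC cu mu.
have mu_ n : measurable_fun [set: R] (u_ n) by exact: inH_meas (hu_ n).
have l2b n : ip leb (u_ n) (u_ n) <= C / A.
  by rewrite ler_pdivlMr // mulrC; apply: le_trans (QC n); exact/l2_le_Q/ltW.
have eb n : ip leb2 (dl (k_ n) (u_ n)) (dl (k_ n) (u_ n)) <= 2 * C.
  apply: (le_trans (energy_le_Q (ltW A0) (hu_ n))).
  by rewrite ler_wpM2l.
have cs t : Num.sqrt (k_ n t) @[n --> \oo] --> Num.sqrt (k t).
  by apply: continuous_cvg; [exact: sqrt_continuous|exact: k_cvg].
have cdl z : dl (k_ n) (u_ n) z @[n --> \oo] --> dl k u z.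
  by apply: cvgM => //; apply: cvgB.
have mdl n : measurable_fun [set: R * R] (dl (k_ n) (u_ n)) by exact: measurable_dl.
have mdlu : measurable_fun [set: R * R] (dl k u) by exact: measurable_dl.
have iE1 n : (\int[leb]_x ((u_ n x) ^+ 2)%:E <= (C / A)%:E)%E.
  by rewrite -ipE ?lee_fin //; exact: (hu_ n).1.
have iE2 n : (\int[leb2]_z ((dl (k_ n) (u_ n) z) ^+ 2)%:E <= (2 * C)%:E)%E.
  by rewrite -ipE ?lee_fin //; exact: (hu_ n).2.
have mu2 n : measurable_fun [set: R] (fun x => u_ n x ^+ 2) by exact: measurable_funX.
have hul : (\int[leb]_x ((u x) ^+ 2)%:E <= (C / A)%:E)%E.
  apply: (fatou_cvg (mu := leb) (f_ := fun n x => u_ n x ^+ 2) (f := fun x => u x ^+ 2)) => //.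
  - by move=> n x; exact: sqr_ge0.
  - by move=> x; apply: cvgM; exact: cu.
have mdl2 n : measurable_fun [set: R * R] (fun z => dl (k_ n) (u_ n) z ^+ 2) by exact: measurable_funX.
have hud : (\int[leb2]_z ((dl k u z) ^+ 2)%:E <= (2 * C)%:E)%E.
  apply: (fatou_cvg (mu := leb2) (f_ := fun n z => dl (k_ n) (u_ n) z ^+ 2) (f := fun z => dl k u z ^+ 2)) => //.
  - by move=> n x; exact: sqr_ge0.
  - by move=> x; apply: cvgM; exact: cdl.
have hu : inH k u.
  by split; split => //; [apply: le_lt_trans hul _|apply: le_lt_trans hud _]; exact: ltry.
have wk phi : inH k phi -> (fun n => Q (k_ n) A (u_ n) phi) @ \oo --> Q k A u phi.
  move=> hphi; apply: cvgD; apply: cvgM; try exact: cvg_cst; last first.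
    by apply: (weak_cvg (C := C / A)) => //; exact: hphi.1.
  pose th n z := Num.sqrt (k_ n (z.1 - z.2)) / Num.sqrt (k (z.1 - z.2)).
  have th01 n z : 0 <= th n z <= 1.
    have /andP[a0 ak] := k_k n (z.1 - z.2).
    have [k00|kp] := eqVneq (k (z.1 - z.2)) 0.
      by rewrite /th k00 sqrtr0 invr0 mulr0 lexx ler01.
    have kp' : 0 < k (z.1 - z.2) by rewrite lt0r kp (le_trans a0).
    by rewrite /th divr_ge0 ?sqrtr_ge0 //= ler_pdivrMr ?sqrtr_gt0 // mul1r ler_sqrt.
  pose G n z := dl (k_ n) (u_ n) z * th n z.
  have mth n : measurable_fun [set: R * R] (th n).
    have -> : th n = (fun z => Num.sqrt (k_ n (z.1 - z.2)) * (Num.sqrt (k (z.1 - z.2)) `^ (-1))).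
      by apply/funext => z; rewrite /th powR_inv1 // sqrtr_ge0.
    apply: measurable_funM.
      by apply: (measurableT_comp measurable_sqrtR); exact: measurable_kdiff.
    apply: (measurableT_comp (measurable_powR _)).
    by apply: (measurableT_comp measurable_sqrtR); exact: measurable_kdiff.
  have mG n : measurable_fun [set: R * R] (G n) by exact: measurable_funM.
  have mG2 n : measurable_fun [set: R * R] (fun z => G n z ^+ 2) by exact: measurable_funX.
  have -> : (fun n => ip leb2 (dl (k_ n) (u_ n)) (dl (k_ n) phi)) = (fun n => ip leb2 (G n) (dl k phi)).
    apply/funext => n; apply: eq_Rintegral => z _.
    rewrite /G /th /dl.
    have [k00|kp] := eqVneq (k (z.1 - z.2)) 0.
      have := k_k n (z.1 - z.2); rewrite k00 => /le_anti <-.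
      by rewrite sqrtr0 !(mulr0, mul0r).
    have : Num.sqrt (k (z.1 - z.2)) != 0 by rewrite sqrtr_eq0 -ltNge lt0r kp k0.
    by move=> ?; field.
  apply: (weak_cvg (C := 2 * C)) => //.
  - move=> n; apply: le_trans (iE2 n); apply: ge0_le_integral => //.
    + by move=> z _; rewrite lee_fin sqr_ge0.
    + by apply/measurable_EFinP; exact: mG2.
    + by apply/measurable_EFinP; exact: mdl2.
    + move=> z _; rewrite lee_fin /G exprMn ler_piMr ?sqr_ge0 //.
      by have /andP[? ?] := th01 n z; rewrite expr2 mulr_ile1.
  - move=> z; rewrite /G /th.
    have [k00|kp] := eqVneq (k (z.1 - z.2)) 0.
      rewrite (_ : dl k u z = 0); last by rewrite /dl k00 sqrtr0 mulr0.
      by under eq_fun do rewrite k00 sqrtr0 invr0 !mulr0; exact: cvg_cst.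
    have sk : Num.sqrt (k (z.1 - z.2)) != 0 by rewrite sqrtr_eq0 -ltNge lt0r kp k0.
    rewrite -[dl k u z]mulr1 -(divff sk); apply: cvgM => //.
    by apply: cvgM => //; exact: cvg_cst.
  - exact: hphi.2.
split => //.
have CS n : Q (k_ n) A (u_ n) u ^+ 2 <= C * Q k A u u.
  apply: (le_trans (Q_CS (ltW A0) (hu_ n) (inH_le_kernel n hu))).
  by apply: ler_pM; [exact/Q_ge0/ltW|exact/Q_ge0/ltW|exact: QC|exact: Q_le_kernel].
have : Q k A u u ^+ 2 <= C * Q k A u u.
  have cQ : (fun n => Q (k_ n) A (u_ n) u ^+ 2) @ \oo --> Q k A u u ^+ 2.
    by apply: cvgM; exact: wk.
  by apply: (cvgr_to_le cQ); apply: nearW.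
have : 0 <= Q k A u u by exact/Q_ge0/ltW.
rewrite le_eqVlt => /predU1P[<- _|Qp].
  by apply: le_trans (QC 0%N); exact/Q_ge0/ltW.
by rewrite expr2 ler_pM2r.
Qed.
End form_limit.

Section powers.
Context {R : realType}.
Local Notation leb := (@lebesgue_measure R).

Lemma powR_nonincr (a x y : R) : a <= 0 -> 0 < x -> x <= y -> y `^ a <= x `^ a.
Proof.
move=> a0 x0 xy; rewrite -[a]opprK !(powRN _ (- a)) lef_pV2 ?posrE ?powR_gt0 ?(lt_le_trans x0) //.
by apply: ge0_ler_powR => //; rewrite ?oppr_ge0 // ?nnegrE ltW // (lt_le_trans x0).
Qed.

Lemma powR_nondecr (a x y : R) : 0 <= a -> 0 <= x -> x <= y -> x `^ a <= y `^ a.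
Proof. by move=> a0 x0 xy; apply: ge0_ler_powR; rewrite ?nnegrE // (le_trans x0). Qed.

Lemma measurable_powRl (a : R) (f : R -> R) : measurable_fun [set: R] f ->
  measurable_fun [set: R] (fun x => f x `^ a).
Proof. by move=> mf; apply: (measurableT_comp (measurable_powR _)). Qed.

Lemma cvg_powR (a x : R) : 0 < x -> {for x, continuous (fun y : R => y `^ a)}.
Proof.
move=> x0; apply: differentiable_continuous; apply/derivable1_diffP.
by apply: derivable_powR; rewrite in_itv/= x0.
Qed.

Lemma integral_powR_itv (c a b : R) : c != 1 -> 0 < a -> a < b ->
  (\int[leb]_(x in `[a, b]) (x `^ (- c))%:E =
   ((b `^ (1 - c) - a `^ (1 - c)) / (1 - c))%:E)%E.
Proof.
move=> c1 a0 ab; have c1' : 1 - c != 0 by rewrite subr_eq0 eq_sym.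
pose F : R -> R := fun x => (1 - c)^-1 * x `^ (1 - c).
have dF (x : R) : 0 < x -> is_derive x 1 F (x `^ (- c)).
  move=> x0; rewrite /F.
  have := fun k => is_deriveZ k (is_derive1_powR (1 - c) x0).
  move=> /(_ (1 - c)^-1); rewrite /GRing.scale/= mulrA mulVf // mul1r.
  by have -> : 1 - c - 1 = - c by ring.
have cF (x : R) : 0 < x -> {for x, continuous F}.
  by move=> x0; apply: differentiable_continuous; apply/derivable1_diffP; have [] := dF x x0.
rewrite (@continuous_FTC2 _ _ F) //.
- by rewrite /F -EFinB; congr (_%:E); ring.
- apply: continuous_in_subspaceT => x; rewrite inE/= in_itv/= => /andP[ax _].
  by apply: cvg_powR; exact: lt_le_trans ax.
- split.
  + move=> x; rewrite in_itv/= => /andP[ax _].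
    by have [] := dF x (lt_trans a0 ax).
  + by apply: cvg_at_right_filter; exact: cF.
  + by apply: cvg_at_left_filter; apply: cF; exact: lt_trans ab.
- move=> x; rewrite in_itv/= => /andP[ax _].
  by rewrite derive1E; have [_] := dF x (lt_trans a0 ax).
Qed.

Lemma integral_powR0 (c r : R) : c < 1 -> 0 < r ->
  (\int[leb]_(x in [set` `]0%R, r]]) (x `^ (- c))%:E <= (r `^ (1 - c) / (1 - c))%:E)%E.
Proof.
move=> c1 r0.
pose F n : set R := [set` `[r / n.+2%:R, r]].
have -> : [set` `]0%R, r]] = \bigcup_n F n.
  apply/seteqP; split => x /=; rewrite in_itv/=.
    move=> /andP[x0 x1].
    exists (Num.trunc (r / x)) => //=; rewrite /F /= in_itv/= x1 andbT.
    rewrite ler_pdivrMr // mulrC -ler_pdivrMr //.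
    by apply: (le_trans (ltW (truncnS_gt _))); rewrite ler_nat.
  move=> [n _]; rewrite /F /= in_itv/= => /andP[h ->]; rewrite andbT.
  by apply: lt_le_trans h; rewrite divr_gt0.
have cv : (\int[leb]_(x in F i) (x `^ (- c))%:E)%E @[i --> \oo] --> (\int[leb]_(x in \bigcup_i F i) (x `^ (- c))%:E)%E.
  apply: ge0_nondecreasing_set_cvg_integral => //.
  - move=> n m nm; apply/subsetPset => x; rewrite /F /= !in_itv/= => /andP[h ->].
    by rewrite andbT; apply: le_trans h; rewrite ler_pM2l // lef_pV2 ?posrE // ler_nat.
  - by move=> i; exact: measurable_itv.
  - move=> i; apply/measurable_EFinP; apply: measurable_funTS.
    exact: (@measurable_powR R).
  - by move=> i x _; rewrite lee_fin powR_ge0.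
have /cvg_lim <- // := cv.
apply: lime_le; first by apply/cvg_ex; eexists; exact: cv.
apply: nearW => n; rewrite integral_powR_itv ?lt_eqF ?divr_gt0 //.
  by rewrite lee_fin ler_pM2r ?invr_gt0 ?subr_gt0 // gerBl powR_ge0.
by rewrite ltr_pdivrMr // ltr_pMr // ltr1n.
Qed.

Lemma integral_powRy (c r : R) : 1 < c -> 0 < r ->
  (\int[leb]_(x in [set` `[r, +oo[]) (x `^ (- c))%:E <= (r `^ (1 - c) / (c - 1))%:E)%E.
Proof.
move=> c1 r0.
pose F n : set R := [set` `[r, r * n.+2%:R]].
have -> : [set` `[r, +oo[] = \bigcup_n F n.
  apply/seteqP; split => x /=; rewrite in_itv/=.
    rewrite andbT => x1.
    exists (Num.trunc (x / r)) => //=; rewrite /F /= in_itv/= x1 /= mulrC -ler_pdivrMr //.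
    by apply: (le_trans (ltW (truncnS_gt _))); rewrite ler_nat.
  by move=> [n _]; rewrite /F /= in_itv/= => /andP[-> _].
have cv : (\int[leb]_(x in F i) (x `^ (- c))%:E)%E @[i --> \oo] --> (\int[leb]_(x in \bigcup_i F i) (x `^ (- c))%:E)%E.
  apply: ge0_nondecreasing_set_cvg_integral => //.
  - move=> n m nm; apply/subsetPset => x; rewrite /F /= !in_itv/= => /andP[-> h] /=.
    by apply: le_trans h _; rewrite ler_pM2l // ler_nat.
  - by move=> i; exact: measurable_itv.
  - move=> i; apply/measurable_EFinP; apply: measurable_funTS.
    exact: (@measurable_powR R).
  - by move=> i x _; rewrite lee_fin powR_ge0.
have /cvg_lim <- // := cv.
apply: lime_le; first by apply/cvg_ex; eexists; exact: cv.
apply: nearW => n; rewrite integral_powR_itv ?gt_eqF ?ltr_pMr ?ltr1n //.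
rewrite lee_fin -opprB -[1 - c]opprB invrN mulrNN ler_pM2r ?invr_gt0 ?subr_gt0 //.
by rewrite gerBl powR_ge0.
Qed.

Lemma dyadic_bound (r0 C a M : R) : 0 < r0 -> a != 0 ->
  exists D M', forall f : R -> R,
  (forall r, 0 < r -> r <= r0 -> f r <= f (2 * r) + C * r `^ (- a)) ->
  (forall r, r0 < r -> f r <= M) ->
  forall r, 0 < r -> r <= r0 -> f r <= D * r `^ (- a) + M'.
Proof.
move=> r00 a0.
have d0 : 1 - 2 `^ (- a) != 0 :> R.
  rewrite subr_eq0 eq_sym powR_eq1 oppr_eq0 (negbTE a0) orbF negb_or -leNgt ler0n andbT.
  by rewrite (eqr_nat R 2 1).
pose D := C / (1 - 2 `^ (- a)).
pose M' := Num.max 0 (M + `|D| * (r0 `^ (- a) + (2 * r0) `^ (- a))).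
exists D, M' => f fr fM.
suff H n r : 0 < r -> r0 / 2 ^+ n < r -> r <= 2 * r0 -> f r <= D * r `^ (- a) + M'.
  move=> r r_0 rr0.
  have [n hn] : exists n : nat, r0 / 2 ^+ n < r.
    exists (Num.trunc (r0 / r)).+1; rewrite ltr_pdivrMr ?exprn_gt0 // -ltr_pdivrMl // mulrC.
    apply: (lt_le_trans (truncnS_gt _)); rewrite -natrX ler_nat.
    exact/ltnW/ltn_expl.
  have h : r <= 2 * r0 by lra.
  exact: H hn h.
elim: n r => [|n IH] r r_0 hr r2.
  rewrite expr0 divr1 in hr.
  apply: (le_trans (fM _ hr)); rewrite -lerBlDl le_max; apply/orP; right.
  rewrite lerD2l.
  have h1 := powR_ge0 r (- a); have h2 := powR_ge0 r0 (- a); have h3 := powR_ge0 (2 * r0) (- a).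
  have [Dp|Dn] := lerP 0 D.
    apply: (@le_trans _ _ 0); first by rewrite oppr_le0 mulr_ge0.
    by rewrite mulr_ge0 // addr_ge0.
  rewrite (ltr0_norm Dn) -mulNr ler_wpM2l ?oppr_ge0 ?(ltW Dn) //.
  have [ap|an] := lerP 0 a.
    have : r `^ (- a) <= r0 `^ (- a) by apply: powR_nonincr => //; [rewrite oppr_le0|exact: ltW].
    by lra.
  have : r `^ (- a) <= (2 * r0) `^ (- a) by apply: powR_nondecr => //; [rewrite oppr_ge0 ltW|exact: ltW].
  by lra.
have [hn|hn] := ltrP (r0 / 2 ^+ n) r; first exact: IH.
have rr0 : r <= r0.
  apply: (le_trans hn); rewrite ler_pdivrMr ?exprn_gt0 // ler_peMr //; first exact: ltW.
  by rewrite exprn_ege1 // ler1n.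
apply: (le_trans (fr _ r_0 rr0)).
have h2 : f (2 * r) <= D * (2 * r) `^ (- a) + M'.
  apply: IH.
  - by rewrite mulr_gt0.
  - by move: hr; rewrite exprS !ltr_pdivrMr ?mulr_gt0 ?exprn_gt0 // => hr; rewrite (_ : 2 * r * 2 ^+ n = r * (2 * 2 ^+ n)) //; ring.
  - by rewrite ler_wpM2l.
have -> : C = D * (1 - 2 `^ (- a)) by rewrite /D divfK.
rewrite (powRM _ (ler0n _ 2) (ltW r_0)) in h2.
have -> : D * r `^ (- a) + M' = D * (2 `^ (- a) * r `^ (- a)) + M' + D * (1 - 2 `^ (- a)) * r `^ (- a) by ring.
by rewrite lerD2r.
Qed.

End powers.

Lemma lebesgue_itvoo (R : realType) (a b : R) : a <= b ->
  (@lebesgue_measure R [set` `]a, b[] = (b - a)%:E)%E.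
Proof.
rewrite lebesgue_measure_itv/= lte_fin le_eqVlt => /predU1P[->|->]; last by rewrite EFinB.
by rewrite ltxx subrr.
Qed.

Section markov.
Context d (T : measurableType d) (R : realType) (mu : {measure set T -> \bar R}).

Lemma integral_ge_cst (S : set T) (f : T -> R) (c V : R) : measurable S ->
  mu S = V%:E -> measurable_fun [set: T] f -> (forall x, 0 <= f x) -> 0 <= c ->
  (forall x, S x -> c <= f x) ->
  ((c * V)%:E <= \int[mu]_x (f x)%:E)%E.
Proof.
move=> mS muS mf f0 c0 cf.
have mE : measurable_fun [set: T] (fun x => (f x)%:E) by exact/measurable_EFinP.
apply: (@le_trans _ _ (\int[mu]_(x in S) (f x)%:E)%E).
  rewrite EFinM -muS -integral_cst //; apply: ge0_le_integral => //.
  exact: measurable_funTS.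
by apply: ge0_subset_integral => // x _; rewrite lee_fin.
Qed.
End markov.

Section energy_bounds.
Context {R : realType}.
Local Notation leb := (@lebesgue_measure R).
Local Notation leb2 := ((@lebesgue_measure R) \x (@lebesgue_measure R))%E.
Variable k : R -> R.
Implicit Types u : R -> R.
Hypothesis mk : measurable_fun [set: R] k.
Hypothesis k_ge0 : forall t, 0 <= k t.
Hypothesis k_even : forall t, k (- t) = k t.

Definition trans2 (u : R -> R) (t : R) : \bar R :=
  (\int[leb]_x ((u (x + t) - u x) ^+ 2)%:E)%E.

Lemma measurable_incr u : measurable_fun [set: R] u ->
  measurable_fun [set: R * R] (fun z : R * R => (u (z.2 + z.1) - u z.2) ^+ 2).
Proof.
move=> mu; apply: measurable_funX; apply: measurable_funB.
  by apply: (measurableT_comp mu); exact: measurable_funD.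
exact: measurableT_comp.
Qed.

Lemma measurable_incr1 u t : measurable_fun [set: R] u ->
  measurable_fun [set: R] (fun x : R => (u (x + t) - u x) ^+ 2).
Proof.
move=> mu; apply: measurable_funX; apply: measurable_funB => //.
by apply: (measurableT_comp mu); exact: measurable_shift.
Qed.

Lemma measurable_trans2 u : measurable_fun [set: R] u ->
  measurable_fun [set: R] (trans2 u).
Proof.
move=> mu; apply: (measurable_tonelliR (f := fun z => ((u (z.2 + z.1) - u z.2) ^+ 2)%:E)).
  by apply/measurable_EFinP; exact: measurable_incr.
by move=> z; rewrite lee_fin sqr_ge0.
Qed.

Lemma trans2_ge0 u t : (0 <= trans2 u t)%E.
Proof. by apply: integral_ge0 => x _; rewrite lee_fin sqr_ge0. Qed.

Lemma energy_trans2 u : measurable_fun [set: R] u ->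
  (\int[leb2]_z ((dl k u z) ^+ 2)%:E = \int[leb]_t ((k t)%:E * trans2 u t))%E.
Proof.
move=> mu.
have m2 : measurable_fun [set: R * R] (fun z => ((dl k u z) ^+ 2)%:E).
  by apply/measurable_EFinP; apply: measurable_funX; exact: measurable_dl.
rewrite ge0_integral2_diag //; last by move=> z; rewrite lee_fin sqr_ge0.
apply: eq_integral => t _; rewrite /trans2.
rewrite -ge0_integralZl //; last 3 first.
- by apply/measurable_EFinP; exact: measurable_incr1.
- by move=> x _; rewrite lee_fin sqr_ge0.
- by rewrite lee_fin.
apply: eq_integral => x _; rewrite dl_sqr //= -EFinM mulrC; congr ((_ * _)%:E).
  by rewrite -k_even; congr k; ring.
by rewrite -sqrrN; congr (_ ^+ 2); ring.
Qed.

Lemma trans2_triangle u (t h : R) : measurable_fun [set: R] u ->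
  (trans2 u h <= 2%:E * trans2 u (h - t) + 2%:E * trans2 u t)%E.
Proof.
move=> mu; rewrite /trans2.
have mi a := measurable_incr1 a mu.
rewrite -[X in (_ <= 2%:E * X + _)%E](@integral_shift _ t (fun x => ((u (x + (h - t)) - u x) ^+ 2)%:E)); last first.
  by apply/measurable_EFinP.
have m1 : measurable_fun [set: R] (fun x : R => (u (x + t + (h - t)) - u (x + t)) ^+ 2).
  by apply: (measurableT_comp (mi (h - t))); exact: measurable_shift.
rewrite -!ge0_integralZl //; try (by apply/measurable_EFinP); try (by move=> x _; rewrite lee_fin sqr_ge0).
have m2 a : measurable_fun [set: R] (fun x => 2%:E * ((u (x + a) - u x) ^+ 2)%:E)%E.
  by apply: emeasurable_funM => //; exact/measurable_EFinP.
have m3 : measurable_fun [set: R] (fun x => 2%:E * ((u (x + t + (h - t)) - u (x + t)) ^+ 2)%:E)%E.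
  by apply: emeasurable_funM => //; exact/measurable_EFinP.
have p2 (f : R -> R) x : (0 <= 2%:E * ((f x) ^+ 2)%:E)%E.
  by rewrite -EFinM lee_fin mulr_ge0 // sqr_ge0.
rewrite -ge0_integralD //; try exact: m2; try exact: m3; try by move=> x _; exact: p2.
apply: ge0_le_integral => //.
- by move=> x _; rewrite lee_fin sqr_ge0.
- by apply/measurable_EFinP; exact: mi.
- by apply: emeasurable_funD; [exact: m3|exact: m2].
move=> x _; rewrite -!EFinM -EFinD lee_fin.
have -> : x + t + (h - t) = x + h by ring.
by have := sqr_ge0 (u (x + h) - u (x + t) - (u (x + t) - u x)); nra.
by apply/measurable_EFinP; exact: mi.
Qed.

Lemma midpoint_average (W : R -> \bar R) (c : \bar R) (h : R) :
  measurable_fun [set: R] W -> (forall t, 0 <= W t)%E -> (0 <= c)%E -> 0 < h ->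
  (forall t, c <= 2%:E * W (h - t)%R + 2%:E * W t)%E ->
  (h%:E * c <= 4%:E * \int[leb]_(t in [set` `]0%R, h[]) W t)%E.
Proof.
move=> mW W0 c0 h0 cW; pose I : set R := [set` `]0%R, h[].
have mI : measurable I by exact: measurable_itv.
have refl : (\int[leb]_(t in I) W (h - t)%R = \int[leb]_(t in I) W t)%E.
  rewrite integral_mkcond [RHS]integral_mkcond.
  have mr : measurable_fun [set: R] (W \_ I).
    have mWI : measurable_fun I W by exact: measurable_funTS.
    exact: (iffLR (measurable_restrictT W mI) mWI).
  apply: (etrans _ (integral_sub h mr)).
  apply: eq_integral => t _; rewrite /patch.
  have -> // : (t \in I) = (h - t \in I).
  by apply/idP/idP; rewrite !inE /I /= !in_itv/= => /andP[? ?]; apply/andP; split; lra.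
have msub : measurable_fun [set: R] (fun t => W (h - t)).
  by apply: (measurableT_comp mW); exact: measurable_funB.
have -> : (h%:E * c = \int[leb]_(t in I) (cst c t))%E.
  rewrite integral_cst // muleC; congr (_ * _)%E.
  by apply: esym; apply: etrans (lebesgue_itvoo (ltW h0)) _; rewrite subr0.
apply: (@le_trans _ _ (\int[leb]_(t in I) (2%:E * W (h - t)%R + 2%:E * W t))%E).
  apply: ge0_le_integral => //.
  by apply: measurable_funTS; apply: emeasurable_funD; apply: emeasurable_funM.
rewrite ge0_integralD //; last 4 first.
- by move=> t _; rewrite mule_ge0.
- by apply: measurable_funTS; apply: emeasurable_funM.
- by move=> t _; rewrite mule_ge0.
- by apply: measurable_funTS; apply: emeasurable_funM.
rewrite !ge0_integralZl //; try exact: measurable_funTS.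
by rewrite refl -ge0_muleDl ?lee_fin // -EFinD (_ : 2 + 2 = 4) //; ring.
Qed.

(* Averaging the triangle inequality over intermediate points [x + t]. *)
Lemma translation_energy u (h m : R) : inH k u -> 0 < h -> 0 <= m ->
  (forall t, 0 < t -> t <= h -> m <= k t) ->
  ((m * h)%:E * trans2 u h <= 4%:E * \int[leb2]_z ((dl k u z) ^+ 2)%:E)%E.
Proof.
move=> [[mu hu] hdu] h0 m0 hm.
pose I : set R := [set` `]0%R, h[].
have mI : measurable I by exact: measurable_itv.
have mW := measurable_trans2 mu.
rewrite energy_trans2 //.
have mkW : measurable_fun [set: R] (fun t => (k t)%:E * trans2 u t)%E.
  by apply: emeasurable_funM => //; exact/measurable_EFinP.
have kW0 t : (0 <= (k t)%:E * trans2 u t)%E by rewrite mule_ge0 ?trans2_ge0 ?lee_fin.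
have step1 : (m%:E * \int[leb]_(t in I) trans2 u t <= \int[leb]_t ((k t)%:E * trans2 u t))%E.
  apply: (@le_trans _ _ (\int[leb]_(t in I) ((k t)%:E * trans2 u t))%E); last first.
    exact: ge0_subset_integral.
  rewrite -ge0_integralZl //; last 2 first.
  - exact: measurable_funTS.
  - by move=> t _; exact: trans2_ge0.
  apply: ge0_le_integral => //.
  - by move=> t _; rewrite mule_ge0 ?trans2_ge0 ?lee_fin.
  - by apply: measurable_funTS; apply: emeasurable_funM.
  - exact: measurable_funTS.
  - move=> t; rewrite /I /= in_itv/= => /andP[t0 th].
    by rewrite lee_wpmul2r ?trans2_ge0 // lee_fin hm // ltW.
have step2 : (h%:E * trans2 u h <= 4%:E * \int[leb]_(t in I) trans2 u t)%E.
  apply: (midpoint_average mW) => // [t||t]; [exact: trans2_ge0|exact: trans2_ge0|exact: trans2_triangle].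
rewrite EFinM -muleA; apply: (@le_trans _ _ (m%:E * (4%:E * \int[leb]_(t in I) trans2 u t))%E).
  by rewrite lee_wpmul2l // lee_fin.
by rewrite muleCA lee_wpmul2l.
Qed.

Lemma cone_energy u (r m : R) : cone u -> 0 < r -> 0 <= m ->
  (forall t, 0 < t -> t <= 3 * r -> m <= k t) ->
  ((m * r ^+ 2 * (u r - u (2 * r)) ^+ 2)%:E <= \int[leb2]_z ((dl k u z) ^+ 2)%:E)%E.
Proof.
move=> cu r0 m0 hm; have mu := measurable_cone cu.
have [_ _ ni] := cu.
pose I : set R := [set` `]0%R, r[]; pose J : set R := [set` `](2 * r), (3 * r)[].
have mI : measurable I by exact: measurable_itv.
have mJ : measurable J by exact: measurable_itv.
have mIJ : measurable (I `*` J) by exact: measurableX.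
have muIJ : (leb2 (I `*` J) = (r ^+ 2)%:E)%E.
  have eI : (leb I = r%:E)%E by rewrite lebesgue_itvoo ?subr0 // ltW.
  have eJ : (leb J = r%:E)%E by rewrite lebesgue_itvoo; [congr (_%:E); ring|lra].
  by rewrite expr2 EFinM product_measure1E //; congr (_ * _)%E; [exact: eI|exact: eJ].
have c0 : 0 <= m * (u r - u (2 * r)) ^+ 2 by rewrite mulr_ge0 // sqr_ge0.
have m2 : measurable_fun [set: R * R] (fun z => (dl k u z) ^+ 2).
  by apply: measurable_funX; exact: measurable_dl.
have := @integral_ge_cst _ _ _ leb2 (I `*` J) _ _ _ mIJ muIJ m2 (fun z => sqr_ge0 _) c0.
rewrite (_ : m * (u r - u (2 * r)) ^+ 2 * r ^+ 2 = m * r ^+ 2 * (u r - u (2 * r)) ^+ 2); last by ring.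
apply => -[x y] [] /=; rewrite /I /J /= !in_itv/= => /andP[x0 xr] /andP[yr y3].
rewrite dl_sqr //= mulrC.
have h1 : u r <= u x by apply: ni => //; exact: ltW.
have h2 : u y <= u (2 * r) by apply: ni; [rewrite mulr_gt0|exact: ltW].
have h3 : u (2 * r) <= u r by apply: ni => //; lra.
apply: ler_pM => //; rewrite ?sqr_ge0 //.
  by rewrite lerXn2r ?nnegrE //; lra.
by rewrite -k_even opprB hm //; lra.
Qed.

Lemma cone_lp_bound u (q x : R) : cone u -> 0 <= q -> 0 < x ->
  ((x * u x `^ q)%:E <= \int[leb]_y (u y `^ q)%:E)%E.
Proof.
move=> cu q0 x0; have [u0 _ ni] := cu.
pose I : set R := [set` `]0%R, x[].
have mI : measurable I by exact: measurable_itv.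
rewrite mulrC; apply: (@integral_ge_cst _ _ _ leb I (fun y => u y `^ q)) => //.
- by apply: etrans (lebesgue_itvoo (ltW x0)) _; rewrite subr0.
- by apply: measurable_powRl; exact: measurable_cone.
- by move=> y; exact: powR_ge0.
- exact: powR_ge0.
- move=> y; rewrite /I /= in_itv/= => /andP[y0 yx]; apply: powR_nondecr => //.
  by apply: ni => //; exact: ltW.
Qed.

End energy_bounds.

(** * The constrained minimiser *)

Section off0.
Context {R : realType}.
Local Notation leb := (@lebesgue_measure R).
Local Notation leb2 := ((@lebesgue_measure R) \x (@lebesgue_measure R))%E.

Lemma integral_eq_off0 (f g : R -> \bar R) : measurable_fun [set: R] f ->
  measurable_fun [set: R] g -> (forall x, x != 0 -> f x = g x) ->
  (\int[leb]_x f x = \int[leb]_x g x)%E.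
Proof.
move=> mf mg fg; apply: ae_eq_integral => //.
exists [set 0]; split; first exact: measurable_set1.
  exact: lebesgue_measure_set1.
move=> x /= h; apply: contrapT => /eqP x0; apply: h => _; exact: fg.
Qed.

Lemma integral2_eq_off0 (f g : R * R -> \bar R) : measurable_fun [set: R * R] f ->
  measurable_fun [set: R * R] g -> (forall z, z.1 != 0 -> z.2 != 0 -> f z = g z) ->
  (\int[leb2]_z f z = \int[leb2]_z g z)%E.
Proof.
move=> mf mg fg; apply: ae_eq_integral => //.
pose N1 : set (R * R) := [set 0] `*` setT; pose N2 : set (R * R) := setT `*` [set 0].
have m0 : measurable [set (0 : R)] by exact: measurable_set1.
have mN1 : measurable N1 by exact: measurableX.
have mN2 : measurable N2 by exact: measurableX.
have z0 : (leb [set (0 : R)%R] = 0)%E by exact: lebesgue_measure_set1.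
have n1 : (leb2 N1 = 0)%E.
  rewrite product_measure1E //; apply: (etrans (congr1 (fun x => x * _)%E z0)).
  by rewrite mul0e.
have n2 : (leb2 N2 = 0)%E.
  rewrite product_measure1E //; apply: (etrans (congr1 (fun x => _ * x)%E z0)).
  by rewrite mule0.
exists (N1 `|` N2); split.
- exact: measurableU.
- by apply: null_set_setU.
- move=> z /= h; apply: contrapT => nz; apply: h => _; apply: fg.
    by apply/eqP => z1; apply: nz; left.
  by apply/eqP => z2; apply: nz; right.
Qed.

Variable k : R -> R.
Hypothesis mk : measurable_fun [set: R] k.

Lemma form_eq_off0 (A : R) (u v : R -> R) : inH k u -> measurable_fun [set: R] v ->
  (forall x, x != 0 -> v x = u x) ->
  inH k v /\ forall phi, inH k phi -> Q k A v phi = Q k A u phi.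
Proof.
move=> hu mv vu; have mu := inH_meas hu.
have m1 (f : R -> R) : measurable_fun [set: R] f -> measurable_fun [set: R] (fun x => (f x ^+ 2)%:E).
  by move=> mf; apply/measurable_EFinP; exact: measurable_funX.
have m2 (f : R * R -> R) : measurable_fun [set: R * R] f -> measurable_fun [set: R * R] (fun x => (f x ^+ 2)%:E).
  by move=> mf; apply/measurable_EFinP; exact: measurable_funX.
have dE z : z.1 != 0 -> z.2 != 0 -> dl k v z = dl k u z by move=> ? ?; rewrite /dl !vu.
have mdu := measurable_dl mk mu; have mdv := measurable_dl mk mv.
split.
  split; split => //.
  - rewrite (@integral_eq_off0 _ (fun x => (u x ^+ 2)%:E)); [exact: hu.1.2|exact: m1|exact: m1|].
    by move=> x x0; rewrite vu.
  - rewrite (@integral2_eq_off0 _ (fun z => (dl k u z ^+ 2)%:E)); [exact: hu.2.2|exact: m2|exact: m2|].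
    by move=> z z1 z2; rewrite dE.
move=> phi hphi; have mphi := inH_meas hphi; have mdphi := measurable_dl mk mphi.
rewrite /Q /ip /Rintegral; congr (_ * fine _ + _ * fine _).
- apply: integral2_eq_off0.
  + by apply/measurable_EFinP; exact: measurable_funM.
  + by apply/measurable_EFinP; exact: measurable_funM.
  + by move=> z z1 z2; rewrite dE.
- apply: integral_eq_off0.
  + by apply/measurable_EFinP; exact: measurable_funM.
  + by apply/measurable_EFinP; exact: measurable_funM.
  + by move=> x x0; rewrite vu.
Qed.

End off0.

Section power_weight.
Context {R : realType}.
Local Notation leb := (@lebesgue_measure R).

Definition pw (b c x : R) : R :=
  if `|x| <= 1 then `|x| `^ (- b) else `|x| `^ (- c).

Lemma measurable_pw b c : measurable_fun [set: R] (pw b c).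
Proof.
apply: measurable_fun_ifT.
- by apply: measurable_fun_ler => //; exact: normr_measurable.
- by apply: measurable_powRl; exact: normr_measurable.
- by apply: measurable_powRl; exact: normr_measurable.
Qed.

Lemma pw_ge0 b c x : 0 <= pw b c x.
Proof. by rewrite /pw; case: ifP => _; exact: powR_ge0. Qed.

Lemma pw_powR b c q x : pw b c x `^ q = pw (b * q) (c * q) x.
Proof. by rewrite /pw; case: ifP => _; rewrite -powRrM mulNr. Qed.

Lemma ge0_integral_even (f : R -> \bar R) : measurable_fun [set: R] f ->
  (forall x, 0 <= f x)%E -> (forall x, f (- x) = f x) ->
  (\int[leb]_x f x = 2%:E * \int[leb]_(x in [set` `]0%R, +oo[]) f x)%E.
Proof.
move=> mf f0 ef.
pose P : set R := [set` `]0%R, +oo[].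
have mP : measurable P by exact: measurable_itv.
have mfP : measurable_fun P f by exact: measurable_funTS.
have mr : measurable_fun [set: R] (f \_ P) by exact: (iffLR (measurable_restrictT f mP) mfP).
have mrN : measurable_fun [set: R] (fun x => (f \_ P) (- x)).
  by apply: (measurableT_comp mr); exact: oppr_measurable.
have r0 x : (0 <= (f \_ P) x)%E by rewrite /patch; case: ifP.
have -> : (\int[leb]_x f x = \int[leb]_x ((f \_ P) x + (f \_ P) (- x)%R))%E.
  apply: integral_eq_off0 => //; first exact: emeasurable_funD.
  have inP y : (y \in P) = (0 < y).
    by apply/idP/idP; rewrite inE /P /= in_itv/= andbT.
  move=> x x0; rewrite /patch !inP.
  have [xp|xn|x00] := ltgtP 0 x.
  - by rewrite oppr_gt0 (lt_gtF xp) (_ : point = 0%E) // adde0.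
  - by rewrite oppr_gt0 xn (_ : point = 0%E) // add0e ef.
  - by rewrite -x00 eqxx in x0.
rewrite ge0_integralD //.
rewrite (integral_opp mr) -/P -integral_mkcond.
by rewrite -[X in (X + X)%E]mul1e -ge0_muleDl ?lee_fin // -EFinD.
Qed.

Lemma integrable_pw b c : b < 1 -> 1 < c -> leb.-integrable setT (EFin \o pw b c).
Proof.
move=> b1 c1; have m := measurable_pw b c.
have mE : measurable_fun [set: R] (fun x => (pw b c x)%:E) by exact/measurable_EFinP.
have mEb : measurable_fun [set: R] (fun x => (x `^ (- b))%:E).
  by apply/measurable_EFinP; exact: (@measurable_powR R).
have mEc : measurable_fun [set: R] (fun x => (x `^ (- c))%:E).
  by apply/measurable_EFinP; exact: (@measurable_powR R).
apply/integrableP; split; first exact: mE.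
have -> : (\int[leb]_x `|(EFin \o pw b c) x| = \int[leb]_x (pw b c x)%:E)%E.
  by apply: eq_integral => x _; rewrite /= ger0_norm ?pw_ge0.
rewrite ge0_integral_even //; last 2 first.
- by move=> x; rewrite lee_fin pw_ge0.
- by move=> x; rewrite /pw normrN.
pose P1 : set R := [set` `]0%R, 1%R]]; pose P2 : set R := [set` `]1%R, +oo[].
have mP1 : measurable P1 by exact: measurable_itv.
have mP2 : measurable P2 by exact: measurable_itv.
have -> : [set` `]0%R, +oo[] = P1 `|` P2.
  apply/seteqP; split => x; rewrite /P1 /P2 /= !in_itv/= !andbT.
    by move=> x0; have [x1|x1] := lerP x 1; [left; rewrite x0|right].
  by case=> [/andP[]|]//; apply: lt_trans.
rewrite ge0_integral_setU //; last 3 first.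
- exact: measurable_funTS.
- by move=> x _; rewrite lee_fin pw_ge0.
- apply/disj_setPS => x []; rewrite /P1 /P2 /= !in_itv/= andbT => /andP[_ x1] /lt_le_trans/(_ x1).
  by rewrite ltxx.
have h1 : (\int[leb]_(x in P1) (pw b c x)%:E <= ((1 - b)^-1)%:E)%E.
  have := integral_powR0 b1 ltr01; rewrite powR1 div1r => H; refine (le_trans _ H); rewrite le_eqVlt; apply/orP; left; apply/eqP.
  apply: eq_integral => x; rewrite inE /P1/= in_itv/= => /andP[x0 x1].
  by rewrite /pw ger0_norm ?(ltW x0) // x1.
have h2 : (\int[leb]_(x in P2) (pw b c x)%:E <= ((c - 1)^-1)%:E)%E.
  have := integral_powRy c1 ltr01; rewrite powR1 div1r => H; refine (le_trans _ H).
  apply: (@le_trans _ _ (\int[leb]_(x in P2) (x `^ (- c))%:E)%E).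
    rewrite le_eqVlt; apply/orP; left; apply/eqP.
    apply: eq_integral => x; rewrite inE /P2/= in_itv/= andbT => x1.
    by rewrite /pw gtr0_norm ?(lt_trans ltr01 x1) // leNgt x1.
  apply: ge0_subset_integral => //.
  - exact: measurable_funTS.
  - by move=> x _; rewrite lee_fin powR_ge0.
  - by move=> x; rewrite /P2 /= !in_itv/= !andbT => /ltW.
apply: (@le_lt_trans _ _ (2%:E * (((1 - b)^-1)%:E + ((c - 1)^-1)%:E))%E).
  by rewrite lee_wpmul2l ?lee_fin // leeD.
by rewrite -EFinD -EFinM ltry.
Qed.

End power_weight.

Section dominated.
Context d (T : measurableType d) (R : realType) (mu : {measure set T -> \bar R}).

Lemma dct_integrable (f_ : nat -> T -> R) (f g : T -> R) :
  measurable_fun [set: T] f -> (forall x, f_ ^~ x @ \oo --> f x) ->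
  mu.-integrable setT (EFin \o g) -> (forall n x, `|f_ n x| <= g x) ->
  mu.-integrable setT (EFin \o f).
Proof.
move=> mf cf ig fg; apply: (le_integrable _ _ _ ig) => //; first exact/measurable_EFinP.
move=> x _ /=; rewrite lee_fin; apply: le_trans (ler_norm _).
have c : (fun n => `|f_ n x|) @ \oo --> `|f x| by apply: cvg_norm.
by apply: (cvgr_to_le c); apply: nearW.
Qed.
End dominated.

Lemma cvg_powR_ge0 (R : realType) (f : nat -> R) (l q : R) : 1 <= q ->
  (forall n, 0 <= f n) -> f @ \oo --> l -> (fun n => f n `^ q) @ \oo --> l `^ q.
Proof.
move=> q1 f0 fl.
have l0 : 0 <= l by apply: (cvgr_to_ge fl); exact: nearW.
have [ll|ll] := eqVneq l 0; last first.
  apply: (@cvg_comp _ _ _ _ (fun y => y `^ q) _ _ _ fl).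
  by apply: cvg_powR; rewrite lt0r ll.
rewrite ll powR0; last by rewrite gt_eqF // (lt_le_trans _ q1).
have f1 : \forall n \near \oo, f n <= 1.
  by apply: (cvgr_le l fl); rewrite ll.
apply: (@squeeze_cvgr _ _ _ _ (fun=> 0) f); last by rewrite -ll.
  apply: filterS f1 => n fn1; rewrite powR_ge0 /=.
  have [->|fn0] := eqVneq (f n) 0; first by rewrite powR0 // gt_eqF // (lt_le_trans _ q1).
  by apply: ge1r_powR => //; rewrite fn1 andbT lt0r fn0 f0.
exact: cvg_cst.
Qed.

Section minimizer.
Context {R : realType}.
Local Notation leb := (@lebesgue_measure R).
Variables (k : R -> R) (A p sg c0 : R).
Hypothesis mk : measurable_fun [set: R] k.
Hypothesis k_ge0 : forall t, 0 <= k t.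
Hypothesis k_even : forall t, k (- t) = k t.
Hypothesis A_gt0 : 0 < A.
Hypothesis p_gt1 : 1 < p.
Hypothesis sg_lt : sg < 2^-1.
Hypothesis p_sub : (p + 1) * (2^-1 - sg) < 1.
Hypothesis sg_gt0 : 0 < sg.
Hypothesis c0_gt0 : 0 < c0.
Hypothesis k_low : forall t, 0 < t -> t <= 1 -> c0 * t `^ (- (1 + 2 * sg)) <= k t.

Let a := 2^-1 - sg.
Let a_gt0 : 0 < a. Proof. by rewrite subr_gt0. Qed.

Lemma cone_decay (u : R -> R) E x : cone u -> inH k u -> Q k A u u <= E -> 0 < x ->
  u x <= Num.sqrt (E / A) * x `^ (- 2^-1).
Proof.
move=> cu hu QE x0; have u0 : 0 <= u x by have [] := cu.
have EA : ip leb u u <= E / A.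
  by rewrite ler_pdivlMr // mulrC; apply: le_trans QE; exact/l2_le_Q/ltW.
have EA0 : 0 <= E / A by apply: le_trans EA; exact: ip_ge0.
have := cone_lp_bound cu (ler0n _ 2) x0.
have -> : (\int[leb]_y (u y `^ 2)%:E = (ip leb u u)%:E)%E.
  rewrite ipE; last exact: hu.1.
  by apply: eq_integral => y _; rewrite powR_mulrn //; have [] := cu.
rewrite lee_fin powR_mulrn // => h.
rewrite powRN powR12_sqrt ?(ltW x0) // -sqrtrV ?(ltW x0) // -sqrtrM //.
rewrite -[leLHS](ger0_norm u0) -sqrtr_sqr ler_wsqrtr //.
by rewrite ler_pdivlMr // mulrC (le_trans h).
Qed.

Lemma cone_jump E : exists2 C, 0 <= C & forall u, cone u -> inH k u -> Q k A u u <= E ->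
  forall r, 0 < r -> r <= 3^-1 -> u r <= u (2 * r) + C * r `^ (- a).
Proof.
pose C := Num.sqrt (2 * E / c0 * 3 `^ (1 + 2 * sg)).
exists C => [|u cu hu QE r r0 r3]; first exact: sqrtr_ge0.
have E0 : 0 <= E by apply: le_trans QE; exact/Q_ge0/ltW.
have [_ _ ni] := cu.
have r31 : 3 * r <= 1 by rewrite mulrC -ler_pdivlMr // mul1r.
have r30 : 0 < 3 * r by rewrite mulr_gt0.
pose m := c0 * (3 * r) `^ (- (1 + 2 * sg)).
have m0 : 0 < m by rewrite mulr_gt0 // powR_gt0.
have hm t : 0 < t -> t <= 3 * r -> m <= k t.
  move=> t0 t3; apply: le_trans (k_low t0 (le_trans t3 r31)).
  rewrite /m ler_pM2l //; apply: powR_nonincr => //.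
  by rewrite oppr_le0 addr_ge0 // mulr_ge0 // ltW.
have := cone_energy mk k_ge0 k_even cu r0 (ltW m0) hm.
rewrite -(ipE hu.2) lee_fin => h.
have h2 : m * r ^+ 2 * (u r - u (2 * r)) ^+ 2 <= 2 * E.
  apply: (le_trans h); apply: (le_trans (energy_le_Q (ltW A_gt0) hu)).
  by rewrite ler_pM2l.
have d0 : 0 <= u r - u (2 * r) by rewrite subr_ge0 ni //; lra.
rewrite -lerBlDl -(@ler_pXn2r _ 2) ?nnegrE ?mulr_ge0 ?sqrtr_ge0 ?powR_ge0 //.
have ar0 : 0 <= 2 * E / c0 * 3 `^ (1 + 2 * sg).
  by rewrite mulr_ge0 ?powR_ge0 // divr_ge0 ?mulr_ge0 // ltW.
rewrite exprMn sqr_sqrtr // -(powR_mulrn 2 (powR_ge0 r (- a))) -powRrM.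
have mr : 0 < m * r ^+ 2 by rewrite mulr_gt0 // exprn_gt0.
rewrite -(ler_pM2l mr); apply: (le_trans h2).
rewrite le_eqVlt; apply/orP; left; apply/eqP.
rewrite /m powRM ?ltW // !powRN.
have -> : - a * 2 = 2 * sg + 1 - 2 by rewrite /a; field.
rewrite powRB; last by rewrite (gt_eqF r0) implybT.
rewrite powR_mulrn ?ltW // [2 * sg + 1]addrC.
have n1 : 3 `^ (1 + 2 * sg) != 0 :> R by rewrite gt_eqF // powR_gt0.
have n2 : r `^ (1 + 2 * sg) != 0 :> R by rewrite gt_eqF // powR_gt0.
have n3 : r != 0 by rewrite gt_eqF.
have n4 : c0 != 0 by rewrite gt_eqF.
by field; rewrite n1 n2 n3 n4.
Qed.

Lemma cone_bound E : exists2 D, 0 <= D & forall u, cone u -> inH k u -> Q k A u u <= E ->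
  forall x, x != 0 -> u x <= D * pw a 2^-1 x.
Proof.
have [C C0 hC] := cone_jump E.
pose M0 := Num.sqrt (E / A).
have M00 : 0 <= M0 by exact: sqrtr_ge0.
have [D1 [M' hD]] := @dyadic_bound R 3^-1 C a (M0 * 2) (ltac:(by rewrite invr_gt0)) (lt0r_neq0 a_gt0).
pose D := `|D1| + `|M'| + 2 * M0.
exists D; first by rewrite !addr_ge0 ?mulr_ge0.
move=> u cu hu QE.
suff H x : 0 < x -> u x <= D * pw a 2^-1 x.
  move=> x x0; rewrite -(cone_norm x cu).
  have -> : pw a 2^-1 x = pw a 2^-1 `|x| by rewrite /pw normr_id.
  by apply: H; rewrite normr_gt0.
move=> x0; have dec := cone_decay cu hu QE.
have h3 y : 3^-1 < y -> u y <= M0 * 2.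
  move=> y3; have y0 : 0 < y by apply: lt_trans y3; rewrite invr_gt0.
  apply: (le_trans (dec _ y0)); rewrite ler_wpM2l //.
  rewrite powRN powR12_sqrt ?(ltW y0) // invf_ple ?posrE ?sqrtr_gt0 //.
  rewrite -[leLHS]ger0_norm ?invr_ge0 // -sqrtr_sqr ler_wsqrtr //.
  by apply: le_trans (ltW y3); rewrite expr2 -invfM lef_pV2 ?posrE //; lra.
rewrite /pw gtr0_norm //; case: ifPn => [x1|]; last first.
  move=> _; apply: (le_trans (dec _ x0)); rewrite ler_wpM2r ?powR_ge0 //.
  by rewrite /D -/M0; have := normr_ge0 D1; have := normr_ge0 M'; lra.
have pa1 : 1 <= x `^ (- a).
  rewrite -[leLHS](_ : 1 `^ (- a) = 1); last by rewrite powR1.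
  by apply: powR_nonincr => //; rewrite oppr_le0 ltW.
have [x3|x3] := lerP x 3^-1.
  have := hD u (hC u cu hu QE) (fun r hr => h3 r hr) x x0 x3.
  move=> /le_trans; apply.
  have e1 : D1 * x `^ (- a) <= `|D1| * x `^ (- a) by rewrite ler_wpM2r ?powR_ge0 // ler_norm.
  have e2 : M' <= `|M'| * x `^ (- a).
    by apply: (le_trans (ler_norm _)); rewrite ler_peMr.
  have e3 : 0 <= 2 * M0 * x `^ (- a) by rewrite !mulr_ge0 ?powR_ge0.
  by rewrite /D !mulrDl; lra.
apply: (le_trans (h3 _ x3)).
apply: (@le_trans _ _ (2 * M0 * x `^ (- a))); first by rewrite [2 * M0]mulrC ler_peMr ?mulr_ge0.
by rewrite ler_wpM2r ?powR_ge0 // /D; have := normr_ge0 D1; have := normr_ge0 M'; lra.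
Qed.

Definition Jp (u : R -> R) : \bar R := (\int[leb]_x (u x `^ (p + 1))%:E)%E.

Lemma minimizer : (exists w0, [/\ cone w0, inH k w0 & Jp w0 = 1%:E]) ->
  exists u, [/\ cone u, inH k u, Jp u = 1%:E, 0 < Q k A u u &
    forall w, cone w -> inH k w -> Jp w = 1%:E -> Q k A u u <= Q k A w w].
Proof.
move=> [w0 [cw0 hw0 Jw0]].
pose S := [set Q k A w w | w in [set w | [/\ cone w, inH k w & Jp w = 1%:E]]].
have S0 : S !=set0 by exists (Q k A w0 w0), w0.
have lS : has_lbound S by exists 0 => _ [w _ <-]; exact/Q_ge0/ltW.
have hS : has_inf S by split.
pose m := inf S.
have mle w : cone w -> inH k w -> Jp w = 1%:E -> m <= Q k A w w.
  by move=> cw hw Jw; apply: ge_inf => //; exists w.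
have seqP n : {w | [/\ cone w, inH k w, Jp w = 1%:E & Q k A w w <= m + n.+1%:R^-1]}.
  apply: cid; have n0 : 0 < n.+1%:R^-1 :> R by rewrite invr_gt0.
  have [_ [w [cw hw Jw] <-] h] := inf_adherent n0 hS.
  by exists w; split => //; exact: ltW.
pose w_ n := projT1 (cid (ex_intro _ (sval (seqP n)) (svalP (seqP n)))).
have hw_ n : [/\ cone (w_ n), inH k (w_ n), Jp (w_ n) = 1%:E & Q k A (w_ n) (w_ n) <= m + n.+1%:R^-1].
  by rewrite /w_; case: (cid _).
pose v_ n x := if x == 0 then 0 else w_ n x.
have vw n x : x != 0 -> v_ n x = w_ n x by rewrite /v_ => /negbTE ->.
have cv n : cone (v_ n).
  have [[c1 c2 c3] _ _ _] := hw_ n; split.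
  - by move=> x; rewrite /v_; case: ifP.
  - by move=> x; rewrite /v_ oppr_eq0 c2.
  - by move=> x y x0 xy; rewrite !vw ?gt_eqF // ?(lt_le_trans x0) // c3.
have hv n : inH k (v_ n) /\ Q k A (v_ n) (v_ n) <= m + n.+1%:R^-1.
  have [_ h _ hQ] := hw_ n.
  have [h1 h2] := form_eq_off0 mk A h (measurable_cone (cv n)) (vw n).
  by split => //; rewrite h2 // QC h2.
have Jv n : Jp (v_ n) = 1%:E.
  have [_ h <- _] := hw_ n; apply: integral_eq_off0.
  - by apply/measurable_EFinP; apply: measurable_powRl; exact: measurable_cone.
  - by apply/measurable_EFinP; apply: measurable_powRl; exact: inH_meas h.
  - by move=> x x0; rewrite vw.
have [D D0 hD] := cone_bound (m + 1).
have vB n x : v_ n x <= D * pw a 2^-1 x.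
  have [->|x0] := eqVneq x 0; first by rewrite /v_ eqxx mulr_ge0 // pw_ge0.
  have [h1 h2] := hv n; apply: hD => //; apply: (le_trans h2).
  by rewrite lerD2l invf_le1 // ler1n.
have [phi [u [nphi cu cvu]]] := helly cv vB.
have mu := measurable_cone cu.
have hQ N : inH k u /\ Q k A u u <= m + N.+1%:R^-1.
  have cvN x : (fun n => v_ (phi (n + N)%N) x) @ \oo --> u x by rewrite (cvg_shiftn N (fun n => v_ (phi n) x)); exact: cvu.
  have e1 (n : nat) t : 0 <= k t <= k t by rewrite k_ge0 lexx.
  have e2 t : (fun n : nat => k t) @ \oo --> k t by exact: cvg_cst.
  have e3 n : inH k (v_ (phi (n + N)%N)) by have [] := hv (phi (n + N)%N).
  have e4 n : Q k A (v_ (phi (n + N)%N)) (v_ (phi (n + N)%N)) <= m + N.+1%:R^-1.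
    have [_ /le_trans] := hv (phi (n + N)%N); apply.
    rewrite lerD2l lef_pV2 ?posrE // ler_nat ltnS.
    by apply: leq_trans (nphi _); exact: leq_addl.
  by have [h1 h2 _] := form_limit (fun=> mk) mk e1 e2 A_gt0 e3 e4 cvN mu.
have hu : inH k u by have [] := hQ 0%N.
have Qm : Q k A u u <= m.
  apply/ler_addgt0Pr => e e0.
  have [_ h] := hQ (Num.trunc e^-1); apply: (le_trans h); rewrite lerD2l.
  by rewrite invf_ple ?posrE // ltW // truncnS_gt.
have Ju : Jp u = 1%:E.
  pose g x := D `^ (p + 1) * pw (a * (p + 1)) (2^-1 * (p + 1)) x.
  have ig : leb.-integrable setT (EFin \o g).
    have i1 : leb.-integrable setT (EFin \o pw (a * (p + 1)) (2^-1 * (p + 1))).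
      by apply: integrable_pw; [rewrite mulrC|have := p_gt1; lra].
    by have := integrableZl measurableT (D `^ (p + 1)) i1; exact: eq_integrable.
  have pp : 0 <= p + 1 by have := p_gt1; lra.
  have mf n : measurable_fun [set: R] (fun x => v_ (phi n) x `^ (p + 1)).
    by apply: measurable_powRl; exact: measurable_cone.
  have mfu : measurable_fun [set: R] (fun x => u x `^ (p + 1)) by exact: measurable_powRl.
  have bg n x : `|v_ (phi n) x `^ (p + 1)| <= g x.
    rewrite ger0_norm ?powR_ge0 // /g -pw_powR -powRM ?pw_ge0 //.
    by apply: powR_nondecr => //; have [] := cv (phi n).
  have cp x : (fun n => v_ (phi n) x `^ (p + 1)) @ \oo --> u x `^ (p + 1).
    apply: cvg_powR_ge0 => //; first by have := p_gt1; lra.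
    by move=> n; have [] := cv (phi n).
  have iu : leb.-integrable setT (EFin \o (fun x => u x `^ (p + 1))).
    exact: (dct_integrable (mu := leb) mfu cp ig bg).
  have e1 n : \int[leb]_x (v_ (phi n) x `^ (p + 1)) = 1.
    by have := Jv (phi n); rewrite /Jp /Rintegral => ->.
  have := dct (mu := leb) mf mfu cp ig bg.
  under eq_fun do rewrite e1.
  move=> /cvg_lim; rewrite lim_cst // => e2.
  by rewrite /Jp -(fineK (integrable_fin_num measurableT iu)) -[fine _]e2.
exists u; split => //; last by move=> w cw hw Jw; apply: (le_trans Qm); exact: mle.
rewrite lt0r Q_ge0 ?(ltW A_gt0) // andbT; apply/eqP => Q0.
have ip0 : ip leb u u = 0.
  have h1 : A * ip leb u u <= 0 by rewrite -Q0; exact/l2_le_Q/ltW.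
  apply/eqP; rewrite eq_le ip_ge0 andbT.
  by move: h1; rewrite pmulr_rle0.
have uz x : x != 0 -> u x = 0.
  move=> x0; have u0 y : 0 <= u y by have [] := cu.
  rewrite -(cone_norm x cu); apply/eqP; rewrite eq_le u0 andbT.
  have xp : 0 < `|x| by rewrite normr_gt0.
  have := cone_lp_bound cu (ler0n _ 2) xp.
  have -> : (\int[leb]_y (u y `^ 2)%:E = (ip leb u u)%:E)%E.
    rewrite ipE; last exact: hu.1.
    by apply: eq_integral => y _; rewrite powR_mulrn.
  rewrite ip0 lee_fin pmulr_rle0 // powR_mulrn // => h.
  by have := sqr_ge0 (u `|x|); nra.
have : Jp u = 0%E.
  rewrite /Jp -(integral0 leb setT); apply: integral_eq_off0 => //.
    by apply/measurable_EFinP; exact: measurable_powRl.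
  by move=> x x0; rewrite uz // powR0 // gt_eqF //; have := p_gt1; lra.
by rewrite Ju => /eqP; rewrite eqe oner_eq0.
Qed.

End minimizer.

(** * The linear equation *)

Section swap.
Context {R : realType}.
Local Notation leb2 := ((@lebesgue_measure R) \x (@lebesgue_measure R))%E.

Lemma measurable_swapR : measurable_fun [set: R * R] (fun z : R * R => (z.2, z.1)).
Proof. by apply: measurable_fun_pair. Qed.

Lemma lebesgue2_measure_swap (A : set (R * R)) : measurable A ->
  leb2 ((fun z => (z.2, z.1)) @^-1` A) = leb2 A.
Proof.
move=> mA; pose phi := fun z : R * R => (z.2, z.1).
have mB : measurable (phi @^-1` A) by rewrite -[_ @^-1` _]setTI; exact: measurable_swapR.
have mIA : measurable_fun [set: R * R] (EFin \o (\1_A : R * R -> R)).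
  by apply/measurable_EFinP; exact: measurable_indic.
have mIB : measurable_fun [set: R * R] (EFin \o (\1_(phi @^-1` A) : R * R -> R)).
  by apply/measurable_EFinP; exact: measurable_indic.
have pos (B : set (R * R)) z : (0 <= (EFin \o (\1_B : R * R -> R)) z)%E by rewrite /= lee_fin.
have -> : leb2 (phi @^-1` A) = (\int[leb2]_z (EFin \o (\1_(phi @^-1` A) : R * R -> R)) z)%E.
  by rewrite integral_indic // setIT.
have -> : leb2 A = (\int[leb2]_z (EFin \o (\1_A : R * R -> R)) z)%E.
  by rewrite integral_indic // setIT.
by rewrite (tonelliR mIB (pos _)) (tonelliR mIA (pos _)) (tonelliC mIA (pos _)).
Qed.

Lemma integral2_swap (f : R * R -> \bar R) : measurable_fun [set: R * R] f ->
  (\int[leb2]_z f (z.2, z.1) = \int[leb2]_z f z)%E.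
Proof.
move=> mf; apply: (@integral_comp_preserving _ _ _ leb2 (fun z : R * R => (z.2, z.1)) f) => //.
  exact: measurable_swapR.
exact: lebesgue2_measure_swap.
Qed.

End swap.

Section convolution.
Context {R : realType}.
Local Notation leb := (@lebesgue_measure R).
Implicit Types w : R -> R.

(* Even functions that are nonincreasing in the absolute value, the origin
   included (unlike [cone]). *)
Definition fcone w := (forall x, 0 <= w x) /\ forall s t, `|s| <= `|t| -> w t <= w s.

Lemma fcone_even w x : fcone w -> w (- x) = w x.
Proof. by case=> _ m; apply/eqP; rewrite eq_le !m // normrN. Qed.

Lemma fcone_cone w : fcone w -> cone w.
Proof.
move=> fw; have [w0 m] := fw; split => // [x|x y x0 xy]; first exact: fcone_even.
by apply: m; rewrite !gtr0_norm // (lt_le_trans x0).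
Qed.

Variable h : R -> R.
Hypothesis fh : fcone h.
Hypothesis ih : leb.-integrable setT (EFin \o h).

Let mh : measurable_fun [set: R] h.
Proof. exact: (measurable_cone (fcone_cone fh)). Qed.
Let h0 x : 0 <= h x. Proof. by have [] := fh. Qed.

Definition mass : R := \int[leb]_x h x.
Definition cv w (x : R) : R := \int[leb]_y (h (x - y) * w y).

Lemma mass_ge0 : 0 <= mass.
Proof. by apply: Rintegral_ge0 => x _; exact: h0. Qed.

Lemma measurable_hsub (x : R) : measurable_fun [set: R] (fun y => h (x - y)).
Proof. by apply: (measurableT_comp mh); exact: measurable_funB. Qed.

Lemma measurable_hdiff : measurable_fun [set: R * R] (fun z : R * R => h (z.1 - z.2)).
Proof. exact: (measurable_kdiff mh). Qed.

Lemma integral_hsub (x : R) : (\int[leb]_y (h (x - y))%:E = mass%:E)%E.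
Proof.
have mE : measurable_fun [set: R] (fun y => (h y)%:E) by exact/measurable_EFinP.
rewrite (integral_sub x mE) /mass /Rintegral fineK //.
exact: integrable_fin_num ih.
Qed.

Lemma integrable_hsub (x : R) : leb.-integrable setT (fun y => (h (x - y))%:E).
Proof.
apply/integrableP; split; first by apply/measurable_EFinP; exact: measurable_hsub.
under eq_integral do rewrite gee0_abs ?lee_fin ?h0 //.
by rewrite integral_hsub ltry.
Qed.

Lemma integrable_cv w B (x : R) : measurable_fun [set: R] w -> (forall y, 0 <= w y <= B) ->
  leb.-integrable setT (fun y => (h (x - y) * w y)%:E).
Proof.
move=> mw wB.
have i1 := integrableZl measurableT B (integrable_hsub x).
apply: (le_integrable _ _ _ i1) => //.
  apply/measurable_EFinP; apply: measurable_funM => //; exact: measurable_hsub.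
move=> y _; have /andP[w0 wb] := wB y.
have B0 : 0 <= B by exact: le_trans wb.
rewrite /= lee_fin !ger0_norm ?mulr_ge0 ?h0 //.
by rewrite [leRHS]mulrC ler_wpM2l.
Qed.

Lemma cv_ge0 w x : (forall y, 0 <= w y) -> 0 <= cv w x.
Proof. by move=> w0; apply: Rintegral_ge0 => y _; rewrite mulr_ge0. Qed.

Lemma cv_le w w' B x : measurable_fun [set: R] w -> measurable_fun [set: R] w' ->
  (forall y, 0 <= w y <= B) -> (forall y, 0 <= w' y <= B) -> (forall y, w y <= w' y) ->
  cv w x <= cv w' x.
Proof.
move=> mw mw' wB wB' ww; apply: le_Rintegral => //.
- exact: integrable_cv mw wB.
- exact: integrable_cv mw' wB'.
- by move=> y _; rewrite ler_wpM2l.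
Qed.

Lemma cv_bound w B x : measurable_fun [set: R] w -> (forall y, 0 <= w y <= B) ->
  cv w x <= mass * B.
Proof.
move=> mw wB; have B0 : 0 <= B by have /andP[] := wB 0; exact: le_trans.
apply: (@le_trans _ _ (\int[leb]_y (h (x - y) * B))).
  apply: le_Rintegral => //.
  - exact: integrable_cv mw wB.
  - apply: (@integrable_cv (fun=> B) B x) => // y; by rewrite B0 lexx.
  - by move=> y _; rewrite ler_wpM2l //; have /andP[] := wB y.
have := integral_hsub x; have i := integrable_hsub x.
rewrite RintegralZr // => e.
by rewrite /Rintegral e.
Qed.

Lemma measurable_cv w : measurable_fun [set: R] w -> (forall y, 0 <= w y) ->
  measurable_fun [set: R] (cv w).
Proof.
move=> mw w0.
have m : measurable_fun [set: R * R] (fun z : R * R => (h (z.1 - z.2) * w z.2)%:E).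
  apply/measurable_EFinP; apply: measurable_funM; first exact: measurable_hdiff.
  exact: measurableT_comp.
have p (z : R * R) : (0 <= (h (z.1 - z.2) * w z.2)%:E)%E by rewrite lee_fin mulr_ge0.
exact: (measurableT_comp (fine_measurable measurableT) (measurable_tonelliR m p)).
Qed.

Lemma cv_even w x : fcone w -> cv w (- x) = cv w x.
Proof.
move=> fw; rewrite /cv /Rintegral; congr fine.
have mw := measurable_cone (fcone_cone fw).
have m : measurable_fun [set: R] (fun y => (h (x - y) * w y)%:E).
  by apply/measurable_EFinP; apply: measurable_funM => //; exact: measurable_hsub.
rewrite -[RHS](integral_opp m); apply: eq_integral => y _.
rewrite (fcone_even _ fw) -(fcone_even _ fh); congr ((h _ * _)%:E); ring.
Qed.

(* Reflect about the midpoint of [x] and [x']: both differences change sign there. *)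
Lemma cv_fcone w B : fcone w -> (forall y, w y <= B) -> fcone (cv w).
Proof.
move=> fw wb; have [w0 wm] := fw; have [_ hm] := fh.
have mw := measurable_cone (fcone_cone fw).
have wB y : 0 <= w y <= B by rewrite w0 wb.
split; first by move=> x; exact: cv_ge0.
suff H x x' : 0 <= x -> x <= x' -> cv w x' <= cv w x.
  move=> s t st.
  have e z : cv w z = cv w `|z| by case: (ger0P z) => // _; rewrite cv_even.
  by rewrite (e s) (e t); apply: H.
move=> x0 xx'; rewrite -subr_ge0; set D := cv w x - cv w x'.
pose g y := h (x - y) - h (x' - y); pose c := x + x'.
have ig1 : leb.-integrable setT (EFin \o (fun y => g y * w y)).
  have := integrableB measurableT (integrable_cv x mw wB) (integrable_cv x' mw wB).
  by apply: eq_integrable => // y _; rewrite /= /g mulrBl.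
have DE : D = \int[leb]_y (g y * w y).
  rewrite /D /cv -RintegralB //; last 2 first.
  - exact: integrable_cv mw wB.
  - exact: integrable_cv mw wB.
  by apply: eq_Rintegral => y _; rewrite /g mulrBl.
have gc y : g (c - y) = - g y.
  have e1 : h (x - (c - y)) = h (x' - y) by rewrite -(fcone_even _ fh); congr h; rewrite /c; ring.
  have e2 : h (x' - (c - y)) = h (x - y) by rewrite -(fcone_even _ fh); congr h; rewrite /c; ring.
  by rewrite /g e1 e2 opprB.
have mg : measurable_fun [set: R] g by apply: measurable_funB; exact: measurable_hsub.
have mwc : measurable_fun [set: R] (fun y => w (c - y)).
  by apply: (measurableT_comp mw); exact: measurable_funB.
have wcB y : 0 <= w (c - y) <= B by [].
have ig2 : leb.-integrable setT (EFin \o (fun y => g y * w (c - y))).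
  have := integrableB measurableT (integrable_cv x mwc wcB) (integrable_cv x' mwc wcB).
  by apply: eq_integrable => // y _; rewrite /= /g mulrBl.
have DE2 : D = - \int[leb]_y (g y * w (c - y)).
  rewrite DE -mulN1r -RintegralZl // /Rintegral; congr fine.
  have m : measurable_fun [set: R] (fun y => (g y * w y)%:E).
    by apply/measurable_EFinP; exact: measurable_funM.
  rewrite -[LHS](integral_sub c m); apply: eq_integral => y _.
  by rewrite gc mulN1r mulNr.
have : 0 <= \int[leb]_y (g y * (w y - w (c - y))).
  apply: Rintegral_ge0 => y _.
  have [yc|yc] := lerP y (c / 2).
    apply: mulr_ge0; rewrite subr_ge0; [apply: hm|apply: wm].
      rewrite ler_norml; rewrite /c in yc; case: (ger0P (x' - y)) => ?; apply/andP; split; lra.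
    rewrite ler_norml; rewrite /c in yc *; case: (ger0P (x + x' - y)) => ?; apply/andP; split; lra.
  rewrite -mulrNN; apply: mulr_ge0; rewrite oppr_ge0 subr_le0; [apply: hm|apply: wm].
    rewrite ler_norml; rewrite /c in yc; case: (ger0P (x - y)) => ?; apply/andP; split; lra.
  rewrite ler_norml; rewrite /c in yc *; case: (ger0P y) => ?; apply/andP; split; lra.
have -> : \int[leb]_y (g y * (w y - w (c - y))) = D + D.
  rewrite {1}DE DE2 -RintegralB //.
  by apply: eq_Rintegral => y _; rewrite mulrBr.
by lra.
Qed.

Lemma integral_cv w B : measurable_fun [set: R] w -> (forall y, 0 <= w y <= B) ->
  (\int[leb]_x (cv w x)%:E = mass%:E * \int[leb]_y (w y)%:E)%E.
Proof.
move=> mw wB; have w0 y : 0 <= w y by have /andP[] := wB y.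
have m : measurable_fun [set: R * R] (fun z : R * R => (h (z.1 - z.2) * w z.2)%:E).
  apply/measurable_EFinP; apply: measurable_funM; first exact: measurable_hdiff.
  exact: measurableT_comp.
have p (z : R * R) : (0 <= (h (z.1 - z.2) * w z.2)%:E)%E by rewrite lee_fin mulr_ge0.
have -> : (\int[leb]_x (cv w x)%:E = \int[leb]_x \int[leb]_y (h (x - y) * w y)%:E)%E.
  apply: eq_integral => x _; rewrite /cv /Rintegral fineK //.
  exact: (integrable_fin_num measurableT (integrable_cv x mw wB)).
rewrite (tonelliC m p) /=.
have mwE : measurable_fun [set: R] (fun y => (w y)%:E) by exact/measurable_EFinP.
rewrite -ge0_integralZl //; [|by move=> y _; rewrite lee_fin|by rewrite lee_fin mass_ge0].
apply: eq_integral => y _.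
under eq_integral do rewrite EFinM muleC.
have mhy : measurable_fun [set: R] (fun x => (h (x - y))%:E).
  by apply/measurable_EFinP; apply: (measurableT_comp mh); exact: measurable_funB.
rewrite ge0_integralZl //; [|by move=> x _; rewrite lee_fin|by rewrite lee_fin].
rewrite muleC; congr (_ * _)%E.
have mE : measurable_fun [set: R] (fun y => (h y)%:E) by exact/measurable_EFinP.
rewrite (integral_shift (- y) mE) /mass /Rintegral fineK //.
exact: integrable_fin_num ih.
Qed.

End convolution.

Section resolvent.
Context {R : realType}.
Local Notation leb := (@lebesgue_measure R).
Local Notation leb2 := ((@lebesgue_measure R) \x (@lebesgue_measure R))%E.
Variables (h : R -> R) (A : R).
Hypothesis fh : fcone h.
Hypothesis ih : leb.-integrable setT (EFin \o h).
Hypothesis A_gt0 : 0 < A.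

Let mh : measurable_fun [set: R] h.
Proof. exact: (measurable_cone (fcone_cone fh)). Qed.
Let h0 x : 0 <= h x. Proof. by have [] := fh. Qed.
Let m0 : 0 <= mass h := mass_ge0 fh.

Section iteration.
Variables (f : R -> R) (M F : R).
Hypothesis ff : fcone f.
Hypothesis fM : forall x, f x <= M.
Hypothesis intf : (\int[leb]_x (f x)%:E = F%:E)%E.

Let kA_gt0 : 0 < mass h + A. Proof. by rewrite ltr_wpDl. Qed.
Let f0 x : 0 <= f x. Proof. by have [] := ff. Qed.
Let mf : measurable_fun [set: R] f := measurable_cone (fcone_cone ff).
Let M0 : 0 <= M := le_trans (f0 0) (fM 0).

Fixpoint resolvent_it (n : nat) : R -> R :=
  if n is n'.+1 then fun x => (cv h (resolvent_it n') x + f x) / (mass h + A)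
  else fun=> 0.

Let F0 : 0 <= F.
Proof. by rewrite -lee_fin -intf; apply: integral_ge0 => x _; rewrite lee_fin. Qed.

Lemma resolvent_itP n : [/\ fcone (resolvent_it n),
  forall x, resolvent_it n x <= M / A &
  (\int[leb]_x (resolvent_it n x)%:E <= (F / A)%:E)%E].
Proof.
elim: n => [|n [fw wM wF]].
  split => //=; first by move=> x; rewrite divr_ge0 // ltW.
  by rewrite integral0 lee_fin divr_ge0 // ltW.
have mw := measurable_cone (fcone_cone fw).
have wB y : 0 <= resolvent_it n y <= M / A by rewrite wM andbT; have [] := fw.
have [c0 cm] := cv_fcone fh ih fw wM.
have A0 : A != 0 by rewrite gt_eqF.
have kA0 : mass h + A != 0 by rewrite gt_eqF.
split => /=.
- split => [x|s t st]; first by rewrite divr_ge0 ?addr_ge0 // ltW.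
  by rewrite ler_pM2r ?invr_gt0 // lerD ?cm //; have [_] := ff; exact.
- move=> x; rewrite ler_pdivrMr //.
  have -> : M / A * (mass h + A) = mass h * (M / A) + M by field.
  by rewrite lerD // (cv_bound _ ih).
- have mcv := measurable_cv fh mw (fun y => fw.1 y).
  have mcE : measurable_fun [set: R] (fun x => (cv h (resolvent_it n) x)%:E) by exact/measurable_EFinP.
  have mfE : measurable_fun [set: R] (fun x => (f x)%:E) by exact/measurable_EFinP.
  have -> : (\int[leb]_x ((cv h (resolvent_it n) x + f x) / (mass h + A))%:E =
      ((mass h + A)^-1)%:E * (\int[leb]_x (cv h (resolvent_it n) x)%:E + \int[leb]_x (f x)%:E))%E.
    rewrite -ge0_integralD //; try (by move=> x _; rewrite lee_fin).
    rewrite -ge0_integralZl //.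
    + by apply: eq_integral => x _; rewrite -EFinD -EFinM mulrC.
    + exact: emeasurable_funD.
    + by move=> x _; rewrite adde_ge0 // lee_fin.
    + by rewrite lee_fin invr_ge0 ltW.
  rewrite (integral_cv fh ih mw wB) intf.
  apply: (@le_trans _ _ (((mass h + A)^-1)%:E * (mass h * (F / A) + F)%:E)%E).
    apply: lee_wpmul2l; first by rewrite lee_fin invr_ge0 ltW.
    rewrite EFinD; apply: leeD => //; rewrite EFinM; apply: lee_wpmul2l => //.
  rewrite -EFinM lee_fin le_eqVlt; apply/orP; left; apply/eqP; field.
  by rewrite A0 kA0.
Qed.

Lemma resolvent_it_nd n x : resolvent_it n x <= resolvent_it n.+1 x.
Proof.
elim: n x => [|n IH] x.
  rewrite /= divr_ge0 ?(ltW kA_gt0) // addr_ge0 //.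
  by apply: (cv_ge0 fh).
have [fw wM _] := resolvent_itP n; have [fw' wM' _] := resolvent_itP n.+1.
have mw := measurable_cone (fcone_cone fw); have mw' := measurable_cone (fcone_cone fw').
have wB y : 0 <= resolvent_it n y <= M / A by rewrite wM andbT; have [] := fw.
have wB' y : 0 <= resolvent_it n.+1 y <= M / A by rewrite wM' andbT; have [] := fw'.
have := cv_le fh ih x mw mw' wB wB' IH.
rewrite -(lerD2r (f x)) -(@ler_pM2r _ (mass h + A)^-1) ?invr_gt0 //.
Qed.

Lemma resolvent_exists : exists w, [/\ fcone w, forall x, w x <= M / A,
  (\int[leb]_x (w x)%:E <= (F / A)%:E)%E &
  forall x, (mass h + A) * w x = cv h w x + f x].
Proof.
pose w x := limn (fun n => resolvent_it n x).
have nd x : {homo (fun n => resolvent_it n x) : n m / (n <= m)%N >-> n <= m}.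
  by apply/nondecreasing_seqP => n; exact: resolvent_it_nd.
have cw x : (fun n => resolvent_it n x) @ \oo --> w x.
  apply: nondecreasing_is_cvgn => //.
  by exists (M / A) => _ [n _ <-]; have [_ + _] := resolvent_itP n.
have fw : fcone w.
  split => [x|s t st].
    by apply: (cvgr_to_ge (cw x)); apply: nearW => n; have [[+ _] _ _] := resolvent_itP n.
  apply: (ler_cvg_to (cw t) (cw s)); apply: nearW => n.
  by have [[_ +] _ _] := resolvent_itP n; exact.
have wM x : w x <= M / A.
  by apply: (cvgr_to_le (cw x)); apply: nearW => n; have [_ + _] := resolvent_itP n.
have mit n : measurable_fun [set: R] (resolvent_it n).
  by have [fc _ _] := resolvent_itP n; exact: (measurable_cone (fcone_cone fc)).
have mw := measurable_cone (fcone_cone fw).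
exists w; split => //.
  apply: (fatou_cvg (mu := leb) (f_ := resolvent_it) (f := w)) => //.
  - by move=> n x; have [[+ _] _ _] := resolvent_itP n.
  - by move=> n; have [_ _ +] := resolvent_itP n.
move=> x.
have c1 : (fun n => cv h (resolvent_it n) x) @ \oo --> cv h w x.
  have mhx : measurable_fun [set: R] (fun y => h (x - y)) by exact: (measurable_hsub fh).
  have mn n : measurable_fun [set: R] (fun y => h (x - y) * resolvent_it n y) by exact: measurable_funM.
  have mx : measurable_fun [set: R] (fun y => h (x - y) * w y) by exact: measurable_funM.
  have ig : leb.-integrable setT (EFin \o (fun y => h (x - y) * (M / A))).
    apply: (@integrable_cv _ h fh ih (fun=> M / A) (M / A) x) => // y.
    by rewrite lexx divr_ge0 // ltW.
  apply: (dct (mu := leb) (g := fun y => h (x - y) * (M / A)) mn mx _ ig).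
  - by move=> y; apply: cvgM => //; exact: cvg_cst.
  - move=> n y; have [[w0 _] w1 _] := resolvent_itP n.
    by rewrite ger0_norm ?mulr_ge0 // ler_wpM2l.
have c2 : (fun n => resolvent_it n.+1 x) @ \oo --> w x by rewrite (cvg_shiftS (fun n => resolvent_it n x)).
have c3 : (fun n => resolvent_it n.+1 x) @ \oo --> (cv h w x + f x) / (mass h + A).
  by apply: cvgM; [apply: cvgD => //; exact: cvg_cst|exact: cvg_cst].
have -> : w x = (cv h w x + f x) / (mass h + A) by apply: (cvg_unique _ c2 c3).
by rewrite mulrC divfK // gt_eqF.
Qed.

End iteration.

Lemma integrable_swap (f : R * R -> R) : leb2.-integrable setT (EFin \o f) ->
  leb2.-integrable setT (EFin \o (fun z => f (z.2, z.1))) /\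
  \int[leb2]_z f (z.2, z.1) = \int[leb2]_z f z.
Proof.
move=> /integrableP[mf fi].
have mE : measurable_fun [set: R * R] (fun z => (f z)%:E) by exact: mf.
have mA : measurable_fun [set: R * R] (fun z => `|(f z)%:E|%E) by exact: measurableT_comp.
split; last by rewrite /Rintegral (integral2_swap mE).
apply/integrableP; split; first exact: (measurableT_comp mE measurable_swapR).
by rewrite (integral2_swap mA).
Qed.

Lemma integral_fst_kernel (g : R -> R) : leb.-integrable setT (EFin \o g) ->
  leb2.-integrable setT (EFin \o (fun z => g z.1 * h (z.1 - z.2))) /\
  \int[leb2]_z (g z.1 * h (z.1 - z.2)) = mass h * \int[leb]_x g x.
Proof.
move=> ig; have /integrableP[mgE gi] := ig.
have mg : measurable_fun [set: R] g by exact/measurable_EFinP.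
have m : measurable_fun [set: R * R] (fun z => (g z.1 * h (z.1 - z.2))%:E).
  apply/measurable_EFinP; apply: measurable_funM; last exact: (measurable_hdiff fh).
  exact: measurableT_comp.
have i2 : leb2.-integrable setT (EFin \o (fun z => g z.1 * h (z.1 - z.2))).
  apply: (iffRL (@integrable12ltyP _ _ _ _ _ leb leb _ m)) => /=.
  have -> : (\int[leb]_x \int[leb]_y (`|g x * h (x - y)|)%:E = \int[leb]_x ((mass h)%:E * (`|g x|)%:E))%E.
    apply: eq_integral => x _; rewrite -(integral_hsub fh ih x) muleC -ge0_integralZl //.
    - by apply: eq_integral => y _; rewrite normrM (ger0_norm (h0 _)) EFinM.
    - by apply/measurable_EFinP; exact: (measurable_hsub fh).
    - by move=> y _; rewrite lee_fin.
  have mn : measurable_fun [set: R] (fun x => (`|g x|)%:E).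
    by apply/measurable_EFinP; exact: measurableT_comp.
  by rewrite ge0_integralZl // lte_mul_pinfty.
split => //.
rewrite /Rintegral -(integral12_prod_meas1 i2) /fubini_F /=.
have -> : (\int[leb]_x \int[leb]_y (g x * h (x - y))%:E = \int[leb]_x ((mass h)%:E * (g x)%:E))%E.
  apply: eq_integral => x _; rewrite -(integral_hsub fh ih x) muleC.
  rewrite -integralZl //; last exact: (integrable_hsub fh ih).
rewrite integralZl // fineM //.
exact: integrable_fin_num.
Qed.

Lemma integral_kernel (g w : R -> R) (B : R) : Ltwo leb g -> Ltwo leb w ->
  (forall x, 0 <= w x <= B) ->
  [/\ leb2.-integrable setT (EFin \o (fun z => g z.1 * w z.2 * h (z.1 - z.2))),
      leb.-integrable setT (EFin \o (fun x => g x * cv h w x)) &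
  \int[leb2]_z (g z.1 * w z.2 * h (z.1 - z.2)) = \int[leb]_x (g x * cv h w x)].
Proof.
move=> hg hw wB; have mg := hg.1; have mw := hw.1.
have m : measurable_fun [set: R * R] (fun z => (g z.1 * w z.2 * h (z.1 - z.2))%:E).
  apply/measurable_EFinP; apply: measurable_funM; last exact: (measurable_hdiff fh).
  by apply: measurable_funM; exact: measurableT_comp.
have [i1 _] := integral_fst_kernel (Ltwo_integrable hg).
have [i2 _] := integral_fst_kernel (Ltwo_integrable hw).
have [i3 _] := integrable_swap i2.
have i4 : leb2.-integrable setT (EFin \o (fun z => g z.1 * w z.2 * h (z.1 - z.2))).
  apply: (le_integrable _ _ _ (integrableD measurableT i1 i3)) => //.
  move=> z _ /=; rewrite lee_fin -(fcone_even (z.2 - z.1) fh) opprB -mulrDl !normrM.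
  have z2 : 0 <= g z.1 ^+ 2 + w z.2 ^+ 2 by rewrite addr_ge0 ?sqr_ge0.
  rewrite (ger0_norm (h0 _)) ler_wpM2r // (ger0_norm z2).
  rewrite -(real_normK (num_real (g z.1))) -(real_normK (num_real (w z.2))).
  by have := sqr_ge0 (`|g z.1| - `|w z.2|); have := mulr_ge0 (normr_ge0 (g z.1)) (normr_ge0 (w z.2)); nra.
have E x : (\int[leb]_y (g x * w y * h (x - y))%:E = (g x * cv h w x)%:E)%E.
  have ic := integrable_cv fh ih x mw wB.
  rewrite EFinM /cv /Rintegral fineK; last exact: integrable_fin_num.
  rewrite -integralZl //; apply: eq_integral => y _; rewrite -EFinM; congr (_%:E); ring.
split => //.
  have := integrable_fubini_F i4; apply: eq_integrable => // x _; exact: E.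
rewrite /Rintegral -(integral12_prod_meas1 i4) /fubini_F /=; congr fine.
by apply: eq_integral => x _; exact: E.
Qed.

Lemma form_resolvent (w phi : R -> R) (B : R) : Ltwo leb w -> Ltwo leb phi ->
  (forall x, 0 <= w x <= B) ->
  [/\ inH h w & Q h A w phi = \int[leb]_x (((mass h + A) * w x - cv h w x) * phi x)].
Proof.
move=> hw hp wB.
have mw := hw.1.
have hwphi := Ltwo_mul hw hp.
have [a1 b1] := integral_fst_kernel hwphi.
have [a2 b2] := integrable_swap a1.
have [a3 icv b3] := integral_kernel hp hw wB.
have [a4 b4] := integrable_swap a3.
split.
  split => //; have [c1 _] := integral_fst_kernel (Ltwo_integrable hw).
  have [c2 _] := integrable_swap c1.
  have c3 := integrableZl measurableT 2 (integrableD measurableT c1 c2).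
  have c4 : leb2.-integrable setT (EFin \o
      (fun z => 2 * (w z.1 ^+ 2 * h (z.1 - z.2) + w z.2 ^+ 2 * h (z.2 - z.1)))).
    by apply: eq_integrable c3.
  apply: (Ltwo_of_le (mu := leb2) _ c4).
  - exact: measurable_dl.
  - move=> z; rewrite dl_sqr // -(fcone_even (z.2 - z.1) fh) opprB -mulrDl mulrA ler_wpM2r //.
    by have := sqr_ge0 (w z.1 + w z.2); nra.
have e : ip leb2 (dl h w) (dl h phi) = 2 * (mass h * ip leb w phi) - 2 * \int[leb]_x (phi x * cv h w x).
  rewrite /ip.
  have -> : \int[leb2]_z (dl h w z * dl h phi z) =
     \int[leb2]_z ((w z.1 * phi z.1 * h (z.1 - z.2) + w z.2 * phi z.2 * h (z.2 - z.1)) -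
       (phi z.1 * w z.2 * h (z.1 - z.2) + phi z.2 * w z.1 * h (z.2 - z.1))).
    apply: eq_Rintegral => z _; rewrite dl_mul // -(fcone_even (z.2 - z.1) fh) opprB; ring.
  rewrite RintegralB //; last 2 first.
  - by have := integrableD measurableT a1 a2; exact: eq_integrable.
  - by have := integrableD measurableT a3 a4; exact: eq_integrable.
  rewrite RintegralD // RintegralD // b1 b3.
  rewrite -[X in _ + X - _]/(\int[leb2]_z (fun z' => w z'.1 * phi z'.1 * h (z'.1 - z'.2)) (z.2, z.1)) b2 b1.
  rewrite -[X in _ - (_ + X)]/(\int[leb2]_z (fun z' => phi z'.1 * w z'.2 * h (z'.1 - z'.2)) (z.2, z.1)) b4 b3.
  ring.
rewrite /Q e.
have -> : \int[leb]_x (((mass h + A) * w x - cv h w x) * phi x) =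
   \int[leb]_x ((mass h + A) * (w x * phi x) - phi x * cv h w x).
  by apply: eq_Rintegral => x _; ring.
rewrite RintegralB //; last first.
  by have := integrableZl measurableT (mass h + A) hwphi; exact: eq_integrable.
rewrite RintegralZl // /ip; by field.
Qed.

End resolvent.

Section linear_solve.
Context {R : realType}.
Local Notation leb := (@lebesgue_measure R).
Variables (k : R -> R) (A : R).
Hypothesis ck : cone k.
Hypothesis ik : forall n : nat, leb.-integrable setT (EFin \o (fun t => Num.min (k t) n%:R)).
Hypothesis A_gt0 : 0 < A.

Let mk : measurable_fun [set: R] k := measurable_cone ck.
Let k0 t : 0 <= k t. Proof. by have [] := ck. Qed.

Definition ktr (n : nat) (t : R) : R := if t == 0 then n%:R else Num.min (k t) n%:R.

Lemma ktr_fcone n : fcone (ktr n).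
Proof.
have [_ ke km] := ck.
split => [t|s t st]; rewrite /ktr.
  by case: ifP => _ //; rewrite le_min k0 ler0n.
have [s0|s0] := eqVneq s 0; first by case: ifP => _ //; rewrite ge_min lexx orbT.
have t0 : t != 0 by rewrite -normr_gt0 (lt_le_trans _ st) // normr_gt0.
rewrite (negbTE t0) -(cone_norm t ck) -(cone_norm s ck).
have kk : k `|t| <= k `|s| by apply: km => //; rewrite normr_gt0.
by rewrite le_min !ge_min kk lexx orbT.
Qed.

Lemma ktr_integrable n : leb.-integrable setT (EFin \o ktr n).
Proof.
have mt := measurable_cone (fcone_cone (ktr_fcone n)).
have mE : measurable_fun [set: R] (fun t => `|(ktr n t)%:E|%E).
  by apply: measurableT_comp => //; exact/measurable_EFinP.
have /integrableP[mi fi] := ik n.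
have mi' : measurable_fun [set: R] (fun t => `|(Num.min (k t) n%:R)%:E|%E).
  by apply: measurableT_comp => //; exact: mi.
apply/integrableP; split; first exact/measurable_EFinP.
by rewrite (integral_eq_off0 mE mi') // => t t0; rewrite /ktr (negbTE t0).
Qed.

Lemma dl_ktr n (u : R -> R) : dl (ktr n) u = dl (fun t => Num.min (k t) n%:R) u.
Proof.
apply/funext => z; rewrite /dl /ktr subr_eq0.
by case: eqP => // ->; rewrite !subrr !mul0r.
Qed.

Lemma Ltwo_bounded (w : R -> R) (B : R) (F : \bar R) : measurable_fun [set: R] w ->
  (forall x, 0 <= w x <= B) -> (\int[leb]_x (w x)%:E <= F)%E -> (F < +oo)%E ->
  Ltwo leb w.
Proof.
move=> mw wB wF Foo.
have iw : leb.-integrable setT (EFin \o w).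
  apply/integrableP; split; first exact/measurable_EFinP.
  under eq_integral do rewrite /= ger0_norm ?(proj1 (andP (wB _))) //.
  exact: le_lt_trans Foo.
have := integrableZl measurableT B iw => iB.
apply: (Ltwo_of_le (mu := leb) (g := fun x => B * w x) mw iB) => x.
by have /andP[h1 h2] := wB x; rewrite expr2 ler_wpM2r.
Qed.

Lemma linear_solve (f : R -> R) (M F : R) : fcone f -> (forall x, f x <= M) ->
  (\int[leb]_x (f x)%:E = F%:E)%E ->
  exists w, [/\ cone w, inH k w, forall x, w x <= M / A &
    forall phi, inH k phi -> Q k A w phi = \int[leb]_x (f x * phi x)].
Proof.
move=> ff fM fF.
have f0 x : 0 <= f x by have [] := ff.
have M0 : 0 <= M by exact: le_trans (f0 0) (fM 0).
have MA0 : 0 <= M / A by rewrite divr_ge0 // ltW.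
have mf := measurable_cone (fcone_cone ff).
have fB x : 0 <= f x <= M by rewrite f0 fM.
have hf : Ltwo leb f by apply: (Ltwo_bounded (F := F%:E) mf fB); rewrite ?fF // ltry.
have if1 : leb.-integrable setT (EFin \o f).
  apply/integrableP; split; first exact/measurable_EFinP.
  by under eq_integral do rewrite /= ger0_norm //; rewrite fF ltry.
have ex n : exists w, [/\ fcone w, forall x, w x <= M / A,
    (\int[leb]_x (w x)%:E <= (F / A)%:E)%E &
    forall x, (mass (ktr n) + A) * w x = cv (ktr n) w x + f x].
  exact: (resolvent_exists (ktr_fcone n) (ktr_integrable n) A_gt0 ff fM fF).
have [w_ wP] := choice ex.
have fw n : fcone (w_ n) by have [] := wP n.
have mw n := measurable_cone (fcone_cone (fw n)).
have wB n x : 0 <= w_ n x <= M / A by have [[w0 _] w1 _ _] := wP n; rewrite w0 w1.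
have hw n : Ltwo leb (w_ n).
  by have [_ _ wF _] := wP n; apply: (Ltwo_bounded (mw n) (wB n) wF); rewrite ltry.
pose k_ n t := Num.min (k t) n%:R.
have wH n : inH (k_ n) (w_ n).
  have [h1 _] := form_resolvent A (ktr_fcone n) (ktr_integrable n) (hw n) (hw n) (wB n).
  by move: h1; rewrite /inH dl_ktr.
have wQ n phi : Ltwo leb phi -> Q (k_ n) A (w_ n) phi = \int[leb]_x (f x * phi x).
  move=> hp; have [_] := form_resolvent A (ktr_fcone n) (ktr_integrable n) (hw n) hp (wB n).
  rewrite /Q !dl_ktr => ->; apply: eq_Rintegral => x _.
  by have [_ _ _ ->] := wP n; rewrite addrC addKr.
have wQQ n : Q (k_ n) A (w_ n) (w_ n) <= M / A * F.
  rewrite wQ //; have -> : M / A * F = \int[leb]_x (M / A * f x).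
    by rewrite RintegralZl // /Rintegral fF.
  apply: le_Rintegral => //.
  - exact: Ltwo_mul.
  - exact: (integrableZl measurableT (M / A) if1).
  - by move=> x _; rewrite mulrC ler_wpM2r //; have /andP[] := wB n x.
have [phi [w [nphi cw cvw]]] := helly (fun n => fcone_cone (fw n))
  (B := fun=> M / A) (fun n x => proj2 (andP (wB n x))).
have mkn n : measurable_fun [set: R] (k_ (phi n)) by exact: measurable_minr.
have kk n t : 0 <= k_ (phi n) t <= k t.
  by rewrite /k_ le_min k0 ler0n /= ge_min lexx.
have kc t : (fun n => k_ (phi n) t) @ \oo --> k t.
  apply: cvg_near_cst; near=> n; rewrite /k_; apply/min_idPl.
  apply: (@le_trans _ _ n%:R); last by rewrite ler_nat.
  by near: n; exact: nbhs_infty_ger.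
have [h1 _ h3] := @form_limit R (fun n => k_ (phi n)) k A mkn mk kk kc A_gt0
  (fun n => w_ (phi n)) w (M / A * F) (fun n => wH _) (fun n => wQQ _) cvw (measurable_cone cw).
exists w; split => //.
  by move=> x; apply: (cvgr_to_le (cvw x)); apply: nearW => n; have /andP[] := wB (phi n) x.
move=> g hg; have := h3 g hg.
have -> : (fun n => Q (k_ (phi n)) A (w_ (phi n)) g) = (fun=> \int[leb]_x (f x * g x)).
  by apply/funext => n; apply: wQ; have [] := hg.
by move=> c; rewrite -(cvg_lim (@Rhausdorff R) c) lim_cst //; exact: Rhausdorff.
Unshelve. all: end_near.
Qed.

End linear_solve.

(** * The Euler-Lagrange equation *)

Lemma young_powR (R : realType) (x y p : R) : 0 <= x -> 0 <= y -> 0 < p ->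
  x `^ p * y <= p / (p + 1) * x `^ (p + 1) + (p + 1)^-1 * y `^ (p + 1).
Proof.
move=> x0 y0 p0.
have p1 : 0 < p + 1 by lra.
have := @conjugate_powR R (x `^ p) y ((p + 1) / p) (p + 1) (powR_ge0 _ _) y0.
have h1 : 0 < (p + 1) / p by rewrite divr_gt0.
have np : p != 0 by rewrite gt_eqF.
have np1 : p + 1 != 0 by rewrite gt_eqF.
move=> /(_ h1 p1).
have -> : ((p + 1) / p)^-1 + (p + 1)^-1 = 1 by field; rewrite np np1.
move=> /(_ erefl); rewrite -powRrM.
have -> : p * ((p + 1) / p) = p + 1 by field.
by rewrite invf_div => /le_trans; apply; rewrite le_eqVlt; apply/orP; left; apply/eqP; ring.
Qed.

Section euler_lagrange.
Context {R : realType}.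
Local Notation leb := (@lebesgue_measure R).
Variables (k : R -> R) (A p : R).
Hypothesis ck : cone k.
Hypothesis ik : forall n : nat, leb.-integrable setT (EFin \o (fun t => Num.min (k t) n%:R)).
Hypothesis A_gt0 : 0 < A.
Hypothesis p_gt1 : 1 < p.

Let mk : measurable_fun [set: R] k := measurable_cone ck.
Let k0 t : 0 <= k t. Proof. by have [] := ck. Qed.
Let p0 : 0 < p. Proof. by have := p_gt1; lra. Qed.

Lemma cone_bounded_powR (w : R -> R) (B q : R) : cone w -> Ltwo leb w ->
  (forall x, w x <= B) -> 2 <= q -> leb.-integrable setT (EFin \o (fun x => w x `^ q)).
Proof.
move=> cw hw wB q2; have [w0 _ _] := cw; have mw := measurable_cone cw.
have i1 := integrableZl measurableT (B `^ (q - 2)) (Ltwo_integrable hw).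
apply: (le_integrable _ _ _ i1) => //; first by apply/measurable_EFinP; exact: measurable_powRl.
move=> x _; rewrite /= lee_fin !ger0_norm ?mulr_ge0 ?powR_ge0 ?sqr_ge0 //.
have [->|wx] := eqVneq (w x) 0; first by rewrite powR0 ?mulr_ge0 ?powR_ge0 ?sqr_ge0 // gt_eqF //; lra.
have -> : w x `^ q = w x `^ (q - 2) * w x ^+ 2.
  by rewrite -powR_mulrn // -powRD ?wx ?implybT // subrK.
rewrite ler_wpM2r ?sqr_ge0 //.
by apply: powR_nondecr => //; lra.
Qed.

Lemma linear_solve_cone (g : R -> R) (M F : R) : cone g -> (forall x, g x <= M) ->
  (\int[leb]_x (g x)%:E = F%:E)%E ->
  exists w, [/\ cone w, inH k w, forall x, w x <= M / A &
    forall phi, inH k phi -> Q k A w phi = \int[leb]_x (g x * phi x)].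
Proof.
move=> cg gM gF; have [g0 ge gm] := cg; have mg := measurable_cone cg.
pose f x := if x == 0 then M else g x.
have M0 : 0 <= M by exact: le_trans (g0 0) (gM 0).
have ff : fcone f.
  split => [x|s t st]; rewrite /f; first by case: ifP.
  have [s0|s0] := eqVneq s 0; first by case: ifP.
  have t0 : t != 0 by rewrite -normr_gt0 (lt_le_trans _ st) // normr_gt0.
  by rewrite (negbTE t0); exact: cone_le.
have mf := measurable_cone (fcone_cone ff).
have fM x : f x <= M by rewrite /f; case: ifP.
have fF : (\int[leb]_x (f x)%:E = F%:E)%E.
  rewrite -gF; apply: integral_eq_off0; [exact/measurable_EFinP|exact/measurable_EFinP|].
  by move=> x x0; rewrite /f (negbTE x0).
have [w [cw hw wM wE]] := linear_solve ck ik A_gt0 ff fM fF.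
exists w; split => // phi hp; have mp := inH_meas hp.
rewrite wE // /Rintegral; congr fine; apply: integral_eq_off0.
- by apply/measurable_EFinP; exact: measurable_funM.
- by apply/measurable_EFinP; exact: measurable_funM.
- by move=> x x0; rewrite /f (negbTE x0).
Qed.

Variable u : R -> R.
Hypothesis cu : cone u.
Hypothesis hu : inH k u.
Hypothesis Ju : Jp p u = 1%:E.
Hypothesis Qu_gt0 : 0 < Q k A u u.
Hypothesis u_min : forall w, cone w -> inH k w -> Jp p w = 1%:E -> Q k A u u <= Q k A w w.

Let lam := Q k A u u.
Let u0 x : 0 <= u x. Proof. by have [] := cu. Qed.
Let mu_ : measurable_fun [set: R] u := measurable_cone cu.

Definition trunc_source (n : nat) (x : R) : R :=
  if `|x| < n%:R then Num.min (u x `^ p) n%:R else 0.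

Lemma trunc_source_cone n : cone (trunc_source n).
Proof.
have [_ ue um] := cu.
split => [x|x|x y x0 xy]; rewrite /trunc_source.
- by case: ifP => // _; rewrite le_min powR_ge0 ler0n.
- by rewrite normrN ue.
- have y0 : 0 < y by exact: lt_le_trans xy.
  rewrite !gtr0_norm //; case: (ltP y n%:R) => yn; last first.
    by case: ifP => // _; rewrite le_min powR_ge0 ler0n.
  rewrite (le_lt_trans xy yn) le_min !ge_min lexx orbT andbT powR_nondecr ?(ltW p0) //.
  exact: um.
Qed.

Lemma trunc_source_bound n x : [/\ 0 <= trunc_source n x, trunc_source n x <= n%:R & trunc_source n x <= u x `^ p].
Proof.
rewrite /trunc_source; case: ifP => _; last by rewrite lexx ler0n powR_ge0.
by rewrite le_min powR_ge0 ler0n !ge_min !lexx orbT.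
Qed.

Lemma trunc_source_cvg x : (fun n => trunc_source n x) @ \oo --> u x `^ p.
Proof.
apply: cvg_near_cst; near=> n; rewrite /trunc_source ifT.
  apply/min_idPl.
  by near: n; exact: nbhs_infty_ger.
by near: n; exact: nbhs_infty_gtr.
Unshelve. all: end_near.
Qed.

Lemma trunc_source_int n : exists F : R, (\int[leb]_x (trunc_source n x)%:E = F%:E)%E.
Proof.
have mg := measurable_cone (trunc_source_cone n).
have mgE : measurable_fun [set: R] (fun x => (trunc_source n x)%:E) by exact/measurable_EFinP.
suff fi : (\int[leb]_x (trunc_source n x)%:E \is a fin_num)%E.
  by exists (fine (\int[leb]_x (trunc_source n x)%:E)%E); rewrite fineK.
rewrite ge0_fin_numE; last first.
  by apply: integral_ge0 => x _; rewrite lee_fin; have [] := trunc_source_bound n x.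
have nn : - n%:R <= n%:R :> R by rewrite ge0_cp // ler0n.
have mI : measurable ([set` `](- n%:R), n%:R[] : set R) by exact: measurable_itv.
pose I : set R := [set` `](- n%:R), n%:R[].
have mind : measurable_fun [set: R] (fun x : R => (n%:R * (\1_I x : R))%:E).
  by apply/measurable_EFinP; apply: measurable_funM => //; exact: measurable_indic.
apply: (@le_lt_trans _ _ (\int[leb]_x (n%:R * (\1_I x : R))%:E)%E).
  apply: ge0_le_integral => //.
  - by move=> x _; rewrite lee_fin; have [] := trunc_source_bound n x.
  - move=> x _; rewrite lee_fin indicE; case: (boolP (x \in _)) => /= h.
      by rewrite mulr1; have [] := trunc_source_bound n x.
    rewrite mulr0 /trunc_source ifF //; apply/negbTE; move: h; apply: contra.
    by move=> h; rewrite inE /I /= in_itv /= -ltr_norml.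
have mi2 : measurable_fun [set: R] (fun x : R => (\1_I x : R)%:E).
  by apply/measurable_EFinP; exact: measurable_indic.
under eq_integral do rewrite EFinM.
rewrite ge0_integralZl //.
have -> : (\int[leb]_x (\1_I x)%:E = (n%:R - - n%:R)%:E)%E.
  by rewrite integral_indic // setIT; exact: lebesgue_itvoo.
by rewrite -EFinM ltry.
Qed.

Let ju : leb.-integrable setT (EFin \o (fun x => u x `^ (p + 1))).
Proof.
apply/integrableP; split; first by apply/measurable_EFinP; exact: measurable_powRl.
under eq_integral do rewrite /= ger0_norm ?powR_ge0 //.
by move: Ju; rewrite /Jp => ->; rewrite ltry.
Qed.

Let up x : u x `^ p * u x = u x `^ (p + 1).
Proof. by rewrite powRD ?powRr1 // gt_eqF // ltr_wpDr. Qed.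

Lemma source_pairing_cvg : (fun n => \int[leb]_x (trunc_source n x * u x)) @ \oo --> (1 : R).
Proof.
have -> : (1 : R) = \int[leb]_x (u x `^ (p + 1)) by move: Ju; rewrite /Jp /Rintegral => ->.
have mg n := measurable_cone (trunc_source_cone n).
have m1 n : measurable_fun [set: R] (fun x => trunc_source n x * u x) by exact: measurable_funM.
have m2 : measurable_fun [set: R] (fun x => u x `^ (p + 1)) by exact: measurable_powRl.
apply: (dct (mu := leb) m1 m2 _ ju).
- by move=> x; rewrite -up; apply: cvgM; [exact: trunc_source_cvg|exact: cvg_cst].
- move=> n x; have [g0 _ gu] := trunc_source_bound n x.
  by rewrite ger0_norm ?mulr_ge0 // -up ler_wpM2r.
Qed.

(* Young's inequality bounds the source term by the [L^(p+1)] norm of [w];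
   minimality of [u] bounds that norm by the energy. *)
Lemma solution_energy n (w : R -> R) (B : R) : cone w -> inH k w -> (forall x, w x <= B) ->
  Q k A w w = \int[leb]_x (trunc_source n x * w x) -> Q k A w w <= lam^-1.
Proof.
move=> cw hw wB E; have [w0 we wm] := cw; have mw := measurable_cone cw.
have p1 : 0 < p + 1 by have := p0; lra.
have np1 : p + 1 != 0 by rewrite gt_eqF.
have iw : leb.-integrable setT (EFin \o (fun x => w x `^ (p + 1))).
  by apply: (cone_bounded_powR cw _ wB); [have [] := hw|have := p_gt1; lra].
pose J := \int[leb]_x (w x `^ (p + 1)).
have JE : Jp p w = J%:E by rewrite /J /Rintegral fineK //; exact: integrable_fin_num iw.
have J0 : 0 <= J by apply: Rintegral_ge0 => x _; exact: powR_ge0.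
have Y t : 0 < t -> Q k A w w <= t * (p / (p + 1)) + t * (p + 1)^-1 * t^-1 `^ (p + 1) * J.
  move=> t0; rewrite E.
  have -> : t * (p / (p + 1)) + t * (p + 1)^-1 * t^-1 `^ (p + 1) * J =
      \int[leb]_x (t * (p / (p + 1)) * u x `^ (p + 1) + t * (p + 1)^-1 * t^-1 `^ (p + 1) * w x `^ (p + 1)).
    have i1 := integrableZl measurableT (t * (p / (p + 1))) ju.
    have i2 := integrableZl measurableT (t * (p + 1)^-1 * t^-1 `^ (p + 1)) iw.
    rewrite RintegralD // RintegralZl // RintegralZl // -/J; congr (_ + _).
    by move: Ju; rewrite /Jp /Rintegral => ->; rewrite mulr1.
  apply: le_Rintegral => //.
  - apply: Ltwo_mul; last by have [] := hw.
    have [F FE] := trunc_source_int n.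
    apply: (@Ltwo_bounded R _ n%:R F%:E) => //; last by rewrite ltry.
    + exact: measurable_cone (trunc_source_cone n).
    + by move=> x; have [-> ->] := trunc_source_bound n x.
    + by rewrite FE.
  - have i1 := integrableZl measurableT (t * (p / (p + 1))) ju.
    have i2 := integrableZl measurableT (t * (p + 1)^-1 * t^-1 `^ (p + 1)) iw.
    by have := integrableD measurableT i1 i2; exact: eq_integrable.
  - move=> x _; have [g0 _ gu] := trunc_source_bound n x.
    apply: (@le_trans _ _ (t * (u x `^ p * (t^-1 * w x)))).
      have -> : t * (u x `^ p * (t^-1 * w x)) = u x `^ p * w x by field; rewrite gt_eqF.
      by rewrite ler_wpM2r.
    have := young_powR (u0 x) (mulr_ge0 (ltW (divr_gt0 ltr01 t0)) (w0 x)) p0.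
    rewrite div1r => /(ler_wpM2l (ltW t0)) H; refine (le_trans H _).
    rewrite powRM ?invr_ge0 ?(ltW t0) // le_eqVlt; apply/orP; left; apply/eqP; ring.
have [JJ|JJ] := eqVneq J 0.
  have l0 : 0 < lam^-1 by rewrite invr_gt0.
  apply: le_trans (Y _ l0) _; rewrite JJ mulr0 addr0 ler_piMr ?(ltW l0) //.
  by rewrite ler_pdivrMr // mul1r; lra.
have Jp0 : 0 < J by rewrite lt_neqAle eq_sym JJ J0.
pose t := J `^ (p + 1)^-1.
have t0 : 0 < t by rewrite powR_gt0.
have tJ : t^-1 `^ (p + 1) * J = 1.
  have -> : t^-1 `^ (p + 1) = J^-1.
    by rewrite /t -powRN -powRrM mulNr mulVf // powRN powRr1.
  by rewrite mulVf.
have Yt : Q k A w w <= t.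
  apply: le_trans (Y t t0) _; rewrite -mulrA tJ mulr1 le_eqVlt; apply/orP; left; apply/eqP.
  by field.
have mn : lam <= Q k A (fun x => t^-1 * w x) (fun x => t^-1 * w x).
  apply: u_min.
  - by split => [x|x|x y x0 xy]; rewrite ?we ?mulr_ge0 ?invr_ge0 ?(ltW t0) // ler_wpM2l ?invr_ge0 ?(ltW t0) ?wm.
  - exact: inHZ.
  - rewrite -tJ /Jp /J /Rintegral EFinM fineK; last exact: integrable_fin_num iw.
    rewrite -integralZl //; apply: eq_integral => x _.
    by rewrite -EFinM powRM // invr_ge0 ltW.
have hw' : inH k (fun x => t^-1 * w x) by exact: inHZ.
rewrite QZl // QC QZl // in mn.
have l0 := Qu_gt0; rewrite -/lam in l0.
rewrite mulrA -expr2 exprVn mulrC ler_pdivlMr ?exprn_gt0 // in mn.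
have lt1 : lam * t <= 1.
  rewrite -(ler_pM2r t0) mul1r -mulrA -expr2; exact: le_trans mn Yt.
by apply: le_trans Yt _; rewrite -[leRHS]mul1r ler_pdivlMr // mulrC.
Qed.

Lemma euler_lagrange phi : inH k phi ->
  leb.-integrable setT (EFin \o (fun x => u x `^ p * phi x)) /\
  Q k A u phi = lam * \int[leb]_x (u x `^ p * phi x).
Proof.
have ex n : exists w, [/\ cone w, inH k w, forall x, w x <= n%:R / A &
    forall phi, inH k phi -> Q k A w phi = \int[leb]_x (trunc_source n x * phi x)].
  have [F FE] := trunc_source_int n.
  by apply: (linear_solve_cone (trunc_source_cone n) _ FE) => x; have [] := trunc_source_bound n x.
have [w_ wP] := choice ex.
pose a n := \int[leb]_x (trunc_source n x * u x).
have l0 := Qu_gt0; rewrite -/lam in l0.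
have A0 := ltW A_gt0.
have hz n : inH k (fun x => lam * w_ n x - u x).
  by have [_ hw _ _] := wP n; apply: inHB => //; exact: inHZ.
have Qz n psi : inH k psi -> Q k A (fun x => lam * w_ n x - u x) psi =
    lam * \int[leb]_x (trunc_source n x * psi x) - Q k A u psi.
  move=> hp; have [_ hw _ wE] := wP n; have hlw : inH k (fun x => lam * w_ n x) by exact: inHZ.
  by rewrite QBl // QZl // wE.
have Qzz n : Q k A (fun x => lam * w_ n x - u x) (fun x => lam * w_ n x - u x) <= 2 * lam * (1 - a n).
  have [cw hw wB wE] := wP n; have hlw : inH k (fun x => lam * w_ n x) by exact: inHZ.
  have en := solution_energy cw hw wB (wE _ hw).
  rewrite QBl // (QC k A _ (fun x => _ - _)) QBl // (QC k A u (fun x => _ - _)) QBl //.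
  rewrite QZl // (QC k A _ (fun x => lam * w_ n x)) QZl // QZl // (QC k A u (fun x => _ * _)) QZl //.
  rewrite -/lam (wE _ hu) -/(a n).
  have : lam * (lam * Q k A (w_ n) (w_ n)) <= lam * (lam * lam^-1).
    by rewrite ler_pM2l // ler_pM2l.
  rewrite divff ?gt_eqF // mulr1; lra.
have cvz psi : inH k psi -> (fun n => lam * \int[leb]_x (trunc_source n x * psi x)) @ \oo --> Q k A u psi.
  move=> hp.
  have c0 : (fun n => Num.sqrt (2 * lam * (1 - a n) * Q k A psi psi)) @ \oo --> (0 : R).
    have -> : (0 : R) = Num.sqrt (2 * lam * (1 - 1) * Q k A psi psi) by rewrite subrr mulr0 mul0r sqrtr0.
    apply: (@cvg_comp _ _ _ (fun n => 2 * lam * (1 - a n) * Q k A psi psi) (@Num.sqrt R) _ _ _ _ (@sqrt_continuous R _)).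
    apply: cvgM; last exact: cvg_cst.
    apply: cvgM; first exact: cvg_cst.
    by apply: cvgB; [exact: cvg_cst|exact: source_pairing_cvg].
  apply/cvgrPdist_le => e e0; near=> n.
  have : Num.sqrt (2 * lam * (1 - a n) * Q k A psi psi) <= e.
    by near: n; exact: (cvgr_le _ c0).
  apply: le_trans; rewrite distrC -Qz // -sqrtr_sqr ler_wsqrtr //.
  apply: le_trans (Q_CS A0 (hz n) hp) _.
  by rewrite ler_wpM2r // Q_ge0.
have mg n := measurable_cone (trunc_source_cone n).
move=> hp; have mp := inH_meas hp.
have hap : inH k (fun x => `|phi x|).
  apply: (inH_contraction mk _ hp); first exact: measurableT_comp.
    by move=> x; rewrite normr_id.
  by move=> x y; exact: ler_dist_dist.
have mup : measurable_fun [set: R] (fun x => u x `^ p) by exact: measurable_powRl.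
have mgp n : measurable_fun [set: R] (fun x => trunc_source n x * phi x) by exact: measurable_funM.
have mgap n : measurable_fun [set: R] (fun x => trunc_source n x * `|phi x|).
  by apply: measurable_funM => //; exact: measurableT_comp.
have hgn n : Ltwo leb (trunc_source n).
  have [F FE] := trunc_source_int n.
  apply: (@Ltwo_bounded R _ n%:R F%:E) => //; last by rewrite ltry.
  + by move=> x; have [-> ->] := trunc_source_bound n x.
  + by rewrite FE.
have iap : leb.-integrable setT (EFin \o (fun x => u x `^ p * `|phi x|)).
  have [C CP] : exists C, forall n, lam * \int[leb]_x (trunc_source n x * `|phi x|) <= C.
    have := cvg_seq_bounded (cvgP _ (cvz _ hap)).
    case=> C [_ /(_ (C + 1))]; rewrite ltrDl ltr01 => /(_ isT) h.
    by exists (C + 1) => n; apply: le_trans (h n I); exact: ler_norm.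
  apply/integrableP; split.
    by apply/measurable_EFinP; apply: measurable_funM => //; exact: measurableT_comp.
  under eq_integral do rewrite /= ger0_norm ?mulr_ge0 ?powR_ge0 //.
  apply: (@le_lt_trans _ _ (C / lam)%:E); last exact: ltry.
  apply: (fatou_cvg (mu := leb) (f_ := fun n x => trunc_source n x * `|phi x|)) => //.
  - by move=> n x; have [g0 _ _] := trunc_source_bound n x; rewrite mulr_ge0.
  - by move=> x; apply: cvgM; [exact: trunc_source_cvg|exact: cvg_cst].
  - move=> n; have := CP n; rewrite mulrC -ler_pdivlMr // -lee_fin; apply: le_trans.
    rewrite /Rintegral fineK //.
    by apply: integrable_fin_num => //; apply: Ltwo_mul => //; have [] := hap.
have mupp : measurable_fun [set: R] (fun x => u x `^ p * phi x) by exact: measurable_funM.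
have ip_ : leb.-integrable setT (EFin \o (fun x => u x `^ p * phi x)).
  apply: (le_integrable _ _ _ iap) => //; first exact/measurable_EFinP.
  by move=> x _; rewrite /= lee_fin !normrM normr_id.
split => //.
have c1 := cvz _ hp.
have c2 : (fun n => lam * \int[leb]_x (trunc_source n x * phi x)) @ \oo --> lam * \int[leb]_x (u x `^ p * phi x).
  apply: cvgM; first exact: cvg_cst.
  apply: (dct (mu := leb) mgp mupp _ iap).
  - by move=> x; apply: cvgM; [exact: trunc_source_cvg|exact: cvg_cst].
  - move=> n x; have [g0 _ gu] := trunc_source_bound n x.
    by rewrite normrM (ger0_norm g0) ler_wpM2r.
exact: (cvg_unique _ c1 c2).
Unshelve. all: end_near.
Qed.

End euler_lagrange.

(** * Boundedness *)

Section rescale.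
Context {R : realType}.
Local Notation leb := (@lebesgue_measure R).
Variables (k : R -> R) (A p : R).
Hypothesis mk : measurable_fun [set: R] k.

Lemma rescale_solution (u : R -> R) (lam : R) : cone u -> inH k u -> 1 < p -> 0 < lam ->
  (forall phi, inH k phi ->
    leb.-integrable setT (EFin \o (fun x => u x `^ p * phi x)) /\
    Q k A u phi = lam * \int[leb]_x (u x `^ p * phi x)) ->
  exists2 c, 0 < c & let v := fun x => c * u x in [/\ cone v, inH k v &
    forall phi, inH k phi ->
      leb.-integrable setT (EFin \o (fun x => v x `^ p * phi x)) /\
      Q k A v phi = \int[leb]_x (v x `^ p * phi x)].
Proof.
move=> cu hu p1 l0 eu; have [u0 ue um] := cu.
have p10 : p - 1 != 0 by rewrite subr_eq0 gt_eqF.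
pose c := lam `^ (p - 1)^-1.
have c0 : 0 < c by exact: powR_gt0.
have cp : c `^ p = c * lam.
  rewrite /c -powRrM -[in RHS](powRr1 (ltW l0)) -powRrM -powRD; last by rewrite (gt_eqF l0) implybT.
  by congr (_ `^ _); field.
have e x : (c * u x) `^ p = c * lam * u x `^ p by rewrite powRM ?(ltW c0) // cp.
exists c => //; split.
- by split => [x|x|x y x0 xy]; rewrite ?ue ?mulr_ge0 ?(ltW c0) // ler_pM2l // um.
- exact: inHZ.
- move=> phi hp; have [i1 e1] := eu _ hp.
  have E x : c * lam * (u x `^ p * phi x) = (c * u x) `^ p * phi x by rewrite e mulrA.
  split.
    by have := integrableZl measurableT (c * lam) i1; apply: eq_integrable => // x _; rewrite /= -EFinM E.
  rewrite QZl // e1 mulrA -RintegralZl //; apply: eq_Rintegral => x _; exact: E.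
Qed.

End rescale.

Lemma powR_le1 (R : realType) (x a : R) : 0 <= a -> 0 <= x -> x <= 1 -> x `^ a <= 1.
Proof. by move=> a0 x0 x1; have := powR_nondecr a0 x0 x1; rewrite powR1. Qed.

Lemma powR_ge1 (R : realType) (x a : R) : a <= 0 -> 0 < x -> x <= 1 -> 1 <= x `^ a.
Proof. by move=> a0 x0 x1; have := powR_nonincr a0 x0 x1; rewrite powR1. Qed.

Section clamp.
Context {R : realType}.
Implicit Types d x y : R.

Definition clamp d y : R := if y <= 0 then 0 else if y <= d then y else d.

Lemma clamp_bounds d y : 0 <= d -> 0 <= clamp d y <= d.
Proof. by move=> d0; rewrite /clamp; case: (leP y 0) => h1; [|case: (leP y d) => h2]; apply/andP; split; lra. Qed.

Lemma clamp_le_norm d y : 0 <= d -> clamp d y <= `|y|.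
Proof.
move=> d0; rewrite /clamp; case: (leP y 0) => h1; first exact: normr_ge0.
by rewrite gtr0_norm //; case: (leP y d) => h2; lra.
Qed.

Lemma clamp_nondecr d x y : 0 <= d -> x <= y -> clamp d x <= clamp d y.
Proof.
by move=> d0 xy; rewrite /clamp; case: (leP x 0) => h1; case: (leP y 0) => h2;
  case: (leP x d) => h3; case: (leP y d) => h4; lra.
Qed.

Lemma clamp_sub d x y : 0 <= d -> x <= y -> clamp d y - clamp d x <= y - x.
Proof.
by move=> d0 xy; rewrite /clamp; case: (leP x 0) => h1; case: (leP y 0) => h2;
  case: (leP x d) => h3; case: (leP y d) => h4; lra.
Qed.

Lemma clamp_lipschitz d x y : 0 <= d -> `|clamp d x - clamp d y| <= `|x - y|.
Proof.
move=> d0; wlog xy : x y / x <= y.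
  by move=> H; have [xy|/ltW yx] := leP x y; [|rewrite distrC [leRHS]distrC]; exact: H.
rewrite distrC [leRHS]distrC !ger0_norm ?subr_ge0 ?clamp_nondecr //; exact: clamp_sub.
Qed.

Lemma clamp_monotone d x y : 0 <= d ->
  (clamp d x - clamp d y) ^+ 2 <= (x - y) * (clamp d x - clamp d y).
Proof.
move=> d0; wlog xy : x y / x <= y.
  move=> H; have [xy|/ltW yx] := leP x y; first exact: H.
  by have := H y x yx; rewrite !expr2; lra.
have h1 := clamp_nondecr d0 xy; have h2 := clamp_sub d0 xy.
by rewrite expr2; nra.
Qed.

Lemma measurable_clamp d : measurable_fun [set: R] (clamp d).
Proof.
rewrite /clamp; apply: measurable_fun_ifT => //; first exact: measurable_fun_ler.
by apply: measurable_fun_ifT => //; exact: measurable_fun_ler.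
Qed.

End clamp.

Section bounded_solution.
Context {R : realType}.
Local Notation leb := (@lebesgue_measure R).
Local Notation leb2 := ((@lebesgue_measure R) \x (@lebesgue_measure R))%E.
Variables (k : R -> R) (A p sg c0 : R).
Hypothesis ck : cone k.
Hypothesis A_gt0 : 0 < A.
Hypothesis p_gt1 : 1 < p.
Hypothesis sg_lt : sg < 2^-1.
Hypothesis p_sub : (p + 1) * (2^-1 - sg) < 1.
Hypothesis sg_gt0 : 0 < sg.
Hypothesis c0_gt0 : 0 < c0.
Hypothesis k_low : forall t, 0 < t -> t <= 1 -> c0 * t `^ (- (1 + 2 * sg)) <= k t.
Variable u : R -> R.
Hypothesis cu : cone u.
Hypothesis hu : inH k u.
Hypothesis eu : forall phi, inH k phi ->
    leb.-integrable setT (EFin \o (fun x => u x `^ p * phi x)) /\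
    Q k A u phi = \int[leb]_x (u x `^ p * phi x).

Let mk : measurable_fun [set: R] k := measurable_cone ck.
Let k0 t : 0 <= k t. Proof. by have [] := ck. Qed.
Let k_even t : k (- t) = k t. Proof. by have [] := ck. Qed.
Let u0 x : 0 <= u x. Proof. by have [] := cu. Qed.
Let um x y : 0 < x -> x <= y -> u y <= u x. Proof. by have [_ _] := cu; exact. Qed.
Let ue x : u (- x) = u x. Proof. by have [] := cu. Qed.
Let mu_ : measurable_fun [set: R] u := measurable_cone cu.
Let p0 : 0 < p. Proof. by have := p_gt1; lra. Qed.

Definition cut (r x : R) : R := clamp (u r - u (2 * r)) (u x - u (2 * r)).

Lemma cut_props r : 0 < r -> [/\ cone (cut r), inH k (cut r),
  cut r r - cut r (2 * r) = u r - u (2 * r),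
  forall x, 0 <= cut r x <= u r - u (2 * r) &
  forall x, 2 * r <= `|x| -> cut r x = 0].
Proof.
move=> r0; have r20 : 0 < 2 * r by rewrite mulr_gt0.
have d0 : 0 <= u r - u (2 * r) by rewrite subr_ge0 um //; lra.
have cd x : 0 <= cut r x <= u r - u (2 * r) by exact: clamp_bounds.
have mc : measurable_fun [set: R] (cut r).
  by apply: (measurableT_comp (measurable_clamp _)); exact: measurable_funB.
split => //.
- split => [x|x|x y x0 xy]; rewrite /cut ?ue //; first by have /andP[] := cd x.
  by apply: clamp_nondecr => //; rewrite lerD2r um.
- apply: (inH_contraction mk mc hu) => [x|x y]; last first.
    by apply: le_trans (clamp_lipschitz _ _ d0) _; rewrite opprB addrA subrK.
  have [ux|ux] := leP (u x) (u (2 * r)).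
    by rewrite /cut /clamp subr_le0 ux normr0.
  have /andP[g0 _] := cd x; rewrite (ger0_norm g0).
  apply: le_trans (clamp_le_norm _ d0) _; rewrite !ger0_norm ?subr_ge0 ?(ltW ux) //.
  by rewrite gerBl.
- rewrite /cut subrr /clamp !lexx subr0; case: (leP (u r - u (2 * r)) 0) => // h.
  by apply/eqP; rewrite eq_le d0 h.
- move=> x x2; have h : u `|x| <= u (2 * r) by exact: um.
  by rewrite cone_norm // in h; rewrite /cut /clamp subr_le0 h.
Qed.

Lemma source_near0 (r D b : R) : 0 < r -> b * p < 1 ->
  (forall x, 0 < x -> x <= 2 * r -> u x <= D * x `^ (- b)) -> 0 <= D ->
  \int[leb]_x (u x `^ p * cut r x) <=
  2 * (u r - u (2 * r)) * (D `^ p * ((2 * r) `^ (1 - b * p) / (1 - b * p))).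
Proof.
move=> r0 bp uD D0; have [cc hc _ cd cz] := cut_props r0.
have r20 : 0 < 2 * r by rewrite mulr_gt0.
have d0 : 0 <= u r - u (2 * r) by rewrite subr_ge0 um //; lra.
have [i1 _] := eu hc.
have mc := measurable_cone cc.
have mup : measurable_fun [set: R] (fun x => u x `^ p) by exact: measurable_powRl.
have mE : measurable_fun [set: R] (fun x => (u x `^ p * cut r x)%:E).
  by apply/measurable_EFinP; exact: measurable_funM.
have pos x : (0 <= (u x `^ p * cut r x)%:E)%E.
  by rewrite lee_fin mulr_ge0 ?powR_ge0 //; have /andP[] := cd x.
rewrite -lee_fin /Rintegral fineK; last exact: integrable_fin_num i1.
rewrite (ge0_integral_even mE pos); last by move=> x; rewrite ue; have [_ -> _] := cc.
rewrite -mulrA EFinM; apply: lee_wpmul2l => //.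
pose I : set R := [set` `]0%R, 2 * r]].
have mI : measurable I by exact: measurable_itv.
have mpw : measurable_fun [set: R] (fun x : R => (x `^ (- (b * p)))%:E).
  by apply/measurable_EFinP; exact: measurable_powRl.
apply: (@le_trans _ _ (\int[leb]_(x in I) (((u r - u (2 * r)) * D `^ p)%:E * (x `^ (- (b * p)))%:E))%E).
  rewrite integral_mkcond [leRHS]integral_mkcond; apply: ge0_le_integral => //.
  - by move=> x _; rewrite /patch; case: ifP.
  - apply/(measurable_restrictT _ _).1 => //; exact: measurable_funTS.
  - apply/(measurable_restrictT _ _).1 => //; apply: measurable_funTS; exact: emeasurable_funM.
  - move=> x _; rewrite /patch mem_setE in_itv /= andbT mem_setE /I in_itv /=.
    case: ltP => //= x0.
    have [x2|x2] := leP x (2 * r); last first.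
      by rewrite cz ?mulr0 // gtr0_norm // ltW.
    rewrite -EFinM lee_fin -mulrA mulrC; apply: ler_pM => //; rewrite ?powR_ge0 //.
    + by have /andP[] := cd x.
    + by have /andP[] := cd x.
    + rewrite -mulNr powRrM -powRM ?powR_ge0 //.
      by apply: powR_nondecr; [exact: ltW|exact: u0|exact: uD].
rewrite ge0_integralZl //; last 3 first.
- exact: measurable_funTS.
- by move=> x _; rewrite lee_fin powR_ge0.
- by rewrite lee_fin mulr_ge0 ?powR_ge0.
have -> : (u r - u (2 * r)) * (D `^ p * ((2 * r) `^ (1 - b * p) / (1 - b * p))) =
    (u r - u (2 * r)) * D `^ p * ((2 * r) `^ (1 - b * p) / (1 - b * p)) by ring.
rewrite [leRHS]EFinM; apply: lee_wpmul2l; first by rewrite lee_fin mulr_ge0 ?powR_ge0.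
exact: integral_powR0.
Qed.

Lemma test_jump (D b : R) : 0 <= b -> b * p < 1 -> 0 <= D ->
  (forall x, 0 < x -> x <= 1 -> u x <= D * x `^ (- b)) ->
  exists2 C, 0 <= C & forall r, 0 < r -> r <= 3^-1 ->
    u r <= u (2 * r) + C * r `^ (2 * sg - b * p).
Proof.
move=> b0 bp D0 uD.
pose C := 4 / c0 * 3 `^ (1 + 2 * sg) * (D `^ p * (2 `^ (1 - b * p) / (1 - b * p))).
have bp' : 0 < 1 - b * p by rewrite subr_gt0.
have C0 : 0 <= C.
  rewrite !mulr_ge0 ?powR_ge0 ?invr_ge0 ?(ltW c0_gt0) // ltW //.
exists C => // r r0 r3.
have [cc hc cj cd cz] := cut_props r0.
have r31 : 3 * r <= 1 by rewrite mulrC -ler_pdivlMr // mul1r.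
have r30 : 0 < 3 * r by rewrite mulr_gt0.
have d0 : 0 <= u r - u (2 * r) by rewrite subr_ge0 um //; lra.
rewrite -lerBlDl.
have [d00|d00] := eqVneq (u r - u (2 * r)) 0; first by rewrite d00 mulr_ge0 // powR_ge0.
have dp : 0 < u r - u (2 * r) by rewrite lt0r d00.
pose m := c0 * (3 * r) `^ (- (1 + 2 * sg)).
have m0 : 0 < m by rewrite mulr_gt0 // powR_gt0.
have hm t : 0 < t -> t <= 3 * r -> m <= k t.
  move=> t0 t3; apply: le_trans (k_low t0 (le_trans t3 r31)).
  rewrite /m ler_pM2l //; apply: powR_nonincr => //.
  by rewrite oppr_le0 addr_ge0 // mulr_ge0 // ltW.
have := cone_energy mk k0 k_even cc r0 (ltW m0) hm.
rewrite -(ipE hc.2) lee_fin cj => h.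
have h2 : 2^-1 * ip leb2 (dl k (cut r)) (dl k (cut r)) <= Q k A u (cut r).
  have h3 : 0 <= A * ip leb u (cut r).
    apply: mulr_ge0; first exact: ltW.
    by apply: Rintegral_ge0 => x _; rewrite mulr_ge0 //; have /andP[] := cd x.
  rewrite /Q -[leLHS]addr0; apply: lerD => //; rewrite ler_pM2l ?invr_gt0 //.
  apply: le_Rintegral => //.
  - exact: Ltwo_mul hc.2 hc.2.
  - exact: Ltwo_mul hu.2 hc.2.
  - by move=> z _; rewrite !dl_mul // ler_wpM2r // -expr2; have := clamp_monotone (u z.1 - u (2 * r)) (u z.2 - u (2 * r)) d0; rewrite opprB addrA subrK; exact.
have [_ e] := eu hc; rewrite e in h2.
have h4 : \int[leb]_x (u x `^ p * cut r x) <=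
  2 * (u r - u (2 * r)) * (D `^ p * ((2 * r) `^ (1 - b * p) / (1 - b * p))).
  by apply: source_near0 => // x x0 x2; apply: uD => //; lra.
set d := u r - u (2 * r) in dp h h2 h4 *.
have h5 : m * r ^+ 2 * d <= 4 * (D `^ p * ((2 * r) `^ (1 - b * p) / (1 - b * p))).
  rewrite -(ler_pM2r dp).
  have -> : m * r ^+ 2 * d * d = m * r ^+ 2 * d ^+ 2 by ring.
  apply: le_trans h _; rewrite -(@ler_pM2l _ 2^-1) ?invr_gt0 //.
  apply: le_trans h2 _; apply: le_trans h4 _; lra.
have mr : 0 < m * r ^+ 2 by rewrite mulr_gt0 // exprn_gt0.
rewrite -(ler_pM2l mr); apply: (le_trans h5).
rewrite le_eqVlt; apply/orP; left; apply/eqP.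
have n2 : r `^ (2 * sg) != 0 by rewrite gt_eqF // powR_gt0.
have n2' : r `^ (b * p) != 0 by rewrite gt_eqF // powR_gt0.
have n1 : 3 `^ (1 + 2 * sg) != 0 :> R by rewrite gt_eqF // powR_gt0.
have n1' : 2 `^ (b * p) != 0 :> R by rewrite gt_eqF // powR_gt0.
have n4 : c0 != 0 by rewrite gt_eqF.
have n3 : r != 0 by rewrite gt_eqF.
have n5 : 1 - b * p != 0 by rewrite gt_eqF.
have rD (x y : R) : r `^ (x + y) = r `^ x * r `^ y by rewrite powRD // n3 implybT.
have rN (x : R) : r `^ (- x) = (r `^ x)^-1 by rewrite powRN.
rewrite /C /m !powRM ?(ltW r0) // !powRN !rD rN powRr1 ?(ltW r0) //.
by field; rewrite n1 n2 n2' n3 n4 n5.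
Qed.

Lemma improve_decay (D b b' : R) : 0 <= b -> b * p < 1 -> 0 <= D ->
  (forall x, 0 < x -> x <= 1 -> u x <= D * x `^ (- b)) ->
  b * p - 2 * sg <= b' -> b' != 0 ->
  exists D' M', forall x, 0 < x -> x <= 3^-1 -> u x <= D' * x `^ (- b') + M'.
Proof.
move=> b0 bp D0 uD bb b'0; have [C C0 HC] := test_jump b0 bp D0 uD.
have r00 : 0 < 3^-1 :> R by rewrite invr_gt0.
have [D' [M' H]] := dyadic_bound C (u 3^-1) r00 b'0.
exists D', M'; apply: H => [r rp r3|r r3]; last by apply: um => //; exact: ltW.
apply: le_trans (HC r rp r3) _; rewrite lerD2l ler_wpM2l //.
have -> : r `^ (2 * sg - b * p) = r `^ (- b') * r `^ (b' - (b * p - 2 * sg)).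
  rewrite -powRD; last by rewrite (gt_eqF rp) implybT.
  by congr (_ `^ _); ring.
rewrite -[leRHS]mulr1 ler_wpM2l ?powR_ge0 //.
apply: powR_le1; rewrite ?subr_ge0 ?(ltW rp) //.
by apply: le_trans r3 _; rewrite invf_le1 // ler1n.
Qed.

(* The exponents [a - i d], [0 <= i <= n], with [a = (n + 1/2) d] avoid [0]. *)
Lemma bounded_solution : exists B, forall x, x != 0 -> u x <= B.
Proof.
have A0 := ltW A_gt0.
pose a := 2^-1 - sg.
have a0 : 0 < a by rewrite /a subr_gt0.
have [D0 D00 HD0] := cone_bound mk k0 k_even A_gt0 sg_lt sg_gt0 c0_gt0 k_low (Q k A u u).
pose P b := exists2 D, 0 <= D & forall x, 0 < x -> x <= 1 -> u x <= D * x `^ (- b).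
have P0 : P a.
  exists D0 => // x x0 x1; have := HD0 u cu hu (lexx _) x (lt0r_neq0 x0).
  by rewrite /pw gtr0_norm // x1.
pose dd := 2 * sg - (p - 1) * a.
have dd0 : 0 < dd by have := p_sub; rewrite /dd /a; lra.
pose n := Num.trunc (a / dd).
have n0 : 0 < n%:R + 2^-1 :> R by rewrite ltr_wpDl.
pose d := a / (n.+1%:R + 2^-1).
have n10 : 0 < n.+1%:R + 2^-1 :> R by rewrite ltr_wpDl.
have d0 : 0 < d by rewrite divr_gt0.
have ddd : d <= dd.
  rewrite ler_pdivrMr // mulrC -ler_pdivrMr //.
  by apply: le_trans (ltW (truncnS_gt _)) _; rewrite lerDl.
have step b : 0 < b -> b <= a -> [/\ 0 <= b, b * p < 1 & b * p - 2 * sg <= b - d].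
  move=> b0 ba; split; first exact: ltW.
    apply: le_lt_trans (_ : a * p < 1); first by rewrite ler_wpM2r // ltW.
    by have := p_sub; rewrite -/a => ?; have := a0; lra.
  have : b * (p - 1) <= a * (p - 1) by rewrite ler_wpM2r // subr_ge0 ltW.
  by move: ddd; rewrite /dd; lra.
have t0 : 0 < 3^-1 :> R by rewrite invr_gt0.
have one_le (x b : R) : 0 < x -> x <= 1 -> 0 <= b -> 1 <= x `^ (- b).
  by move=> x0 x1 b0; apply: powR_ge1 => //; rewrite oppr_le0.
have aE : a = (n.+1%:R + 2^-1) * d by rewrite /d mulrC divfK // gt_eqF.
have down i : (i <= n.+1)%N -> P (a - i%:R * d).
  elim: i => [_|i IH iN]; first by rewrite mul0r subr0.
  have iR : i%:R + 1 <= n.+1%:R :> R by rewrite natr1 ler_nat.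
  have [D Dp HD] := IH (ltnW iN).
  have b0 : 0 < a - i%:R * d by rewrite aE -mulrBl mulr_gt0 //; lra.
  have b0' : 0 < a - i.+1%:R * d by rewrite aE -mulrBl mulr_gt0 // -natr1; lra.
  have ba : a - i%:R * d <= a by rewrite gerBl mulr_ge0 // ltW.
  have [h1 h2 h3] := step _ b0 ba.
  have h3' : (a - i%:R * d) * p - 2 * sg <= a - i.+1%:R * d.
    by apply: le_trans h3 _; rewrite -natr1 mulrDl mul1r; lra.
  have [D' [M' H]] := improve_decay h1 h2 Dp HD h3' (lt0r_neq0 b0').
  exists (`|D'| + `|M'| + u 3^-1) => [|x x0 x1]; first by rewrite !addr_ge0.
  have x1' := one_le _ _ x0 x1 (ltW b0').
  have [x3|x3] := leP x 3^-1.
    apply: le_trans (H x x0 x3) _.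
    have := ler_norm D'; have := ler_norm M'; have := normr_ge0 M'; have := u0 3^-1.
    by have := normr_ge0 D'; nra.
  apply: le_trans (um t0 (ltW x3)) _.
  have := normr_ge0 M'; have := u0 3^-1; have := normr_ge0 D'; nra.
have [D Dp HD] := down n.+1 (leqnn _).
have bE : a - n.+1%:R * d = d / 2 by rewrite aE; ring.
rewrite bE in HD.
have b0 : 0 < d / 2 by rewrite divr_gt0.
have ba : d / 2 <= a by rewrite -bE gerBl mulr_ge0 // ltW.
have [h1 h2 h3] := step _ b0 ba.
have nb : d / 2 - d != 0 by rewrite lt_eqF //; lra.
have [D' [M' H]] := improve_decay h1 h2 Dp HD h3 nb.
exists (`|D'| + `|M'| + u 3^-1) => x x0.
rewrite -(cone_norm x cu); have xp : 0 < `|x| by rewrite normr_gt0.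
have [x3|x3] := leP `|x| 3^-1; last first.
  by apply: le_trans (um t0 (ltW x3)) _; rewrite lerDr addr_ge0.
apply: le_trans (H _ xp x3) _.
have y1 : `|x| `^ (- (d / 2 - d)) <= 1.
  apply: powR_le1 => //; first by lra.
  by apply: le_trans x3 _; rewrite invf_le1 // ler1n.
have y0 := powR_ge0 `|x| (- (d / 2 - d)).
have := ler_norm D'; have := ler_norm M'; have := normr_ge0 M'; have := u0 3^-1.
by have := normr_ge0 D'; nra.
Qed.

End bounded_solution.

(** * Regularity *)

Section L2norm.
Context d (T : measurableType d) (R : realType) (mu : {measure set T -> \bar R}).
Implicit Types f g : T -> R.

Definition nm f : R := Num.sqrt (ip mu f f).

Lemma nm_ge0 f : 0 <= nm f. Proof. exact: sqrtr_ge0. Qed.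

Lemma nm_sqr f : nm f ^+ 2 = ip mu f f.
Proof. by rewrite sqr_sqrtr // ip_ge0. Qed.

Lemma ip_CS f g : Ltwo mu f -> Ltwo mu g -> ip mu f g ^+ 2 <= ip mu f f * ip mu g g.
Proof.
move=> hf hg; apply: quadratic_discr; first exact: ip_ge0.
move=> t; have htg := LtwoZ t hg; have hs := LtwoD hf htg.
have := ip_ge0 mu (fun x => f x + t * g x).
rewrite ipDl // ipZl // (ipC _ f) (ipC _ g) !ipDl // !ipZl // (ipC _ g f).
by rewrite expr2; lra.
Qed.

Lemma ip_le_nm f g : Ltwo mu f -> Ltwo mu g -> `|ip mu f g| <= nm f * nm g.
Proof.
move=> hf hg; rewrite -(@ler_pXn2r _ 2) ?nnegrE ?mulr_ge0 ?nm_ge0 //.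
by rewrite real_normK ?num_real // exprMn !nm_sqr; exact: ip_CS.
Qed.

Lemma nmD f g : Ltwo mu f -> Ltwo mu g -> nm (fun x => f x + g x) <= nm f + nm g.
Proof.
move=> hf hg; rewrite -(@ler_pXn2r _ 2) ?nnegrE ?addr_ge0 ?nm_ge0 //.
have hs := LtwoD hf hg.
rewrite sqrrD !nm_sqr ipDl // (ipC _ f) (ipC _ g) !ipDl // (ipC _ g f).
have := ip_le_nm hf hg; have := ler_norm (ip mu f g); lra.
Qed.

Lemma nmZ a f : Ltwo mu f -> nm (fun x => a * f x) = `|a| * nm f.
Proof.
move=> hf; have hz := LtwoZ a hf.
by rewrite /nm ipZl // (ipC _ f) ipZl // mulrA -expr2 sqrtrM ?sqr_ge0 // sqrtr_sqr.
Qed.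

Lemma nmB f g : Ltwo mu f -> Ltwo mu g -> nm (fun x => f x - g x) <= nm f + nm g.
Proof.
move=> hf hg; have := nmD hf (LtwoZ (-1) hg); rewrite nmZ // normrN1 mul1r.
by under eq_fun do rewrite mulN1r.
Qed.

Lemma nm_le f g : measurable_fun [set: T] f -> Ltwo mu g ->
  (forall x, `|f x| <= `|g x|) -> nm f <= nm g.
Proof.
move=> mf hg fg; have hf := Ltwo_le mf hg fg.
apply: ler_wsqrtr; apply: le_Rintegral => //; [exact: Ltwo_mul|exact: Ltwo_mul|].
move=> x _; rewrite -!expr2 -(real_normK (num_real (f x))) -(real_normK (num_real (g x))).
by rewrite ler_pXn2r ?nnegrE.
Qed.

End L2norm.

Section increments.
Context {R : realType}.
Local Notation leb := (@lebesgue_measure R).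
Implicit Types w : R -> R.

Definition incr h w (x : R) : R := w (x + h) - w x.

Lemma incr_comm l h w : incr l (incr h w) = incr h (incr l w).
Proof. by apply/funext => x; rewrite /incr -!addrA [h + l]addrC; ring. Qed.

Lemma incr_double h w : incr (2 * h) w = fun x => 2 * incr h w x + incr h (incr h w) x.
Proof.
apply/funext => x; rewrite /incr.
have -> : x + 2 * h = x + h + h by ring.
ring.
Qed.

Lemma Ltwo_incr h w : Ltwo leb w -> Ltwo leb (incr h w).
Proof. by move=> hw; apply: LtwoB => //; exact: Ltwo_shift. Qed.

Lemma nm_incr_le h w : Ltwo leb w -> nm leb (incr h w) <= 2 * nm leb w.
Proof.
move=> hw; have mw : measurable_fun [set: R] w := hw.1; have := nmB (Ltwo_shift h hw) hw.
have -> : nm leb (fun x => w (x + h)) = nm leb w by rewrite /nm (ip_shift h mw mw).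
by rewrite (_ : 2 * nm leb w = nm leb w + nm leb w) //; ring.
Qed.

(* Compare dyadic averages of [w] on [x, x + 2^-n] for consecutive [n]. *)
Lemma morrey (e : R) : 0 < e -> exists2 C, 0 <= C & forall w (B : R), continuous w ->
  Ltwo leb w -> (forall l, 0 < l -> l <= 1 -> nm leb (incr l w) <= B * l `^ (2^-1 + e)) ->
  forall x, `|w x| <= nm leb w + C * B.
Proof.
move=> e0; pose r : R := 2^-1 `^ e.
have r1 : r < 1.
  have := @gt0_ltr_powR R e e0 2^-1 1; rewrite powR1; apply; rewrite ?nnegrE //.
  by rewrite invf_lt1 // ltr1n.
have r0 : 0 < r by rewrite powR_gt0.
exists (2^-1 * (r / (1 - r))) => [|w B cw hw HB x].
  by rewrite mulr_ge0 // divr_ge0 ?(ltW r0) // subr_ge0 ltW.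
have mw := hw.1.
have hB l : 0 < l -> l <= 1 -> nm leb (incr l w) <= B * l `^ (2^-1 + e) by exact: HB.
have B0 : 0 <= B by have := HB 1 ltr01 (lexx _); rewrite powR1 mulr1; exact/le_trans/nm_ge0.
pose I (a l : R) : R -> R := fun y => \1_([set` `]a, a + l]] : set R) y.
have IE a l y : I a l y = ((a < y <= a + l)%R : nat)%:R.
  by rewrite /I indicE; congr ((nat_of_bool _)%:R); apply/idP/idP; rewrite inE /= in_itv.
have mI a l : measurable_fun [set: R] (I a l).
  by apply: measurable_indic; exact: measurable_itv.
have I01 a l y : I a l y * I a l y = I a l y.
  by rewrite IE; case: (a < y <= a + l); rewrite ?mulr0 ?mulr1.
have Iint a l : 0 <= l -> (\int[leb]_y (I a l y)%:E = l%:E)%E.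
  move=> l0; rewrite integral_indic // setIT.
  apply: etrans (lebesgue_measure_itv _) _; rewrite /= lte_fin.
  have e1 : a + l - a = l by ring.
  case: ltP => h; first by rewrite -EFinB e1.
  by congr (_%:E); lra.
have hI a l : 0 <= l -> Ltwo leb (I a l).
  move=> l0; split; first exact: mI.
  by under eq_integral do rewrite expr2 I01; rewrite Iint // ltry.
have nI a l : 0 <= l -> ip leb (I a l) (I a l) = l.
  move=> l0; rewrite /ip /Rintegral; under eq_integral do rewrite I01.
  by rewrite Iint.
pose av n := 2 ^+ n * ip leb w (I x (2^-1 ^+ n)).
have p2 n : 2 ^+ n * 2^-1 ^+ n = 1 :> R by rewrite -exprMn divff // expr1n.
have l0 n : 0 < 2^-1 ^+ n :> R by rewrite exprn_gt0.
have l1 n : 2^-1 ^+ n <= 1 :> R by rewrite exprn_ile1 // invf_le1 // ler1n.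
have av0 : `|av 0%N| <= nm leb w.
  rewrite /av !expr0 mul1r; apply: le_trans (ip_le_nm hw (hI _ _ ler01)) _.
  by rewrite [X in _ * X]/nm nI // sqrtr1 mulr1.
have avS n : `|av n.+1 - av n| <= 2^-1 * B * r ^+ n.+1.
  set l := 2^-1 ^+ n.+1 : R.
  have E : av n.+1 - av n = - (2 ^+ n * ip leb (incr l w) (I x l)).
    have hl := ltW (l0 n.+1).
    have ln : 2^-1 ^+ n = l + l by rewrite /l exprS; field.
    have -> : av n = 2 ^+ n * (ip leb w (I x l) + ip leb w (I (x + l) l)).
      rewrite /av ln; congr (_ * _).
      rewrite !(ipC leb w) -ipDl //; [|exact: hI|exact: hI].
      congr ip; apply/funext => y; rewrite !IE addrA.
      have lp := l0 n.+1; rewrite -/l in lp.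
      have e2 : (x < y <= x + (l + l)) = (x < y <= x + l) || (x + l < y <= x + l + l).
        apply/idP/orP => [/andP[h1 h2]|[|]/andP[h1 h2]].
        - by case: (leP y (x + l)) => h3; [left; rewrite h1|right; rewrite -addrA h2].
        - by rewrite h1 /=; lra.
        - by rewrite addrA h2 andbT; lra.
      have e3 : (x < y <= x + l) && (x + l < y <= x + l + l) = false.
        by apply/negP => /andP[/andP[_ h1] /andP[h2 _]]; lra.
      rewrite -addrA e2; move: e3; rewrite -addrA.
      by case: (x < y <= x + l); case: (x + l < y <= x + (l + l)); rewrite ?addr0 ?add0r.
    rewrite /incr ipDl; last 3 first.
    - exact: Ltwo_shift.
    - by have := LtwoZ (-1) hw; apply: eq_Ltwo => y; rewrite mulN1r.
    - exact: hI.
    have -> : ip leb (fun y => w (y + l)) (I x l) = ip leb w (I (x + l) l).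
      rewrite -(ip_shift l mw (mI (x + l) l)); congr ip; apply/funext => y; rewrite !IE.
      by rewrite ltrD2r lerD2r.
    have -> : ip leb (fun y => - w y) (I x l) = - ip leb w (I x l).
      rewrite -mulN1r -ipZl //; last exact: hI.
      by congr ip; apply/funext => y; rewrite mulN1r.
    rewrite /av -/l exprS; ring.
  rewrite E normrN normrM ger0_norm ?exprn_ge0 //.
  have hl := l0 n.+1; rewrite -/l in hl.
  have h1 := ip_le_nm (Ltwo_incr l hw) (hI x l (ltW hl)).
  have h2 : nm leb (I x l) = l `^ 2^-1 by rewrite /nm nI ?(ltW hl) // powR12_sqrt // ltW.
  rewrite h2 in h1.
  have h3 := ler_wpM2r (powR_ge0 l 2^-1) (hB l hl (l1 n.+1)).
  have h4 : B * l `^ (2^-1 + e) * l `^ 2^-1 = B * l * l `^ e.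
    have ll : l `^ 2^-1 * l `^ 2^-1 = l.
      by rewrite -powRD ?(gt_eqF hl) ?implybT // (_ : 2^-1 + 2^-1 = 1) ?powRr1 ?(ltW hl) //; field.
    transitivity (B * (l `^ 2^-1 * l `^ 2^-1) * l `^ e); last by rewrite ll.
    by rewrite powRD ?(gt_eqF hl) ?implybT //; ring.
  have h5 : l `^ e = r ^+ n.+1.
    by rewrite /l /r -powR_mulrn // -powRrM mulrC powRrM powR_mulrn ?powR_ge0.
  rewrite h4 h5 in h3.
  apply: le_trans (ler_wpM2l (exprn_ge0 n (ler0n _ 2)) (le_trans h1 h3)) _.
  have -> : 2 ^+ n * (B * l * r ^+ n.+1) = (2 ^+ n.+1 * l) * (2^-1 * B * r ^+ n.+1).
    by rewrite (exprS 2 n); field.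
  by rewrite /l p2 mul1r.
have avB n : `|av n| <= nm leb w + 2^-1 * B * (r / (1 - r) * (1 - r ^+ n)).
  elim: n => [|n IH]; first by rewrite expr0 subrr !mulr0 addr0.
  have -> : av n.+1 = av n + (av n.+1 - av n) by ring.
  apply: le_trans (ler_normD _ _) _; apply: le_trans (lerD IH (avS n)) _.
  rewrite -addrA lerD2l -mulrDr ler_wpM2l ?mulr_ge0 //.
  rewrite le_eqVlt; apply/orP; left; apply/eqP; rewrite exprS; field.
  by rewrite subr_eq0 gt_eqF.
have avC : av @ \oo --> w x.
  apply/cvgrPdist_le => eta eta0.
  have /cvgrPdist_le/(_ _ eta0)/nbhs_ballP[dl /= dl0 H] := cw x.
  have c0 : (fun n => 2^-1 ^+ n : R) @ \oo --> (0 : R).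
    by apply: cvg_expr; rewrite gtr0_norm // invf_lt1 // ltr1n.
  near=> n.
  have ln : 2^-1 ^+ n < dl.
    by near: n; exact: (cvgr_lt _ c0).
  set l := 2^-1 ^+ n : R in ln; have lp : 0 < l by exact: l0.
  have Hy y : x < y <= x + l -> w x - eta <= w y <= w x + eta.
    move=> /andP[h1 h2]; have := H y; rewrite /ball /= ler_norml => h3.
    have /andP[] : - eta <= w x - w y <= eta.
      by apply: h3; rewrite ltr0_norm ?subr_lt0 //; lra.
    by move=> *; apply/andP; split; lra.
  have iI := Ltwo_mul (hI x l (ltW lp)) (hI x l (ltW lp)).
  have iI' : leb.-integrable setT (EFin \o (I x l)).
    by move: iI; apply: eq_integrable => // y _; rewrite /= I01.
  have iw := Ltwo_mul hw (hI x l (ltW lp)).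
  have cst c : \int[leb]_y (c * I x l y) = c * l.
    by rewrite RintegralZl // /Rintegral Iint ?(ltW lp).
  have icst c : leb.-integrable setT (EFin \o (fun y => c * I x l y)).
    by have := integrableZl measurableT c iI'; apply: eq_integrable.
  have up : ip leb w (I x l) <= (w x + eta) * l.
    rewrite -cst; apply: le_Rintegral => // y _; rewrite IE.
    by case: (boolP (x < y <= x + l)) => h; rewrite ?mulr0 // !mulr1; have /andP[] := Hy y h.
  have lo : (w x - eta) * l <= ip leb w (I x l).
    rewrite -cst; apply: le_Rintegral => // y _; rewrite IE.
    by case: (boolP (x < y <= x + l)) => h; rewrite ?mulr0 // !mulr1; have /andP[] := Hy y h.
  have pn : 0 < 2 ^+ n :> R by rewrite exprn_gt0.
  have p2n : 2 ^+ n * l = 1 by exact: p2.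
  have e1 c : c = 2 ^+ n * (c * l) by rewrite mulrCA p2n mulr1.
  have : av n <= w x + eta by rewrite [leRHS]e1 /av ler_pM2l.
  have : w x - eta <= av n by rewrite [leLHS]e1 /av ler_pM2l.
  by move=> *; rewrite ler_norml; apply/andP; split; lra.
have Bn n : `|av n| <= nm leb w + 2^-1 * (r / (1 - r)) * B.
  have rr : r / (1 - r) * (1 - r ^+ n) <= r / (1 - r).
    by rewrite ler_piMr ?divr_ge0 ?(ltW r0) ?subr_ge0 ?(ltW r1) // gerBl exprn_ge0 ?(ltW r0).
  apply: le_trans (avB n) _; rewrite lerD2l [leRHS]mulrAC; apply: ler_wpM2l rr.
  by rewrite mulr_ge0.
have cn : (fun n => `|av n|) @ \oo --> `|w x| by exact: cvg_norm.
by apply: (cvgr_to_le cn); exact: nearW.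
Unshelve. all: end_near.
Qed.

End increments.

Lemma doubling (R : realType) (g : R -> R) (h0 M : R) : 0 < h0 ->
  (forall h, 0 < h -> h <= h0 -> g h <= g (2 * h)) -> (forall h, h0 < h -> g h <= M) ->
  forall h, 0 < h -> g h <= M.
Proof.
move=> h00 gh gM h hp.
have [n hn] : exists n : nat, h0 < 2 ^+ n * h.
  exists (Num.trunc (h0 / h)).+1; rewrite -ltr_pdivrMr //.
  apply: lt_le_trans (truncnS_gt _) _.
  by rewrite -natrX ler_nat ltnW // ltn_expl.
elim: n h hp hn => [|n IH] h hp; first by rewrite expr0 mul1r; exact: gM.
move=> hn; have [hh|hh] := leP h h0; last exact: gM.
apply: le_trans (gh h hp hh) _; apply: IH; first by rewrite mulr_gt0.
by move: hn; rewrite exprSr -mulrA.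
Qed.

Lemma interpolate (R : realType) (X a b t : R) : 0 <= X -> X <= a -> X <= b ->
  0 <= t <= 1 -> X <= a `^ t * b `^ (1 - t).
Proof.
move=> X0 Xa Xb /andP[t0 t1].
have [->|Xn] := eqVneq X 0; first by rewrite mulr_ge0 ?powR_ge0.
have -> : X = X `^ t * X `^ (1 - t).
  by rewrite -powRD ?Xn ?implybT // addrC subrK powRr1.
by apply: ler_pM; rewrite ?powR_ge0 //; apply: powR_nondecr => //; rewrite subr_ge0.
Qed.

Lemma powR_lipschitz (R : realType) (p B a b : R) : 1 < p -> 0 <= a <= B -> 0 <= b <= B ->
  `|a `^ p - b `^ p| <= p * B `^ (p - 1) * `|a - b|.
Proof.
move=> p1; wlog ba : a b / b <= a.
  move=> H ha hb; have [|/ltW] := leP b a => h; first exact: H.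
  by rewrite distrC [X in _ * X]distrC; exact: H.
move=> /andP[a0 aB] /andP[b0 bB].
have p10 : 0 < p - 1 by lra.
have pp : 0 < p by lra.
rewrite !ger0_norm ?subr_ge0 ?powR_nondecr ?(ltW pp) //.
have := young_powR a0 b0 p10; rewrite subrK => h.
have aa : a `^ (p - 1) * a = a `^ p by rewrite mulrC mulr_powRB1.
have h2 : p * (a `^ (p - 1) * b) <= (p - 1) * a `^ p + b `^ p.
  have := ler_wpM2l (ltW pp) h; congr (_ <= _).
  by field; rewrite gt_eqF.
have h3 : a `^ p - b `^ p <= p * a `^ (p - 1) * (a - b).
  by rewrite mulrBr -!mulrA aa; lra.
apply: le_trans h3 _; rewrite ler_wpM2r ?subr_ge0 // ler_pM2l //.
by apply: powR_nondecr => //; exact: ltW.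
Qed.

Section regularity.
Context {R : realType}.
Local Notation leb := (@lebesgue_measure R).
Variables (k : R -> R) (A s c0 : R).
Hypothesis ck : cone k.
Hypothesis A_ge0 : 0 <= A.
Hypothesis s_gt0 : 0 < s.
Hypothesis s_lt1 : s < 1.
Hypothesis c0_gt0 : 0 < c0.
Hypothesis k_low : forall t, 0 < t -> t <= 1 -> c0 * t `^ (- (1 + 2 * s)) <= k t.

Let mk : measurable_fun [set: R] k := measurable_cone ck.
Let k0 t : 0 <= k t. Proof. by have [] := ck. Qed.
Let k_even t : k (- t) = k t. Proof. by have [] := ck. Qed.

Lemma inH_incr h (w : R -> R) : inH k w -> inH k (incr h w).
Proof. by move=> hw; apply: inHB => //; exact: inH_shift. Qed.

Lemma Q_incr_adj h (w phi : R -> R) : inH k w -> inH k phi ->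
  Q k A (incr h w) phi = Q k A w (incr (- h) phi).
Proof.
move=> hw hp; have hws := inH_shift h hw; have hps := inH_shift (- h) hp.
rewrite /incr QBl // [RHS]QC QBl // ![Q k A _ w]QC.
have := Q_shift A h hw hps.
by under [X in Q _ _ _ X]eq_fun do rewrite addrK; move=> ->; rewrite [Q k A w phi]QC.
Qed.

Lemma ip_incr_adj h (f phi : R -> R) : Ltwo leb f -> Ltwo leb phi ->
  ip leb (incr h f) phi = ip leb f (incr (- h) phi).
Proof.
move=> hf hp; have hfs := Ltwo_shift h hf; have hps := Ltwo_shift (- h) hp.
have mf : measurable_fun [set: R] f := hf.1.
have mps : measurable_fun [set: R] (fun x => phi (x - h)) := hps.1.
have B (f1 f2 g : R -> R) : Ltwo leb f1 -> Ltwo leb f2 -> Ltwo leb g ->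
    ip leb (fun x => f1 x - f2 x) g = ip leb f1 g - ip leb f2 g.
  move=> h1 h2 h3; have := ipDl h1 (LtwoZ (-1) h2) h3; rewrite ipZl // mulN1r => <-.
  by congr ip; apply/funext => x; rewrite mulN1r.
rewrite /incr B // [RHS]ipC B // ![ip leb _ f]ipC.
have := ip_shift h mf mps.
by under [X in ip _ _ X]eq_fun do rewrite addrK; move=> ->; rewrite [ip leb f phi]ipC.
Qed.

Lemma nm_incr_energy l (w : R -> R) : inH k w -> 0 < l -> l <= 1 ->
  nm leb (incr l w) ^+ 2 <= 8 / c0 * l `^ (2 * s) * Q k A w w.
Proof.
move=> hw l0 l1.
have m0 : 0 <= c0 * l `^ (- (1 + 2 * s)) by rewrite mulr_ge0 ?powR_ge0 // ltW.
have km t : 0 < t -> t <= l -> c0 * l `^ (- (1 + 2 * s)) <= k t.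
  move=> t0 tl; apply: le_trans (k_low t0 (le_trans tl l1)); rewrite ler_pM2l //.
  by apply: powR_nonincr => //; rewrite oppr_le0 addr_ge0 // mulr_ge0 // ltW.
have := translation_energy mk k0 k_even hw l0 m0 km.
have -> : trans2 w l = (ip leb (incr l w) (incr l w))%:E.
  by rewrite ipE //; exact: Ltwo_incr hw.1.
rewrite -(ipE hw.2) -!EFinM lee_fin nm_sqr => h.
have h2 := energy_le_Q A_ge0 hw.
have ll : l * l `^ (- (1 + 2 * s)) * l `^ (2 * s) = 1.
  rewrite -{1}(powRr1 (ltW l0)) -!powRD ?(gt_eqF l0) ?implybT //.
  by rewrite (_ : 1 + - (1 + 2 * s) + 2 * s = 0) ?powRr0 //; ring.
have lp : 0 < l `^ (2 * s) by rewrite powR_gt0.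
have h3 : c0 * l `^ (- (1 + 2 * s)) * l * ip leb (incr l w) (incr l w) <= 8 * Q k A w w by lra.
have := ler_wpM2r (ltW lp) h3.
have -> : c0 * l `^ (- (1 + 2 * s)) * l * ip leb (incr l w) (incr l w) * l `^ (2 * s) =
   c0 * ip leb (incr l w) (incr l w) * (l * l `^ (- (1 + 2 * s)) * l `^ (2 * s)) by ring.
rewrite ll mulr1 => h4.
rewrite -(ler_pM2l c0_gt0); apply: le_trans h4 _.
by rewrite le_eqVlt; apply/orP; left; apply/eqP; field; rewrite gt_eqF.
Qed.

Variables (u F : R -> R) (L : R).
Hypothesis hu : inH k u.
Hypothesis hF : Ltwo leb F.
Hypothesis L_ge0 : 0 <= L.
Hypothesis lipF : forall x y, `|F x - F y| <= L * `|u x - u y|.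
Hypothesis eu : forall phi, inH k phi -> Q k A u phi = ip leb F phi.

Lemma Q_incr_le h phi : inH k phi ->
  `|Q k A (incr h u) phi| <= L * nm leb (incr h u) * nm leb phi.
Proof.
move=> hp; rewrite Q_incr_adj // eu; last exact: inH_incr.
rewrite -ip_incr_adj //; last exact: hp.1.
have hi := Ltwo_incr h hu.1.
apply: le_trans (ip_le_nm (Ltwo_incr h hF) hp.1) _.
rewrite ler_wpM2r ?nm_ge0 // -[X in X * _](ger0_norm L_ge0) -nmZ //.
apply: nm_le => //; first exact: (Ltwo_incr h hF).1.
  exact: LtwoZ.
by move=> x; rewrite normrM (ger0_norm L_ge0) /incr.
Qed.

Let K1 := Num.sqrt (8 / c0 * L).

Lemma incr2_le l h : 0 < l -> l <= 1 ->
  nm leb (incr l (incr h u)) <= K1 * l `^ s * nm leb (incr h u).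
Proof.
move=> l0 l1; have hh := inH_incr h hu.
rewrite -(@ler_pXn2r _ 2) ?nnegrE ?mulr_ge0 ?nm_ge0 ?sqrtr_ge0 ?powR_ge0 //.
apply: le_trans (nm_incr_energy hh l0 l1) _.
have h1 := le_trans (ler_norm _) (Q_incr_le h hh).
have c8 : 0 <= 8 / c0 by rewrite divr_ge0 // ltW.
have c8L : 0 <= 8 / c0 * L by rewrite mulr_ge0.
rewrite !exprMn sqr_sqrtr // -(powR_mulrn 2 (powR_ge0 _ _)) -powRrM (mulrC s).
have -> : 8 / c0 * L * l `^ (2 * s) * nm leb (incr h u) ^+ 2 =
  8 / c0 * l `^ (2 * s) * (L * nm leb (incr h u) * nm leb (incr h u)) by ring.
by rewrite ler_wpM2l // mulr_ge0 ?powR_ge0.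
Qed.

Let K2 := Num.sqrt (16 / c0 * L * K1).

Lemma incr3_le m l h : 0 < m -> m <= 1 -> 0 < l -> l <= 1 ->
  nm leb (incr m (incr l (incr h u))) <= K2 * m `^ s * l `^ (s / 2) * nm leb (incr h u).
Proof.
move=> m0 m1 l0 l1; have hh := inH_incr h hu; have hl := inH_incr l hh.
have K10 : 0 <= K1 by exact: sqrtr_ge0.
rewrite -(@ler_pXn2r _ 2) ?nnegrE ?mulr_ge0 ?nm_ge0 ?sqrtr_ge0 ?powR_ge0 //.
apply: le_trans (nm_incr_energy hl m0 m1) _.
have h1 : Q k A (incr l (incr h u)) (incr l (incr h u)) <=
    2 * L * K1 * l `^ s * nm leb (incr h u) ^+ 2.
  rewrite Q_incr_adj //.
  have hll := inH_incr (- l) hl.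
  apply: le_trans (le_trans (ler_norm _) (Q_incr_le h hll)) _.
  have h2 := nm_incr_le (- l) hl.1; have h3 := incr2_le h l0 l1.
  have Ln : 0 <= L * nm leb (incr h u) by rewrite mulr_ge0 ?nm_ge0.
  have h4 : nm leb (incr (- l) (incr l (incr h u))) <= 2 * (K1 * l `^ s * nm leb (incr h u)).
    by apply: le_trans h2 _; rewrite ler_pM2l.
  apply: le_trans (ler_wpM2l Ln h4) _.
  by rewrite le_eqVlt; apply/orP; left; apply/eqP; ring.
have c16 : 0 <= 16 / c0 * L * K1 by rewrite !mulr_ge0 ?invr_ge0 // ltW.
rewrite !exprMn sqr_sqrtr // -!(powR_mulrn 2 (powR_ge0 _ _)) -!powRrM (mulrC s 2) divfK //.
have -> : 16 / c0 * L * K1 * m `^ (2 * s) * l `^ s * nm leb (incr h u) ^+ 2 =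
  8 / c0 * m `^ (2 * s) * (2 * L * K1 * l `^ s * nm leb (incr h u) ^+ 2) by ring.
by rewrite ler_wpM2l // !mulr_ge0 ?powR_ge0 ?invr_ge0 // ltW.
Qed.

Lemma incr_decay e : 0 < e -> e < 1 -> exists2 C, 0 <= C & forall h, 0 < h ->
  nm leb (incr h u) <= C * h `^ (1 - e).
Proof.
move=> e0 e1; pose eta : R := 2 - 2 `^ (1 - e).
have eta0 : 0 < eta.
  rewrite subr_gt0 powRB ?pnatr_eq0 ?implybT // powRr1 // ltr_pdivrMr ?powR_gt0 // ltr_pMr //.
  by have := @gt0_ltr_powR R e e0 1 2; rewrite powR1; apply; rewrite ?nnegrE // ltr1n.
have K10 : 0 <= K1 by exact: sqrtr_ge0.
pose h0 := Num.min 1 ((eta / (K1 + 1)) `^ s^-1).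
have K11 : 0 < K1 + 1 by rewrite ltr_wpDl.
have h00 : 0 < h0 by rewrite lt_min ltr01 powR_gt0 // divr_gt0.
pose M := 2 * nm leb u * h0 `^ (- (1 - e)).
have M0 : 0 <= M by rewrite !mulr_ge0 ?powR_ge0 ?nm_ge0.
exists M => // h hp.
suff : nm leb (incr h u) * h `^ (- (1 - e)) <= M.
  have hn : 0 < h `^ (1 - e) by rewrite powR_gt0.
  by rewrite powRN -ler_pdivlMr ?invr_gt0 // invrK.
apply: (@doubling R (fun h => nm leb (incr h u) * h `^ (- (1 - e))) h0 M) => // {h hp} h.
  move=> hp hh0; have h1 : h <= 1 by apply: le_trans hh0 _; rewrite ge_min lexx.
  have hs : K1 * h `^ s <= eta.
    have : h `^ s <= eta / (K1 + 1).
      have -> : eta / (K1 + 1) = (eta / (K1 + 1)) `^ s^-1 `^ s.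
        by rewrite -powRrM mulVf ?gt_eqF // powRr1 // divr_ge0 // ltW.
      apply: powR_nondecr; rewrite ?(ltW s_gt0) ?(ltW hp) //.
      by apply: le_trans hh0 _; rewrite ge_min lexx orbT.
    rewrite ler_pdivlMr // mulrDr mulr1 mulrC; have := powR_ge0 h s; lra.
  have h2 := incr2_le h hp h1.
  have hh := Ltwo_incr h hu.1.
  have h3 : 2 * nm leb (incr h u) <= nm leb (incr (2 * h) u) + nm leb (incr h (incr h u)).
    have -> : 2 * nm leb (incr h u) = nm leb (fun x => 2 * incr h u x).
      by rewrite nmZ // ger0_norm.
    have -> : (fun x => 2 * incr h u x) = (fun x => incr (2 * h) u x - incr h (incr h u) x).
      by apply/funext => x; rewrite incr_double addrK.
    by apply: nmB; [exact: Ltwo_incr hu.1|exact: Ltwo_incr].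
  have h4 : 2 `^ (1 - e) * nm leb (incr h u) <= nm leb (incr (2 * h) u).
    have := ler_wpM2r (nm_ge0 leb (incr h u)) hs; rewrite /eta mulrBl; lra.
  have two : 0 < 2 `^ (1 - e) :> R by rewrite powR_gt0.
  rewrite (powRM _ (ler0n _ 2) (ltW hp)) mulrA ler_wpM2r ?powR_ge0 //.
  by rewrite powRN ler_pdivlMr // mulrC.
move=> hh; apply: ler_pM; rewrite ?nm_ge0 ?powR_ge0 //; first exact: nm_incr_le hu.1.
by apply: powR_nonincr => //; [rewrite oppr_le0 subr_ge0 ltW|exact: ltW].
Qed.

Let e := (1 - s) / 8.
Let gam := 2 * s + (1 - s) / 4.

Lemma incr3_decay : exists2 C, 0 <= C & forall l h, 0 < l -> l <= 1 -> 0 < h -> h <= 1 ->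
  nm leb (incr l (incr h (incr h u))) <= C * l `^ (2^-1 + e) * h `^ gam.
Proof.
have e0 : 0 < e by have := s_lt1; rewrite /e; lra.
have e18 : e < 8^-1 by have := s_gt0; rewrite /e; lra.
have e1 : e < 1 by lra.
have [K3 K30 HK] := incr_decay e0 e1.
pose K := K2 * K3.
have K0 : 0 <= K by rewrite mulr_ge0 // sqrtr_ge0.
exists K => // l h l0 l1 h0 h1.
set X := nm _ _.
have lD a b : l `^ (a + b) = l `^ a * l `^ b by rewrite powRD // (gt_eqF l0) implybT.
have hD a b : h `^ (a + b) = h `^ a * h `^ b by rewrite powRD // (gt_eqF h0) implybT.
have Xa : X <= K * l `^ (1 - e) * h `^ (3 * s / 2).
  rewrite /X (incr_comm l h) (incr_comm l h u).
  apply: le_trans (incr3_le l h0 h1 h0 h1) _.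
  have -> : 3 * s / 2 = s + s / 2 by field.
  rewrite hD.
  have -> : K * l `^ (1 - e) * (h `^ s * h `^ (s / 2)) = K2 * h `^ s * h `^ (s / 2) * (K3 * l `^ (1 - e)).
    by rewrite /K; ring.
  by rewrite ler_wpM2l ?HK // !mulr_ge0 ?powR_ge0 ?sqrtr_ge0.
have Xb : X <= K * l `^ (s / 2) * h `^ (1 + s - e).
  rewrite /X (incr_comm l h).
  apply: le_trans (incr3_le h h0 h1 l0 l1) _.
  have -> : 1 + s - e = s + (1 - e) by ring.
  rewrite hD.
  have -> : K * l `^ (s / 2) * (h `^ s * h `^ (1 - e)) = K2 * h `^ s * l `^ (s / 2) * (K3 * h `^ (1 - e)).
    by rewrite /K; ring.
  by rewrite ler_wpM2l ?HK // !mulr_ge0 ?powR_ge0 ?sqrtr_ge0.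
pose t := (2^-1 + e - s / 2) / (1 - e - s / 2).
have den : 0 < 1 - e - s / 2 by have := s_lt1; lra.
have t01 : 0 <= t <= 1.
  rewrite /t divr_ge0 ?(ltW den) ?ler_pdivrMr //=; have := s_lt1; lra.
have := interpolate (nm_ge0 _ _) Xa Xb t01.
congr (_ <= _).
have P a b c : (K * l `^ a * h `^ b) `^ c = K `^ c * l `^ (a * c) * h `^ (b * c).
  rewrite (powRM _ (mulr_ge0 K0 (powR_ge0 _ _)) (powR_ge0 _ _)).
  by rewrite (powRM _ K0 (powR_ge0 _ _)) !powRrM.
rewrite !P.
have tD : t * (1 - e - s / 2) = 2^-1 + e - s / 2 by rewrite /t divfK // gt_eqF.
have -> : 2^-1 + e = (1 - e) * t + s / 2 * (1 - t).
  rewrite (_ : _ * t + _ = t * (1 - e - s / 2) + s / 2); last by ring.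
  by rewrite tD; ring.
have -> : gam = 3 * s / 2 * t + (1 + s - e) * (1 - t).
  rewrite (_ : _ * t + _ = (1 + s - e) - t * (1 - e - s / 2)); last by field.
  by rewrite tD /gam /e; field.
rewrite lD hD.
have KK : K = K `^ t * K `^ (1 - t).
  have [K00|Kn] := eqVneq K 0.
    have tn : t != 0 by rewrite /t mulf_neq0 ?invr_eq0 ?gt_eqF //; have := s_lt1; lra.
    by rewrite K00 powR0 // mul0r.
  by rewrite -powRD ?Kn ?implybT // addrC subrK powRr1.
by rewrite [X in _ = X * _ * _]KK; ring.
Qed.

Hypothesis cu : continuous u.

Lemma second_difference : exists2 C, 0 <= C & forall x h, 0 < h -> h <= 1 ->
  `|2 * u x - u (x + h) - u (x - h)| <= C * h `^ gam.
Proof.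
have e0 : 0 < e by have := s_lt1; rewrite /e; lra.
have e1 : e < 1 by have := s_gt0; rewrite /e; lra.
have [K K0 HK] := incr3_decay.
have [K3 K30 HK3] := incr_decay e0 e1.
have [Cm Cm0 HC] := @morrey R e e0.
exists (K1 * K3 + Cm * K) => [|x h h0 h1].
  by rewrite addr_ge0 // mulr_ge0 // sqrtr_ge0.
pose w := incr h (incr h u).
have hw : Ltwo leb w by do 2 apply: Ltwo_incr; exact: hu.1.
have cw : continuous w.
  have ci v : continuous v -> continuous (incr h v).
    move=> cv y; apply: cvgB; last exact: cv.
    apply: (@cvg_comp _ _ _ (fun z => z + h) v); last exact: cv.
    by apply: cvgD; [exact: cvg_id|exact: cvg_cst].
  exact/ci/ci.
have Hl l : 0 < l -> l <= 1 -> nm leb (incr l w) <= K * h `^ gam * l `^ (2^-1 + e).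
  by move=> l0 l1; rewrite mulrAC; exact: HK.
have := HC w (K * h `^ gam) cw hw Hl (x - h).
have -> : w (x - h) = - (2 * u x - u (x + h) - u (x - h)).
  rewrite /w /incr !subrK; ring.
rewrite normrN => /le_trans; apply.
rewrite mulrDl mulrA lerD2r.
apply: le_trans (incr2_le h h0 h1) _.
apply: (@le_trans _ _ (K1 * h `^ s * (K3 * h `^ (1 - e)))).
  by rewrite ler_wpM2l ?HK3 // mulr_ge0 ?powR_ge0 ?sqrtr_ge0.
have -> : K1 * h `^ s * (K3 * h `^ (1 - e)) = K1 * K3 * h `^ (s + (1 - e)).
  by rewrite powRD ?(gt_eqF h0) ?implybT //; ring.
rewrite ler_wpM2l ?mulr_ge0 ?sqrtr_ge0 //.
have -> : s + (1 - e) = gam + (2^-1 - s / 2 + e) by rewrite /gam /e; field.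
rewrite powRD ?(gt_eqF h0) ?implybT // ler_piMr ?powR_ge0 //.
by apply: powR_le1; rewrite ?(ltW h0) //; have := s_lt1; lra.
Qed.

End regularity.

Section continuity.
Context {R : realType}.
Local Notation leb := (@lebesgue_measure R).

Lemma cone_continuous (u : R -> R) (C e : R) : cone u -> Ltwo leb u ->
  (forall x, u x <= u 0) -> (forall d, 0 < d -> exists2 x, 0 < x & u 0 - d < u x) ->
  0 <= C -> e < 2^-1 -> (forall h, 0 < h -> nm leb (incr h u) <= C * h `^ (1 - e)) ->
  continuous u.
Proof.
move=> cu hu u00 u0s C0 e2 HC; have [un ue um] := cu.
have mu_ : measurable_fun [set: R] u := measurable_cone cu.
have cpos x : 0 < x -> {for x, continuous u}.
  move=> x0; apply/cvgrPdist_lt => d d0.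
  pose D := C ^+ 2 * 3 `^ (2 - 2 * e).
  have D0 : 0 <= D by rewrite mulr_ge0 ?sqr_ge0 ?powR_ge0.
  have D1 : 0 < D + 1 by rewrite ltr_wpDl.
  have ee : 0 < 1 - 2 * e by lra.
  pose h := Num.min (x / 3) ((d ^+ 2 / (D + 1)) `^ (1 - 2 * e)^-1 / 2).
  have dd : 0 < d ^+ 2 / (D + 1) by rewrite divr_gt0 // exprn_gt0.
  have h0 : 0 < h by rewrite lt_min !divr_gt0 // powR_gt0.
  have hx : 2 * h < x.
    have h3 : h <= x / 3 by rewrite ge_min lexx.
    by lra.
  have hd : h `^ (1 - 2 * e) <= d ^+ 2 / (D + 1).
    have -> : d ^+ 2 / (D + 1) = (d ^+ 2 / (D + 1)) `^ (1 - 2 * e)^-1 `^ (1 - 2 * e).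
      by rewrite -powRrM mulVf ?gt_eqF // powRr1 // ltW.
    apply: powR_nondecr; rewrite ?(ltW ee) ?(ltW h0) //.
    have h4 : h <= (d ^+ 2 / (D + 1)) `^ (1 - 2 * e)^-1 / 2 by rewrite ge_min lexx orbT.
    by have := powR_ge0 (d ^+ 2 / (D + 1)) (1 - 2 * e)^-1; lra.
  have j0 : 0 <= u (x - h) - u (x + h) by rewrite subr_ge0 um //; lra.
  have jd : u (x - h) - u (x + h) < d.
    rewrite -(@ltr_pXn2r _ 2) ?nnegrE ?(ltW d0) //.
    pose S : set R := [set` `]x - 2 * h, x - h[].
    have lS : leb S = h%:E.
      apply: etrans (lebesgue_itvoo _) _; first by lra.
      by congr (_%:E); ring.
    have mi : measurable_fun [set: R] (fun y => incr (3 * h) u y ^+ 2) by exact: measurable_incr1.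
    have := @integral_ge_cst _ _ R leb S (fun y => incr (3 * h) u y ^+ 2) ((u (x - h) - u (x + h)) ^+ 2) h
       (measurable_itv _) lS mi (fun y => sqr_ge0 _) (sqr_ge0 _).
    have Hy y : S y -> (u (x - h) - u (x + h)) ^+ 2 <= incr (3 * h) u y ^+ 2.
      rewrite /S /= in_itv /= => /andP[y1 y2].
      have h1 : u (x - h) <= u y by apply: um; lra.
      have h2 : u (y + 3 * h) <= u (x + h) by apply: um; lra.
      have h3 : u (x - h) - u (x + h) <= u y - u (y + 3 * h) by lra.
      rewrite /incr -[leRHS]sqrrN opprB ler_pXn2r ?nnegrE //; exact: le_trans h3.
    move=> /(_ Hy).
    have hi := Ltwo_incr (3 * h) hu.
    rewrite -(ipE hi) lee_fin -nm_sqr => h1.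
    have h2 := HC (3 * h) (mulr_gt0 (ltr0n _ 3) h0).
    have h3 : nm leb (incr (3 * h) u) ^+ 2 <= (C * (3 * h) `^ (1 - e)) ^+ 2.
      by rewrite ler_pXn2r ?nnegrE ?nm_ge0 ?mulr_ge0 ?powR_ge0.
    have h4 : (C * (3 * h) `^ (1 - e)) ^+ 2 = D * h `^ (1 - 2 * e) * h.
      rewrite exprMn -(powR_mulrn 2 (powR_ge0 _ _)) -powRrM powRM ?(ltW h0) //.
      have -> : (1 - e) * 2 = 2 - 2 * e by ring.
      have -> : h `^ (2 - 2 * e) = h `^ (1 - 2 * e) * h.
        rewrite -[X in _ = _ * X](powRr1 (ltW h0)) -powRD ?(gt_eqF h0) ?implybT //.
        by congr (_ `^ _); ring.
      by rewrite /D; ring.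
    rewrite h4 in h3; have := le_trans h1 h3; rewrite ler_pM2r // => h5.
    apply: le_lt_trans h5 _.
    apply: le_lt_trans (ler_wpM2l D0 hd) _.
    by rewrite mulrCA gtr_pMr ?exprn_gt0 // ltr_pdivrMr // mul1r ltrDl.
  near=> y.
  have yh : `|x - y| < h by near: y; exact: (@cvgr_dist_lt _ _ _ _ _ _ _ cvg_id).
  move: yh; rewrite ltr_norml => /andP[y1 y2].
  have a1 : u y <= u (x - h) by apply: um; lra.
  have a2 : u (x + h) <= u y by apply: um; lra.
  have a3 : u x <= u (x - h) by apply: um; lra.
  have a4 : u (x + h) <= u x by apply: um; lra.
  by rewrite ltr_norml; apply/andP; split; lra.
move=> x; have [x0|x0|->] := ltgtP x 0; [|exact: cpos|].
- have : {for - x, continuous u} by apply: cpos; rewrite oppr_gt0.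
  move=> cx; have -> : u = u \o -%R by apply/funext => y /=; rewrite ue.
  by apply: continuous_comp; [exact: opp_continuous|exact: cx].
- apply/cvgrPdist_lt => d d0; have [z z0 zd] := u0s d d0.
  near=> y.
  have yz : `|0 - y| < z by near: y; exact: (@cvgr_dist_lt _ _ _ _ _ _ _ cvg_id).
  have h1 : u z <= u y.
    rewrite -(cone_norm y cu); have [->|yn] := eqVneq y 0; first by rewrite normr0.
    by apply: um; rewrite ?normr_gt0 // -normrN -sub0r ltW.
  by have h2 := u00 y; rewrite ger0_norm ?subr_ge0 //; lra.
Unshelve. all: end_near.
Qed.

End continuity.

(** * The pointwise equation *)

Section singular.
Context {R : realType}.
Local Notation leb := (@lebesgue_measure R).
Variables (k : R -> R) (s C1 : R).
Hypothesis ck : cone k.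
Hypothesis s_gt0 : 0 < s.
Hypothesis s_lt1 : s < 1.
Hypothesis C1_ge0 : 0 <= C1.
Hypothesis k_up : forall t, t != 0 -> k t <= C1 * pw (1 + 2 * s) 2 t.

Let mk : measurable_fun [set: R] k := measurable_cone ck.
Let k0 t : 0 <= k t. Proof. by have [] := ck. Qed.
Let k_even t : k (- t) = k t. Proof. by have [] := ck. Qed.

Definition modulus (c t : R) : R := Num.min 1 (`|t| `^ c).

Lemma modulus_ge0 c t : 0 <= modulus c t.
Proof. by rewrite /modulus le_min ler01 powR_ge0. Qed.

Lemma measurable_modulus c : measurable_fun [set: R] (modulus c).
Proof.
apply: measurable_minr => //; apply: measurable_powRl; exact: normr_measurable.
Qed.

Lemma modulus_kernel_integrable c : 2 * s < c ->
  leb.-integrable setT (EFin \o (fun t => modulus c t * k t)).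
Proof.
move=> sc; have c0 : 0 < c by have := s_gt0; lra.
have b1 : 1 + 2 * s - c < 1 by lra.
have i1 := integrableZl measurableT C1 (integrable_pw b1 (ltr1n _ 2)).
apply: (le_integrable _ _ _ i1) => //.
  by apply/measurable_EFinP; apply: measurable_funM => //; exact: measurable_modulus.
move=> t _; rewrite /= lee_fin !ger0_norm ?mulr_ge0 ?modulus_ge0 ?pw_ge0 //.
have [->|t0] := eqVneq t 0.
  by rewrite /modulus normr0 powR0 ?gt_eqF // min_r // mul0r mulr_ge0 ?pw_ge0.
have tp : 0 < `|t| by rewrite normr_gt0.
apply: le_trans (ler_wpM2l (modulus_ge0 _ _) (k_up t0)) _.
rewrite mulrCA ler_wpM2l // /modulus /pw; case: (leP `|t| 1) => t1.
  have h : Num.min 1 (`|t| `^ c) <= `|t| `^ c by rewrite ge_min lexx orbT.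
  apply: le_trans (ler_wpM2r (powR_ge0 _ _) h) _.
  rewrite -powRD; last by rewrite (gt_eqF tp) implybT.
  by rewrite le_eqVlt; apply/orP; left; apply/eqP; congr (_ `^ _); ring.
have h : Num.min 1 (`|t| `^ c) <= 1 by rewrite ge_min lexx.
by apply: le_trans (ler_wpM2r (powR_ge0 _ _) h) _; rewrite mul1r.
Qed.

Lemma truncated_kernel_integrable (n : nat) :
  leb.-integrable setT (EFin \o (fun t => Num.min (k t) n%:R)).
Proof.
have i1 := integrableZl measurableT (n%:R + C1) (integrable_pw (ltr01 : 0 < 1 :> R) (ltr1n _ 2)).
apply: (le_integrable _ _ _ i1) => //.
  by apply/measurable_EFinP; exact: measurable_minr.
move=> t _; rewrite /= lee_fin.
rewrite [leRHS]ger0_norm ?mulr_ge0 ?addr_ge0 ?pw_ge0 // ger0_norm ?le_min ?k0 ?ler0n //.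
have h1 : Num.min (k t) n%:R <= n%:R by rewrite ge_min lexx orbT.
have h2 : Num.min (k t) n%:R <= k t by rewrite ge_min lexx.
rewrite /pw; case: (leP `|t| 1) => t1.
  by rewrite oppr0 powRr0 mulr1; apply: le_trans h1 _; rewrite lerDl.
have t0 : t != 0 by rewrite -normr_gt0 (lt_trans _ t1).
apply: le_trans h2 _; apply: le_trans (k_up t0) _.
by rewrite /pw (lt_geF t1) mulrDl lerDr mulr_ge0 ?powR_ge0.
Qed.

Lemma bump_inH (phi : R -> R) (B M r : R) : measurable_fun [set: R] phi -> 0 <= r ->
  (forall x, `|phi x| <= B) -> (forall x y, `|phi x - phi y| <= M * `|x - y|) ->
  (forall x, r <= `|x| -> phi x = 0) -> inH k phi.
Proof.
move=> mp r0 pB pM pr.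
have B0 : 0 <= B by exact: le_trans (pB 0).
have Iint (r' : R) : 0 <= r' -> (\int[leb]_x (\1_([set` `[- r', r']] : set R) x)%:E = (2 * r')%:E)%E.
  move=> r'0; rewrite integral_indic // setIT.
  apply: etrans (lebesgue_measure_itv _) _; rewrite /= lte_fin.
  case: ltP => h; first by rewrite -EFinB; congr (_%:E); ring.
  by congr (_%:E); lra.
have bound (f : R -> R) (c r' : R) : measurable_fun [set: R] f -> 0 <= r' -> 0 <= c ->
    (forall x, 0 <= f x) ->
    (forall x, f x <= c) -> (forall x, r' < `|x| -> f x = 0) ->
    (\int[leb]_x (f x)%:E <= (c * (2 * r'))%:E)%E.
  move=> mf r'0 cc f0 fc fr.
  pose I : set R := [set` `[- r', r']].
  have mI1 : measurable_fun [set: R] (fun x : R => (\1_I x : R)%:E).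
    by apply/measurable_EFinP; apply: measurable_indic; exact: measurable_itv.
  rewrite EFinM -(Iint _ r'0) -ge0_integralZl //.
  - apply: ge0_le_integral => //.
    + by move=> x _; rewrite lee_fin.
    + exact/measurable_EFinP.
    + exact: emeasurable_funM.
    move=> x _; rewrite -EFinM lee_fin -/I indicE.
    case: (boolP (x \in I)) => xI; first by rewrite mulr1.
    rewrite mulr0 fr //; rewrite ltNge; apply: contra xI => h.
    by rewrite inE /I /= in_itv /= -ler_norml.
have hp : Ltwo leb phi.
  split => //; apply: le_lt_trans (_ : (_ <= (B ^+ 2 * (2 * r))%:E)%E) (ltry _).
  apply: bound => //.
  - by apply: measurable_funX.
  - by rewrite sqr_ge0.
  - by move=> x; exact: sqr_ge0.
  - by move=> x; rewrite -(real_normK (num_real (phi x))) ler_pXn2r ?nnegrE.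
  - by move=> x rx; rewrite pr ?expr0n //= ltW.
split => //; split; first exact: measurable_dl.
rewrite (energy_trans2 mk k0 k_even mp).
pose D := Num.max (M ^+ 2 * (2 * (r + 1))) (4 * (B ^+ 2 * (2 * r))).
have D0 : 0 <= D by rewrite le_max; apply/orP; left; rewrite mulr_ge0 ?sqr_ge0 // mulr_ge0 // addr_ge0.
have key t : ((k t)%:E * trans2 phi t <= D%:E * (modulus 2 t * k t)%:E)%E.
  have [->|t0] := eqVneq t 0.
    rewrite (_ : trans2 phi 0 = 0%E).
      by rewrite mule0 mule_ge0 // lee_fin ?mulr_ge0 ?modulus_ge0.
    by rewrite /trans2; under eq_integral do rewrite addr0 subrr expr0n /=; rewrite integral0.
  rewrite (mulrC (modulus 2 t)) EFinM muleCA; apply: lee_wpmul2l; first by rewrite lee_fin.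
  rewrite -EFinM /modulus.
  have [t1|t1] := leP `|t| 1.
    apply: (@le_trans _ _ ((M * t) ^+ 2 * (2 * (r + 1)))%:E).
      apply: bound => //.
      + exact: measurable_incr1.
      + by rewrite addr_ge0.
      + exact: sqr_ge0.
      + by move=> x; exact: sqr_ge0.
      + move=> x; rewrite -[leLHS]real_normK ?num_real // -[leRHS]real_normK ?num_real //.
        rewrite ler_pXn2r ?nnegrE //; apply: le_trans (pM _ _) _.
        by rewrite addrAC subrr add0r normrM ler_wpM2r // ler_norm.
      + move=> x rx; have h1 : r <= `|x| by lra.
        have h2 : r <= `|x + t|.
          have := ler_normB (x + t) t; rewrite addrK; lra.
        by rewrite !pr // subrr expr0n.
    rewrite lee_fin min_r; last by apply: powR_le1.
    rewrite powR_mulrn // real_normK ?num_real // exprMn.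
    have -> : M ^+ 2 * t ^+ 2 * (2 * (r + 1)) = M ^+ 2 * (2 * (r + 1)) * t ^+ 2 by ring.
    by rewrite ler_wpM2r ?sqr_ge0 // le_max lexx.
  rewrite min_l; last first.
    have := @powR_nondecr R 2 1 `|t|; rewrite powR1; apply => //; exact: ltW.
  rewrite mulr1; apply: (@le_trans _ _ (4 * (B ^+ 2 * (2 * r)))%:E); last first.
    by rewrite lee_fin le_max lexx orbT.
  have -> : trans2 phi t = (ip leb (incr t phi) (incr t phi))%:E.
    by rewrite ipE //; exact: Ltwo_incr.
  rewrite lee_fin -nm_sqr.
  have h1 := nm_incr_le t hp.
  have h2 : nm leb phi ^+ 2 <= B ^+ 2 * (2 * r).
    rewrite nm_sqr -lee_fin ipE //; apply: bound => //.
    - by apply: measurable_funX.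
    - by rewrite sqr_ge0.
    - by move=> x; exact: sqr_ge0.
    - by move=> x; rewrite -(real_normK (num_real (phi x))) ler_pXn2r ?nnegrE.
    - by move=> x rx; rewrite pr ?expr0n //= ltW.
  have h3 : nm leb (incr t phi) ^+ 2 <= (2 * nm leb phi) ^+ 2.
    by rewrite ler_pXn2r ?nnegrE ?nm_ge0 ?mulr_ge0 ?nm_ge0.
  by rewrite exprMn in h3; lra.
have i1 := modulus_kernel_integrable (_ : 2 * s < 2).
have {i1} /integrableP[mi fi] : leb.-integrable setT (EFin \o (fun t => modulus 2 t * k t)).
  by apply: i1; have := s_lt1; lra.
apply: (@le_lt_trans _ _ (\int[leb]_t (D%:E * (modulus 2 t * k t)%:E))%E).
  apply: ge0_le_integral => //.
  - by move=> t _; rewrite mule_ge0 ?trans2_ge0 // lee_fin.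
  - apply: emeasurable_funM; first exact/measurable_EFinP.
    exact: measurable_trans2.
  - by apply: emeasurable_funM => //; exact: mi.
rewrite ge0_integralZl //; last by move=> t _; rewrite lee_fin mulr_ge0 ?modulus_ge0.
apply: lte_mul_pinfty => //; apply: le_lt_trans fi.
under [leRHS]eq_integral do rewrite gee0_abs ?lee_fin ?mulr_ge0 ?modulus_ge0 //.
exact: lexx.
Qed.

Definition tent (x0 d x : R) : R := Num.max (d - `|x - x0|) 0.

Lemma tent_ge0 x0 d x : 0 <= tent x0 d x.
Proof. by rewrite /tent le_max lexx orbT. Qed.

Lemma measurable_tent x0 d : measurable_fun [set: R] (tent x0 d).
Proof.
apply: measurable_maxr => //; apply: measurable_funB => //.
by apply: measurableT_comp => //; exact: measurable_funB.
Qed.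

Lemma tent_inH x0 d : 0 < d -> inH k (tent x0 d).
Proof.
move=> d0; apply: (@bump_inH _ d 1 (`|x0| + d)).
- exact: measurable_tent.
- by rewrite addr_ge0 // ltW.
- move=> x; rewrite ger0_norm ?tent_ge0 // /tent ge_max gerBl normr_ge0 ltW //.
- move=> x y; rewrite mul1r /tent.
  have h := ler_dist_dist (x - x0) (y - x0).
  rewrite opprB addrA subrK in h; apply: le_trans h.
  set a := `|x - x0|; set b := `|y - x0|.
  rewrite ler_norml /Num.max; apply/andP; split; case: (ltP (d - a) 0) => h1; case: (ltP (d - b) 0) => h2;
   have := ler_norm (a - b); have := ler_norm (b - a); rewrite (distrC b a); lra.
- move=> x hx; rewrite /tent max_r // subr_le0.
  by have := ler_normD (x - x0) x0; rewrite subrK; lra.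
Qed.

Lemma tent_cone d : cone (tent 0 d).
Proof.
split => [x|x|x y x0 xy]; rewrite ?tent_ge0 // /tent !subr0 ?normrN //.
rewrite !gtr0_norm ?(lt_le_trans x0) // /Num.max.
by case: (ltP (d - x) 0) => h1; case: (ltP (d - y) 0) => h2; lra.
Qed.

End singular.

Section tents.
Context {R : realType}.
Local Notation leb := (@lebesgue_measure R).

Lemma tent_integrable (x0 d : R) : 0 < d -> leb.-integrable setT (EFin \o tent x0 d).
Proof.
move=> d0; have c1 : cone (fun=> 0 : R) by split.
have h2 : Ltwo leb (tent x0 (2 * d)).
  apply: (proj1 (@tent_inH R (fun=> 0) 2^-1 0 c1 _ _ _ _ x0 (2 * d) _)); rewrite ?invr_gt0 ?mulr_gt0 //.
    by rewrite invf_lt1 // ltr1n.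
  by move=> t _; rewrite mul0r.
have i1 := integrableZl measurableT d^-1 (Ltwo_integrable h2).
apply: (le_integrable _ _ _ i1) => //; first by apply/measurable_EFinP; exact: measurable_tent.
move=> x _; rewrite /= lee_fin !ger0_norm ?mulr_ge0 ?sqr_ge0 ?invr_ge0 ?(ltW d0) ?tent_ge0 //.
rewrite /tent; set a := `|x - x0|; have a0 : 0 <= a by exact: normr_ge0.
rewrite -(ler_pM2l d0) mulrA divff ?gt_eqF // mul1r.
by rewrite /Num.max; case: (ltP (d - a) 0) => h1; case: (ltP (2 * d - a) 0) => h3; nra.
Qed.

Lemma continuous_tent_zero (G : R -> R) (M : R) : continuous G -> (forall x, `|G x| <= M) ->
  (forall x0 d, 0 < d -> \int[leb]_x (G x * tent x0 d x) = 0) -> forall x, G x = 0.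
Proof.
have it (H : R -> R) x0 d : continuous H -> (forall x, `|H x| <= M) -> 0 < d ->
    leb.-integrable setT (EFin \o (fun x => H x * tent x0 d x)).
  move=> cH HM d0; have i1 := integrableZl measurableT M (tent_integrable x0 d0).
  have mH : measurable_fun [set: R] H by exact: continuous_measurable_fun.
  apply: (le_integrable _ _ _ i1) => //.
    by apply/measurable_EFinP; apply: measurable_funM => //; exact: measurable_tent.
  have M0 : 0 <= M by exact: le_trans (HM 0).
  by move=> x _; rewrite /= lee_fin !normrM (ger0_norm M0) ler_wpM2r.
have main (H : R -> R) x0 : continuous H -> (forall x, `|H x| <= M) ->
    (forall x0 d, 0 < d -> \int[leb]_x (H x * tent x0 d x) = 0) -> H x0 <= 0.
  move=> cH HM H0; rewrite leNgt; apply/negP => Hx.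
  have /cvgrPdist_le/(_ (H x0 / 2))/(_ (divr_gt0 Hx (ltr0n _ 2)))/nbhs_ballP[d /= d0 Hd] := cH x0.
  have mH : measurable_fun [set: R] H by exact: continuous_measurable_fun.
  have near x : `|x - x0| < d -> H x0 / 2 <= H x.
    move=> xd; have := Hd x; rewrite /ball /= distrC => /(_ xd).
    by rewrite ler_norml => /andP[h1 h2]; lra.
  have mf : measurable_fun [set: R] (fun x => H x * tent x0 d x).
    by apply: measurable_funM => //; exact: measurable_tent.
  have f0 x : 0 <= H x * tent x0 d x.
    have [xd|xd] := ltP `|x - x0| d.
      by rewrite mulr_ge0 ?tent_ge0 //; have := near x xd; lra.
    by rewrite /tent max_r ?mulr0 // subr_le0.
  pose S : set R := [set` `]x0 - d / 2, x0 + d / 2[].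
  have lS : leb S = d%:E.
    apply: etrans (lebesgue_itvoo _) _; first by lra.
    by congr (_%:E); field.
  have c0 : 0 <= H x0 / 2 * (d / 2) by rewrite mulr_ge0 // divr_ge0 // ltW.
  have Sc x : S x -> H x0 / 2 * (d / 2) <= H x * tent x0 d x.
    rewrite /S /= in_itv /= => /andP[h1 h2].
    have xd : `|x - x0| <= d / 2 by rewrite ler_norml; apply/andP; split; lra.
    apply: ler_pM; rewrite ?divr_ge0 ?(ltW d0) ?(ltW Hx) //; first by apply: near; lra.
    by rewrite /tent le_max; apply/orP; left; lra.
  have := @integral_ge_cst _ _ R leb S _ _ d (measurable_itv _) lS mf f0 c0 Sc.
  have := H0 x0 d d0; rewrite /Rintegral => e.
  rewrite -(fineK (integrable_fin_num measurableT (it H x0 d cH HM d0))) e lee_fin leNgt => /negP; apply.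
  by rewrite !mulr_gt0 ?invr_gt0.
move=> cG GM G0 x; apply/eqP; rewrite eq_le main //= -oppr_le0.
apply: (main (fun x => - G x)) => [y|y|x0 d d0].
- by apply: cvgN; exact: cG.
- by rewrite normrN.
- have -> : \int[leb]_x (- G x * tent x0 d x) = \int[leb]_x (-1 * (G x * tent x0 d x)).
    by apply: eq_Rintegral => z _; rewrite mulN1r mulNr.
  by rewrite RintegralZl ?G0 ?mulr0 //; exact: it.
Qed.

End tents.

Section pointwise.
Context {R : realType}.
Local Notation leb := (@lebesgue_measure R).
Variables (k : R -> R) (A s C1 : R).
Hypothesis ck : cone k.
Hypothesis A_gt0 : 0 < A.
Hypothesis s_gt0 : 0 < s.
Hypothesis s_lt1 : s < 1.
Hypothesis C1_ge0 : 0 <= C1.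
Hypothesis k_up : forall t, t != 0 -> k t <= C1 * pw (1 + 2 * s) 2 t.
Variables (u F : R -> R) (B BF Cs gam : R).
Hypothesis hu : inH k u.
Hypothesis cu : continuous u.
Hypothesis cF : continuous F.
Hypothesis uB : forall x, 0 <= u x <= B.
Hypothesis FB : forall x, `|F x| <= BF.
Hypothesis Cs_ge0 : 0 <= Cs.
Hypothesis gam_gt : 2 * s < gam.
Hypothesis u2 : forall x h, 0 < h -> h <= 1 ->
  `|2 * u x - u (x + h) - u (x - h)| <= Cs * h `^ gam.
Hypothesis eu : forall phi, inH k phi -> Q k A u phi = ip leb F phi.

Let mk : measurable_fun [set: R] k := measurable_cone ck.
Let k0 t : 0 <= k t. Proof. by have [] := ck. Qed.
Let k_even t : k (- t) = k t. Proof. by have [] := ck. Qed.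
Let B0 : 0 <= B. Proof. by have /andP[] := uB 0; exact: le_trans. Qed.
Let mu_ : measurable_fun [set: R] u. Proof. exact: continuous_measurable_fun. Qed.
Let gam0 : 0 < gam. Proof. by have := gam_gt; have := s_gt0; lra. Qed.

Definition diff2 (x t : R) : R := 2 * u x - u (x + t) - u (x - t).

Let C2 := Cs + 4 * B.

Lemma diff2_bound x t : `|diff2 x t| <= C2 * modulus gam t.
Proof.
have ev : diff2 x t = diff2 x `|t|.
  by rewrite /diff2; case: (ger0P t) => // _; rewrite opprK; ring.
have [->|t0] := eqVneq t 0.
  rewrite /diff2 addr0 subr0 (_ : _ - _ - _ = 0) ?normr0 ?mulr_ge0 ?modulus_ge0 ?addr_ge0 ?mulr_ge0 //.
  ring.
have tp : 0 < `|t| by rewrite normr_gt0.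
rewrite ev /modulus; have [t1|t1] := leP `|t| 1.
  rewrite min_r; last by apply: powR_le1 => //; exact: ltW.
  apply: le_trans (u2 x tp t1) _; rewrite ler_wpM2r ?powR_ge0 // lerDl mulr_ge0 //.
rewrite min_l; last first.
  by have := @powR_nondecr R gam 1 `|t|; rewrite powR1; apply => //; exact: ltW.
have /andP[a1 a2] := uB x; have /andP[b1 b2] := uB (x + `|t|); have /andP[c1 c2] := uB (x - `|t|).
rewrite mulr1 /diff2 /C2 ler_norml; have := Cs_ge0; have := B0 => *; apply/andP; split; lra.
Qed.

Let C20 : 0 <= C2. Proof. by rewrite /C2 addr_ge0 // mulr_ge0. Qed.

Let mki := modulus_kernel_integrable ck s_gt0 C1_ge0 k_up gam_gt.

Lemma measurable_diff2 x : measurable_fun [set: R] (diff2 x).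
Proof.
apply: measurable_funB; first apply: measurable_funB => //.
  by apply: (measurableT_comp mu_); exact: measurable_funD.
by apply: (measurableT_comp mu_); exact: measurable_funB.
Qed.

Let dom t : R := C2 * (modulus gam t * k t).

Let idom : leb.-integrable setT (EFin \o dom).
Proof. by have := integrableZl measurableT C2 mki; apply: eq_integrable. Qed.

Let dom_bound x (h : R -> R) t : 0 <= h t <= k t -> `|diff2 x t * h t| <= dom t.
Proof.
move=> /andP[h0 hk]; rewrite normrM (ger0_norm h0) /dom mulrA.
by apply: ler_pM => //; exact: diff2_bound.
Qed.

Lemma diff2_integrable x : leb.-integrable setT (EFin \o (fun t => diff2 x t * k t)).
Proof.
apply: (le_integrable _ _ _ idom) => //.
  by apply/measurable_EFinP; apply: measurable_funM => //; exact: measurable_diff2.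
move=> t _; rewrite /= lee_fin [leRHS]ger0_norm ?mulr_ge0 ?modulus_ge0 //.
by apply: dom_bound; rewrite k0 lexx.
Qed.

Definition singular_integral x : R := 2^-1 * \int[leb]_t (diff2 x t * k t).

Lemma singular_integral_continuous : continuous singular_integral.
Proof.
move=> x; apply: cvgM; first exact: cvg_cst.
have := @continuity_under_integral R _ _ leb (fun x t => diff2 x t * k t) setT measurableT (x - 1) (x + 1)
  (fun y _ => diff2_integrable y) _ dom idom _ x.
apply; last by rewrite inE /= in_itv /=; apply/andP; split; lra.
- apply/aeW => t _ y _; apply: cvgM; last exact: cvg_cst.
  apply: cvgB; last first.
    by apply: (@cvg_comp _ _ _ (fun z => z - t) u); [apply: cvgB; [exact: cvg_id|exact: cvg_cst]|exact: cu].
  apply: cvgB; first by apply: cvgM; [exact: cvg_cst|exact: cu].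
  by apply: (@cvg_comp _ _ _ (fun z => z + t) u); [apply: cvgD; [exact: cvg_id|exact: cvg_cst]|exact: cu].
- by move=> y _; apply/aeW => t _; apply: dom_bound; rewrite k0 lexx.
Qed.

Lemma singular_integral_trunc n x :
  mass (ktr k n) * u x - cv (ktr k n) u x = 2^-1 * \int[leb]_t (diff2 x t * ktr k n t).
Proof.
have fh := ktr_fcone ck n.
have ih := ktr_integrable ck (truncated_kernel_integrable ck C1_ge0 k_up) n.
set h := ktr k n in fh ih *.
have h0 t : 0 <= h t by have [] := fh.
have mh : measurable_fun [set: R] h := measurable_cone (fcone_cone fh).
have i1 (c : R) : leb.-integrable setT (EFin \o (fun y => h (x - y) * c)).
  have := integrableZl measurableT c (integrable_hsub fh ih x).
  by apply: eq_integrable => // y _; rewrite /= -EFinM mulrC.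
have i2 := integrable_cv fh ih x mu_ uB.
have E : mass h * u x - cv h u x = \int[leb]_y (h (x - y) * (u x - u y)).
  have -> : mass h * u x = \int[leb]_y (h (x - y) * u x).
    rewrite RintegralZr //; last exact: (integrable_hsub fh ih x).
    by rewrite /Rintegral (integral_hsub fh ih).
  rewrite /cv -RintegralB //; apply: eq_Rintegral => y _; ring.
have mf : measurable_fun [set: R] (fun t : R => (h t * (u x - u (x - t)))%:E).
  apply/measurable_EFinP; apply: measurable_funM => //; apply: measurable_funB => //.
  by apply: (measurableT_comp mu_); exact: measurable_funB.
have E1 : mass h * u x - cv h u x = \int[leb]_t (h t * (u x - u (x - t))).
  rewrite E /Rintegral -(integral_sub x mf); congr fine.
  by apply: eq_integral => y _; rewrite opprB addrCA subrr addr0.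
have E2 : mass h * u x - cv h u x = \int[leb]_t (h t * (u x - u (x + t))).
  rewrite E1 /Rintegral -(integral_opp mf); congr fine.
  by apply: eq_integral => y _; rewrite opprK (fcone_even _ fh).
have ib (v : R -> R) : measurable_fun [set: R] v -> (forall t, 0 <= v t <= B) ->
    leb.-integrable setT (EFin \o (fun t => h t * (u x - v t))).
  move=> mv vB; have := integrableZl measurableT B ih => iB.
  apply: (le_integrable _ _ _ iB) => //.
    by apply/measurable_EFinP; apply: measurable_funM => //; exact: measurable_funB.
  move=> t _; rewrite /= lee_fin !normrM (ger0_norm (h0 t)) mulrC (ger0_norm B0) ler_wpM2r //.
  have /andP[a1 a2] := uB x; have /andP[b1 b2] := vB t.
  by rewrite ler_norml; apply/andP; split; lra.
have iE1 : leb.-integrable setT (EFin \o (fun t => h t * (u x - u (x - t)))).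
  by apply: ib => //; apply: (measurableT_comp mu_); exact: measurable_funB.
have iE2 : leb.-integrable setT (EFin \o (fun t => h t * (u x - u (x + t)))).
  by apply: ib => //; apply: (measurableT_comp mu_); exact: measurable_funD.
have -> : \int[leb]_t (diff2 x t * h t) =
    \int[leb]_t (h t * (u x - u (x - t)) + h t * (u x - u (x + t))).
  by apply: eq_Rintegral => t _; rewrite /diff2; ring.
rewrite RintegralD // -E1 -E2; by field.
Qed.

Let ktr_le n t : t != 0 -> 0 <= ktr k n t <= k t.
Proof. by move=> t0; rewrite /ktr (negbTE t0) le_min k0 ler0n ge_min lexx. Qed.

Let dom_ktr n x t : `|diff2 x t * ktr k n t| <= dom t.
Proof.
have [->|t0] := eqVneq t 0; last exact/dom_bound/ktr_le.
by rewrite /diff2 addr0 subr0 (_ : _ - _ - _ = 0) ?mul0r ?normr0 ?mulr_ge0 ?modulus_ge0 //; ring.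
Qed.

Let mktr n : measurable_fun [set: R] (ktr k n).
Proof. exact: measurable_cone (fcone_cone (ktr_fcone ck n)). Qed.

Lemma singular_integral_cvg x :
  (fun n => mass (ktr k n) * u x - cv (ktr k n) u x) @ \oo --> singular_integral x.
Proof.
under eq_fun do rewrite singular_integral_trunc.
apply: cvgM; first exact: cvg_cst.
have m1 n : measurable_fun [set: R] (fun t => diff2 x t * ktr k n t).
  by apply: measurable_funM => //; exact: measurable_diff2.
have m2 : measurable_fun [set: R] (fun t => diff2 x t * k t).
  by apply: measurable_funM => //; exact: measurable_diff2.
apply: (dct (mu := leb) m1 m2 _ idom) => // t.
have [->|t0] := eqVneq t 0.
  have -> : diff2 x 0 = 0 by rewrite /diff2 addr0 subr0; ring.
  by rewrite mul0r; under eq_fun do rewrite mul0r; exact: cvg_cst.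
apply: cvgM; first exact: cvg_cst.
apply: cvg_near_cst; near=> n; rewrite /ktr (negbTE t0); apply/min_idPl.
by near: n; exact: nbhs_infty_ger.
Unshelve. all: end_near.
Qed.

Lemma singular_integral_bound n x :
  `|mass (ktr k n) * u x - cv (ktr k n) u x| <= 2^-1 * \int[leb]_t dom t.
Proof.
rewrite singular_integral_trunc normrM ger0_norm // ler_wpM2l //.
have m1 : measurable_fun [set: R] (fun t => diff2 x t * ktr k n t).
  by apply: measurable_funM => //; exact: measurable_diff2.
have i1 : leb.-integrable setT (EFin \o (fun t => diff2 x t * ktr k n t)).
  apply: (le_integrable _ _ _ idom) => //; first exact/measurable_EFinP.
  by move=> t _; rewrite /= lee_fin [leRHS]ger0_norm ?mulr_ge0 ?modulus_ge0.
apply: le_trans (le_normr_Rintegral _ _) _ => //.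
apply: le_Rintegral => //.
by move: i1 => /integrable_norm; apply: eq_integrable.
Qed.

Lemma weak_singular phi : inH k phi -> leb.-integrable setT (EFin \o phi) ->
  Q k A u phi = \int[leb]_x ((A * u x + singular_integral x) * phi x).
Proof.
move=> hp ip_; have mp := inH_meas hp.
pose k_ n t := Num.min (k t) n%:R.
have mkn n : measurable_fun [set: R] (k_ n) by exact: measurable_minr.
have kk n t : 0 <= k_ n t <= k t by rewrite /k_ le_min k0 ler0n /= ge_min lexx.
have kc t : (fun n => k_ n t) @ \oo --> k t.
  apply: cvg_near_cst; near=> n; rewrite /k_; apply/min_idPl.
  by near: n; exact: nbhs_infty_ger.
have hun n : inH (k_ n) u by exact: (inH_le_kernel mkn kk n hu).
have Qn n : Q (k_ n) A u u <= Q k A u u by apply: (Q_le_kernel A mkn kk n hu).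
have [_ _ /(_ phi hp)] := @form_limit R k_ k A mkn mk kk kc A_gt0 (fun=> u) u (Q k A u u) hun Qn (fun x => cvg_cst _) mu_.
have E n : Q (k_ n) A u phi = \int[leb]_x ((A * u x + (mass (ktr k n) * u x - cv (ktr k n) u x)) * phi x).
  have fh := ktr_fcone ck n.
  have ih := ktr_integrable ck (truncated_kernel_integrable ck C1_ge0 k_up) n.
  have [_] := form_resolvent A fh ih hu.1 hp.1 uB.
  rewrite /Q !dl_ktr => ->; apply: eq_Rintegral => x _; ring.
have -> : (fun n => Q (k_ n) A u phi) = (fun n => \int[leb]_x ((A * u x + (mass (ktr k n) * u x - cv (ktr k n) u x)) * phi x)).
  by apply/funext => n; exact: E.
move=> c1.
pose D := A * B + 2^-1 * \int[leb]_t dom t.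
have mcv n : measurable_fun [set: R] (cv (ktr k n) u).
  by apply: (measurable_cv (ktr_fcone ck n) mu_) => y; have /andP[] := uB y.
have m1 n : measurable_fun [set: R] (fun x => (A * u x + (mass (ktr k n) * u x - cv (ktr k n) u x)) * phi x).
  apply: measurable_funM => //; apply: measurable_funD; first exact: measurable_funM.
  by apply: measurable_funB => //; exact: measurable_funM.
have msi : measurable_fun [set: R] singular_integral.
  by apply: continuous_measurable_fun; exact: singular_integral_continuous.
have m2 : measurable_fun [set: R] (fun x => (A * u x + singular_integral x) * phi x).
  by apply: measurable_funM => //; apply: measurable_funD => //; exact: measurable_funM.
have iD : leb.-integrable setT (EFin \o (fun x => D * `|phi x|)).
  have := integrableZl measurableT D (integrable_norm ip_).
  by apply: eq_integrable.
have c2 := dct (mu := leb) m1 m2 _ iD _.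
apply: (cvg_unique _ c1); first exact: Rhausdorff.
apply: c2 => [x|n x].
  apply: cvgM; last exact: cvg_cst.
  by apply: cvgD; [exact: cvg_cst|exact: singular_integral_cvg].
rewrite normrM ler_wpM2r //; apply: le_trans (ler_normD _ _) _; apply: lerD.
  have /andP[a1 a2] := uB x; have A0 := ltW A_gt0.
  by rewrite ger0_norm ?mulr_ge0 // ler_wpM2l.
exact: singular_integral_bound.
Unshelve. all: end_near.
Qed.

Lemma pointwise_equation x : singular_integral x = F x - A * u x.
Proof.
pose G x := F x - A * u x - singular_integral x.
suff : G x = 0 by rewrite /G => /eqP; rewrite subr_eq0 => /eqP ->.
pose Dm := 2^-1 * \int[leb]_t dom t.
have siB y : `|singular_integral y| <= Dm.
  have cn : (fun n => `|mass (ktr k n) * u y - cv (ktr k n) u y|) @ \oo --> `|singular_integral y|.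
    by apply: cvg_norm; exact: singular_integral_cvg.
  by apply: (cvgr_to_le cn); apply: nearW => n; exact: singular_integral_bound.
have A0 := ltW A_gt0.
have auB y : `|A * u y| <= A * B.
  by have /andP[a1 a2] := uB y; rewrite ger0_norm ?mulr_ge0 // ler_wpM2l.
have mF : measurable_fun [set: R] F by exact: continuous_measurable_fun.
have msi : measurable_fun [set: R] singular_integral.
  by apply: continuous_measurable_fun; exact: singular_integral_continuous.
apply: (@continuous_tent_zero R G (BF + A * B + Dm)) => [y|y|x0 d d0].
- apply: cvgB; last exact: singular_integral_continuous.
  by apply: cvgB; [exact: cF|apply: cvgM; [exact: cvg_cst|exact: cu]].
- apply: le_trans (ler_normB _ _) _; apply: lerD => //.
  by apply: le_trans (ler_normB _ _) _; apply: lerD.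
have ht : inH k (tent x0 d) by exact: (tent_inH ck s_gt0 s_lt1 C1_ge0 k_up).
have it := tent_integrable x0 d0.
have mt := measurable_tent x0 d.
have itM (v : R -> R) (M : R) : measurable_fun [set: R] v -> (forall y, `|v y| <= M) ->
   leb.-integrable setT (EFin \o (fun y => v y * tent x0 d y)).
  move=> mv vM; have i1 := integrableZl measurableT M it.
  apply: (le_integrable _ _ _ i1) => //; first by apply/measurable_EFinP; exact: measurable_funM.
  have M0 : 0 <= M by exact: le_trans (vM 0).
  by move=> y _; rewrite /= lee_fin !normrM (ger0_norm M0) ler_wpM2r.
have i1 := itM F BF mF FB.
have mAu : measurable_fun [set: R] (fun y => A * u y + singular_integral y).
  by apply: measurable_funD => //; exact: measurable_funM.
have i2 : leb.-integrable setT (EFin \o (fun y => (A * u y + singular_integral y) * tent x0 d y)).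
  apply: (itM _ (A * B + Dm)) => // y.
  by apply: le_trans (ler_normD _ _) _; apply: lerD.
have -> : \int[leb]_y (G y * tent x0 d y) =
   \int[leb]_y (F y * tent x0 d y - (A * u y + singular_integral y) * tent x0 d y).
  by apply: eq_Rintegral => y _; rewrite /G; ring.
rewrite RintegralB // -weak_singular // eu // /ip subrr //.
Qed.

Definition pv_trunc (x e : R) : \bar R :=
  (\int[leb]_(y in [set y : R | e < `|x - y|]%R) ((u x - u y) * k (x - y))%:E)%E.

Let sel (e t : R) : R := (e < `|t|)%R%:R.

Let msel e : measurable_fun [set: R] (sel e).
Proof.
have -> : sel e = (fun t => if e < `|t| then 1 else 0).
  by apply/funext => t; rewrite /sel; case: (e < `|t|).
apply: measurable_fun_ifT => //; apply: measurable_fun_ltr => //; exact: normr_measurable.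
Qed.

Lemma pv_truncE x e : 0 < e ->
  pv_trunc x e = (2^-1 * \int[leb]_t (diff2 x t * k t * sel e t))%:E.
Proof.
move=> e0; pose f t := (u x - u (x - t)) * k t * sel e t.
have mf : measurable_fun [set: R] f.
  apply: measurable_funM => //; apply: measurable_funM => //; apply: measurable_funB => //.
  by apply: (measurableT_comp mu_); exact: measurable_funB.
have mfE : measurable_fun [set: R] (fun t => (f t)%:E) by exact/measurable_EFinP.
have T1 : pv_trunc x e = (\int[leb]_t (f t)%:E)%E.
  rewrite -(integral_sub x mfE) /pv_trunc integral_mkcond; apply: eq_integral => y _.
  rewrite /patch /f /sel opprB addrCA subrr addr0.
  have -> : (y \in [set z : R | e < `|x - z|]) = (e < `|x - y|) by apply/idP/idP; rewrite inE.
  by case: (e < `|x - y|); rewrite ?mulr1 ?mulr0 // (_ : point = 0%E).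
have ifs : leb.-integrable setT (EFin \o f).
  pose c := modulus gam e; have c0 : 0 < c by rewrite /c /modulus lt_min ltr01 powR_gt0 // normr_gt0 gt_eqF.
  have i1 := integrableZl measurableT (B / c) mki.
  apply: (le_integrable _ _ _ i1) => //.
  move=> t _; rewrite /= lee_fin [leRHS]ger0_norm ?mulr_ge0 ?invr_ge0 ?(ltW c0) ?modulus_ge0 //.
  rewrite /f /sel; case: (ltP e `|t|) => et; last by rewrite mulr0 normr0 !mulr_ge0 ?invr_ge0 ?(ltW c0) ?modulus_ge0.
  rewrite mulr1 normrM (ger0_norm (k0 t)) mulrA ler_wpM2r //.
  have h1 : `|u x - u (x - t)| <= B.
    have /andP[a1 a2] := uB x; have /andP[b1 b2] := uB (x - t).
    by rewrite ler_norml; apply/andP; split; lra.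
  apply: le_trans h1 _; rewrite -mulrA ler_peMr // mulrC ler_pdivlMr // mul1r.
  rewrite /c /modulus le_min !ge_min lexx /=; apply/orP; right.
  by apply: powR_nondecr; rewrite ?(ltW gam0) // gtr0_norm // ltW.
have T2 : pv_trunc x e = (\int[leb]_t (f (- t))%:E)%E by rewrite T1 (integral_opp mfE).
have ifsN : leb.-integrable setT (EFin \o (fun t => f (- t))).
  apply/integrableP; split.
    by apply: (measurableT_comp mfE); exact: oppr_measurable.
  have mA : measurable_fun [set: R] (fun t => `|(f t)%:E|%E) by exact: measurableT_comp.
  have /integrableP[_] := ifs.
  by rewrite -(integral_opp mA).
have E : \int[leb]_t (diff2 x t * k t * sel e t) = \int[leb]_t (f t + f (- t)).
  apply: eq_Rintegral => t _; rewrite /f /diff2 /sel k_even normrN opprK; ring.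
have R1 : pv_trunc x e = (\int[leb]_t f t)%:E.
  by rewrite T1 /Rintegral fineK //; exact: integrable_fin_num ifs.
have R2 : pv_trunc x e = (\int[leb]_t f (- t))%:E.
  by rewrite T2 /Rintegral fineK //; exact: integrable_fin_num ifsN.
rewrite E RintegralD //.
have [e1] : (\int[leb]_t f t)%:E = (\int[leb]_t f (- t))%:E by rewrite -R1.
by rewrite -e1 R1; congr (_%:E); field.
Qed.

Lemma pv_cvg x : pv_trunc x @ 0^'+ --> (singular_integral x)%:E.
Proof.
apply: (@cvg_trans _ ((fun e => (2^-1 * \int[leb]_t (diff2 x t * k t * sel e t))%:E) @ 0^'+)).
  by apply: near_eq_cvg; apply: filterS (nbhs_right_gt 0) => e e0; rewrite pv_truncE.
apply: cvg_EFin; first by apply: nearW.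
apply: cvgM; first exact: cvg_cst.
apply/cvg_at_rightP => e_ [e0 ec].
have m1 n : measurable_fun [set: R] (fun t => diff2 x t * k t * sel (e_ n) t).
  by apply: measurable_funM => //; apply: measurable_funM => //; exact: measurable_diff2.
have m2 : measurable_fun [set: R] (fun t => diff2 x t * k t).
  by apply: measurable_funM => //; exact: measurable_diff2.
apply: (dct (mu := leb) m1 m2 _ idom) => [t|n t].
  have [->|t0] := eqVneq t 0.
    have -> : diff2 x 0 = 0 by rewrite /diff2 addr0 subr0; ring.
    by rewrite mul0r; under eq_fun do rewrite mul0r; exact: cvg_cst.
  apply: cvg_near_cst; near=> n; rewrite /sel.
  have -> : e_ n < `|t|.
    by near: n; apply: (cvgr_lt _ ec); rewrite normr_gt0.
  by rewrite mulr1.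
apply: le_trans (_ : `|diff2 x t * k t| <= _).
  by rewrite normrM ler_piMr // /sel; case: (e_ n < `|t|); rewrite ?normr1 ?normr0.
by apply: dom_bound; rewrite k0 lexx.
Unshelve. all: end_near.
Qed.

(* At a zero of [u] the equation makes the integral of a nonnegative function vanish. *)
Lemma zero_propagates x y c0 : 0 < c0 ->
  (forall t, 0 < t -> t <= 1 -> c0 * t `^ (- (1 + 2 * s)) <= k t) ->
  (forall z, u z = 0 -> F z = 0) -> u x = 0 -> `|y - x| < 1 -> u y = 0.
Proof.
move=> c00 k_low F0 ux yx; apply/eqP/negPn/negP => uy.
have uyp : 0 < u y by rewrite lt0r uy; have /andP[] := uB y.
have t0 : 0 < `|y - x|.
  by rewrite normr_gt0 subr_eq0; apply: contraNneq uy => ->; rewrite ux.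
pose h t := u (x + t) + u (x - t).
pose f t := h t * k t.
have ch : continuous h.
  move=> t; apply: cvgD.
    by apply: (@cvg_comp _ _ _ (fun z => x + z) u); [apply: cvgD; [exact: cvg_cst|exact: cvg_id]|exact: cu].
  by apply: (@cvg_comp _ _ _ (fun z => x - z) u); [apply: cvgB; [exact: cvg_cst|exact: cvg_id]|exact: cu].
have h0 t : 0 <= h t.
  by rewrite /h addr_ge0 //; [have /andP[] := uB (x + t)|have /andP[] := uB (x - t)].
have hy : u y <= h `|y - x|.
  have /andP[b1 _] := uB (x + (y - x)); have /andP[b2 _] := uB (x - (y - x)).
  have b3 : x + (y - x) = y by ring.
  by rewrite /h; case: (ger0P (y - x)) => _; rewrite ?opprK b3; rewrite b3 in b1; lra.
have /cvgrPdist_le/(_ (u y / 2))/(_ (divr_gt0 uyp (ltr0n _ 2)))/nbhs_ballP[d /= d0 Hd] := ch `|y - x|.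
set t1 := `|y - x| in yx t0 hy Hd *.
pose d' := Num.min d (Num.min (1 - t1) t1).
have d'0 : 0 < d' by rewrite !lt_min d0 t0 subr_gt0 yx.
have [da [db dc]] : d' <= d /\ d' <= 1 - t1 /\ d' <= t1.
  by rewrite !ge_min !lexx !orbT.
pose S : set R := [set` `]t1 - d', t1 + d'[].
have lS : leb S = (2 * d')%:E.
  apply: etrans (lebesgue_itvoo _) _; first by lra.
  by congr (_%:E); ring.
have mh : measurable_fun [set: R] h by exact: continuous_measurable_fun.
have mf : measurable_fun [set: R] f by exact: measurable_funM.
have f0 t : 0 <= f t by rewrite mulr_ge0.
have cc0 : 0 <= u y / 2 * c0 by rewrite mulr_ge0 ?divr_ge0 // ltW.
have Sc t : S t -> u y / 2 * c0 <= f t.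
  rewrite /S /= in_itv /= => /andP[h1 h2].
  have tp : 0 < t by lra.
  have tl : t <= 1 by lra.
  apply: ler_pM; rewrite ?divr_ge0 ?(ltW c00) ?(ltW uyp) //.
    have tb : ball t1 d t.
      by rewrite /ball /= ltr_norml; apply/andP; split; lra.
    have := Hd t tb; rewrite /=.
    by rewrite ler_norml => /andP[h3 h4]; lra.
  apply: le_trans (k_low t tp tl); rewrite ler_peMr ?(ltW c00) //.
  by apply: powR_ge1 => //; rewrite oppr_le0 addr_ge0 // mulr_ge0 // ltW.
have := @integral_ge_cst _ _ R leb S _ _ (2 * d') (measurable_itv _) lS mf f0 cc0 Sc.
have If : leb.-integrable setT (EFin \o f).
  have := integrableZl measurableT (-1) (diff2_integrable x).
  by apply: eq_integrable => // t _; rewrite /= -EFinM /f /h /diff2 ux; congr (_%:E); ring.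
have : \int[leb]_t f t = 0.
  have -> : \int[leb]_t f t = \int[leb]_t (-1 * (diff2 x t * k t)).
    by apply: eq_Rintegral => t _; rewrite /f /h /diff2 ux; ring.
  rewrite RintegralZl //; last exact: diff2_integrable.
  have := pointwise_equation x; rewrite F0 // ux mulr0 subr0 /singular_integral => /eqP.
  by rewrite mulf_eq0 invr_eq0 pnatr_eq0 /= => /eqP ->; rewrite mulr0.
rewrite /Rintegral -{2}(fineK (integrable_fin_num measurableT If)) => ->.
by rewrite lee_fin leNgt => /negP; apply; rewrite !mulr_gt0.
Qed.

End pointwise.

Section real_kernel.
Context {R : realType}.
Local Notation leb := (@lebesgue_measure R).
Variables (k : R -> R) (A p s c0 C1 : R).
Hypothesis ck : cone k.
Hypothesis A_gt0 : 0 < A.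
Hypothesis p_gt1 : 1 < p.
Hypothesis s_gt0 : 0 < s.
Hypothesis s_lt1 : s < 1.
Hypothesis p_sub : s < 2^-1 -> (p + 1) * (2^-1 - s) < 1.
Hypothesis c0_gt0 : 0 < c0.
Hypothesis k_low : forall t, 0 < t -> t <= 1 -> c0 * t `^ (- (1 + 2 * s)) <= k t.
Hypothesis C1_ge0 : 0 <= C1.
Hypothesis k_up : forall t, t != 0 -> k t <= C1 * pw (1 + 2 * s) 2 t.

Let mk : measurable_fun [set: R] k := measurable_cone ck.
Let k0 t : 0 <= k t. Proof. by have [] := ck. Qed.
Let k_even t : k (- t) = k t. Proof. by have [] := ck. Qed.

Definition weak_sol (v : R -> R) := forall phi, inH k phi ->
  leb.-integrable setT (EFin \o (fun x => v x `^ p * phi x)) /\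
  Q k A v phi = \int[leb]_x (v x `^ p * phi x).

Lemma subcritical_order : exists sg, [/\ 0 < sg, sg < 2^-1, (p + 1) * (2^-1 - sg) < 1 &
  forall t, 0 < t -> t <= 1 -> c0 * t `^ (- (1 + 2 * sg)) <= k t].
Proof.
have [s2|s2] := ltP s 2^-1; first by exists s; split => //; exact: p_sub.
have p1 : 0 < p + 1 by have := p_gt1; lra.
have p11 : (p + 1)^-1 < 1 by rewrite invf_lt1 //; have := p_gt1; lra.
have p10 : 0 < (p + 1)^-1 by rewrite invr_gt0.
exists (2^-1 - 2^-1 * (p + 1)^-1); split; try lra.
  have -> : 2^-1 - (2^-1 - 2^-1 * (p + 1)^-1) = 2^-1 * (p + 1)^-1 by ring.
  by rewrite mulrCA divff ?gt_eqF // mulr1 invf_lt1 // ltr1n.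
move=> t t0 t1; apply: le_trans (k_low t0 t1); rewrite ler_pM2l //.
by apply: ger_powR; [rewrite t0 t1|lra].
Qed.

Lemma admissible_exists : exists w0, [/\ cone w0, inH k w0 & Jp p w0 = 1%:E].
Proof.
have p1 : 0 < p + 1 by have := p_gt1; lra.
pose w : R -> R := tent 0 1.
have cw : cone w := tent_cone 1.
have hw : inH k w := tent_inH ck s_gt0 s_lt1 C1_ge0 k_up 0 ltr01.
have w0 x : 0 <= w x by exact: tent_ge0.
have wB x : w x <= 1 by rewrite /w /tent subr0 ge_max ler01 andbT gerBl normr_ge0.
have mw : measurable_fun [set: R] w := measurable_cone cw.
have mwp : measurable_fun [set: R] (fun x => w x `^ (p + 1)) by exact: measurable_powRl.
have iw : leb.-integrable setT (EFin \o (fun x => w x `^ (p + 1))).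
  by apply: (cone_bounded_powR cw hw.1 wB); have := p_gt1; lra.
pose J := \int[leb]_x (w x `^ (p + 1)).
have JE : (\int[leb]_x (w x `^ (p + 1))%:E = J%:E)%E.
  by rewrite /J /Rintegral fineK //; exact: integrable_fin_num iw.
have J0 : 0 < J.
  pose S : set R := [set` `]0, 2^-1[].
  have lS : leb S = (2^-1)%:E.
    by apply: etrans (lebesgue_itvoo _) _; rewrite ?subr0 // invr_ge0.
  have := @integral_ge_cst _ _ R leb S (fun x => w x `^ (p + 1)) (2^-1 `^ (p + 1)) 2^-1 (measurable_itv _) lS mwp.
  rewrite JE lee_fin => H; apply: lt_le_trans (H _ _ _).
  - by rewrite mulr_gt0 // powR_gt0.
  - by move=> x; exact: powR_ge0.
  - exact: powR_ge0.
  - move=> x; rewrite /S /= in_itv /= => /andP[x0 x1].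
    apply: powR_nondecr; rewrite ?(ltW p1) //.
    by rewrite /w /tent subr0 gtr0_norm // le_max; apply/orP; left; lra.
pose c := J `^ (- (p + 1)^-1).
have c0' : 0 < c by exact: powR_gt0.
have [_ we wm] := cw.
exists (fun x => c * w x); split.
- by split => [x|x|x y x0 xy]; rewrite ?we ?mulr_ge0 ?(ltW c0') // ler_pM2l // wm.
- exact: inHZ.
- rewrite /Jp; have mE : measurable_fun [set: R] (fun x => (w x `^ (p + 1))%:E) by exact/measurable_EFinP.
  transitivity (\int[leb]_x ((c `^ (p + 1))%:E * (w x `^ (p + 1))%:E))%E.
    by apply: eq_integral => x _; rewrite powRM ?(ltW c0') // EFinM.
  rewrite ge0_integralZl //; last 2 first.
  - by move=> x _; rewrite lee_fin powR_ge0.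
  - by rewrite lee_fin powR_ge0.
  rewrite JE -EFinM /c -powRrM mulNr mulVf ?gt_eqF //; congr (_%:E).
  by rewrite powRN powRr1 ?(ltW J0) // mulVf // gt_eqF.
Qed.

Lemma weak_solution_exists : exists v, [/\ cone v, inH k v, weak_sol v,
  exists B, forall x, x != 0 -> v x <= B & exists2 x, x != 0 & 0 < v x].
Proof.
have [sg [sg0 sg2 psg klow]] := subcritical_order.
have [u [cu hu Ju Qu umin]] := minimizer mk k0 k_even A_gt0 p_gt1 sg2 psg sg0 c0_gt0 klow admissible_exists.
have ik := truncated_kernel_integrable ck C1_ge0 k_up.
have EL phi := euler_lagrange ck ik A_gt0 p_gt1 cu hu Ju Qu umin (phi := phi).
have [c c00 [cv hv ev]] := rescale_solution cu hu p_gt1 Qu EL.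
have [B HB] := bounded_solution ck A_gt0 p_gt1 sg2 psg sg0 c0_gt0 klow cv hv ev.
exists (fun x => c * u x); split => //; first by exists B.
apply: contrapT => H.
have u00 x : x != 0 -> u x = 0.
  move=> x0; apply/eqP; rewrite eq_le; have [-> _ _] := cu; rewrite andbT leNgt; apply/negP => ux.
  by apply: H; exists x => //; rewrite mulr_gt0.
have : Jp p u = 0%E.
  rewrite /Jp; have mu_ := measurable_cone cu.
  rewrite (@integral_eq_off0 R _ (fun=> 0%E)) ?integral0 //.
    by apply/measurable_EFinP; exact: measurable_powRl.
  by move=> x x0; rewrite u00 // powR0 // gt_eqF //; have := p_gt1; lra.
by rewrite Ju => -[] /eqP; rewrite oner_eq0.
Qed.

Lemma continuous_representative : exists v B, [/\ cone v, inH k v, weak_sol v,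
  (forall x, 0 <= v x <= B) & exists x, 0 < v x] /\
  ((forall x, v x <= v 0) /\ (forall d, 0 < d -> exists2 x, 0 < x & v 0 - d < v x)).
Proof.
have [v [cv hv ev [B vB] [x1 x10 vx1]]] := weak_solution_exists.
have [v0 ve vm] := cv.
pose E : set R := [set v x | x in [set x : R | 0 < x]].
have supE : has_sup E.
  split; first by exists (v 1), 1 => //=.
  by exists B => _ [x /= x0 <-]; apply: vB; rewrite gt_eqF.
pose w x := if x == 0 then sup E else v x.
have wv x : x != 0 -> w x = v x by move=> x0; rewrite /w (negbTE x0).
have vE x : x != 0 -> v x <= sup E.
  move=> x0; rewrite -(cone_norm x cv); apply: (sup_ubound supE.2).
  by exists `|x| => //=; rewrite normr_gt0.
have mv := measurable_cone cv.
have E0 : 0 <= sup E by apply: le_trans (v0 1) (vE 1 _); rewrite oner_neq0.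
have cw : cone w.
  split => [x|x|x y x0 xy]; rewrite /w.
  - by case: ifP.
  - by rewrite oppr_eq0 ve.
  - by rewrite !gt_eqF // ?(lt_le_trans x0) // vm.
have mw := measurable_cone cw.
have [hw ew] := form_eq_off0 mk A hv mw wv.
have w00 : w 0 = sup E by rewrite /w eqxx.
have wE x : w x <= sup E by rewrite /w; case: eqP => // /eqP x0; exact: vE.
exists w, (sup E); split; last first.
  split => [x|d d0]; first by rewrite w00.
  rewrite w00; have [_ [x /= x0 <-] h] := sup_adherent d0 supE.
  by exists x => //; rewrite wv // gt_eqF.
split => //.
- move=> phi hp; have mp := inH_meas hp; have [i1 e1] := ev phi hp.
  have mE1 : measurable_fun [set: R] (fun x => (v x `^ p * phi x)%:E).
    by apply/measurable_EFinP; apply: measurable_funM => //; exact: measurable_powRl.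
  have mE2 : measurable_fun [set: R] (fun x => (w x `^ p * phi x)%:E).
    by apply/measurable_EFinP; apply: measurable_funM => //; exact: measurable_powRl.
  split; last first.
    rewrite (ew phi hp) e1 /Rintegral; congr fine; apply/esym/(integral_eq_off0 mE2 mE1) => x x0.
    by rewrite wv.
  have /integrableP[_ f1] := i1; apply/integrableP; split; first exact: mE2.
  have mA1 : measurable_fun [set: R] (fun x => `|(v x `^ p * phi x)%:E|%E) by exact: measurableT_comp.
  have mA2 : measurable_fun [set: R] (fun x => `|(w x `^ p * phi x)%:E|%E) by exact: measurableT_comp.
  by rewrite (integral_eq_off0 mA2 mA1) // => x x0; rewrite wv.
- by move=> x; rewrite wE; have [-> _ _] := cw.
- by exists x1; rewrite wv.
Qed.

Theorem real_kernel_solution : exists v, [/\ inH k v, weak_sol v, continuous v,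
  forall x, 0 < v x &
  forall x, pv_trunc k v x @ 0^'+ --> (v x `^ p - A * v x)%:E].
Proof.
have [v [B [[cv hv ev vB [x1 vx1]] [v00 v0s]]]] := continuous_representative.
have p0 : 0 < p by have := p_gt1; lra.
have mv := measurable_cone cv.
have B0 : 0 <= B by have /andP[] := vB 0; exact: le_trans.
pose F x := v x `^ p; pose L := p * B `^ (p - 1).
have L0 : 0 <= L by rewrite mulr_ge0 ?powR_ge0 // ltW.
have lipF x y : `|F x - F y| <= L * `|v x - v y| by exact: powR_lipschitz.
have F0 x : 0 <= F x by exact: powR_ge0.
have Fz x : v x = 0 -> F x = 0 by move=> vx; rewrite /F vx powR0 // gt_eqF.
have mF : measurable_fun [set: R] F by exact: measurable_powRl.
have hF : Ltwo leb F.
  apply: (Ltwo_le (mu := leb) mF (LtwoZ L hv.1)) => x.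
  rewrite normrM !ger0_norm //; last by have /andP[] := vB x.
  have := powR_lipschitz p_gt1 (vB x) (_ : 0 <= 0 <= B); rewrite lexx B0 => /(_ isT).
  rewrite powR0 ?gt_eqF // !subr0 !ger0_norm ?powR_ge0 //; by have /andP[] := vB x.
have eF phi : inH k phi -> Q k A v phi = ip leb F phi by move=> /ev [].
have A0 := ltW A_gt0.
have q0 : 0 < 4^-1 :> R by rewrite invr_gt0.
have q1 : 4^-1 < 1 :> R by rewrite invf_lt1 // ltr1n.
have [C C0 HC] := incr_decay ck A0 s_gt0 c0_gt0 k_low hv hF L0 lipF eF q0 q1.
have cont : continuous v.
  apply: (@cone_continuous R v C 4^-1) => //; first exact: hv.1.
  by rewrite ltf_pV2 ?posrE // ltr_nat.
have [Cs Cs0 HCs] := second_difference ck A0 s_gt0 s_lt1 c0_gt0 k_low hv hF L0 lipF eF cont.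
have contF : continuous F.
  move=> x; apply/cvgrPdist_lt => e e0; have L1 : 0 < L + 1 by rewrite ltr_wpDl.
  have /cvgrPdist_lt/(_ (e / (L + 1)) (divr_gt0 e0 L1)) := cont x.
  apply: filterS => y hy; apply: le_lt_trans (lipF x y) _.
  have : L * `|v x - v y| <= (L + 1) * `|v x - v y| by rewrite ler_wpM2r // lerDl.
  by move=> /le_lt_trans; apply; rewrite mulrC -ltr_pdivlMr.
have FB x : `|F x| <= B `^ p.
  rewrite ger0_norm //; apply: powR_nondecr; rewrite ?(ltW p0) //; by have /andP[] := vB x.
have gam : 2 * s < 2 * s + (1 - s) / 4 by have := s_lt1; lra.
have pe := pointwise_equation ck A_gt0 s_gt0 s_lt1 C1_ge0 k_up hv cont contF vB FB Cs0 gam HCs eF.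
have pv := pv_cvg ck s_gt0 C1_ge0 k_up cont vB Cs0 gam HCs.
have zp := zero_propagates ck A_gt0 s_gt0 s_lt1 C1_ge0 k_up hv cont contF vB FB Cs0 gam HCs eF c0_gt0 k_low Fz.
exists v; split => //; last by move=> x; rewrite -pe; exact: pv.
move=> x; rewrite lt0r; have /andP[-> _] := vB x; rewrite andbT; apply/negP => /eqP vx.
have vN (z : R) : v z = 0 -> v `|z| = 0 by rewrite cone_norm.
have down n (z : R) : 0 <= z -> z <= n%:R / 2 -> v z = 0 -> v 0 = 0.
  elim: n z => [|n IH] z z0 zn vz.
    have zz : z = 0 by rewrite mul0r in zn; apply/eqP; rewrite eq_le z0 zn.
    by rewrite zz in vz.
  have [zs|zs] := leP z 2^-1.
    apply: zp vz _; rewrite sub0r normrN ger0_norm //; lra.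
  apply: (IH (z - 2^-1)); [lra| |].
    by move: zn; rewrite -natr1 mulrDl mul1r; lra.
  apply: zp vz _.
  have -> : z - 2^-1 - z = - 2^-1 by ring.
  by rewrite normrN ger0_norm ?invr_ge0 // invf_lt1 // ltr1n.
have v0 : v 0 = 0.
  apply: (down (2 * (Num.trunc `|x|).+1)%N `|x|) => //; last exact: vN.
  by rewrite natrM mulrAC divff // mul1r ltW // truncnS_gt.
by have := v00 x1; rewrite v0 leNgt vx1.
Qed.

End real_kernel.

(** * Iterated integrals *)

Section iterated.
Context {R : realType}.
Local Notation leb := (@lebesgue_measure R).
Implicit Types (f g : (nat -> R) -> \bar R) (l : seq nat) (y : nat -> R).

Definition upd y (i : nat) (x : R) : nat -> R := fun m => if m == i then x else y m.

Fixpoint intL l f y : \bar R :=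
  if l is i :: l' then (\int[leb]_(x in [set: R]) intL l' f (upd y i x))%E else f y.

Lemma upd_comm y i j x z : i != j -> upd (upd y i x) j z = upd (upd y j z) i x.
Proof.
move=> ij; apply/funext => m; rewrite /upd.
by case: (eqVneq m j) => // ->; rewrite eq_sym (negbTE ij).
Qed.

Lemma intL_upd l f y i x : i \notin l -> intL l (fun z => f (upd z i x)) y = intL l f (upd y i x).
Proof.
elim: l y => //= j l IH y; rewrite inE negb_or => /andP[ij il].
by apply: eq_integral => z _; rewrite IH // upd_comm // eq_sym.
Qed.

Lemma intRnE n f : intRn n f = intL (rev (iota 0 n)) f (fun=> 0).
Proof.
elim: n f => // n IH f.
rewrite -addn1 iotaD rev_cat /= add0n addn1 /=.
apply: eq_integral => x _; rewrite (IH (fun z => f (upd z n x))) intL_upd //.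
by rewrite mem_rev mem_iota add0n ltnn andbF.
Qed.

(* Measurability along every measurable family of coordinates: this avoids
   choosing a sigma-algebra on [nat -> R]. *)
Definition cmeas f := forall d (T : measurableType d) (c : T -> nat -> R),
  (forall i, measurable_fun [set: T] (fun w => c w i)) ->
  measurable_fun [set: T] (fun w => f (c w)).

Lemma cmeas_intL l f : cmeas f -> (forall y, 0 <= f y)%E ->
  cmeas (intL l f) /\ (forall y, 0 <= intL l f y)%E.
Proof.
move=> mf f0; elim: l => [//|i l [ml l0]]; split => /= [d T c mc|y]; last first.
  by apply: integral_ge0 => x _; exact: l0.
have m : measurable_fun [set: T * R] (fun z : T * R => intL l f (upd (c z.1) i z.2)).
  apply: ml => j; rewrite /upd; case: (j == i); first exact: measurable_snd.
  by apply: (measurableT_comp (mc j)); exact: measurable_fst.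
exact: (@measurable_fun_fubini_tonelli_F _ _ _ _ R leb _ m (fun z => l0 _)).
Qed.

Lemma intL_swap i j l f y : i != j -> cmeas f -> (forall y, 0 <= f y)%E ->
  intL [:: i, j & l] f y = intL [:: j, i & l] f y.
Proof.
move=> ij mf f0 /=; have [ml l0] := cmeas_intL l mf f0.
have m : measurable_fun [set: R * R] (fun z : R * R => intL l f (upd (upd y i z.1) j z.2)).
  apply: ml => m; rewrite /upd; case: (m == j); first exact: measurable_snd.
  by case: (m == i); [exact: measurable_fst|exact: measurable_cst].
rewrite (tonelliC m (fun z => l0 _)) /=.
by apply: eq_integral => z _; apply: eq_integral => x _; rewrite upd_comm.
Qed.

Lemma intL_front j l f y : uniq l -> j \in l -> cmeas f -> (forall y, 0 <= f y)%E ->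
  intL l f y = intL (j :: rem j l) f y.
Proof.
move=> + + mf f0; elim: l y => // i l IH y /= /andP[il ul].
rewrite inE eq_sym; case: (eqVneq i j) => [-> //|ij /= jl].
rewrite -/(intL [:: j, i & rem j l] f y) -(intL_swap _ _ ij) //=.
by apply: eq_integral => x _; exact: IH.
Qed.

Lemma intL_le l f g y : cmeas f -> (forall y, 0 <= f y)%E -> cmeas g ->
  (forall y, f y <= g y)%E -> (intL l f y <= intL l g y)%E.
Proof.
move=> mf f0 mg fg; have g0 z : (0 <= g z)%E by exact: le_trans (fg z).
elim: l y => //= i l IH y.
have [mlf lf0] := cmeas_intL l mf f0; have [mlg lg0] := cmeas_intL l mg g0.
have mu m : measurable_fun [set: R] (fun x => upd y i x m).
  by rewrite /upd; case: (m == i).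
apply: ge0_le_integral => //.
- exact: (mlf _ _ _ mu).
- exact: (mlg _ _ _ mu).
Qed.

Lemma intLZ l f y (c : R) : cmeas f -> (forall y, 0 <= f y)%E -> 0 <= c ->
  intL l (fun y => c%:E * f y)%E y = (c%:E * intL l f y)%E.
Proof.
move=> mf f0 c0; elim: l y => //= i l IH y.
have [mlf lf0] := cmeas_intL l mf f0.
have mu m : measurable_fun [set: R] (fun x => upd y i x m).
  by rewrite /upd; case: (m == i).
have mi : measurable_fun [set: R] (fun x => intL l f (upd y i x)) by exact: (mlf _ _ _ mu).
rewrite -ge0_integralZl //; by apply: eq_integral => x _; exact: IH.
Qed.

End iterated.

Section one_dim.
Context {R : realType}.
Local Notation leb := (@lebesgue_measure R).

Lemma japanese_integral (r : R) : 2^-1 < r -> exists2 C : R, 0 <= C &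
  forall tau b : R, 0 < tau ->
  (\int[leb]_x ((tau + (x - b) ^+ 2) `^ (- r))%:E <= (C * tau `^ (2^-1 - r))%:E)%E.
Proof.
move=> r2; have r0 : 0 < r by rewrite (lt_trans _ r2) // invr_gt0.
have c1 : 0 < 2 * r - 1 by lra.
pose C := 2 * (1 + (2 * r - 1)^-1).
exists C => [|tau b t0]; first by rewrite mulr_ge0 // addr_ge0 // invr_ge0 ltW.
pose f x := ((tau + x ^+ 2) `^ (- r))%:E.
have mf : measurable_fun [set: R] f.
  apply/measurable_EFinP; apply: measurable_powRl; exact: measurable_funD.
rewrite (integral_shift (- b) mf).
have f0 x : (0 <= f x)%E by rewrite lee_fin powR_ge0.
rewrite (ge0_integral_even mf f0); last by move=> x; rewrite /f sqrrN.
pose d := Num.sqrt tau; have d0 : 0 < d by rewrite sqrtr_gt0.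
have dE : d = tau `^ 2^-1 by rewrite /d powR12_sqrt // ltW.
pose P1 : set R := [set` `]0%R, d]]; pose P2 : set R := [set` `]d, +oo[].
have mP1 : measurable P1 by exact: measurable_itv.
have mP2 : measurable P2 by exact: measurable_itv.
have -> : [set` `]0%R, +oo[] = P1 `|` P2.
  apply/seteqP; split => x; rewrite /P1 /P2 /= !in_itv/= !andbT.
    by move=> x0; have [x1|x1] := lerP x d; [left; rewrite x0|right].
  by case=> [/andP[]|]//; apply: lt_trans.
rewrite ge0_integral_setU //; last 2 first.
- exact: measurable_funTS.
- apply/disj_setPS => x []; rewrite /P1 /P2 /= !in_itv/= andbT => /andP[_ x1] /lt_le_trans/(_ x1).
  by rewrite ltxx.
have mP c : measurable_fun [set: R] (fun x : R => (x `^ (- c))%:E).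
  by apply/measurable_EFinP; exact: measurable_powRl.
have pos c x : (0 <= (x `^ (- c))%:E :> \bar R)%E by rewrite lee_fin powR_ge0.
have h1 : (\int[leb]_(x in P1) f x <= (tau `^ (2^-1 - r))%:E)%E.
  apply: (@le_trans _ _ (\int[leb]_(x in P1) ((tau `^ (- r))%:E * (x `^ (- 0))%:E))%E).
    apply: ge0_le_integral => //.
    - exact: measurable_funTS.
    - by apply: measurable_funTS; apply: emeasurable_funM => //; exact: (mP 0).
    - move=> x _; rewrite oppr0 powRr0 mule1 lee_fin; apply: powR_nonincr => //.
        by rewrite oppr_le0 ltW.
      by rewrite lerDl sqr_ge0.
  have mP10 : measurable_fun P1 (fun x : R => (x `^ (- 0))%:E) by apply: measurable_funTS; exact: mP.
  have tr0 : (0 <= (tau `^ (- r))%:E)%E by rewrite lee_fin powR_ge0.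
  rewrite ge0_integralZl //.
  have := integral_powR0 (ltr01 : 0 < 1) d0; rewrite subr0 divr1 powRr1 ?(ltW d0) // => H.
  apply: le_trans (lee_wpmul2l _ H) _; first by rewrite lee_fin powR_ge0.
  by rewrite -EFinM dE mulrC -powRD ?(gt_eqF t0) ?implybT.
have h2 : (\int[leb]_(x in P2) f x <= (tau `^ (2^-1 - r) / (2 * r - 1))%:E)%E.
  have c2 : 1 < 2 * r by lra.
  have := integral_powRy c2 d0 => H.
  apply: (@le_trans _ _ (\int[leb]_(x in [set` `[d, +oo[]) (x `^ (- (2 * r)))%:E)%E).
    apply: (@le_trans _ _ (\int[leb]_(x in P2) (x `^ (- (2 * r)))%:E)%E).
      apply: ge0_le_integral => //; [exact: measurable_funTS|apply: measurable_funTS; exact: mP|].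
      move=> x; rewrite /P2 /= in_itv /= andbT => dx.
      have x0 : 0 < x by exact: lt_trans dx.
      rewrite lee_fin -mulrN powRrM powR_mulrn ?(ltW x0) //.
      apply: powR_nonincr; rewrite ?oppr_le0 ?(ltW r0) ?exprn_gt0 //.
      by rewrite lerDr ltW.
    apply: ge0_subset_integral => //.
    - by apply: measurable_funTS; exact: mP.
    - by move=> x; rewrite /P2 /= !in_itv/= !andbT => /ltW.
  apply: le_trans H _; rewrite lee_fin ler_pM2r ?invr_gt0 // dE -powRrM.
  by rewrite le_eqVlt; apply/orP; left; apply/eqP; congr (_ `^ _); field.
apply: (@le_trans _ _ (2%:E * ((tau `^ (2^-1 - r))%:E + (tau `^ (2^-1 - r) / (2 * r - 1))%:E))%E).
  by rewrite lee_wpmul2l // leeD.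
rewrite -EFinD -EFinM lee_fin le_eqVlt; apply/orP; left; apply/eqP; rewrite /C; ring.
Qed.

End one_dim.

Section iterated_bounds.
Context {R : realType}.
Local Notation leb := (@lebesgue_measure R).
Implicit Types (f g : (nat -> R) -> \bar R) (l : seq nat) (y : nat -> R).

Lemma eq_intL l f g y : (forall z, (forall m, m \notin l -> z m = y m) -> f z = g z) ->
  intL l f y = intL l g y.
Proof.
elim: l y => /= [|i l IH] y fg; first exact: fg.
apply: eq_integral => x _; apply: IH => z zy; apply: fg => m.
rewrite inE negb_or => /andP[mi ml].
by rewrite zy // /upd (negbTE mi).
Qed.

Variables (j : nat) (a : nat -> R).

Definition devsq l y : R := \sum_(i <- l) (y i - a i * y j) ^+ 2.

Lemma measurable_devsq l d (T : measurableType d) (c : T -> nat -> R) :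
  (forall i, measurable_fun [set: T] (fun w => c w i)) ->
  measurable_fun [set: T] (fun w => devsq l (c w)).
Proof.
move=> mc; apply: measurable_sum => i; apply: measurable_funX.
by apply: measurable_funB => //; exact: measurable_funM.
Qed.

Lemma devsq_ge0 l y : 0 <= devsq l y.
Proof. by apply: sumr_ge0 => i _; exact: sqr_ge0. Qed.

Lemma cmeas_devsq_pow l tau r : cmeas (fun y => ((tau + devsq l y) `^ (- r))%:E).
Proof.
move=> d T c mc; apply/measurable_EFinP.
apply: (measurableT_comp (f := fun x : R => x `^ (- r))); first exact: measurable_powR.
by apply: measurable_funD => //; exact: measurable_devsq.
Qed.

Lemma intL_devsq_upper l r : uniq l -> j \notin l -> (size l)%:R / 2 + 2^-1 < r + 2^-1 ->
  exists2 C : R, 0 <= C & forall tau y, 0 < tau ->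
  (intL l (fun y => ((tau + devsq l y) `^ (- r))%:E) y <= (C * tau `^ ((size l)%:R / 2 - r))%:E)%E.
Proof.
elim: l r => [|i l IH] r /=.
  move=> _ _ _; exists 1 => // tau y t0; rewrite /devsq big_nil addr0 mul0r add0r mul1r //.
move=> /andP[il ul]; rewrite inE negb_or => /andP[ij jl] hr.
have sl : (size l).+1%:R = (size l)%:R + 1 :> R by rewrite natr1.
rewrite sl in hr *.
have [C C0 HC] := IH r ul jl (ltac:(lra)).
have r2 : 2^-1 < r - (size l)%:R / 2 by lra.
have [C' C'0 HC'] := japanese_integral r2.
exists (C * C') => [|tau y t0]; first exact: mulr_ge0.
have tp x : 0 < tau + (x - a i * y j) ^+ 2 by rewrite ltr_wpDr ?sqr_ge0.
apply: (@le_trans _ _ (\int[leb]_x (C%:E * ((tau + (x - a i * y j) ^+ 2) `^ (- (r - (size l)%:R / 2)))%:E))%E).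
  have mu m : measurable_fun [set: R] (fun x => upd y i x m) by rewrite /upd; case: (m == i).
  have [ml l0] := cmeas_intL l (cmeas_devsq_pow (i :: l) tau r) (fun y => powR_ge0 _ _ : (0 <= _%:E)%E).
  apply: ge0_le_integral => //.
  - exact: (ml _ _ _ mu).
  - apply: emeasurable_funM => //; apply/measurable_EFinP; apply: measurable_powRl.
    by apply: measurable_funD => //; apply: measurable_funX; exact: measurable_funB.
  - move=> x _.
    rewrite (@eq_intL l _ (fun z => ((tau + (x - a i * y j) ^+ 2 + devsq l z) `^ (- r))%:E)).
      apply: le_trans (HC _ _ (tp x)) _; rewrite -EFinM lee_fin opprB //.
    move=> z zy; rewrite /devsq big_cons addrA (zy i il) (zy j jl) /upd eqxx (negbTE ij) //.
rewrite ge0_integralZl //; last 2 first.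
- apply/measurable_EFinP; apply: measurable_powRl.
  by apply: measurable_funD => //; apply: measurable_funX; exact: measurable_funB.
- by move=> x _; rewrite lee_fin powR_ge0.
apply: le_trans (lee_wpmul2l _ (HC' tau (a i * y j) t0)) _; first by rewrite lee_fin.
rewrite -EFinM lee_fin mulrA le_eqVlt; apply/orP; left; apply/eqP; congr (_ * _ `^ _).
by field.
Qed.

Definition devbox w l y : bool := all (fun i => `|y i - a i * y j| <= w) l.

Lemma cmeas_devbox w l : cmeas (fun y => (devbox w l y)%:R%:E).
Proof.
move=> d T c mc; apply/measurable_EFinP.
have -> : (fun t => (devbox w l (c t))%:R) = (fun t => if devbox w l (c t) then 1 else 0 : R).
  by apply/funext => t; case: devbox.
apply: measurable_fun_ifT => //.
elim: l => [|i l IH]; first exact: measurable_cst.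
apply: measurable_and => //; apply: measurable_fun_ler => //.
by apply: measurableT_comp => //; apply: measurable_funB => //; exact: measurable_funM.
Qed.

Lemma intL_devbox w l y : 0 <= w -> uniq l -> j \notin l ->
  intL l (fun y => (devbox w l y)%:R%:E) y = ((2 * w) ^+ size l)%:E.
Proof.
move=> w0; elim: l y => [|i l IH] y /=; first by rewrite expr0.
move=> /andP[il ul]; rewrite inE negb_or => /andP[ij jl].
pose I : set R := [set` `[a i * y j - w, a i * y j + w]].
have mI : measurable I by exact: measurable_itv.
have mind : measurable_fun [set: R] (fun x => (\1_I x : R)%:E).
  by apply/measurable_EFinP; exact: measurable_indic.
transitivity (\int[leb]_x (((2 * w) ^+ size l)%:E * (\1_I x)%:E))%E.
  apply: eq_integral => x _.
  rewrite (@eq_intL l _ (fun z => (\1_I x)%:E * (devbox w l z)%:R%:E)%E).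
    rewrite intLZ //; last exact: cmeas_devbox.
    by rewrite IH // muleC.
  move=> z zy; rewrite /devbox /= (zy i il) (zy j jl) /upd eqxx (negbTE ij) -EFinM.
  rewrite indicE; have -> : (x \in I) = (`|x - a i * y j| <= w).
    by apply/idP/idP; rewrite inE /I /= in_itv /= ler_norml => /andP[? ?]; apply/andP; split; lra.
  by case: (`|x - a i * y j| <= w); rewrite ?mul1r ?mul0r.
rewrite ge0_integralZl //; last by rewrite lee_fin exprn_ge0 // mulr_ge0.
rewrite integral_indic // setIT exprSr EFinM; congr (_ * _)%E.
apply: etrans (lebesgue_measure_itv _) _; rewrite /= lte_fin.
case: ltP => h; first by rewrite -EFinB; congr (_%:E); ring.
by congr (_%:E); lra.
Qed.

End iterated_bounds.

(** * Spherical integrals *)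

Section sphere_bounds.
Context {R : realType}.
Local Notation leb := (@lebesgue_measure R).
Implicit Types x : nat -> R.
Variables (N : nat) (s : R) (theta : nat -> R).
Hypothesis N_gt0 : (0 < N)%N.
Hypothesis s_gt0 : 0 < s.
Hypothesis theta_norm : normRn N theta = 1.

Let q : R := (N%:R + 2 * s) / 2.
Let q_gt0 : 0 < q.
Proof. by rewrite divr_gt0 // addr_gt0 ?ltr0n // mulr_gt0. Qed.

Definition nsq (x : nat -> R) : R := \sum_(i < N) x i ^+ 2.
Local Notation dot := (dotRn N theta).

Definition Phi (a : R) (x : nat -> R) : R :=
  if (0 < normRn N x) && (normRn N x <= 1) then (a - 2 * (dot x / normRn N x)) `^ (- q) else 0.

Definition Sint (a : R) : \bar R := (N%:R%:E * intRn N (fun x => (Phi a x)%:E))%E.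

Lemma Phi_ge0 a x : 0 <= Phi a x.
Proof. by rewrite /Phi; case: ifP => // _; exact: powR_ge0. Qed.

Lemma nsq_ge0 x : 0 <= nsq x.
Proof. by apply: sumr_ge0 => i _; exact: sqr_ge0. Qed.

Lemma normRn_sqr x : normRn N x ^+ 2 = nsq x.
Proof. by rewrite /normRn sqr_sqrtr // nsq_ge0. Qed.

Lemma nsq_theta : nsq theta = 1.
Proof. by rewrite -normRn_sqr theta_norm expr1n. Qed.

Lemma nsq_line x c : \sum_(i < N) (x i - c * theta i) ^+ 2 = nsq x - 2 * c * dot x + c ^+ 2.
Proof.
have -> : c ^+ 2 = c ^+ 2 * nsq theta by rewrite nsq_theta mulr1.
rewrite /nsq /dotRn !mulr_sumr -sumrB -big_split /=.
by apply: eq_bigr => i _; ring.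
Qed.

Lemma dot_sqr_le x : dot x ^+ 2 <= nsq x.
Proof.
have : 0 <= \sum_(i < N) (x i - dot x * theta i) ^+ 2 by apply: sumr_ge0 => i _; exact: sqr_ge0.
by rewrite nsq_line expr2; lra.
Qed.

Lemma dot_le_norm x : `|dot x| <= normRn N x.
Proof.
rewrite -(@ler_pXn2r _ 2) ?nnegrE ?sqrtr_ge0 // real_normK ?num_real // normRn_sqr.
exact: dot_sqr_le.
Qed.

Lemma cosine_bounds x : 0 < normRn N x -> -1 <= dot x / normRn N x <= 1.
Proof.
move=> x0; have := dot_le_norm x; rewrite ler_norml => /andP[h1 h2].
by rewrite ler_pdivrMr // mul1r h2 andbT ler_pdivlMr // mulN1r.
Qed.

Lemma cmeas_Phi a : cmeas (fun x => (Phi a x)%:E).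
Proof.
move=> d T c mc; apply/measurable_EFinP.
have mdot : measurable_fun [set: T] (fun w => dot (c w)).
  by apply: measurable_sum => i; exact: measurable_funM.
have mn : measurable_fun [set: T] (fun w => normRn N (c w)).
  apply: (measurableT_comp (@measurable_sqrtR R)).
  by apply: measurable_sum => i; exact: measurable_funX.
apply: measurable_fun_ifT => //.
  by apply: measurable_and; [exact: measurable_fun_ltr|exact: measurable_fun_ler].
apply: (measurableT_comp (f := fun x : R => x `^ (- q))); first exact: measurable_powR.
apply: measurable_funB => //; apply: measurable_funM => //; apply: measurable_funM => //.
have -> : (fun w => (normRn N (c w))^-1) = (fun w => normRn N (c w) `^ (-1)).
  by apply/funext => w; rewrite powR_inv1 // sqrtr_ge0.
by apply: (measurableT_comp (f := fun x : R => x `^ (-1))); first exact: measurable_powR.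
Qed.

Lemma Sint_ge0 a : (0 <= Sint a)%E.
Proof.
rewrite /Sint mule_ge0 ?lee_fin // intRnE.
by have [_] := cmeas_intL (rev (iota 0 N)) (cmeas_Phi a) (fun x => Phi_ge0 a x).
Qed.

Lemma Sint_le a a' : 2 < a -> a <= a' -> (Sint a' <= Sint a)%E.
Proof.
move=> a2 aa; rewrite /Sint lee_wpmul2l ?lee_fin // !intRnE.
apply: intL_le => [|x||x]; rewrite ?lee_fin ?Phi_ge0 //; try exact: cmeas_Phi.
rewrite /Phi; case: ifP => // /andP[x0 _].
have /andP[_ c1] := cosine_bounds x0.
by apply: powR_nonincr; [rewrite oppr_le0 ltW|lra|lra].
Qed.

Lemma Sint_far a : 3 <= a -> (Sint a <= ((a / 15) `^ (- q))%:E * Sint 3)%E.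
Proof.
move=> a3; rewrite /Sint muleCA lee_wpmul2l ?lee_fin // !intRnE.
rewrite -intLZ ?powR_ge0 //; last 2 first.
- exact: cmeas_Phi.
- by move=> y; rewrite lee_fin Phi_ge0.
apply: intL_le => [|x||x]; rewrite -?EFinM ?lee_fin ?Phi_ge0 //.
- exact: cmeas_Phi.
- move=> d T c mc; apply: emeasurable_funM => //; exact: cmeas_Phi.
rewrite /Phi; case: ifP => [/andP[x0 _]|_]; last by rewrite mulr0.
have /andP[cm1 c1] := cosine_bounds x0.
rewrite -powRM ?divr_ge0 //; [|lra|lra].
apply: powR_nonincr; [by rewrite oppr_le0 ltW|apply: mulr_gt0; lra|nra].
Qed.

Lemma intRn_ext f g : f =1 g -> @intRn R N f = intRn N g.
Proof. by move=> fg; congr intRn; apply/funext. Qed.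

Lemma sphere_scale c a : 0 < c -> 2 < a ->
  sphere_int N (fun sg => epowneg `|c * (a - 2 * dot sg)| (- q)) = ((c `^ (- q))%:E * Sint a)%E.
Proof.
move=> c0 a2; rewrite /sphere_int /Sint muleCA; congr (_ * _)%E.
rewrite (@intRn_ext _ (fun x => (c `^ (- q))%:E * (Phi a x)%:E)%E); last first.
  move=> x; rewrite /Phi; case: ifP => [/andP[x0 _]|_]; last by rewrite mule0.
  have -> : dot (fun i => x i / normRn N x) = dot x / normRn N x.
    by rewrite /dotRn mulr_suml; apply: eq_bigr => i _; rewrite mulrA.
  have /andP[cm1 c1] := cosine_bounds x0.
  have p1 : 0 < a - 2 * (dot x / normRn N x) by lra.
  rewrite /epowneg gtr0_norm ?mulr_gt0 // gt_eqF ?mulr_gt0 // powRM ?(ltW c0) ?(ltW p1) //.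
by rewrite !intRnE (intLZ _ _ (cmeas_Phi a) (fun x => Phi_ge0 a x) (powR_ge0 _ _)).
Qed.

Lemma large_coordinate : exists2 j, (j < N)%N & 1 <= N%:R * theta j ^+ 2.
Proof.
apply: contrapT => H.
have lt1 (i : 'I_N) : theta i ^+ 2 < N%:R^-1.
  rewrite ltNge; apply/negP => h; apply: H; exists i => //.
  by rewrite mulrC -ler_pdivrMr ?ltr0n // div1r.
have : \sum_(i < N) theta i ^+ 2 < \sum_(i < N) (N%:R^-1 : R).
  apply: ltr_sum => [|i _]; last exact: lt1.
  by apply/hasP; exists (Ordinal N_gt0); rewrite ?mem_index_enum.
rewrite sumr_const card_ord -[_ *+ N]mulr_natr mulVf ?pnatr_eq0 -?lt0n //.
by have := nsq_theta; rewrite /nsq => ->; rewrite ltxx.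
Qed.

Section coordinates.
Variable j : nat.
Hypothesis jN : (j < N)%N.
Hypothesis jbig : 1 <= N%:R * theta j ^+ 2.

Let l0 := rem j (rev (iota 0 N)).
Let al (i : nat) : R := theta i / theta j.

Let uN : uniq (rev (iota 0 N)). Proof. by rewrite rev_uniq iota_uniq. Qed.
Let jmem : j \in rev (iota 0 N). Proof. by rewrite mem_rev mem_iota. Qed.
Let ul0 : uniq l0. Proof. exact: rem_uniq. Qed.
Let jl0 : j \notin l0. Proof. by rewrite mem_rem_uniqF. Qed.
Let sl0 : (size l0)%:R = N%:R - 1 :> R.
Proof. by rewrite size_rem // size_rev size_iota -subn1 natrB. Qed.
Let tj0 : theta j != 0.
Proof. by apply: contraTneq jbig => ->; rewrite expr0n /= mulr0 -ltNge. Qed.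

Lemma coord_sum (F : nat -> R) : \sum_(i < N) F i = F j + \sum_(i <- l0) F i.
Proof.
have <- : \sum_(i <- rev (iota 0 N)) F i = F j + \sum_(i <- l0) F i by rewrite (big_rem j jmem).
rewrite -(big_mkord xpredT F) /index_iota subn0.
by apply: perm_big; rewrite perm_sym perm_rev.
Qed.

Lemma devsq_sum x : devsq j al l0 x = \sum_(i < N) (x i - al i * x j) ^+ 2.
Proof.
by rewrite (coord_sum (fun i => (x i - al i * x j) ^+ 2)) /al divff // mul1r subrr expr0n /= add0r.
Qed.

Lemma devsq_le x : devsq j al l0 x <= (2 + 2 * N%:R) * (nsq x - dot x ^+ 2).
Proof.
pose z i := x i - dot x * theta i.
have Z : \sum_(i < N) z i ^+ 2 = nsq x - dot x ^+ 2 by rewrite nsq_line; ring.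
have zj : z j ^+ 2 <= nsq x - dot x ^+ 2.
  by rewrite -Z (coord_sum (fun i => z i ^+ 2)) lerDl sumr_ge0 // => i _; exact: sqr_ge0.
have a2 : \sum_(i < N) al i ^+ 2 <= N%:R.
  have -> : \sum_(i < N) al i ^+ 2 = (theta j ^+ 2)^-1.
    transitivity ((theta j ^+ 2)^-1 * nsq theta); last by rewrite nsq_theta mulr1.
    by rewrite /nsq mulr_sumr; apply: eq_bigr => i _; rewrite /al expr_div_n mulrC.
  by rewrite -div1r ler_pdivrMr // exprn_even_gt0.
rewrite devsq_sum.
apply: (@le_trans _ _ (\sum_(i < N) (2 * z i ^+ 2 + 2 * z j ^+ 2 * al i ^+ 2))).
  apply: ler_sum => i _.
  have -> : x i - al i * x j = z i - al i * z j.
    by rewrite /z /al; field.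
  by have := sqr_ge0 (z i + al i * z j); rewrite !expr2; lra.
rewrite big_split /= -!mulr_sumr Z.
have z0 : 0 <= z j ^+ 2 by exact: sqr_ge0.
have n0 : 0 <= N%:R :> R by exact: ler0n.
have : z j ^+ 2 * \sum_(i < N) al i ^+ 2 <= (nsq x - dot x ^+ 2) * N%:R.
  by apply: ler_pM => //; apply: sumr_ge0 => i _; exact: sqr_ge0.
rewrite mulrDl; lra.
Qed.

Let kap : R := (2 + 2 * N%:R)^-1.
Let kap0 : 0 < kap. Proof. by rewrite invr_gt0 ltr_pwDl // mulr_ge0. Qed.
Let kap1 : kap <= 1. Proof. by rewrite invf_le1 ?ltr_pwDl ?mulr_ge0 //; have := ler0n R N; lra. Qed.

(* [2 - 2c >= 1 - c^2] bounds the chord from below by the distance to the axis. *)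
Lemma Phi_upper a x : 2 < a ->
  Phi a x <= ((`|x j| <= 1)%R : nat)%:R * (kap `^ (- q) * (a - 2 + devsq j al l0 x) `^ (- q)).
Proof.
move=> a2; rewrite /Phi; case: ifP => [/andP[x0 x1]|_]; last first.
  by rewrite !mulr_ge0 ?powR_ge0.
have n1 : nsq x <= 1 by rewrite -normRn_sqr exprn_ile1 // ltW.
have n0 : 0 < nsq x by rewrite -normRn_sqr exprn_gt0.
have -> : `|x j| <= 1.
  rewrite -(@ler_pXn2r _ 2) ?nnegrE // expr1n real_normK ?num_real //.
  apply: le_trans n1; rewrite /nsq (coord_sum (fun i => x i ^+ 2)) lerDl.
  by apply: sumr_ge0 => i _; exact: sqr_ge0.
have t0 : 0 <= a - 2 + devsq j al l0 x by rewrite addr_ge0 ?devsq_ge0 // subr_ge0 ltW.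
rewrite mul1r -(powRM _ (ltW kap0) t0).
apply: powR_nonincr; first by rewrite oppr_le0 ltW.
  by rewrite mulr_gt0 // ltr_pwDl ?subr_gt0 ?devsq_ge0.
have d1 := devsq_le x.
have d2 : kap * devsq j al l0 x <= nsq x - dot x ^+ 2.
  by rewrite mulrC ler_pdivrMr ?ltr_pwDl ?mulr_ge0 // mulrC.
set c := dot x / normRn N x.
have cE : c ^+ 2 = dot x ^+ 2 / nsq x by rewrite expr_div_n normRn_sqr.
have d3 : nsq x - dot x ^+ 2 <= 1 - c ^+ 2.
  have -> : 1 - c ^+ 2 = (nsq x - dot x ^+ 2) / nsq x by rewrite cE; field; rewrite gt_eqF.
  rewrite ler_pdivlMr // ler_piMr // subr_ge0; exact: dot_sqr_le.
have d4 := sqr_ge0 (1 - c).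
have d5 : kap * (a - 2) <= a - 2 by rewrite ler_piMl // subr_ge0 ltW.
rewrite mulrDr; move: d4 d3; rewrite !expr2; lra.
Qed.

Lemma Sint_upper_coord : exists2 C : R, 0 <= C & forall a, 2 < a ->
  (Sint a <= (C * (a - 2) `^ (- (2^-1 + s)))%:E)%E.
Proof.
have hr : (size l0)%:R / 2 + 2^-1 < q + 2^-1 by rewrite sl0 /q; have := s_gt0; lra.
have [C C0 HC] := intL_devsq_upper al ul0 jl0 hr.
exists (N%:R * (2 * (kap `^ (- q) * C))) => [|a a2].
  by rewrite !mulr_ge0 // powR_ge0.
rewrite /Sint -[N%:R * _ * _]mulrA EFinM; apply: lee_wpmul2l; first by rewrite lee_fin.
pose G x := (((`|x j| <= 1)%R : nat)%:R * (kap `^ (- q) * (a - 2 + devsq j al l0 x) `^ (- q)))%:E : \bar R.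
have mind d (T : measurableType d) (c : T -> R) : measurable_fun [set: T] c ->
    measurable_fun [set: T] (fun w => (((`|c w| <= 1)%R : nat)%:R : R)).
  move=> mc; have -> : (fun w => (((`|c w| <= 1)%R : nat)%:R : R)) = (fun w => if `|c w| <= 1 then 1 else 0).
    by apply/funext => w; case: (`|c w| <= 1).
  by apply: measurable_fun_ifT => //; apply: measurable_fun_ler => //; exact: measurableT_comp.
have mG : cmeas G.
  move=> d T c mc; apply/measurable_EFinP; apply: measurable_funM; first exact: mind.
  apply: measurable_funM => //.
  by have /measurable_EFinP := cmeas_devsq_pow j al l0 (a - 2) q mc.
have G0 x : (0 <= G x)%E by rewrite lee_fin !mulr_ge0 ?powR_ge0.
rewrite intRnE; apply: (@le_trans _ _ (intL (rev (iota 0 N)) G (fun=> 0))).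
  apply: intL_le => [|x||x]; rewrite ?lee_fin ?Phi_ge0 //; first exact: cmeas_Phi.
  exact: Phi_upper.
rewrite (intL_front _ uN jmem mG G0) /= -/l0.
have t0 : 0 < a - 2 by rewrite subr_gt0.
pose I : set R := [set` `[-1, 1]].
have mI : measurable I by exact: measurable_itv.
have IE (x : R) : (\1_I x : R) = ((`|x| <= 1)%R : nat)%:R.
  rewrite indicE; congr ((nat_of_bool _)%:R); apply/idP/idP; rewrite ?inE /I /= in_itv /= -ler_norml //.
pose D := kap `^ (- q) * C * (a - 2) `^ ((size l0)%:R / 2 - q).
have D0 : 0 <= D by rewrite !mulr_ge0 ?powR_ge0.
have mu m : measurable_fun [set: R] (fun x : R => upd (fun=> 0 : R) j x m).
  by rewrite /upd; case: (m == j).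
have [mlG lG0] := cmeas_intL l0 mG G0.
have mi : measurable_fun [set: R] (fun x : R => (\1_I x : R)%:E).
  by apply/measurable_EFinP; exact: measurable_indic.
apply: (@le_trans _ _ (\int[leb]_x (D%:E * (\1_I x)%:E))%E).
  apply: ge0_le_integral => //.
  - exact: (mlG _ _ _ mu).
  - exact: emeasurable_funM.
  - move=> x _.
    rewrite (@eq_intL _ l0 _ (fun z => (((`|x| <= 1)%R : nat)%:R * kap `^ (- q))%:E * ((a - 2 + devsq j al l0 z) `^ (- q))%:E)%E).
      rewrite intLZ; last 3 first.
      - exact: cmeas_devsq_pow.
      - by move=> z; rewrite lee_fin powR_ge0.
      - by rewrite mulr_ge0 ?powR_ge0.
      rewrite IE; case: (`|x| <= 1); last by rewrite mul0r mul0e mule0.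
      rewrite mul1r mule1 /D -mulrA EFinM; apply: lee_wpmul2l; first by rewrite lee_fin powR_ge0.
      exact: HC.
    by move=> z zy; rewrite /G (zy j jl0) /upd eqxx -EFinM mulrA.
rewrite ge0_integralZl //.
have -> : (\int[leb]_x (\1_I x)%:E = 2%:E)%E.
  rewrite integral_indic // setIT; apply: etrans (lebesgue_measure_itv _) _.
  by rewrite /= lte_fin ifT; [rewrite -EFinB; congr (_%:E); ring|lra].
rewrite -EFinM lee_fin /D le_eqVlt; apply/orP; left; apply/eqP.
have -> : (size l0)%:R / 2 - q = - (2^-1 + s) by rewrite sl0 /q; field.
ring.
Qed.

Lemma Sint_lower_coord : exists2 c : R, 0 < c & forall a, 2 < a -> a <= 5 ->
  ((c * (a - 2) `^ (- (2^-1 + s)))%:E <= Sint a)%E.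
Proof.
have Np : 0 < N%:R :> R by rewrite ltr0n.
pose dl : R := (16 * N%:R)^-1.
have dl0 : 0 < dl by rewrite invr_gt0 mulr_gt0.
have ntj : 0 < `|theta j| by rewrite normr_gt0.
exists (N%:R * (2 `^ (- q) * (2 * dl) ^+ size l0 * (`|theta j| / 4))).
  rewrite mulr_gt0 // mulr_gt0 ?divr_gt0 // mulr_gt0 ?powR_gt0 //.
  by rewrite exprn_gt0 // mulr_gt0.
move=> a a2 a5; pose tau := a - 2; have t0 : 0 < tau by rewrite subr_gt0.
have t3 : tau <= 3 by rewrite /tau; lra.
pose w := dl * Num.sqrt tau; have w0 : 0 <= w by rewrite mulr_ge0 ?sqrtr_ge0 // ltW.
rewrite /Sint -[N%:R * _ * _]mulrA EFinM; apply: lee_wpmul2l; first by rewrite lee_fin.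
pose V := (2 * tau) `^ (- q).
have V0 : 0 <= V by exact: powR_ge0.
pose m0 := 3 / 8 * theta j; pose r0 := `|theta j| / 8.
pose sel (z : R) : R := ((`|z - m0| <= r0)%R : nat)%:R.
pose G x : \bar R := ((V * sel (x j))%:E * ((devbox j al w l0 x)%:R)%:E)%E.
have msel d (T : measurableType d) (c : T -> R) : measurable_fun [set: T] c ->
    measurable_fun [set: T] (fun t => sel (c t)).
  move=> mc; have -> : (fun t => sel (c t)) = (fun t => if `|c t - m0| <= r0 then 1 else 0).
    by apply/funext => t; rewrite /sel; case: (_ <= r0).
  apply: measurable_fun_ifT => //; apply: measurable_fun_ler => //.
  by apply: measurableT_comp => //; exact: measurable_funB.
have mG : cmeas G.
  move=> d T c mc; apply: emeasurable_funM; last exact: cmeas_devbox mc.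
  by apply/measurable_EFinP; apply: measurable_funM => //; exact: msel.
have G0 x : (0 <= G x)%E by rewrite mule_ge0 // lee_fin mulr_ge0.
have GPhi x : (G x <= (Phi a x)%:E)%E.
  rewrite /G -EFinM lee_fin /sel.
  case: (leP `|x j - m0| r0) => hm; last by rewrite mulr0 mul0r Phi_ge0.
  case: (boolP (devbox j al w l0 x)) => hb; last by rewrite mulr0 Phi_ge0.
  rewrite !mulr1; pose lam := x j / theta j.
  have lamE : `|lam - 3 / 8| <= 8^-1.
    have -> : lam - 3 / 8 = (x j - m0) / theta j by rewrite /lam /m0; field.
    by rewrite normrM normfV ler_pdivrMr // mulrC.
  move: lamE; rewrite ler_norml => /andP[lam1 lam2].
  pose Y := nsq x - 2 * lam * dot x + lam ^+ 2.
  have YE : devsq j al l0 x = Y.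
    rewrite devsq_sum /Y -nsq_line; apply: eq_bigr => i _; congr (_ ^+ 2).
    by rewrite /al /lam; field.
  have Yw : Y <= tau / 256.
    rewrite -YE; apply: (@le_trans _ _ (\sum_(i <- l0) w ^+ 2)).
      rewrite /devsq !big_seq; apply: ler_sum => i il.
      have /allP/(_ i il) h := hb.
      by rewrite -(real_normK (num_real (x i - _))) ler_pXn2r ?nnegrE.
    rewrite big_const_seq count_predT iter_addr_0 -[w ^+ 2 *+ _]mulr_natr sl0 /w exprMn sqr_sqrtr ?(ltW t0) //.
    have -> : dl ^+ 2 * tau * (N%:R - 1) = tau * (dl ^+ 2 * (N%:R - 1)) by ring.
    rewrite ler_pM2l //.
    have dN : dl * N%:R = 16^-1 by rewrite /dl; field; rewrite gt_eqF.
    have d1 : dl <= 16^-1.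
      by rewrite /dl lef_pV2 ?posrE ?mulr_gt0 // ler_peMr // ler1n.
    have -> : dl ^+ 2 * (N%:R - 1) = dl * (dl * N%:R) - dl ^+ 2 by ring.
    rewrite dN; have := sqr_ge0 dl; lra.
  have dy2 : (dot x - lam) ^+ 2 <= Y.
    by have := dot_sqr_le x; rewrite /Y !expr2; lra.
  have dy : `|dot x - lam| <= 8^-1.
    rewrite -(@ler_pXn2r _ 2) ?nnegrE ?invr_ge0 // real_normK ?num_real //.
    by apply: le_trans dy2 _; apply: le_trans Yw _; rewrite expr2; lra.
  move: dy; rewrite ler_norml => /andP[dy1 dy3].
  have dot8 : 8^-1 <= dot x by lra.
  have nd : dot x <= normRn N x by apply: le_trans (dot_le_norm x); exact: ler_norm.
  have np : 0 < normRn N x by lra.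
  have n1 : normRn N x <= 1.
    rewrite -(@ler_pXn2r _ 2) ?nnegrE ?(ltW np) // expr1n normRn_sqr.
    have -> : nsq x = Y + lam ^+ 2 + 2 * lam * (dot x - lam) by rewrite /Y; ring.
    by rewrite expr2; nra.
  rewrite /Phi np n1 /=.
  have h1 : (normRn N x - dot x) * (normRn N x + dot x) <= Y.
    have -> : (normRn N x - dot x) * (normRn N x + dot x) = nsq x - dot x ^+ 2.
      by rewrite -normRn_sqr; ring.
    by move: (sqr_ge0 (dot x - lam)); rewrite /Y !expr2; lra.
  have h2 : normRn N x - dot x <= 4 * Y by nra.
  have h3 : 1 - dot x / normRn N x <= 32 * Y.
    have -> : 1 - dot x / normRn N x = (normRn N x - dot x) / normRn N x.
      by field; rewrite gt_eqF.
    by rewrite ler_pdivrMr //; nra.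
  have h4 : dot x / normRn N x <= 1 by rewrite ler_pdivrMr // mul1r.
  by apply: powR_nonincr; [rewrite oppr_le0 ltW|rewrite /tau in t0; lra|rewrite /tau in Yw *; lra].
rewrite intRnE; apply: (@le_trans _ _ (intL (rev (iota 0 N)) G (fun=> 0))); last first.
  by apply: intL_le => //; exact: cmeas_Phi.
rewrite (intL_front _ uN jmem mG G0) /= -/l0.
pose I : set R := [set` `[m0 - r0, m0 + r0]].
have mI : measurable I by exact: measurable_itv.
have IE (x : R) : (\1_I x : R) = sel x.
  rewrite indicE /sel; congr ((nat_of_bool _)%:R).
  by apply/idP/idP; rewrite inE /I /= in_itv /= ler_norml => /andP[? ?]; apply/andP; split; lra.
have mi : measurable_fun [set: R] (fun x : R => (\1_I x : R)%:E).
  by apply/measurable_EFinP; exact: measurable_indic.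
pose D := V * (2 * w) ^+ size l0.
have D0 : 0 <= D by rewrite mulr_ge0 // exprn_ge0 // mulr_ge0.
have -> : (\int[leb]_x intL l0 G (upd (fun=> 0%R) j x) = \int[leb]_x (D%:E * (\1_I x)%:E))%E.
  apply: eq_integral => x _.
  rewrite (@eq_intL _ l0 _ (fun z => (V * sel x)%:E * ((devbox j al w l0 z)%:R)%:E)%E).
    rewrite intLZ; last 3 first.
    - exact: cmeas_devbox.
    - by move=> z; rewrite lee_fin.
    - by rewrite mulr_ge0.
    by rewrite (intL_devbox al _ w0 ul0 jl0) -IE /D -!EFinM; congr (_%:E); ring.
  by move=> z zy; rewrite /G (zy j jl0) /upd eqxx.
rewrite ge0_integralZl //.
have -> : (\int[leb]_x (\1_I x)%:E = (`|theta j| / 4)%:E)%E.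
  rewrite integral_indic // setIT; apply: etrans (lebesgue_measure_itv _) _.
  by rewrite /= lte_fin ifT; [rewrite -EFinB; congr (_%:E); rewrite /r0; field|rewrite /r0; lra].
rewrite -EFinM lee_fin /D /V /w le_eqVlt; apply/orP; left; apply/eqP.
rewrite -/tau (powRM _ (ler0n _ 2) (ltW t0)) mulrA -(powR12_sqrt (ltW t0)) (exprMn _ (2 * dl)).
rewrite -(powR_mulrn _ (powR_ge0 _ _)) -powRrM.
have -> : - (2^-1 + s) = - q + 2^-1 * (size l0)%:R by rewrite sl0 /q; field.
rewrite powRD ?(gt_eqF t0) ?implybT //; ring.
Qed.

End coordinates.

Lemma Sint_upper : exists2 C : R, 0 <= C & forall a, 2 < a ->
  (Sint a <= (C * (a - 2) `^ (- (2^-1 + s)))%:E)%E.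
Proof. by have [j jN jb] := large_coordinate; exact: Sint_upper_coord jN jb. Qed.

Lemma Sint_lower : exists2 c : R, 0 < c & forall a, 2 < a -> a <= 5 ->
  ((c * (a - 2) `^ (- (2^-1 + s)))%:E <= Sint a)%E.
Proof. by have [j jN jb] := large_coordinate; exact: Sint_lower_coord jN jb. Qed.

End sphere_bounds.

(** * The kernel *)

Lemma powRV (R : realType) (x a : R) : 0 <= x -> x^-1 `^ a = (x `^ a)^-1.
Proof. by move=> x0; rewrite -powR_inv1 // -powRrM mulN1r powRN. Qed.

Section hyperbolic.
Context {R : realType}.
Implicit Types t x y : R.

Definition ch (t : R) : R := expR t + expR (- t).

Lemma chN t : ch (- t) = ch t.
Proof. by rewrite /ch opprK addrC. Qed.

Lemma ch_norm t : ch `|t| = ch t.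
Proof. by case: (ger0P t) => _; rewrite ?chN. Qed.

Lemma continuous_ch : continuous ch.
Proof.
move=> x; apply: cvgD; first exact: continuous_expR.
apply: (@cvg_comp _ _ _ -%R expR); last exact: continuous_expR.
exact: (@oppr_continuous R R^o).
Qed.

Lemma ch_nondecr x y : 0 <= x -> x <= y -> ch x <= ch y.
Proof.
move=> x0 xy; rewrite /ch !expRN.
have X1 : 1 <= expR x by rewrite -expR0 ler_expR.
have XY : expR x <= expR y by rewrite ler_expR.
set X := expR x in X1 XY *; set Y := expR y in XY *.
rewrite -subr_ge0.
have -> : Y + Y^-1 - (X + X^-1) = (Y - X) * (1 - (X * Y)^-1).
  by field; rewrite !gt_eqF //; lra.
rewrite mulr_ge0 ?subr_ge0 // invf_le1; last by apply: mulr_gt0; lra.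
by nra.
Qed.

Lemma ch_sub2 t : ch t - 2 = (expR (t / 2) - expR (- (t / 2))) ^+ 2.
Proof.
have e1 : expR t = expR (t / 2) ^+ 2.
  by rewrite expr2 -expRD; congr expR; field.
have e2 : expR (- t) = expR (- (t / 2)) ^+ 2.
  by rewrite expr2 -expRD; congr expR; field.
have e3 : expR (t / 2) * expR (- (t / 2)) = 1 by rewrite -expRD subrr expR0.
by rewrite sqrrB e3 /ch e1 e2; ring.
Qed.

Lemma ch_ge t : t ^+ 2 / 4 <= ch t - 2.
Proof.
rewrite -[t ^+ 2]real_normK ?num_real // -ch_norm ch_sub2; set x := `|t|.
have x0 : 0 <= x by exact: normr_ge0.
have h1 := expR_ge1Dx (x / 2).
have h2 : expR (- (x / 2)) <= 1 by rewrite -expR0 ler_expR oppr_le0 divr_ge0.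
have -> : x ^+ 2 / 4 = (x / 2) ^+ 2 by rewrite expr_div_n; congr (_ / _); ring.
by rewrite ler_pXn2r ?nnegrE ?divr_ge0 //; lra.
Qed.

Lemma ch_gt2 t : t != 0 -> 2 < ch t.
Proof.
move=> t0; rewrite -subr_gt0; apply: lt_le_trans (ch_ge t).
by rewrite divr_gt0 // exprn_even_gt0.
Qed.

Lemma ch_le t : 0 < t -> t <= 1 -> ch t - 2 <= 3 * t ^+ 2.
Proof.
move=> t0 t1; rewrite ch_sub2; set x := t / 2.
have xE : t = 2 * x by rewrite /x; field.
have x0 : 0 < x by rewrite divr_gt0.
have x1 : x <= 2^-1 by rewrite /x; lra.
have h1 := expR_ge1Dx (- x); have h2 : expR x * expR (- x) = 1 by rewrite -expRD subrr expR0.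
have h3 : expR x <= 1 + 2 * x by have := expR_gt0 x; nra.
have h4 : 1 + x <= expR x by exact: expR_ge1Dx.
have h5 : expR (- x) <= 1 by rewrite -expR0 ler_expR oppr_le0 ltW.
apply: (@le_trans _ _ ((3 * x) ^+ 2)); last by rewrite xE !exprMn; nra.
by rewrite ler_pXn2r ?nnegrE //; lra.
Qed.

Lemma ch_ge3 t : 2 <= t -> 3 <= ch t.
Proof. by move=> t2; have := expR_ge1Dx t; have := expR_gt0 (- t); rewrite /ch; lra. Qed.

(* [cosh x - 1 = (e^x - 1)(1 - e^{-x})/2] *)
Lemma ch_le_sqr x : 0 <= x -> ch x - 2 <= x ^+ 2 * expR x.
Proof.
move=> x0; have h1 := expR_ge1Dx (- x).
have h2 : expR x * expR (- x) = 1 by rewrite -expRD subrr expR0.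
have -> : ch x - 2 = expR x * (1 - expR (- x)) ^+ 2.
  transitivity (expR x - 2 * (expR x * expR (- x)) + expR x * expR (- x) * expR (- x)).
    by rewrite h2 /ch; ring.
  by ring.
rewrite mulrC ler_pM2r ?expR_gt0 //.
have h3 : expR (- x) <= 1 by rewrite -expR0 ler_expR oppr_le0.
by rewrite ler_pXn2r ?nnegrE //; lra.
Qed.

Lemma expRN_le_inv2 (c : R) t : 0 < c -> 0 < t -> expR (- (c * t)) <= 4 / c ^+ 2 * t `^ (- 2).
Proof.
move=> c0 t0; have ct : 0 < c * t by exact: mulr_gt0.
have h := expR_ge1Dx (c * t / 2).
rewrite expRN powRN powR_mulrn ?(ltW t0) //.
have -> : expR (c * t) = expR (c * t / 2) ^+ 2 by rewrite expr2 -expRD; congr expR; field.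
have -> : 4 / c ^+ 2 * (t ^+ 2)^-1 = ((c * t / 2) ^+ 2)^-1.
  by field; rewrite !gt_eqF.
rewrite lef_pV2 ?posrE ?exprn_gt0 ?expR_gt0 ?divr_gt0 //.
rewrite ler_pXn2r ?nnegrE ?expR_ge0 ?divr_ge0 ?(ltW ct) //; lra.
Qed.

End hyperbolic.

Lemma ratio_bound {R : realType} (X Y r : R) : 0 <= X ->
  r * X <= Y <= X \/ X <= Y <= r * X -> `|X - Y| <= X * `|r - 1|.
Proof.
move=> X0 h.
have h1 : X * (r - 1) <= X * `|r - 1| by rewrite ler_wpM2l // ler_norm.
have h2 : X * (1 - r) <= X * `|r - 1| by rewrite distrC ler_wpM2l // ler_norm.
by case: h => /andP[h3 h4]; [rewrite ger0_norm|rewrite distrC ger0_norm]; lra.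
Qed.

Section sphere_kernel.
Context {R : realType}.
Variables (N : nat) (s : R) (theta : nat -> R).
Hypothesis N_gt0 : (0 < N)%N.
Hypothesis s_gt0 : 0 < s.
Hypothesis theta_norm : normRn N theta = 1.

Let q : R := (N%:R + 2 * s) / 2.
Let q_gt0 : 0 < q.
Proof. by rewrite divr_gt0 // addr_gt0 ?ltr0n // mulr_gt0. Qed.

Definition kr (t : R) : R := fine (Sint N s theta (ch t)).

Lemma Sint_fin a : 2 < a -> Sint N s theta a \is a fin_num.
Proof.
move=> a2; have [C C0 HC] := Sint_upper N_gt0 s_gt0 theta_norm.
rewrite ge0_fin_numE; last exact: Sint_ge0.
by apply: le_lt_trans (HC _ a2) _; rewrite ltry.
Qed.

Lemma kr_Sint t : t != 0 -> (kr t)%:E = Sint N s theta (ch t).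
Proof. by move=> t0; rewrite /kr fineK // Sint_fin // ch_gt2. Qed.

Lemma kernelK_kr t : t != 0 -> kernelK N s theta t = (kr t)%:E.
Proof.
move=> t0; rewrite kr_Sint // /kernelK -/q.
have e1 : expR (- t) * expR t = 1 by rewrite -expRD addNr expR0.
have e2 : expR (- 2 * t) = expR (- t) * expR (- t) by rewrite -expRD; congr expR; ring.
have -> : (fun sg => epowneg `|1 + expR (- 2 * t) - 2 * expR (- t) * dotRn N theta sg| (- q)) =
   (fun sg => epowneg `|expR (- t) * (ch t - 2 * dotRn N theta sg)| (- q)).
  apply/funext => sg; congr (epowneg `|_| _).
  by rewrite /ch mulrBr mulrDr e1 -e2; ring.
rewrite sphere_scale ?expR_gt0 ?ch_gt2 // muleA -EFinM -expRM -expRD.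
by have -> : - t * q + - t * - q = 0; [ring|rewrite expR0 mul1e].
Qed.

Lemma kr_cone : cone kr.
Proof.
split => [t|t|x y x0 xy].
- by rewrite /kr fine_ge0 // Sint_ge0.
- by rewrite /kr chN.
- have y0 : 0 < y by exact: lt_le_trans xy.
  have xn : x != 0 by rewrite gt_eqF.
  have yn : y != 0 by rewrite gt_eqF.
  apply: fine_le; [by apply: Sint_fin; exact: ch_gt2|by apply: Sint_fin; exact: ch_gt2|].
  by apply: Sint_le => //; [exact: ch_gt2|apply: ch_nondecr => //; exact: ltW].
Qed.

Lemma kr_low : exists2 c, 0 < c & forall t, 0 < t -> t <= 1 -> c * t `^ (- (1 + 2 * s)) <= kr t.
Proof.
have [c c0 Hc] := Sint_lower N_gt0 s_gt0 theta_norm.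
exists (c * 3 `^ (- (2^-1 + s))) => [|t t0 t1]; first by rewrite mulr_gt0 ?powR_gt0.
have tn : t != 0 by rewrite gt_eqF.
rewrite -lee_fin kr_Sint //.
have c5 : ch t - 2 <= 3 * t ^+ 2 := ch_le t0 t1.
have t2 : t ^+ 2 <= 1 by rewrite expr_le1 // ltW.
apply: le_trans (Hc _ (ch_gt2 tn) _); last by lra.
rewrite lee_fin -mulrA ler_pM2l //.
have -> : t `^ (- (1 + 2 * s)) = (t ^+ 2) `^ (- (2^-1 + s)).
  by rewrite -powR_mulrn ?(ltW t0) // -powRrM; congr (_ `^ _); field.
rewrite -powRM ?sqr_ge0 //; apply: powR_nonincr => //; last by rewrite subr_gt0 ch_gt2.
by rewrite oppr_le0 addr_ge0 // ltW.
Qed.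

Lemma kr_near : exists2 C, 0 <= C & forall t, t != 0 -> kr t <= C * `|t| `^ (- (1 + 2 * s)).
Proof.
have [C C0 HC] := Sint_upper N_gt0 s_gt0 theta_norm.
exists (C * 4^-1 `^ (- (2^-1 + s))) => [|t t0]; first by rewrite mulr_ge0 ?powR_ge0.
rewrite -lee_fin kr_Sint //; apply: le_trans (HC _ (ch_gt2 t0)) _.
rewrite lee_fin -mulrA ler_wpM2l //.
have -> : `|t| `^ (- (1 + 2 * s)) = (t ^+ 2) `^ (- (2^-1 + s)).
  by rewrite -[t ^+ 2]real_normK ?num_real // -powR_mulrn // -powRrM; congr (_ `^ _); field.
rewrite -powRM ?sqr_ge0 ?invr_ge0 //; apply: powR_nonincr.
- by rewrite oppr_le0 addr_ge0 // ltW.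
- by rewrite mulr_gt0 ?invr_gt0 // exprn_even_gt0.
- by rewrite mulrC ch_ge.
Qed.

Lemma kr_far : exists2 C, 0 <= C & forall t, 1 <= `|t| -> kr t <= C * expR (- (q * `|t|)).
Proof.
have [k0 _ kd] := kr_cone.
have f3 : Sint N s theta 3 \is a fin_num by apply: Sint_fin; rewrite ltr_nat.
pose D := fine (Sint N s theta 3) * 15^-1 `^ (- q).
have D0 : 0 <= D by rewrite mulr_ge0 ?powR_ge0 // fine_ge0 // Sint_ge0.
have E0 : 0 <= kr 1 * expR (2 * q) by rewrite mulr_ge0 ?expR_ge0.
exists (D + kr 1 * expR (2 * q)) => [|t t1]; first by rewrite addr_ge0.
rewrite -(cone_norm t kr_cone); set x := `|t| in t1 *.
rewrite mulrDl; have [x2|x2] := leP 2 x.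
  apply: (@le_trans _ _ (D * expR (- (q * x)))); last first.
    by rewrite lerDl mulr_ge0 ?expR_ge0.
  rewrite -lee_fin kr_Sint ?gt_eqF //; last by lra.
  apply: le_trans (Sint_far _ _ _ (ch_ge3 x2)) _ => //.
  rewrite -(fineK f3) -EFinM lee_fin /D mulrC -mulrA ler_wpM2l ?fine_ge0 ?Sint_ge0 //.
  have -> : expR (- (q * x)) = expR x `^ (- q) by rewrite -expRM; congr expR; ring.
  rewrite -powRM ?expR_ge0 ?invr_ge0 //; apply: powR_nonincr.
  - by rewrite oppr_le0 ltW.
  - by rewrite mulr_gt0 ?invr_gt0 ?expR_gt0.
  - by rewrite mulrC ler_pM2r ?invr_gt0 // /ch lerDl expR_ge0.
apply: (@le_trans _ _ (kr 1 * expR (2 * q) * expR (- (q * x)))); last first.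
  by rewrite lerDr mulr_ge0 ?expR_ge0.
apply: (@le_trans _ _ (kr 1)); first exact: kd.
rewrite -mulrA ler_peMr // -expRD -[leLHS]expR0 ler_expR.
by have := q_gt0; nra.
Qed.

Lemma kr_up : exists2 C, 0 <= C & forall t, t != 0 -> kr t <= C * pw (1 + 2 * s) 2 t.
Proof.
have [C C0 HC] := kr_near; have [D D0 HD] := kr_far.
have E0 : 0 <= D * (4 / q ^+ 2) by rewrite mulr_ge0 // divr_ge0 // ?exprn_ge0 ?(ltW q_gt0).
exists (C + D * (4 / q ^+ 2)) => [|t t0]; first exact: addr_ge0.
rewrite /pw; case: ifP => [_|/negbT]; rewrite mulrDl.
  by apply: (le_trans (HC _ t0)); rewrite lerDl mulr_ge0 ?powR_ge0.
rewrite -ltNge => t1; apply: (le_trans (HD _ (ltW t1))).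
apply: (@le_trans _ _ (D * (4 / q ^+ 2) * `|t| `^ (- 2))); last by rewrite lerDr mulr_ge0 ?powR_ge0.
rewrite -mulrA ler_wpM2l //; apply: expRN_le_inv2 => //; exact: lt_trans t1.
Qed.

Lemma Sint_ratio a a' : 2 < a -> a <= a' ->
  (Sint N s theta a <= (((a - 2) / (a' - 2)) `^ (- q))%:E * Sint N s theta a')%E.
Proof.
move=> a2 aa; rewrite /Sint muleCA lee_wpmul2l ?lee_fin // !intRnE.
have a2' : 2 < a' by exact: lt_le_trans aa.
rewrite -intLZ ?powR_ge0 //; last 2 first.
- exact: cmeas_Phi.
- by move=> y; rewrite lee_fin Phi_ge0.
apply: intL_le => [|x||x]; rewrite -?EFinM ?lee_fin ?Phi_ge0 //.
- exact: cmeas_Phi.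
- move=> d T c mc; apply: emeasurable_funM => //; exact: cmeas_Phi.
rewrite /Phi; case: ifP => [/andP[x0 _]|_]; last by rewrite mulr0.
have /andP[cm1 c1] := cosine_bounds theta_norm x0.
set c := dotRn N theta x / normRn N x in cm1 c1 *.
rewrite -powRM ?divr_ge0 //; [|lra|lra|lra].
apply: powR_nonincr; [by rewrite oppr_le0 ltW|apply: mulr_gt0; [apply: divr_gt0; lra|lra]|].
by rewrite mulrAC ler_pdivrMr; [nra|lra].
Qed.

Lemma continuous_kr t : t != 0 -> {for t, continuous kr}.
Proof.
move=> t0; have [k0 _ _] := kr_cone.
pose r (x : R) : R := ((ch t - 2) / (ch x - 2)) `^ q.
have ct := ch_gt2 t0.
have key a b : 2 < a -> a <= b -> fine (Sint N s theta b) <= fine (Sint N s theta a) <=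
    ((b - 2) / (a - 2)) `^ q * fine (Sint N s theta b).
  move=> a2 ab; have b2 : 2 < b by exact: lt_le_trans ab.
  rewrite -!lee_fin EFinM !fineK ?Sint_fin // Sint_le //=.
  have -> : ((b - 2) / (a - 2)) `^ q = ((a - 2) / (b - 2)) `^ (- q).
    by rewrite powRN -powRV ?divr_ge0 ?subr_ge0 ?(ltW a2) ?(ltW b2) // invf_div.
  exact: Sint_ratio.
have bnd x : x != 0 -> `|kr t - kr x| <= kr t * `|r x - 1|.
  move=> x0; have cx := ch_gt2 x0; rewrite /kr.
  have S0 : 0 <= fine (Sint N s theta (ch t)) by rewrite fine_ge0 // Sint_ge0.
  have [h|/ltW h] := leP (ch t) (ch x).
    have /andP[h1 h2] := key _ _ ct h.
    have p0 : 0 < ((ch x - 2) / (ch t - 2)) `^ q by rewrite powR_gt0 // divr_gt0 // subr_gt0.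
    have rE : r x = (((ch x - 2) / (ch t - 2)) `^ q)^-1.
      by rewrite /r -powRV ?divr_ge0 ?subr_ge0 ?(ltW ct) ?(ltW cx) // invf_div.
    apply: (ratio_bound S0); left; rewrite h1 andbT.
    by move: h2; rewrite rE ler_pdivrMl.
  by apply: (ratio_bound S0); right; exact: key.
have cr : r x @[x --> t] --> (1 : R).
  have -> : (1 : R) = r t by rewrite /r divff ?powR1 // gt_eqF // subr_gt0.
  have d1 : (ch t - 2) / (ch t - 2) = 1 :> R by rewrite divff // gt_eqF // subr_gt0.
  apply: (@cvg_comp _ _ _ (fun x => (ch t - 2) / (ch x - 2)) (fun y => y `^ q)); last first.
    by apply: cvg_powR; rewrite d1.
  apply: cvgM; first exact: cvg_cst.
  apply: cvgV; first by rewrite gt_eqF // subr_gt0.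
  apply: cvgB; [exact: continuous_ch|exact: cvg_cst].
apply/cvgrPdist_le => e e0.
have e1 : 0 < e / (kr t + 1) by rewrite divr_gt0 // ltr_wpDl.
near=> x.
have x0 : x != 0.
  by near: x; apply: (@cvgr_neq0 _ _ _ _ _ id t (@cvg_id _ _) t0).
apply: (le_trans (bnd _ x0)).
have : `|1 - r x| <= e / (kr t + 1).
  by near: x; move/cvgrPdist_le : cr; apply.
rewrite distrC ler_pdivlMr ?ltr_wpDl //.
have := normr_ge0 (r x - 1); have := k0 t; nra.
Unshelve. all: end_near.
Qed.

End sphere_kernel.

(** * The constant A *)

Section exponential_substitution.
Context {R : realType}.
Local Notation leb := (@lebesgue_measure R).
Implicit Types G : R -> R.

Lemma derive1_expR : (@expR R)^`()%classic = @expR R.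
Proof. by apply/funext => x; rewrite derive1E; have [_] := is_derive_expR x. Qed.

Lemma integral_expR_itv G (a b : R) : a <= b ->
  (forall t, a <= t -> t <= b -> {for expR t, continuous G}) ->
  (\int[leb]_(x in [set` `[expR a, expR b]]) (G x)%:E =
   \int[leb]_(t in [set` `[a, b]]) (G (expR t) * expR t)%:E)%E.
Proof.
move=> ab cG.
rewrite integration_by_substitution_increasing //.
- by apply: eq_integral => t _; rewrite derive1_expR.
- by move=> x y _ _; rewrite ltr_expR.
- by rewrite derive1_expR => x _; exact: continuous_expR.
- rewrite derive1_expR; apply/cvg_ex; exists (expR a).
  by apply: cvg_at_right_filter; exact: continuous_expR.
- rewrite derive1_expR; apply/cvg_ex; exists (expR b).
  by apply: cvg_at_left_filter; exact: continuous_expR.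
- split.
  + by move=> x _; have [] := is_derive_expR x.
  + by apply: cvg_at_right_filter; exact: continuous_expR.
  + by apply: cvg_at_left_filter; exact: continuous_expR.
- apply: continuous_in_subspaceT => x; rewrite inE/= in_itv/= => /andP[ax xb].
  have x0 : 0 < x by apply: lt_le_trans ax; exact: expR_gt0.
  rewrite -(lnK x0); apply: cG.
    by rewrite -(expRK a) ler_ln ?posrE ?expR_gt0.
  by rewrite -(expRK b) ler_ln ?posrE ?expR_gt0.
Qed.

Lemma ge0_integral_expR_exhaust G (a b : nat -> R) :
  measurable_fun [set: R] G ->
  (forall n, a n <= b n) -> (forall n m, (n <= m)%N -> a m <= a n) ->
  (forall n m, (n <= m)%N -> b n <= b m) ->
  (forall n t, a n <= t -> t <= b n -> {for expR t, continuous G}) ->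
  (forall n t, a n <= t -> t <= b n -> 0 <= G (expR t)) ->
  (\int[leb]_(x in \bigcup_n [set` `[expR (a n), expR (b n)]]) (G x)%:E =
   \int[leb]_(t in \bigcup_n [set` `[a n, b n]]) (G (expR t) * expR t)%:E)%E.
Proof.
move=> mG ab na nb cG G0.
have mE : measurable_fun [set: R] (fun t => (G (expR t) * expR t)%:E).
  apply/measurable_EFinP; apply: measurable_funM; last exact: measurable_expR.
  by apply: (measurableT_comp mG); exact: measurable_expR.
have mGE : measurable_fun [set: R] (fun t => (G t)%:E) by exact/measurable_EFinP.
have c1 : (\int[leb]_(x in [set` `[expR (a i), expR (b i)]]) (G x)%:E)%E @[i --> \oo] -->
    (\int[leb]_(x in \bigcup_n [set` `[expR (a n), expR (b n)]]) (G x)%:E)%E.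
  apply: ge0_nondecreasing_set_cvg_integral => //.
  - move=> n m nm; apply/subsetPset => x; rewrite /= !in_itv/= => /andP[h1 h2].
    by rewrite (le_trans _ h1) ?ler_expR ?na // (le_trans h2) // ler_expR nb.
  - by move=> i; exact: measurable_funTS.
  - move=> i x; rewrite /= in_itv/= => /andP[h1 h2]; rewrite lee_fin.
    have x0 : 0 < x by apply: lt_le_trans h1; exact: expR_gt0.
    rewrite -(lnK x0); apply: (G0 i).
      by rewrite -(expRK (a i)) ler_ln ?posrE ?expR_gt0.
    by rewrite -(expRK (b i)) ler_ln ?posrE ?expR_gt0.
have c2 : (\int[leb]_(t in [set` `[a i, b i]]) (G (expR t) * expR t)%:E)%E @[i --> \oo] -->
    (\int[leb]_(t in \bigcup_n [set` `[a n, b n]]) (G (expR t) * expR t)%:E)%E.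
  apply: ge0_nondecreasing_set_cvg_integral => //.
  - move=> n m nm; apply/subsetPset => x; rewrite /= !in_itv/= => /andP[h1 h2].
    by rewrite (le_trans _ h1) ?na // (le_trans h2) // nb.
  - by move=> i; exact: measurable_funTS.
  - move=> i x; rewrite /= in_itv/= => /andP[h1 h2]; rewrite lee_fin mulr_ge0 ?expR_ge0 //.
    exact: (G0 i).
apply: (cvg_unique _ c1) => //.
rewrite (_ : (fun i => _) = (fun i => (\int[leb]_(t in [set` `[a i, b i]]) (G (expR t) * expR t)%:E)%E)) //.
by apply/funext => i; rewrite integral_expR_itv // => t; exact: cG.
Qed.

Lemma ge0_integral_expR_gt G (c : R) : measurable_fun [set: R] G ->
  (forall t, c < t -> {for expR t, continuous G}) -> (forall t, c < t -> 0 <= G (expR t)) ->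
  (\int[leb]_(x in [set x | (expR c < x)%R]) (G x)%:E =
   \int[leb]_(t in [set t | (c < t)%R]) (G (expR t) * expR t)%:E)%E.
Proof.
move=> mG cG G0.
have E : [set t : R | c < t] = \bigcup_n [set` `[c + n.+1%:R^-1, c + n.+1%:R]].
  apply/seteqP; split => t /=.
    move=> ct; have d0 : 0 < t - c by rewrite subr_gt0.
    pose n := maxn (Num.trunc (t - c)^-1) (Num.trunc (t - c)).
    exists n => //=; rewrite in_itv/=; apply/andP; split.
      rewrite -lerBrDl -[t - c]invrK lef_pV2 ?posrE ?invr_gt0 //.
      by apply: (le_trans (ltW (truncnS_gt _))); rewrite ler_nat ltnS leq_maxl.
    rewrite -lerBlDl; apply: (le_trans (ltW (truncnS_gt _))).
    by rewrite ler_nat ltnS leq_maxr.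
  move=> [n _]; rewrite /= in_itv/= => /andP[h _]; apply: lt_le_trans h.
  by rewrite ltrDl invr_gt0.
have E' : [set x : R | expR c < x] = \bigcup_n [set` `[expR (c + n.+1%:R^-1), expR (c + n.+1%:R)]].
  apply/seteqP; split => x /=.
    move=> cx; have x0 : 0 < x by apply: lt_trans cx; exact: expR_gt0.
    have : [set t : R | c < t] (ln x) by rewrite /= -(expRK c) ltr_ln ?posrE ?expR_gt0.
    rewrite E => -[n _]; rewrite /= in_itv/= -!(ler_expR _ (ln x)) -(ler_expR (ln x)) lnK // => h.
    by exists n => //=; rewrite in_itv.
  move=> [n _]; rewrite /= in_itv/= => /andP[h _]; apply: lt_le_trans h.
  by rewrite ltr_expR ltrDl invr_gt0.
rewrite E E'; apply: ge0_integral_expR_exhaust => //.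
- by move=> n; rewrite lerD2l (@le_trans _ _ 1) ?ler1n // invf_le1 // ler1n.
- by move=> n m nm; rewrite lerD2l lef_pV2 ?posrE // ler_nat.
- by move=> n m nm; rewrite lerD2l ler_nat.
- by move=> n t h _; apply: cG; apply: lt_le_trans h; rewrite ltrDl invr_gt0.
- by move=> n t h _; apply: G0; apply: lt_le_trans h; rewrite ltrDl invr_gt0.
Qed.

Lemma ge0_integral_expR_lt G (c : R) : measurable_fun [set: R] G ->
  (forall t, t < c -> {for expR t, continuous G}) -> (forall t, t < c -> 0 <= G (expR t)) ->
  (\int[leb]_(x in [set x | 0 < x < expR c]%R) (G x)%:E =
   \int[leb]_(t in [set t | (t < c)%R]) (G (expR t) * expR t)%:E)%E.
Proof.
move=> mG cG G0.
have E : [set t : R | t < c] = \bigcup_n [set` `[c - n.+1%:R, c - n.+1%:R^-1]].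
  apply/seteqP; split => t /=.
    move=> ct; have d0 : 0 < c - t by rewrite subr_gt0.
    pose n := maxn (Num.trunc (c - t)^-1) (Num.trunc (c - t)).
    exists n => //=; rewrite in_itv/=; apply/andP; split.
      rewrite lerBlDr -lerBlDl; apply: (le_trans (ltW (truncnS_gt _))).
      by rewrite ler_nat ltnS leq_maxr.
    rewrite lerBrDr -lerBrDl -[c - t]invrK lef_pV2 ?posrE ?invr_gt0 //.
    by apply: (le_trans (ltW (truncnS_gt _))); rewrite ler_nat ltnS leq_maxl.
  move=> [n _]; rewrite /= in_itv/= => /andP[_ h]; apply: le_lt_trans h _.
  by rewrite ltrBlDr ltrDl invr_gt0.
have E' : [set x : R | 0 < x < expR c] = \bigcup_n [set` `[expR (c - n.+1%:R), expR (c - n.+1%:R^-1)]].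
  apply/seteqP; split => x /=.
    move=> /andP[x0 cx].
    have : [set t : R | t < c] (ln x) by rewrite /= -(expRK c) ltr_ln ?posrE ?expR_gt0.
    rewrite E => -[n _]; rewrite /= in_itv/= -!(ler_expR _ (ln x)) -(ler_expR (ln x)) lnK // => h.
    by exists n => //=; rewrite in_itv.
  move=> [n _]; rewrite /= in_itv/= => /andP[h1 h]; apply/andP; split.
    by apply: lt_le_trans h1; exact: expR_gt0.
  by apply: le_lt_trans h _; rewrite ltr_expR ltrBlDr ltrDl invr_gt0.
rewrite E E'; apply: ge0_integral_expR_exhaust => //.
- by move=> n; rewrite lerD2l lerN2 (@le_trans _ _ 1) ?ler1n // invf_le1 // ler1n.
- by move=> n m nm; rewrite lerD2l lerN2 ler_nat.
- by move=> n m nm; rewrite lerD2l lerN2 lef_pV2 ?posrE // ler_nat.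
- by move=> n t _ h; apply: cG; apply: le_lt_trans h _; rewrite ltrBlDr ltrDl invr_gt0.
- by move=> n t _ h; apply: G0; apply: le_lt_trans h _; rewrite ltrBlDr ltrDl invr_gt0.
Qed.

End exponential_substitution.
Lemma expR_le_affine {R : realType} (x : R) : 0 <= x -> x <= 2^-1 -> expR x <= 1 + 2 * x.
Proof.
move=> x0 x1; have h1 := expR_ge1Dx (- x).
have h2 : expR x * expR (- x) = 1 by rewrite -expRD subrr expR0.
by have := expR_gt0 x; nra.
Qed.

Section principal_value_constant.
Context {R : realType}.
Local Notation leb := (@lebesgue_measure R).
Variables (N : nat) (s : R) (theta : nat -> R).
Hypothesis N_gt0 : (0 < N)%N.
Hypothesis s_gt0 : 0 < s.
Hypothesis s_lt1 : s < 1.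
Hypothesis s_sub : 2 * s < N%:R.
Hypothesis theta_norm : normRn N theta = 1.

Let q : R := (N%:R + 2 * s) / 2.
Let b : R := (N%:R - 2 * s) / 2.
Let q_gt0 : 0 < q.
Proof. by rewrite divr_gt0 // addr_gt0 ?ltr0n // mulr_gt0. Qed.
Let b_gt0 : 0 < b. Proof. by rewrite divr_gt0 // subr_gt0. Qed.
Let k := kr N s theta.
Let ck : cone k := kr_cone N_gt0 s_gt0 theta_norm.
Let mk : measurable_fun [set: R] k := measurable_cone ck.
Let k0 t : 0 <= k t. Proof. by have [] := ck. Qed.
Let k_even t : k (- t) = k t. Proof. by have [] := ck. Qed.

Definition radial (x : R) : R := x ^+ N.-1 * (1 - x `^ betaN N s) * (x `^ (- q) * k (ln x)).
Definition hr (t : R) : R := (expR (b * t) - 1) * k t.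
Definition gr (t : R) : R := (1 - expR (- (b * t))) * k t.
Definition wr (t : R) : R := (ch (b * t) - 2) * k t.

Lemma hr_wr_gr t : hr t = wr t + gr t.
Proof. by rewrite /hr /wr /gr /ch; ring. Qed.

Lemma hrN t : hr (- t) = - gr t.
Proof. by rewrite /hr /gr k_even mulrN; ring. Qed.

Lemma measurable_expRl c : measurable_fun [set: R] (fun t : R => expR (c * t)).
Proof. by apply: (measurableT_comp (@measurable_expR R)); exact: measurable_funM. Qed.

Lemma measurable_hr : measurable_fun [set: R] hr.
Proof.
by apply: measurable_funM => //; apply: measurable_funB => //; exact: measurable_expRl.
Qed.

Lemma measurable_gr : measurable_fun [set: R] gr.
Proof.
apply: measurable_funM => //; apply: measurable_funB => //.
rewrite (_ : (fun t : R => expR (- (b * t))) = (fun t => expR (- b * t))); last first.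
  by apply/funext => t; rewrite mulNr.
exact: measurable_expRl.
Qed.

Lemma measurable_wr : measurable_fun [set: R] wr.
Proof.
rewrite (_ : wr = (fun t => hr t - gr t)); first by apply: measurable_funB; [exact: measurable_hr|exact: measurable_gr].
by apply/funext => t; rewrite hr_wr_gr addrK.
Qed.

Lemma wr_ge0 t : 0 <= wr t.
Proof.
rewrite mulr_ge0 //; apply: le_trans (ch_ge (b * t)).
by rewrite divr_ge0 // sqr_ge0.
Qed.

Lemma hr_ge0 t : 0 <= t -> 0 <= hr t.
Proof.
move=> t0; rewrite mulr_ge0 // subr_ge0 -expR0 ler_expR.
by rewrite mulr_ge0 // ltW.
Qed.

Lemma gr_ge0 t : 0 <= t -> 0 <= gr t.
Proof.
move=> t0; rewrite mulr_ge0 // subr_ge0 -expR0 ler_expR oppr_le0.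
by rewrite mulr_ge0 // ltW.
Qed.

Lemma radial_expR t : radial (expR t) * expR t = hr t.
Proof.
rewrite /radial -powR_mulrn ?expR_ge0 // -!expRM expRK /hr.
have -> : expR (t * N.-1%:R) * (1 - expR (t * betaN N s)) * (expR (t * - q) * k t) * expR t =
  (expR (t * N.-1%:R) * expR (t * - q) * expR t) * (1 - expR (t * betaN N s)) * k t by ring.
rewrite -!expRD.
have -> : t * N.-1%:R + t * - q + t = b * t.
  by rewrite -subn1 natrB // /q /b; field.
rewrite mulrBr mulr1 -expRD.
by have -> : b * t + t * betaN N s = 0; [rewrite /betaN /b; field|rewrite expR0].
Qed.

Lemma continuous_radial t : t != 0 -> {for expR t, continuous radial}.
Proof.
move=> t0; have e0 := expR_gt0 t.
apply: cvgM.
  apply: cvgM; first exact: exprn_continuous.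
  by apply: cvgB; [exact: cvg_cst|exact: cvg_powR].
apply: cvgM; first exact: cvg_powR.
apply: (@cvg_comp _ _ _ (@ln R) k); first exact: continuous_ln.
by rewrite expRK; exact: continuous_kr.
Qed.

Lemma measurable_radial : measurable_fun [set: R] radial.
Proof.
apply: measurable_funM.
  apply: measurable_funM; first exact: measurable_funX.
  by apply: measurable_funB => //; exact: measurable_powR.
apply: measurable_funM; first exact: measurable_powR.
by apply: (measurableT_comp mk); exact: measurable_ln.
Qed.

Lemma radial_sphere x : 0 < x -> x != 1 ->
  ((x ^+ N.-1 * (1 - x `^ betaN N s))%R%:E *
    sphere_int N (fun sigma => epowneg `|1 + x ^+ 2 - 2 * x * dotRn N theta sigma|%R (- q)%R))%E =
  (radial x)%:E.
Proof.
move=> x0 x1; have l0 : ln x != 0.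
  by apply: contra x1 => /eqP l; rewrite -(lnK x0) l expR0.
rewrite /radial [RHS]EFinM; congr (_ * _)%E.
have -> : (fun sg => epowneg `|1 + x ^+ 2 - 2 * x * dotRn N theta sg| (- q)) =
   (fun sg => epowneg `|x * (ch (ln x) - 2 * dotRn N theta sg)| (- q)).
  apply/funext => sg; congr (epowneg `|_| _).
  by rewrite /ch expRN lnK //; field; rewrite gt_eqF.
by rewrite sphere_scale ?ch_gt2 // EFinM kr_Sint.
Qed.

(* Needed because [hr] and [gr] are subtracted in the extended reals. *)
Lemma gr_tail (d : R) : 0 < d -> (\int[leb]_(t in [set t | (d < t)%R]) (gr t)%:E < +oo)%E.
Proof.
move=> d0; have [C C0 HC] := kr_up N_gt0 s_gt0 theta_norm.
pose n := (Num.trunc (k d)).+1.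
have it := truncated_kernel_integrable ck C0 HC n.
have mS : measurable [set t : R | d < t] by rewrite -set_itvoy; exact: measurable_itv.
have m1 : measurable_fun [set: R] (fun t => (Num.min (k t) n%:R)%:E).
  by apply/measurable_EFinP; exact: measurable_minr.
have m2 : measurable_fun [set: R] (fun t => (gr t)%:E) by apply/measurable_EFinP; exact: measurable_gr.
have mn0 t : (0 <= (Num.min (k t) n%:R)%:E)%E by rewrite lee_fin le_min k0 ler0n.
apply: (@le_lt_trans _ _ (\int[leb]_(t in [set t | (d < t)%R]) (Num.min (k t) n%:R)%:E)%E).
  apply: ge0_le_integral => //.
  - by move=> t /= dt; rewrite lee_fin gr_ge0 // ltW // (lt_trans d0).
  - exact: measurable_funTS.
  - exact: measurable_funTS.
  - move=> t /= dt; rewrite lee_fin.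
    have kn : k t <= n%:R.
      apply: (@le_trans _ _ (k d)); last exact: ltW (truncnS_gt _).
      by have [_ _ kd] := ck; apply: kd => //; exact: ltW.
    rewrite min_l // /gr ler_piMl // gerBl; exact: expR_ge0.
apply: (@le_lt_trans _ _ (\int[leb]_t (Num.min (k t) n%:R)%:E)%E).
  by apply: ge0_subset_integral.
have /integrableP[_] := it; apply: le_lt_trans.
apply: ge0_le_integral => //.
  by apply: measurableT_comp.
by move=> t _; rewrite /= lee_fin ler_norm.
Qed.

Lemma integral_lt_gr (d : R) :
  (\int[leb]_(t in [set t | (t < - d)%R]) (- hr t)%:E = \int[leb]_(t in [set t | (d < t)%R]) (gr t)%:E)%E.
Proof.
rewrite integral_mkcond [RHS]integral_mkcond.
have mS : measurable [set t : R | d < t] by rewrite -set_itvoy; exact: measurable_itv.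
have m2 : measurable_fun [set: R] (fun t => (gr t)%:E) by apply/measurable_EFinP; exact: measurable_gr.
rewrite -[RHS]integral_opp.
  apply: eq_integral => t _; rewrite !patchE.
  have -> : (t \in [set t | t < - d]) = (- t \in [set t | d < t]).
    by apply/idP/idP; rewrite !inE /= ltrNr.
  case: ifP => // _; congr EFin.
  by rewrite -[X in - hr X]opprK hrN opprK.
by apply/(measurable_restrictT _ _).1 => //; exact: measurable_funTS.
Qed.

(* In the variable [t = ln rho] the parts at [t] and [- t] add up to [wr]; what remains is
   the gap between the images of [1 + e] and [1 / (1 - e)]. *)
Lemma A_truncE e : 0 < e -> e < 1 ->
  A_trunc N s theta e = (\int[leb]_(t in [set t | (ln (1 + e) < t <= - ln (1 - e))%R]) (hr t)%:E +
    \int[leb]_(t in [set t | (- ln (1 - e) < t)%R]) (wr t)%:E)%E.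
Proof.
move=> e0 e1.
set c1 := ln (1 + e); set d := - ln (1 - e).
have E1 : expR c1 = 1 + e by rewrite lnK // posrE; lra.
have E2 : expR (- d) = 1 - e by rewrite opprK lnK // posrE; lra.
have c10 : 0 < c1 by rewrite -ltr_expR expR0 E1; lra.
have c1d : c1 <= d.
  rewrite -[d]opprK -ler_expR expRN E2 E1.
  by rewrite -[_^-1]mul1r ler_pdivlMr; [nra|lra].
have mgt (c : R) : measurable [set t : R | c < t] by rewrite -set_itvoy; exact: measurable_itv.
have mh : measurable_fun [set: R] (fun t => (hr t)%:E) by apply/measurable_EFinP; exact: measurable_hr.
have mg : measurable_fun [set: R] (fun t => (gr t)%:E) by apply/measurable_EFinP; exact: measurable_gr.
have mw : measurable_fun [set: R] (fun t => (wr t)%:E) by apply/measurable_EFinP; exact: measurable_wr.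
have mr : measurable_fun [set: R] (fun t => (radial t)%:E) by apply/measurable_EFinP; exact: measurable_radial.
pose L : set R := [set x | 0 < x < expR (- d)].
pose U : set R := [set x | expR c1 < x].
have mL : measurable L by rewrite /L -set_itvoo; exact: measurable_itv.
have LU : [set x : R | 0 < x /\ e < `|x - 1|] = L `|` U.
  apply/seteqP; split => x; rewrite /L /U /= E1 E2.
    move=> [x0]; rewrite lter_normr x0 /= => /orP[h|h]; [right|left]; lra.
  by move=> [/andP[x0 h]|h]; split; rewrite ?lter_normr; lra.
have -> : (A_trunc N s theta e = \int[leb]_(x in L `|` U) (radial x)%:E)%E.
  rewrite /A_trunc LU; apply: eq_integral => x; rewrite inE -LU /= => -[x0 xe].
  apply: radial_sphere => //; apply: contraTneq xe => ->.
  by rewrite subrr normr0 -leNgt ltW.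
rewrite integral_setU //; [|exact: mgt|exact: measurable_funTS|]; last first.
  rewrite disj_set2E; apply/eqP/seteqP; split => // x [/= /andP[_ h1] h2].
  by move: (lt_trans h2 h1); rewrite E1 E2; lra.
rewrite ge0_integral_expR_gt; [|exact: measurable_radial|..]; last first.
- move=> t ct; have t0 : 0 <= t by rewrite ltW // (lt_trans c10).
  by rewrite -(pmulr_lge0 _ (expR_gt0 t)) radial_expR hr_ge0.
- by move=> t ct; apply: continuous_radial; rewrite gt_eqF // (lt_trans c10).
have hd : 0 < d by exact: lt_le_trans c1d.
have -> : (\int[leb]_(t in [set t | (c1 < t)%R]) (radial (expR t) * expR t)%:E =
    \int[leb]_(t in [set t | (c1 < t)%R]) (hr t)%:E)%E.
  by apply: eq_integral => t _; rewrite radial_expR.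
have -> : (\int[leb]_(x in L) (radial x)%:E = - \int[leb]_(t in [set t | (d < t)%R]) (gr t)%:E)%E.
  transitivity (- \int[leb]_(x in L) (- radial x)%:E)%E.
    rewrite -integral_ge0N.
      by apply: eq_integral => x _; rewrite EFinN oppeK.
    move=> x /= /andP[x0 x1]; rewrite lee_fin oppr_ge0.
    rewrite -(pmulr_lle0 _ x0) -{1 2}(lnK x0) radial_expR -[ln x]opprK hrN oppr_le0 gr_ge0 //.
    rewrite oppr_ge0 -ler_expR expR0 lnK //; apply: ltW; apply: lt_trans x1 _.
    by rewrite E2; lra.
  congr (- _)%E; rewrite /L (@ge0_integral_expR_lt _ (fun x => - radial x)).
  - rewrite -integral_lt_gr; apply: eq_integral => t _.
    by rewrite mulNr radial_expR.
  - by apply: measurableT_comp => //; exact: measurable_radial.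
  - move=> t td; apply: cvgN; apply: continuous_radial.
    by rewrite lt_eqF // (lt_trans td) // oppr_lt0.
  - move=> t td; rewrite oppr_ge0 -(pmulr_lle0 _ (expR_gt0 t)) radial_expR -[t]opprK hrN oppr_le0 gr_ge0 //.
    by rewrite oppr_ge0 ltW // (lt_trans td) // oppr_lt0.
have gfin : (\int[leb]_(t in [set t | (d < t)%R]) (gr t)%:E)%E \is a fin_num.
  rewrite ge0_fin_numE ?gr_tail //.
  by apply: integral_ge0 => t /= dt; rewrite lee_fin gr_ge0 // ltW // (lt_trans hd).
have -> : [set t | c1 < t] = [set t | c1 < t <= d] `|` [set t | d < t].
  apply/seteqP; split => t /=; first by move=> ->; case: (leP t d) => ?; [left|right].
  by move=> [/andP[]//|]; exact: le_lt_trans.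
rewrite ge0_integral_setU //; last 5 first.
- by rewrite -set_itvoc; exact: measurable_itv.
- exact: mgt.
- exact: measurable_funTS.
- move=> t [/= /andP[h _]|/= h]; rewrite lee_fin hr_ge0 // ltW //.
    exact: lt_trans h.
  exact: lt_trans h.
- rewrite disj_set2E; apply/eqP/seteqP; split => // x [/= /andP[_ h1] h2].
  by move: (le_lt_trans h1 h2); rewrite ltxx.
have -> : (\int[leb]_(t in [set t | (d < t)%R]) (hr t)%:E =
  \int[leb]_(t in [set t | (d < t)%R]) (wr t)%:E + \int[leb]_(t in [set t | (d < t)%R]) (gr t)%:E)%E.
  rewrite -ge0_integralD //.
  - by apply: eq_integral => t _; rewrite hr_wr_gr EFinD.
  - exact: mgt.
  - by move=> t _; rewrite lee_fin wr_ge0.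
  - exact: measurable_funTS.
  - by move=> t /= dt; rewrite lee_fin gr_ge0 // ltW // (lt_trans hd).
  - exact: measurable_funTS.
by rewrite addeC addeA addeK.
Qed.

Lemma wr_integrable : leb.-integrable setT (EFin \o wr).
Proof.
have [C C0 HC] := kr_near N_gt0 s_gt0 theta_norm.
have [D D0 HD] := kr_far N_gt0 s_gt0 theta_norm.
pose M1 := C * (b ^+ 2 * expR b); pose M2 := D * (4 / (2 * s) ^+ 2).
have M10 : 0 <= M1 by rewrite mulr_ge0 // mulr_ge0 ?expR_ge0 ?sqr_ge0.
have M20 : 0 <= M2 by rewrite mulr_ge0 // divr_ge0 // sqr_ge0.
have b1 : 2 * s - 1 < 1 by have := s_lt1; lra.
have i1 := integrableZl measurableT (M1 + M2) (integrable_pw b1 (ltr1n _ 2)).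
apply: (le_integrable _ _ _ i1) => //.
  by apply/measurable_EFinP; exact: measurable_wr.
move=> t _; rewrite /= lee_fin (ger0_norm (wr_ge0 t)) ger0_norm ?mulr_ge0 ?addr_ge0 ?pw_ge0 //.
have [->|t0] := eqVneq t 0.
  by rewrite /wr mulr0 /ch oppr0 expR0 (_ : 1 + 1 - 2 = 0) ?mul0r ?mulr_ge0 ?addr_ge0 ?pw_ge0 //; ring.
have tp : 0 < `|t| by rewrite normr_gt0.
have bt0 : 0 <= b * `|t| by rewrite mulr_ge0 // ltW.
have -> : wr t = (ch (b * `|t|) - 2) * k t.
  by rewrite /wr -(ch_norm (b * t)) normrM (gtr0_norm b_gt0).
have c0 : 0 <= ch (b * `|t|) - 2.
  by apply: le_trans (ch_ge _); rewrite divr_ge0 // sqr_ge0.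
rewrite /pw; case: ifP => [t1|/negbT]; rewrite [(M1 + M2) * _]mulrDl.
  apply: (@le_trans _ _ (M1 * `|t| `^ (- (2 * s - 1)))); last by rewrite lerDl mulr_ge0 ?powR_ge0.
  have h1 : ch (b * `|t|) - 2 <= `|t| ^+ 2 * (b ^+ 2 * expR b).
    apply: le_trans (ch_le_sqr bt0) _; rewrite exprMn -mulrA mulrCA.
    rewrite ler_wpM2l ?sqr_ge0 // ler_wpM2l ?sqr_ge0 // ler_expR.
    by apply: ler_piMr => //; exact: ltW.
  apply: le_trans (ler_pM c0 (k0 t) h1 (HC _ t0)) _.
  rewrite le_eqVlt; apply/orP; left; apply/eqP.
  have -> : - (2 * s - 1) = 2 + - (1 + 2 * s) by ring.
  rewrite powRD; last by rewrite (gt_eqF tp) implybT.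
  rewrite -[`|t| ^+ 2]powR_mulrn // /M1; ring.
rewrite -ltNge => t1; apply: (@le_trans _ _ (M2 * `|t| `^ (- 2))); last by rewrite lerDr mulr_ge0 ?powR_ge0.
have h1 : ch (b * `|t|) - 2 <= expR (b * `|t|).
  rewrite /ch; have : expR (- (b * `|t|)) <= 1 by rewrite -expR0 ler_expR oppr_le0.
  lra.
apply: le_trans (ler_pM c0 (k0 t) h1 (HD _ (ltW t1))) _.
rewrite mulrCA -expRD /M2 -[leRHS]mulrA ler_wpM2l //.
have -> : b * `|t| + - (q * `|t|) = - (2 * s * `|t|) by rewrite /b /q; field.
by apply: expRN_le_inv2 => //; exact: mulr_gt0.
Qed.

Definition Ar : R := \int[leb]_t (wr t * (if 0 < t then 1 else 0)).

Lemma half_line_integrable (d : R) :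
  leb.-integrable setT (EFin \o (fun t => wr t * (if d < t then 1 else 0))).
Proof.
apply: (le_integrable _ _ _ wr_integrable) => //.
  apply/measurable_EFinP; apply: measurable_funM; first exact: measurable_wr.
  by apply: measurable_fun_ifT => //; exact: measurable_fun_ltr.
move=> t _; rewrite /= lee_fin normrM ler_piMr //; case: (d < t); rewrite ?normr1 ?normr0 //.
Qed.

Lemma half_line_integral (d : R) : (\int[leb]_(t in [set t | (d < t)%R]) (wr t)%:E)%E =
  (\int[leb]_t (wr t * (if d < t then 1 else 0)))%:E.
Proof.
rewrite /Rintegral fineK; last first.
  by apply: integrable_fin_num => //; exact: half_line_integrable.
rewrite [LHS]integral_mkcond; apply: eq_integral => t _; rewrite patchE.
have -> : (t \in [set t | d < t]) = (d < t) by apply/idP/idP; rewrite inE.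
by case: (d < t); rewrite ?mulr1 ?mulr0.
Qed.

Lemma Ar_gt0 : 0 < Ar.
Proof.
have [c c0 Hc] := kr_low N_gt0 s_gt0 theta_norm.
pose S : set R := [set` `]2^-1, 1[].
have lS : leb S = (2^-1)%:E.
  by apply: etrans (lebesgue_itvoo _) _; [lra|congr (_%:E); lra].
pose m := b ^+ 2 / 16 * c.
have m0 : 0 < m by rewrite mulr_gt0 // divr_gt0 // exprn_gt0.
have f0 t : 0 <= wr t * (if 0 < t then 1 else 0) by rewrite mulr_ge0 ?wr_ge0 //; case: ifP.
have Sc t : S t -> m <= wr t * (if 0 < t then 1 else 0).
  rewrite /S /= in_itv/= => /andP[t1 t2]; have t0 : 0 < t by lra.
  rewrite t0 mulr1 /wr; apply: ler_pM; [by rewrite divr_ge0 // sqr_ge0|exact: ltW| |].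
    apply: le_trans (ch_ge _); rewrite [(b * t) ^+ 2]exprMn.
    have -> : b ^+ 2 / 16 = b ^+ 2 * 4^-1 / 4 by field.
    rewrite ler_pM2r ?invr_gt0 // ler_pM2l ?exprn_gt0 // expr2; nra.
  apply: (@le_trans _ _ (k 1)).
    by have := Hc 1 ltr01 (lexx _); rewrite powR1 mulr1.
  by have [_ _ kd] := ck; apply: kd => //; exact: ltW.
have mf : measurable_fun [set: R] (fun t => wr t * (if 0 < t then 1 else 0)).
  by have /measurable_int/measurable_EFinP := half_line_integrable 0.
have := @integral_ge_cst _ _ R leb S _ _ _ (measurable_itv _) lS mf f0 (ltW m0) Sc.
move=> h; rewrite -lte_fin /Ar /Rintegral fineK; last first.
  by apply: integrable_fin_num => //; exact: half_line_integrable.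
by apply: lt_le_trans h; rewrite lte_fin divr_gt0.
Qed.

Lemma A_trunc_gap : exists2 M, 0 <= M & forall e, 0 < e -> e < 2^-1 ->
  (\int[leb]_(t in [set t | (ln (1 + e) < t <= - ln (1 - e))%R]) (hr t)%:E <=
   (M * e `^ (2 - 2 * s))%:E)%E.
Proof.
have [C C0 HC] := kr_near N_gt0 s_gt0 theta_norm.
pose M0 := b * expR b * C; pose M := M0 * 2^-1 `^ (- (2 * s)) * 2.
have M00 : 0 <= M0 by rewrite mulr_ge0 // mulr_ge0 ?expR_ge0 // ltW.
exists M => [|e e0 e2]; first by rewrite mulr_ge0 // mulr_ge0 // powR_ge0.
set c1 := ln (1 + e); set d := - ln (1 - e).
have E1 : expR c1 = 1 + e by rewrite lnK // posrE; lra.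
have E2 : expR (- d) = 1 - e by rewrite opprK lnK // posrE; lra.
have c1e : 2^-1 * e <= c1.
  by rewrite -ler_expR E1; apply: le_trans (expR_le_affine _ _) _; lra.
have d1 : d <= 1.
  rewrite -[d]opprK lerNl -ler_expR E2 expRN; have h := expR_ge1Dx (1 : R).
  by apply: (@le_trans _ _ 2^-1); [rewrite lef_pV2 ?posrE ?expR_gt0 //; lra|lra].
have dc : d - c1 <= 2 * e ^+ 2.
  rewrite -lerN2 opprB -ler_expR expRD E1 E2 expRN.
  have h := expR_ge1Dx (2 * e ^+ 2).
  rewrite -[_^-1]mul1r ler_pdivrMr ?expR_gt0 //.
  have p0 : 0 <= (1 + e) * (1 - e) by apply: mulr_ge0; lra.
  apply: le_trans (ler_wpM2l p0 h).
  have : e ^+ 2 <= 2^-1 by rewrite expr2; nra.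
  by have := sqr_ge0 e; set y := e ^+ 2; have -> : (1 + e) * (1 - e) = 1 - y; [rewrite /y; ring|nra].
have c10 : 0 < c1 by apply: lt_le_trans c1e; rewrite mulr_gt0.
pose V := M0 * (2^-1 * e) `^ (- (2 * s)).
have V0 : 0 <= V by rewrite mulr_ge0 // powR_ge0.
have bnd t : c1 < t <= d -> hr t <= V.
  move=> /andP[ct td]; have t0 : 0 < t by exact: lt_trans ct.
  have bt0 : 0 <= b * t by rewrite mulr_ge0 // ltW.
  have h1 : expR (b * t) - 1 <= b * t * expR b.
    apply: (@le_trans _ _ (b * t * expR (b * t))).
      have h2 := expR_ge1Dx (- (b * t)).
      have h3 : expR (b * t) * expR (- (b * t)) = 1 by rewrite -expRD subrr expR0.
      by have := expR_gt0 (b * t); nra.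
    rewrite ler_wpM2l // ler_expR; apply: ler_piMr; [exact: ltW|exact: le_trans d1].
  have h0 : 0 <= expR (b * t) - 1 by rewrite subr_ge0 -expR0 ler_expR.
  have kt := HC t; rewrite gt_eqF // gtr0_norm // in kt.
  apply: le_trans (ler_pM h0 (k0 t) h1 (kt isT)) _.
  have -> : b * t * expR b * (C * t `^ (- (1 + 2 * s))) = M0 * t `^ (- (2 * s)).
    have -> : - (2 * s) = 1 + - (1 + 2 * s) by ring.
    rewrite powRD; last by rewrite (gt_eqF t0) implybT.
    by rewrite powRr1 ?(ltW t0) // /M0; ring.
  rewrite /V ler_wpM2l //; apply: powR_nonincr.
  - by rewrite oppr_le0 mulr_ge0 // ltW.
  - by rewrite mulr_gt0.
  - by apply: le_trans c1e _; exact: ltW.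
have mS : measurable [set t : R | c1 < t <= d] by rewrite -set_itvoc; exact: measurable_itv.
apply: (@le_trans _ _ (\int[leb]_(t in [set t | (c1 < t <= d)%R]) V%:E)%E).
  apply: ge0_le_integral => //.
  - by move=> t /= /andP[ct _]; rewrite lee_fin hr_ge0 // ltW // (lt_trans c10).
  - by apply: measurable_funTS; apply/measurable_EFinP; exact: measurable_hr.
rewrite integral_cst // -set_itvoc.
apply: (@le_trans _ _ (V%:E * (2 * e ^+ 2)%:E)%E).
  rewrite lee_wpmul2l ?lee_fin //; apply: le_trans (_ : (d - c1)%:E <= _)%E; last by rewrite lee_fin.
  have c1d : c1 <= d.
    rewrite -[d]opprK -ler_expR expRN E2 E1 -[_^-1]mul1r ler_pdivlMr; last by lra.
    by nra.
  rewrite le_eqVlt; apply/orP; left; apply/eqP.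
  apply: etrans (lebesgue_measure_itv _) _; rewrite /= lte_fin.
  by move: c1d; rewrite le_eqVlt => /predU1P[->|->]; rewrite ?ltxx ?subrr // EFinB.
rewrite -EFinM lee_fin /V /M le_eqVlt; apply/orP; left; apply/eqP.
rewrite powRM ?invr_ge0 ?(ltW e0) // [2 - 2 * s]addrC powRD; last by rewrite (gt_eqF e0) implybT.
by rewrite -powR_mulrn ?(ltW e0) //; ring.
Qed.

Lemma A_trunc_cvg : A_trunc N s theta e @[e --> 0^'+] --> Ar%:E.
Proof.
have [M M0 HM] := A_trunc_gap.
pose J e : R := \int[leb]_t (wr t * (if - ln (1 - e) < t then 1 else 0)).
have cJ : J e @[e --> 0^'+] --> Ar.
  apply/cvg_at_rightP => e_ [e0 ec].
  have mf (d : R) : measurable_fun [set: R] (fun t => wr t * (if d < t then 1 else 0)).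
    by have /measurable_int/measurable_EFinP := half_line_integrable d.
  apply: (dct (mu := leb) (fun n => mf _) (mf _) _ wr_integrable) => [t|n t]; last first.
    rewrite normrM ger0_norm ?wr_ge0 // ler_piMr ?wr_ge0 //.
    by case: ifP; rewrite ?normr1 ?normr0.
  apply: cvgM; first exact: cvg_cst.
  apply: cvg_near_cst; case: (ltP 0 t) => t0.
    near=> n; rewrite ifT //.
    have en : e_ n < 1 - expR (- t).
      near: n; apply: (cvgr_lt _ ec); rewrite subr_gt0 -expR0 ltr_expR.
      by rewrite oppr_lt0.
    rewrite ltrNl -ltr_expR lnK; first by lra.
    by rewrite posrE; have := expR_gt0 (- t); lra.
  apply: nearW => n; rewrite ifF //; apply/negbTE; rewrite -leNgt.
  by apply: le_trans t0 _; rewrite oppr_ge0; apply: ln_le0; have := e0 n; lra.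
have c1 : (J e)%:E @[e --> 0^'+] --> Ar%:E by apply: cvg_EFin => //; exact: nearW.
have c2 : (J e + M * e `^ (2 - 2 * s))%:E @[e --> 0^'+] --> Ar%:E.
  apply: cvg_EFin; first exact: nearW.
  have cM : M * e `^ (2 - 2 * s) @[e --> 0^'+] --> M * 0.
    apply: cvgM; first exact: cvg_cst.
    by apply: powR_cvg0; have := s_lt1; lra.
  have cS : J e + M * e `^ (2 - 2 * s) @[e --> 0^'+] --> Ar + M * 0 by exact: cvgD.
  by rewrite mulr0 addr0 in cS; exact: cS.
apply: (squeeze_cvge _ c1 c2); near=> e.
have e0 : 0 < e by near: e; exact: nbhs_right_gt.
have e2 : e < 2^-1 by near: e; exact: nbhs_right_lt.
have e1 : e < 1 by lra.
rewrite (A_truncE e0 e1).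
rewrite half_line_integral -/(J e) [J e + _]addrC EFinD leeDr ?leeD2r ?HM //.
apply: integral_ge0 => t /= /andP[ct _]; rewrite lee_fin hr_ge0 // ltW //.
by apply: le_lt_trans ct; apply: ln_ge0; lra.
Unshelve. all: end_near.
Qed.

Lemma A_sNE : A_sN N s theta = Ar.
Proof. by rewrite /A_sN (cvg_lim _ A_trunc_cvg). Qed.

End principal_value_constant.

Section transfer.
Context {R : realType}.
Local Notation leb := (@lebesgue_measure R).
Local Notation leb2 := ((@lebesgue_measure R) \x (@lebesgue_measure R))%E.
Variables (K : R -> \bar R) (k : R -> R).
Hypothesis ck : cone k.
Hypothesis Kk : forall t, t != 0 -> K t = (k t)%:E.

Let mk : measurable_fun [set: R] k := measurable_cone ck.
Let k0 t : 0 <= k t. Proof. by have [] := ck. Qed.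

(* Off the diagonal [K] and [k] agree; on it [0 * +oo = 0] makes [K] irrelevant. *)
Lemma kernel_mul (a t : R) : (t = 0 -> a = 0) -> (a%:E * K t)%E = (a * k t)%:E.
Proof.
move=> a0; have [t0|/Kk ->] := eqVneq t 0; last by [].
by rewrite (a0 t0) mul0e mul0r.
Qed.

Lemma diagonal (u : R -> R) (x y : R) : x - y = 0 -> u x - u y = 0.
Proof. by move/subr0_eq => ->; rewrite subrr. Qed.

Lemma HsK_inH u : HsK K u <-> inH k u.
Proof.
have E : measurable_fun [set: R] u ->
    (\int[leb2]_z (((u z.1 - u z.2) ^+ 2)%:E * K (z.1 - z.2)%R) = \int[leb2]_z ((dl k u z) ^+ 2)%:E)%E.
  move=> mu; apply: eq_integral => -[x y] _; rewrite (dl_sqr k0) /=; apply: kernel_mul.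
  by move=> xy; rewrite (diagonal u xy) expr0n.
split.
  by move=> [mu h1 h2]; split; split => //; [exact: measurable_dl|rewrite -E].
by move=> [[mu h1] [_ h2]]; split => //; rewrite E.
Qed.

Lemma weak_variational A p v : inH k v -> weak_sol k A p v -> variational_solution K A p v.
Proof.
move=> hv wv; split=> [|phi /HsK_inH hphi]; first exact/HsK_inH.
have [iv Qv] := wv phi hphi.
have [h1 h2] := hv; have [h3 h4] := hphi.
have -> : (\int[leb2]_z (((v z.1 - v z.2) * (phi z.1 - phi z.2))%:E * K (z.1 - z.2)%R) =
    (ip leb2 (dl k v) (dl k phi))%:E)%E.
  rewrite /ip /Rintegral fineK; last by apply: integrable_fin_num => //; exact: Ltwo_mul.
  apply: eq_integral => -[x y] _; rewrite (dl_mul k0) /=; apply: kernel_mul.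
  by move=> xy; rewrite (diagonal v xy) mul0r.
have -> : (\int[leb]_x (v x * phi x)%:E = (ip leb v phi)%:E)%E.
  by rewrite /ip /Rintegral fineK //; apply: integrable_fin_num => //; exact: Ltwo_mul.
have -> : (\int[leb]_x (v x `^ p * phi x)%:E = (\int[leb]_x (v x `^ p * phi x))%:E)%E.
  by rewrite /Rintegral fineK //; exact: integrable_fin_num.
by rewrite -Qv /Q EFinD !EFinM.
Qed.

Lemma T_truncE u x e : 0 < e -> T_trunc K u x e = pv_trunc k u x e.
Proof.
move=> e0; apply: eq_integral => y; rewrite inE /= => exy.
rewrite kernel_mul // => xy; move: exy; rewrite xy normr0 => h.
by move: (lt_trans e0 h); rewrite ltxx.
Qed.

End transfer.

Theorem theorem4p4 (R : realType) (N : nat) (s alpha : R) (theta : nat -> R) :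
  (0 < N)%N -> 0 < s -> s < 1 -> 2 * s < N%:R ->
  normRn N theta = 1 ->
  ((2^-1 <= s /\ - (2 * s) < alpha) \/
   (s < 2^-1 /\ - (2 * s) < alpha /\ alpha < 2 * s * (N%:R - 1) / (1 - 2 * s))) ->
  exists v : R -> R,
    [/\ variational_solution (kernelK N s theta) (A_sN N s theta)
          (crit_exp N alpha s) v,
        (forall x, 0 <= v x),
        ~ (forall x, v x = 0),
        classical_solution (kernelK N s theta) (A_sN N s theta)
          (crit_exp N alpha s) v &
        (forall x, 0 < v x)].
Proof.
move=> N0 s0 s1 sN th alphaH.
have alpha_low : - (2 * s) < alpha by case: alphaH => [[]|[_ []]].
have d0 : 0 < N%:R - 2 * s by rewrite subr_gt0.
have p1 : 1 < crit_exp N alpha s by rewrite /crit_exp ltr_pdivlMr //; lra.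
have p_sub : s < 2^-1 -> (crit_exp N alpha s + 1) * (2^-1 - s) < 1.
  move=> s2; case: alphaH => [[]|[_ [_ ]]]; first by lra.
  have e0 : 0 < 1 - 2 * s by lra.
  rewrite ltr_pdivlMr // => h.
  have -> : crit_exp N alpha s + 1 = (2 * N%:R + 2 * alpha) / (N%:R - 2 * s).
    by rewrite /crit_exp; field; rewrite gt_eqF.
  rewrite mulrAC ltr_pdivrMr //; lra.
have ck := kr_cone N0 s0 th.
have [c0 c00 klow] := kr_low N0 s0 th.
have [C1 C10 kup] := kr_up N0 s0 th.
have Kk := kernelK_kr N0 s0 th.
have AE := A_sNE N0 s0 s1 sN th; have A0 := Ar_gt0 N0 s0 s1 sN th.
have [v [hv wv cv v0 pv]] := real_kernel_solution ck A0 p1 s0 s1 p_sub c00 klow C10 kup.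
exists v; rewrite AE; split => //.
- exact: (weak_variational ck Kk hv wv).
- by move=> x; exact: ltW.
- by move=> /(_ 0) v00; have := v0 0; rewrite v00 ltxx.
- split=> // x; apply: cvg_trans (pv x).
  by apply: near_eq_cvg; apply: filterS (nbhs_right_gt 0) => e e0; rewrite (T_truncE Kk).
Qed.
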